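(* Let $N\ge 1$ be an integer and $N<p<\infty$. Let $a\in L^\infty(\mathbb{R}^N)$ with $a_-=\operatorname{ess\,inf}_{\mathbb{R}^N} a>0$, let $f:\mathbb{R}^N\times\mathbb{R}\to\mathbb{R}$ be an $L^1$-Carathéodory function, and let $F(x,t)=\int_0^t f(x,\xi)\,d\xi$. Assume that there exist $x_0\in\mathbb{R}^N$, $R>0$ and two constants $c,d$ such that, with $S=B(x_0,R)\setminus B(x_0,\frac R2)$: (i) $0<c<d$; (ii) $F(x,t)\ge 0$ for a.e. $x\in S$ and for all $t\in[0,d]$; (iii) $\displaystyle \frac{\int_{\mathbb{R}^N}\max_{|t|\le c}F(x,t)\,dx}{c^p}<K_R\,\frac{\int_{B(x_0,\frac R2)}F(x,d)\,dx}{d^p}$; (iv) $\displaystyle\lim_{|t|\to+\infty}\frac{F(x,t)}{|t|^p}=0$ for a.e. $x\in\mathbb{R}^N$, uniformly with respect to $x$. Then, for each $\lambda\in(\lambda_1,\lambda_2)$, where $$\lambda_1=\frac{1}{p\,k_a^p\,K_R}\,\frac{d^p}{\int_{B(x_0,\frac R2)}F(x,d)\,dx},\qquad \lambda_2=\frac{1}{p\,k_a^p}\,\frac{c^p}{\int_{\mathbb{R}^N}\max_{|t|\le c}F(x,t)\,dx},$$ the problem $$-\Delta_p u+a(x)|u|^{p-2}u=\lambda f(x,u)\ \text{ in }\mathbb{R}^N,\qquad u\in W^{1,p}(\mathbb{R}^N),$$ admits at least three (distinct) weak solutions.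
   Context: $\Delta_p u=\operatorname{div}(|\nabla u|^{p-2}\nabla u)$. $B(x_0,\rho)$ is the ball of $\mathbb{R}^N$ with centre $x_0$ and radius $\rho$. $f$ is $L^1$-Carathéodory means: $f(\cdot,t)$ is measurable for all $t\in\mathbb{R}$, $f(x,\cdot)$ is continuous for a.e. $x\in\mathbb{R}^N$, and $\sup_{|t|\le\sigma}|f(\cdot,t)|\in L^1(\mathbb{R}^N)$ for all $\sigma>0$. A function $u\in W^{1,p}(\mathbb{R}^N)$ is a weak solution of the problem if $$\int_{\mathbb{R}^N}\left(|\nabla u|^{p-2}\nabla u\cdot\nabla v+a(x)|u|^{p-2}uv\right)dx=\lambda\int_{\mathbb{R}^N}f(x,u)\,v\,dx\quad\text{for all }v\in W^{1,p}(\mathbb{R}^N).$$ Constants: $$k_a=\left(\frac1{a_-}\right)^{\frac{p-N}{p^2}}2^{\frac{p-1}{p}}\left(\frac{\Gamma(1+\frac N2)}{\pi^{N/2}}\right)^{\frac1p}\frac{1}{N^{\frac{N}{p^2}}}\left(\frac{p-1}{p-N}\right)^{\frac{N(p-1)}{p^2}},$$ $$K_R=\frac{1}{k_a^p}\,\frac{\Gamma(1+\frac N2)}{\pi^{N/2}}\left(\frac{R^{p-N}}{2^p-2^{p-N}+R^p\|a\|_\infty}\right),$$ where $\Gamma$ is the Gamma function. The uniform limit in (iv) means: for every $\varepsilon>0$ there is $\delta>0$ such that $|F(x,t)|\le\varepsilon|t|^p$ for a.e. $x\in\mathbb{R}^N$ and all $|t|>\delta$. Convention: if $\int_{\mathbb{R}^N}\max_{|t|\le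 c}F(x,t)\,dx=0$, then $\lambda_2=+\infty$. *)

(* Defs.v *)
From HB Require Import structures.
From mathcomp Require Import all_boot all_order all_algebra.
From mathcomp Require Import all_classical all_reals all_analysis.
From mathcomp Require Import ess_sup_inf.

Set Implicit Arguments.
Unset Strict Implicit.
Unset Printing Implicit Defensive.
Import Order.TTheory GRing.Theory Num.Theory.
Import numFieldNormedType.Exports.

Local Open Scope classical_set_scope.
Local Open Scope ring_scope.

Definition measure_rV_display : measure_display -> measure_display.
Proof. exact. Qed.

(* The product sigma-algebra on row vectors. *)
Section measurable_rV.
Context {d} {T : measurableType d} (n : nat).

Definition rV_coord (i : 'I_n) (x : 'rV[T]_n) : T := x ord0 i.

Let rV_set0 : g_sigma_preimage rV_coord set0.
Proof. exact: sigma_algebra0. Qed.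

Let rV_setC A : g_sigma_preimage rV_coord A -> g_sigma_preimage rV_coord (~` A).
Proof. exact: sigma_algebraC. Qed.

Let rV_bigcup (F : (set 'rV[T]_n)^nat) :
  (forall i, g_sigma_preimage rV_coord (F i)) ->
  g_sigma_preimage rV_coord (\bigcup_i (F i)).
Proof. exact: sigma_algebra_bigcup. Qed.

HB.instance Definition _ := @isMeasurable.Build (measure_rV_display d)
  'rV[T]_n (g_sigma_preimage rV_coord) rV_set0 rV_setC rV_bigcup.

End measurable_rV.

Section measurable_rV_lemmas.
Context d d' (S : measurableType d') (T : measurableType d).

Lemma measurable_rV_coord n (i : 'I_n) :
  measurable_fun setT (@rV_coord _ T n i).
Proof.
move=> _ Y mY; rewrite setTI; apply: sub_sigma_algebra => /=.
rewrite -bigcup_seq/=; exists i => /=; first by rewrite mem_index_enum.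
by exists Y => //; rewrite setTI.
Qed.

Lemma measurable_fun_rV n (f : S -> 'rV[T]_n) :
  (forall i, measurable_fun setT (fun x => f x ord0 i)) ->
  measurable_fun setT f.
Proof.
move=> mf; have fS : g_sigma_preimage (fun i => @rV_coord _ T n i \o f)
    `<=` measurable.
  apply: smallest_sub; first exact: sigma_algebra_measurable.
  case: n => [|n] in f mf *; first by rewrite big_ord0.
  rewrite -bigcup_mkord_ord; apply: bigcup_sub => i Ii.
  by move=> A [B mB <-]; exact: mf.
move=> _ A mA; apply: fS.
by rewrite g_sigma_preimage_comp; exists A.
Qed.

End measurable_rV_lemmas.

Section lebesgue_rV_step.
Context (R : realType) (n : nat).
Variable m : {sigma_finite_measure set 'rV[measurableTypeR R]_n -> \bar R}.
Local Notation RR := (measurableTypeR R).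

Definition rV_cons (x : RR * 'rV[RR]_n) : 'rV[RR]_n.+1 :=
  \row_i oapp (fun j => x.2 ord0 j) x.1 (unlift ord0 i).

Definition rV_uncons (v : 'rV[RR]_n.+1) : RR * 'rV[RR]_n :=
  (v ord0 ord0, \row_j v ord0 (lift ord0 j)).

Lemma rV_consK : cancel rV_cons rV_uncons.
Proof.
move=> [x v]; rewrite /rV_cons /rV_uncons mxE unlift_none/=; congr pair.
by apply/rowP => j; rewrite !mxE liftK.
Qed.

Lemma rV_unconsK : cancel rV_uncons rV_cons.
Proof.
move=> v; apply/rowP => i; rewrite mxE.
by case: unliftP => [j|] ->//=; rewrite mxE.
Qed.

Lemma measurable_rV_cons : measurable_fun setT rV_cons.
Proof.
apply: measurable_fun_rV => i.
have [j|] := unliftP ord0 i => ij.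
- rewrite (_ : (fun x => _) = @rV_coord _ RR n j \o snd).
    by apply: measurableT_comp => //; exact: measurable_rV_coord.
  by apply/funext => x; rewrite /rV_cons mxE ij liftK.
- rewrite (_ : (fun x => _) = fst); first exact: measurable_fst.
  by apply/funext => x; rewrite /rV_cons mxE ij unlift_none.
Qed.

Lemma measurable_rV_uncons : measurable_fun setT rV_uncons.
Proof.
apply: measurable_fun_pair; first exact: (@measurable_rV_coord _ RR).
apply: measurable_fun_rV => i.
rewrite (_ : (fun x => _) = @rV_coord _ RR n.+1 (lift ord0 i)).
  exact: measurable_rV_coord.
by apply/funext => x; rewrite mxE.
Qed.

Definition lebesgue_rV_step : set 'rV[RR]_n.+1 -> \bar R :=
  pushforward (@lebesgue_measure R \x m)%E rV_cons.

Let step0 : lebesgue_rV_step set0 = 0%E.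
Proof. by rewrite /lebesgue_rV_step /pushforward preimage_set0 measure0. Qed.

Let step_ge0 A : (0 <= lebesgue_rV_step A)%E.
Proof. by rewrite /lebesgue_rV_step /pushforward; exact: measure_ge0. Qed.

Let step_sigma_additive : semi_sigma_additive lebesgue_rV_step.
Proof.
move=> F mF tF mUF; rewrite /lebesgue_rV_step /pushforward preimage_bigcup.
have mrV := measurable_rV_cons.
apply: measure_semi_sigma_additive.
- by move=> k; rewrite -[X in measurable X]setTI; exact: mrV.
- apply/trivIsetP => /= i j _ _ ij; rewrite -preimage_setI.
  by move/trivIsetP : tF => /(_ _ _ _ _ ij) ->//; rewrite preimage_set0.
- by rewrite -preimage_bigcup -[X in measurable X]setTI; exact: mrV.
Qed.

HB.instance Definition _ := isMeasure.Build _ _ _ lebesgue_rV_step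
  step0 step_ge0 step_sigma_additive.

Let step_sigma_finite : sigma_finite setT lebesgue_rV_step.
Proof.
have /sigma_finiteP[F [TF ndF Foo]] := sigma_finiteT (@lebesgue_measure R).
have /sigma_finiteP[G [TG ndG Goo]] := sigma_finiteT m.
exists (fun k => rV_uncons @^-1` (F k `*` G k)).
  rewrite -preimage_bigcup (_ : \bigcup_k _ = setT) ?preimage_setT//.
  rewrite -setXTT TF TG predeqE => -[x y]; split.
    by move=> [k _ []/= ? ?]; split; exists k.
  move=> [/= [k _ Fkx] [l _ Gly]]; exists (maxn k l) => //; split.
  - by move: x Fkx; exact/subsetPset/ndF/leq_maxl.
  - by move: y Gly; exact/subsetPset/ndG/leq_maxr.
move=> k; have [mF ?] := Foo k; have [mG ?] := Goo k; split.
  rewrite -[X in measurable X]setTI; apply: measurable_rV_uncons => //.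
  exact: measurableX.
rewrite /lebesgue_rV_step /pushforward -comp_preimage.
rewrite (_ : rV_uncons \o rV_cons = id); last exact/funext/rV_consK.
by rewrite preimage_id product_measure1E// lte_mul_pinfty// ge0_fin_numE.
Qed.

HB.instance Definition _ := Measure_isSigmaFinite.Build _ _ _ lebesgue_rV_step
  step_sigma_finite.

End lebesgue_rV_step.

(* Lebesgue measure on the Borel sets of R^n, as an n-fold product measure. *)
Fixpoint borel_lebesgue_rV (R : realType) (n : nat) :
    {sigma_finite_measure set 'rV[measurableTypeR R]_n -> \bar R} :=
  match n with
  | 0 => @dirac _ 'rV[measurableTypeR R]_0 (0 : 'rV[R]_0) R
  | n'.+1 => @lebesgue_rV_step R n' (borel_lebesgue_rV R n')
  end.

Lemma measurable_rV_box (R : realType) (n : nat)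
    (A : 'I_n -> set (measurableTypeR R)) : (forall i, measurable (A i)) ->
  measurable [set x : 'rV[measurableTypeR R]_n | forall i, A i (x ord0 i)].
Proof.
move=> mA; rewrite (_ : mkset _ =
    \bigcap_(i in [set: 'I_n]) (@rV_coord _ (measurableTypeR R) n i @^-1` A i)).
  apply: fin_bigcap_measurable; first exact: finite_finset.
  move=> i _.
  by rewrite -[X in measurable X]setTI; exact: measurable_rV_coord.
by apply/seteqP; split=> [x xA i _|x xA i]; [exact: xA|exact: xA].
Qed.

Lemma borel_lebesgue_rV_box (R : realType) (n : nat)
    (A : 'I_n -> set (measurableTypeR R)) : (forall i, measurable (A i)) ->
  borel_lebesgue_rV R n [set x | forall i, A i (x ord0 i)] =
  (\prod_(i < n) lebesgue_measure (A i))%E.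
Proof.
elim: n => [|n IH] in A * => mA.
  by rewrite big_ord0 /= diracE mem_set// => -[].
rewrite big_ord_recl -(IH (fun i => A (lift ord0 i)))//.
rewrite /= /lebesgue_rV_step /pushforward -product_measure1E//; last first.
  exact: (@measurable_rV_box R n (fun i => A (lift ord0 i))).
congr (_ _); apply/seteqP; split=> [[x v] xA|[x v] [/= Ax Av] i].
  split=> [|i].
    by have := xA ord0; rewrite /rV_cons mxE unlift_none.
  by have := xA (lift ord0 i); rewrite /rV_cons mxE liftK.
by rewrite /rV_cons mxE; case: unliftP => [j|] ->.
Qed.

(* The domain of [leb R n] is (an alias of) 'rV[R]_n equipped with the complete
   sigma-algebra of Lebesgue measurable sets, not just with the Borel sets. *)
Definition leb (R : realType) (n : nat) : set _ -> \bar R :=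
  @completed_measure_extension _ _ _ (borel_lebesgue_rV R n).
Arguments leb : clear implicits.

HB.instance Definition _ (R : realType) (n : nat) := Measure.on (leb R n).

Definition leb_measurable (R : realType) (n : nat) (g : 'rV[R]_n -> R) : Prop :=
  measurable_fun
    [set: caratheodory_type (mu_ext (borel_lebesgue_rV R n))] g.

Section euclidean.
Context {R : realType} {N : nat}.

Definition dot (v w : 'rV[R]_N) : R := \sum_i v ord0 i * w ord0 i.

(* The library norm on 'rV[R]_N is the sup norm, hence these definitions. *)
Definition enorm (v : 'rV[R]_N) : R := Num.sqrt (dot v v).

Definition eball (x : 'rV[R]_N) (r : R) : set 'rV[R]_N :=
  [set y | enorm (y - x) < r].

End euclidean.

Section sobolev.
Context {R : realType} {N : nat}.
Implicit Types (u v phi : 'rV[R]_N -> R) (G : 'rV[R]_N -> 'rV[R]_N) (p : R).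

Definition partial (i : 'I_N) phi : 'rV[R]_N -> R :=
  fun x => 'D_(delta_mx ord0 i : 'rV[R]_N) phi x.

Definition smooth phi : Prop := forall s : seq 'I_N,
  let psi := foldr partial phi s in
  continuous psi /\
  forall (i : 'I_N) x, derivable psi x (delta_mx ord0 i : 'rV[R]_N).

Definition test_function phi : Prop :=
  smooth phi /\ compact (closure [set x | phi x != 0]).

Definition loc_integrable u : Prop := forall K : set 'rV[R]_N,
  compact K -> (leb R N).-integrable K (EFin \o u).

Definition is_weak_gradient u G : Prop :=
  loc_integrable u /\
  forall i : 'I_N, loc_integrable (fun x => G x ord0 i) /\
    forall phi, test_function phi ->
      \int[leb R N]_x (u x * partial i phi x) =
      - \int[leb R N]_x (G x ord0 i * phi x).

(* A representative of the weak gradient, which is unique up to a.e. equality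
   when it exists. *)
Definition weak_gradient u : 'rV[R]_N -> 'rV[R]_N := get (is_weak_gradient u).

Definition W1p p u : Prop :=
  u \in Lfun (leb R N) p%:E /\
  exists2 G, is_weak_gradient u G &
    forall i : 'I_N, (fun x => G x ord0 i) \in Lfun (leb R N) p%:E.

(* As 0 `^ s is 0 (or 1 when s = 0), |z|^(p-2) z is read as 0 at z = 0, also
   when p < 2. *)
Definition weak_solution p (a : 'rV[R]_N -> R) (f : 'rV[R]_N -> R -> R)
    (lambda : R) u : Prop :=
  W1p p u /\
  forall v, W1p p v ->
    \int[leb R N]_x
      (enorm (weak_gradient u x) `^ (p - 2) *
         dot (weak_gradient u x) (weak_gradient v x) +
       a x * `|u x| `^ (p - 2) * u x * v x) =
    lambda * \int[leb R N]_x (f x (u x) * v x).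

End sobolev.

Section nonlinearity.
Context {R : realType} {N : nat}.
Implicit Types (f : 'rV[R]_N -> R -> R).

Definition L1_caratheodory f : Prop :=
  [/\ forall t : R,
        leb_measurable (f ^~ t),
      \forall x \ae leb R N, continuous (f x) &
      forall sigma : R, 0 < sigma ->
        (leb R N).-integrable setT
          (fun x => ereal_sup [set `|f x t|%:E | t in [set t | `|t| <= sigma]])].

(* F(x, t), the integral of f(x, .) from 0 to t, oriented when t < 0. *)
Definition primitive f (x : 'rV[R]_N) (t : R) : R :=
  if 0 <= t then \int[lebesgue_measure]_(xi in `[0, t]) f x xi
  else - \int[lebesgue_measure]_(xi in `[t, 0]) f x xi.

(* The supremum is a maximum whenever F x is continuous. *)
Definition max_le (F : 'rV[R]_N -> R -> R) (c : R) (x : 'rV[R]_N) : R :=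
  sup [set F x t | t in [set t | `|t| <= c]].

End nonlinearity.

Section constants.
Context {R : realType}.

Definition Gamma (s : R) : R :=
  \int[lebesgue_measure]_(t in `]0, +oo[) (t `^ (s - 1) * expR (- t)).

Definition ess_lower {N : nat} (a : 'rV[R]_N -> R) : R :=
  fine (ess_inf (leb R N) (EFin \o a)).

Definition Linfty_norm {N : nat} (a : 'rV[R]_N -> R) : R :=
  fine ('N[leb R N]_+oo[EFin \o a])%E.

(* The inverse of the volume of the unit ball of R^N. *)
Definition inv_ball_volume (N : nat) : R :=
  Gamma (1 + N%:R / 2) / pi `^ (N%:R / 2).

Definition k_const (N : nat) (p : R) (a : 'rV[R]_N -> R) : R :=
  (1 / ess_lower a) `^ ((p - N%:R) / p ^+ 2) *
  2 `^ ((p - 1) / p) *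
  inv_ball_volume N `^ (1 / p) *
  (1 / N%:R `^ (N%:R / p ^+ 2)) *
  ((p - 1) / (p - N%:R)) `^ (N%:R * (p - 1) / p ^+ 2).

Definition K_const (N : nat) (p : R) (a : 'rV[R]_N -> R) (r : R) : R :=
  1 / k_const p a `^ p * inv_ball_volume N *
  (r `^ (p - N%:R) /
   (2 `^ p - 2 `^ (p - N%:R) + r `^ p * Linfty_norm a)).

Definition lambda1 (N : nat) (p : R) (a : 'rV[R]_N -> R)
    (F : 'rV[R]_N -> R -> R) (x0 : 'rV[R]_N) (r d : R) : R :=
  1 / (p * k_const p a `^ p * K_const p a r) *
  (d `^ p / \int[leb R N]_(x in eball x0 (r / 2)) F x d).

(* The convention c^p / 0 = +oo is built in. *)
Definition lambda2 (N : nat) (p : R) (a : 'rV[R]_N -> R)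
    (F : 'rV[R]_N -> R -> R) (c : R) : \bar R :=
  let M := \int[leb R N]_x max_le F c x in
  if M == 0 then +oo%E
  else (1 / (p * k_const p a `^ p) * (c `^ p / M))%:E.

End constants.

(* Main.v *)
(* Let ||u||^p = int |grad u|^p + a |u|^p and J(u) = ||u||^p / p - lambda int F(x, u).

   For p > N, averaging |u(x + z) - u(x)| over a ball of suitable radius and bounding the increment by the
   integral of |grad u| along the segment gives |u| <= k_a ||u|| almost everywhere, with exactly the constant
   k_a of the statement. Hence J is bounded below by a positive constant on the sphere ||u|| = c / k_a when
   lambda < lambda_2. On the other hand J(0) = 0, and when lambda > lambda_1 the functional is negative at the
   radial function equal to d on B(x0, R/2) and decreasing linearly to 0 at distance R, which lies outside
   that sphere since d > c.

   So J is almost minimised at an almost critical point inside the sphere and at another one outside it, both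
   at nonpositive levels, and a minimax over the chains joining 0 to the radial function gives almost critical
   points at a positive level. By (iv) J is coercive, and it satisfies the Palais-Smale condition: a bounded
   sequence has a subsequence converging almost everywhere, along which the nonlinear term passes to the limit
   by domination, and the strong monotonicity of |z|^(p-2) z then makes the subsequence Cauchy in norm. The
   three limits are distinct because they are separated by the sphere or by the sign of J. *)

From HB Require Import structures.
From mathcomp Require Import all_boot all_order all_algebra.
From mathcomp Require Import all_classical all_reals all_analysis.
From mathcomp Require Import ess_sup_inf measurable_realfun.
From mathcomp Require Import ring lra.
Require Import Defs.

Set Implicit Arguments.
Unset Strict Implicit.
Unset Printing Implicit Defensive.
Import Order.TTheory GRing.Theory Num.Theory.
Import numFieldNormedType.Exports.

Local Open Scope classical_set_scope.
Local Open Scope ring_scope.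

(** * Completion of a measure *)

(** The sphere has radius c / k_a, so the embedding is needed with exactly that constant. Morrey's
    estimate on a ball of radius [rho] bounds |u(x)| by a multiple of the L^p norm of u plus a
    multiple of that of its gradient. Take p-th powers, at the cost of the convexity factor 2^(p-1):
    [rho] is chosen so that both terms enter the energy with the same coefficient, and that
    coefficient is k_a^p.

    The embedding into bounded functions also explains why an L^1-Caratheodory f, whatever its
    growth, gives a differentiable functional: on a bounded set of W^(1,p) the values of u stay in
    one interval, where a single integrable function dominates f.

    The statement uses completed Lebesgue measure and a weak gradient picked by choice. Fubini,
    translations and addition are easier for Borel pairs (u, G) under the product measure, so the
    analysis is done there and transferred at both ends. Two such pairs may represent the same
    function; distinctness is therefore read off from the energy and from J, which do not see null
    sets. *)

Section completion.
Local Open Scope ereal_scope.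
Context d (T : measurableType d) (R : realType).
Variable mu : {sigma_finite_measure set T -> \bar R}.
Local Notation cT := (caratheodory_type (mu_ext mu)).
Local Notation cmu := (@completed_measure_extension _ _ _ mu).

Lemma completion_measurable (A : set T) :
  measurable A -> measurable (A : set cT).
Proof. by move=> mA; exact: caratheodory_measurable_mu_ext. Qed.

Lemma completionE (A : set T) : measurable A -> cmu A = mu A.
Proof. by move=> mA; rewrite /completed_measure_extension measurable_mu_extE. Qed.

Lemma completion_measurable_fun d' (S : measurableType d') (f : T -> S) :
  measurable_fun setT f -> measurable_fun [set: cT] (f : cT -> S).
Proof.
move=> mf _ Y mY; apply: completion_measurable.
exact: (mf measurableT Y mY).
Qed.

(** The identity from the completed space to [T] is measurable and pushes [cmu] forward to [mu], so
    this is a change of variables. *)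
Lemma completion_integral (f : T -> \bar R) :
  measurable_fun [set: T] f -> (forall x, 0 <= f x) ->
  \int[cmu]_x f x = \int[mu]_x f x.
Proof.
move=> mf f0.
have mid : measurable_fun [set: cT] (idfun : cT -> T).
  exact: completion_measurable_fun (@measurable_id _ T setT).
rewrite -(@ge0_integral_pushforward _ _ cT T R idfun mid cmu setT f) //.
apply: eq_measure_integral => A mA _.
exact: completionE.
Qed.

(** A measurable hull: countable covers with excess 1/(n+1) over the outer measure, intersected over
    n. *)
Lemma outer_measure_borel_cover (E : set T) : mu_ext mu E < +oo ->
  exists F, [/\ measurable F, E `<=` F & mu F = mu_ext mu E].
Proof.
move=> Eoo.
have Efin : mu_ext mu E \is a fin_num by rewrite ge0_fin_numE// mu_ext_ge0.
have H n : exists F, [/\ measurable F, E `<=` F &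
    mu F <= mu_ext mu E + n.+1%:R^-1%:E].
  have [_/= [A [mA EA] <-] hA] :=
    lb_ereal_inf_adherent (divr_gt0 ltr01 (ltr0Sn R n)) Efin.
  exists (\bigcup_k A k); split => //; first exact: bigcupT_measurable.
  rewrite div1r in hA; apply: le_trans (ltW hA).
  by apply: measure_sigma_subadditive => //; exact: bigcupT_measurable.
have [F HF] := choice H.
exists (\bigcap_n F n); split.
- by apply: bigcapT_measurable => n; have [] := HF n.
- by move=> x Ex n _; have [_ + _] := HF n; apply.
have mF : measurable (\bigcap_n F n).
  by apply: bigcapT_measurable => n; have [] := HF n.
apply/eqP; rewrite eq_le; apply/andP; split; last first.
  rewrite -(measurable_mu_extE mu mF); apply: le_mu_ext.
  by move=> x Ex n _; have [_ + _] := HF n; apply.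
apply/lee_addgt0Pr => _/posnumP[e].
near \oo => n.
apply: (@le_trans _ _ (mu (F n))).
  by apply: le_measure; rewrite ?inE//; [have [] := HF n|exact: bigcap_inf].
have [_ _ /le_trans] := HF n; apply.
rewrite leeD// lee_fin ltW//.
by near: n; apply: near_infty_natSinv_lt.
Unshelve. all: by end_near. Qed.

(** For finite outer measure, take a hull F of the set; additivity of the completed measure makes
    the difference null, and a hull of this difference is the null Borel set to remove.
    Sigma-finiteness reduces the general case to countably many finite pieces. *)
Lemma completion_set (E : set T) : measurable (E : set cT) ->
  exists B N0, [/\ measurable B, measurable N0, mu N0 = 0 & E `\` N0 = B `\` N0].
Proof.
have fincase E' : measurable (E' : set cT) -> mu_ext mu E' < +oo ->
  exists B N0, [/\ measurable B, measurable N0, mu N0 = 0 & E' `\` N0 = B `\` N0].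
  move=> mE Eoo; have [F [mF EF muF]] := outer_measure_borel_cover Eoo.
  have d0 : mu_ext mu (F `\` E') = 0.
    have h := @measureD _ cT _ cmu F E' (completion_measurable mF) mE.
    rewrite -[LHS]/(cmu (F `\` E')) h; last first.
      by rewrite -[X in X < _]/(cmu F) [cmu F]completionE// muF.
    rewrite setIidr// -[X in X - _ = _]/(cmu F) [cmu F]completionE// muF.
    by rewrite -[mu_ext mu E']/(cmu E') subee// ge0_fin_numE.
  have [G [mG FG muG]] : exists F0, [/\ measurable F0, F `\` E' `<=` F0 &
      mu F0 = mu_ext mu (F `\` E')].
    by apply: outer_measure_borel_cover; rewrite d0.
  exists F, G; split => //; first by rewrite muG.
  apply/seteqP; split => x [Fx nG]; split => //; first exact: EF.
  by apply: contrapT => nE; apply: nG; exact: FG.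
move=> mE.
have /sigma_finiteP[S [ST ndS Soo]] := sigma_finiteT mu.
have H n : exists BN : set T * set T,
    [/\ measurable BN.1, measurable BN.2, mu BN.2 = 0 &
       (E `&` S n) `\` BN.2 = BN.1 `\` BN.2].
  have [mS Sfin] := Soo n.
  have [|//|B [N0 ?]] := fincase (E `&` S n); last by exists (B, N0).
    by apply: measurableI => //; exact: completion_measurable.
  have h : mu_ext mu (S n) < +oo by rewrite measurable_mu_extE.
  apply: le_lt_trans h.
  exact: le_mu_ext.
have [BN HBN] := choice H.
exists (\bigcup_n (BN n).1), (\bigcup_n (BN n).2); split.
- by apply: bigcupT_measurable => n; have [] := HBN n.
- by apply: bigcupT_measurable => n; have [] := HBN n.
- apply/negligibleP; first by apply: bigcupT_measurable => n; have [] := HBN n.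
  apply: negligible_bigcup => n; apply/negligibleP; by have [] := HBN n.
- apply/seteqP; split => x [Ex nx]; split => //.
  + have : [set: T] x by []. rewrite ST => -[n _ Snx].
    have [_ _ _ e] := HBN n; have : (E `&` S n `\` (BN n).2) x.
      by split=> // ?; apply: nx; exists n.
    by rewrite e => -[? _]; exists n.
  + case: Ex => n _ Bx; have [_ _ _ e] := HBN n.
    have : ((BN n).1 `\` (BN n).2) x by split=> // ?; apply: nx; exists n.
    by rewrite -e => -[[]].
Qed.

Lemma completion_negligible (A : set T) :
  cmu.-negligible A <-> mu.-negligible A.
Proof.
split=> -[B [mB B0 AB]]; last first.
  by exists B; split => //; [exact: completion_measurable|rewrite completionE].
have [|F [mF BF muF]] := @outer_measure_borel_cover B.
  by rewrite -[mu_ext mu B]/(cmu B) B0.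
exists F; split => //; first by rewrite muF -[mu_ext mu B]/(cmu B).
exact: subset_trans BF.
Qed.

(** Each rational sublevel set is Borel up to a null set; the countably many null sets are removed
    at once, and the function is set to 0 on their union. *)
Lemma completion_fun (f : T -> R) : measurable_fun [set: cT] (f : cT -> R) ->
  exists N0, [/\ measurable N0, mu N0 = 0 &
    measurable_fun [set: T] (fun x => f x * \1_(~` N0) x)%R].
Proof.
move=> mf.
(* An enumeration of the rationals; indices that decode to nothing give 0, which does no harm. *)
pose q n : R := ratr (odflt (0 : rat)%R (unpickle n)).
have H n : exists BN : set T * set T,
    [/\ measurable BN.1, measurable BN.2, mu BN.2 = 0 &
       [set x | f x < q n]%R `\` BN.2 = BN.1 `\` BN.2].
  have : measurable ([set x | f x < q n]%R : set cT).
    have := mf measurableT `]-oo, (q n)[%classic (measurable_itv _).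
    by rewrite setTI; congr measurable; apply/seteqP; split => x /=; rewrite in_itv.
  by move/completion_set => [B [N0 ?]]; exists (B, N0).
have [BN HBN] := choice H.
pose NN := \bigcup_n (BN n).2.
have mNN : measurable NN.
  by apply: bigcupT_measurable => n; have [] := HBN n.
exists NN; split => //.
  apply/negligibleP => //; apply: negligible_bigcup => n.
  by apply/negligibleP; have [] := HBN n.
apply: (measurability _ (RGenInftyO.measurableE R)) => //= _ [_ [x ->] <-].
rewrite setTI.
(* Off [NN], f < x means f < q for some rational q < x. On [NN] the modified function is 0, so [NN]
   lies in the preimage exactly when 0 < x. *)
suff -> : (fun x => f x * \1_(~` NN) x)%R @^-1` `]-oo, x[ =
    (\bigcup_n (if (q n < x)%R then (BN n).1 `\` NN else set0)) `|`
    (if (0 < x)%R then NN else set0).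
  apply: measurableU; last by case: ifP.
  apply: bigcupT_measurable => n; case: ifP => // _.
  by apply: measurableD => //; have [] := HBN n.
apply/seteqP; split => y /=; rewrite in_itv /= indicE.
- have [yN|yN] := pselect (NN y).
    by rewrite memNset ?mulr0//= => ->; right.
  rewrite mem_set ?mulr1// => fx; left.
  have [r] := rat_in_itvoo fx; rewrite in_itv /= => /andP[fr rx].
  have qE : q (pickle r) = ratr r by rewrite /q pickleK.
  exists (pickle r) => //; rewrite qE rx; split => //.
  have [_ _ _ e] := HBN (pickle r).
  have : ([set x | f x < q (pickle r)]%R `\` (BN (pickle r)).2) y.
    by split; rewrite /= ?qE// => ?; apply: yN; exists (pickle r).
  by rewrite e => -[].
- case=> [[n _]|]; last first.
    by case: ifP => // x0 yN; rewrite memNset ?mulr0//; apply.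
  case: ifP => // qx -[By yN]; rewrite mem_set// mulr1.
  have [_ _ _ e] := HBN n.
  have : ((BN n).1 `\` (BN n).2) y by split => // ?; apply: yN; exists n.
  by rewrite -e => -[/= fy _]; exact: lt_trans qx.
Qed.

End completion.

(** * Lebesgue measure on row vectors *)

Section euclidean_measure.
Context {R : realType}.
Local Notation RR := (measurableTypeR R).

Definition obox N (a b : 'I_N -> R) : set 'rV[RR]_N :=
  [set x | forall i, a i < x ord0 i < b i].

Lemma oboxE N (a b : 'I_N -> R) :
  obox a b = [set x : 'rV[RR]_N | forall i, `]a i, b i[%classic (x ord0 i)].
Proof. by apply/seteqP; split=> x h i; have := h i; rewrite /= in_itv. Qed.

Lemma measurable_obox N (a b : 'I_N -> R) : measurable (obox a b).
Proof. by rewrite oboxE; apply: (@measurable_rV_box R N (fun i => `]a i, b i[%classic)) => i; exact: measurable_itv. Qed.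

Lemma obox_measure N (a b : 'I_N -> R) : (forall i, a i <= b i) ->
  borel_lebesgue_rV R N (obox a b) = (\prod_(i < N) (b i - a i))%:E.
Proof.
move=> ab; rewrite oboxE (@borel_lebesgue_rV_box R N (fun i => `]a i, b i[%classic)); last by move=> i; exact: measurable_itv.
rewrite (eq_bigr (fun i => (b i - a i)%:E)); last first.
  move=> i _; rewrite lebesgue_measure_itv /= lte_fin.
  case: ltP => [//|h]; have -> : a i = b i by apply/le_anti; rewrite ab h.
  by rewrite subrr.
by rewrite prodEFin.
Qed.

Lemma obox_empty N (a b : 'I_N -> R) : ~ (forall i, a i <= b i) -> obox a b = set0.
Proof.
move=> nab; apply/seteqP; split => // x h; apply: nab => i.
by have /andP[/lt_trans /[apply] /ltW] := h i.
Qed.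

(** Bounded boxes already generate: a cylinder over one open interval is the union over n of the
    boxes whose other sides are ]-n, n[. *)
Lemma measurable_rV_obox N : (@measurable _ 'rV[RR]_N) =
  <<s [set A | exists a b, A = obox a b] >>.
Proof.
apply/seteqP; split; last first.
  apply: smallest_sub; first exact: sigma_algebra_measurable.
  by move=> _ [a [b ->]]; exact: measurable_obox.
apply: smallest_sub; first exact: smallest_sigma_algebra.
case: N => [|N]; first by rewrite big_ord0.
rewrite -bigcup_mkord_ord; apply: bigcup_sub => i Ii.
pose S := [set A | exists a b : 'I_N.+1 -> R, A = obox a b].
suff : (@measurable _ RR) `<=` [set B | <<s S >> (@rV_coord _ RR _ (inord i) @^-1` B)].
  by move=> h A [B mB <-]; rewrite setTI; exact: h.
rewrite RGenOpens.measurableE; apply: smallest_sub.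
  split=> [|B /= hB|F /= hF].
  - by rewrite /= preimage_set0; exact: sigma_algebra0.
  - by rewrite setTD preimage_setC; exact: sigma_algebraC.
  - by rewrite preimage_bigcup; exact: sigma_algebra_bigcup.
move=> _ [a [b ->]] /=.
have -> : @rV_coord _ RR _ (inord i) @^-1` `]a, b[ = \bigcup_n
    obox (fun j : 'I_N.+1 => if j == inord i then a else - n%:R)
         (fun j : 'I_N.+1 => if j == inord i then b else n%:R).
  apply/seteqP; split => [x /=|x [n _ h] /=]; last first.
    by have := h (inord i); rewrite eqxx in_itv.
  rewrite in_itv /= => xab.
  exists (Num.truncn (\sum_j `|x ord0 j|)).+1 => // j; case: eqP => [->//|_].
  rewrite -ltr_norml; apply: le_lt_trans (truncnS_gt _).
  by rewrite (bigD1 j) //= lerDl sumr_ge0.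
apply: sigma_algebra_bigcup => n; apply: sub_sigma_algebra.
by eexists; eexists.
Qed.

Lemma obox_setI_closed N :
  setI_closed [set A : set 'rV[RR]_N | exists a b, A = obox a b].
Proof.
move=> _ _ [a [b ->]] [a' [b' ->]].
exists (fun i => Num.max (a i) (a' i)), (fun i => Num.min (b i) (b' i)).
apply/seteqP; split => x /=.
+ by move=> [h h'] i; have /andP[h1 h2] := h i; have /andP[h3 h4] := h' i;
    rewrite gt_max lt_min h1 h2 h3 h4.
+ move=> h; split=> i; have := h i; rewrite gt_max lt_min => /andP[/andP[? ?] /andP[? ?]];
    exact/andP.
Qed.

Lemma rV_measure_unique N (m1 m2 : {measure set 'rV[RR]_N -> \bar R}) :
  (forall a b, m1 (obox a b) = m2 (obox a b)) ->
  (forall a b, m1 (obox a b) < +oo)%E ->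
  forall A, measurable A -> m1 A = m2 A.
Proof.
move=> m12 m1oo A mA.
apply: (measure_unique [set A | exists a b, A = obox a b]
  (fun n => obox (fun=> - n%:R) (fun=> n%:R))) => //.
- exact: measurable_rV_obox.
- exact: obox_setI_closed.
- by move=> i; exists (fun=> - i%:R), (fun=> i%:R).
- apply/seteqP; split => // x _.
  exists (Num.truncn (\sum_i `|x ord0 i|)).+1 => // i.
  have : `|x ord0 i| < (Num.truncn (\sum_i `|x ord0 i|)).+1%:R.
    apply: le_lt_trans (truncnS_gt _).
    by rewrite (bigD1 i) //= lerDl sumr_ge0.
  by rewrite ltr_norml.
- by move=> _ [a [b ->]].
Qed.

Lemma affine_measurable N (t : R) (b : 'rV[RR]_N) :
  measurable_fun [set: 'rV[RR]_N] (fun x : 'rV[RR]_N => (t *: (x : 'rV[R]_N) + b : 'rV[RR]_N)).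
Proof.
apply: measurable_fun_rV => i.
rewrite (_ : (fun x => _) = fun x : 'rV[RR]_N => t * x ord0 i + b ord0 i).
  apply: measurable_funD => //; apply: measurable_funM => //.
  exact: (measurable_rV_coord (T := RR)).
by apply/funext => x; rewrite !mxE.
Qed.

(** The image of the measure under the affine map and t^-N times the measure agree on boxes, hence
    on all Borel sets. Translations are the case t = 1, dilations the case b = 0. *)
Lemma affine_integral N (t : R) (b : 'rV[RR]_N) (f : 'rV[RR]_N -> \bar R) :
  0 < t -> measurable_fun [set: 'rV[RR]_N] f -> (forall x, 0 <= f x)%E ->
  (\int[borel_lebesgue_rV R N]_x f ((t *: (x : 'rV[R]_N) + b)%R : 'rV[RR]_N) =
   (t ^- N)%:E * \int[borel_lebesgue_rV R N]_x f x)%E.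
Proof.
move=> t0 mf f0.
have tN0 : 0 <= t ^- N by rewrite invr_ge0 exprn_ge0// ltW.
have mA := affine_measurable t b.
rewrite -(@ge0_integral_pushforward _ _ _ _ R _ mA _ setT f)//.
rewrite -[X in (X%:E * _)%E]/((NngNum tN0)%:num).
rewrite -ge0_integral_mscale//.
apply: eq_measure_integral => A mB _.
apply: rV_measure_unique => // [a' b'|a' b'].
- rewrite /= /pushforward /mscale/=.
  have -> : (fun x : 'rV[RR]_N => (t *: (x : 'rV[R]_N) + b : 'rV[RR]_N)) @^-1` obox a' b' =
    obox (fun i => (a' i - b ord0 i) / t) (fun i => (b' i - b ord0 i) / t).
    by apply/seteqP; split => x h i; have := h i; rewrite !mxE ltr_pdivrMr// ltr_pdivlMr// ltrBlDr ltrBrDr (mulrC t).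
  have [ab|nab] := pselect (forall i, a' i <= b' i); last first.
    rewrite !obox_empty// ?measure0 ?mule0//.
    apply: contra_not nab => h i; have := h i.
    by rewrite ler_pM2r ?invr_gt0// lerD2r.
  rewrite !obox_measure//; last first.
    by move=> i; rewrite ler_pM2r ?invr_gt0// lerD2r ab.
  rewrite -EFinM; congr EFin.
  under eq_bigr => i _ do rewrite -mulrBl opprB addrA addrNK.
  by rewrite big_split/= prodr_const card_ord mulrC exprVn.
- rewrite /= /pushforward.
  have -> : (fun x : 'rV[RR]_N => (t *: (x : 'rV[R]_N) + b : 'rV[RR]_N)) @^-1` obox a' b' =
    obox (fun i => (a' i - b ord0 i) / t) (fun i => (b' i - b ord0 i) / t).
    by apply/seteqP; split => x h i; have := h i; rewrite !mxE ltr_pdivrMr// ltr_pdivlMr// ltrBlDr ltrBrDr (mulrC t).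
  set a2 := (fun i => _); set b2 := (fun i => _).
  have [ab|nab] := pselect (forall i, a2 i <= b2 i); last by rewrite obox_empty// measure0.
  by rewrite obox_measure// ltry.
Qed.

(** The topology is that of the sup norm, whose balls are cubes: an open set is the union of the
    cubes of rational centre and half-side 1/(n+1) that it contains. [F] sends every other cube to
    the empty set. *)
Lemma open_measurable_rV N (U : set 'rV[R]_N) : open U -> measurable (U : set 'rV[RR]_N).
Proof.
move=> oU.
pose F (k : 'rV[rat]_N * nat) : set 'rV[RR]_N :=
  let B := obox (fun i => ratr (k.1 ord0 i) - k.2.+1%:R^-1)
                (fun i => ratr (k.1 ord0 i) + k.2.+1%:R^-1) in
  if `[< B `<=` U >] then B else set0.
have -> : U = \bigcup_k F k.
  apply/seteqP; split => [x Ux|x [k _]]; last by rewrite /F; case: asboolP => // h /h.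
  have /nbhs_ballP[e /= e0 exU] := open_nbhs_nbhs (conj oU Ux : open_nbhs x U).
  have [n ne] : exists n, n.+1%:R^-1 < e / 2 :> R.
    have e2 : 0 < e / 2 by rewrite divr_gt0.
    have := near_infty_natSinv_lt (PosNum e2) => -[n _ hn].
    by exists n; apply: hn => /=.
  have H i : exists q : rat, x ord0 i - n.+1%:R^-1 < ratr q < x ord0 i + n.+1%:R^-1.
    have : x ord0 i - n.+1%:R^-1 < x ord0 i + n.+1%:R^-1.
      by rewrite ltrD2l gtrN// invr_gt0.
    by move=> /rat_in_itvoo[q]; rewrite in_itv; exists q.
  have [q hq] := choice H.
  exists (\row_i q i, n) => //; rewrite /F /=.
  rewrite asboolT.
    move=> i; rewrite mxE.
    have sym (y z w : R) : y - w < z < y + w -> z - w < y < z + w by lra.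
    exact: sym (hq i).
  move=> y hy; apply: exU; split=> // i j; rewrite (ord1 i) /ball /=.
  have := hy j; rewrite mxE => yj.
  have tri (h w z y' : R) : h < e / 2 -> w - h < z < w + h ->
    z - h < y' < z + h -> `|w - y'| < e by rewrite ltr_norml; lra.
  exact: tri ne (hq j) yj.
apply: countable_bigcupT_measurable => [|k]; first exact: countableP.
by rewrite /F; case: ifP => // _; exact: measurable_obox.
Qed.

Lemma continuous_measurable_rV N (f : 'rV[R]_N -> R) : continuous f ->
  measurable_fun [set: 'rV[RR]_N] (f : 'rV[RR]_N -> R).
Proof.
move=> cf; apply: (measurability _ (RGenOpens.measurableE R)) => //= _ [_ [a [b ->]] <-].
rewrite setTI; apply: open_measurable_rV.
by apply: open_comp => //; exact: interval_open.
Qed.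

End euclidean_measure.

(** * The Euclidean norm *)

Section euclidean_norm.
Context {R : realType} {N : nat}.
Implicit Types v w : 'rV[R]_N.

Lemma dotC v w : dot v w = dot w v.
Proof. by apply: eq_bigr => i _; rewrite mulrC. Qed.

Lemma dotDl u v w : dot (u + v) w = dot u w + dot v w.
Proof. by rewrite -big_split; apply: eq_bigr => i _; rewrite mxE mulrDl. Qed.

Lemma dotZl t v w : dot (t *: v) w = t * dot v w.
Proof. by rewrite mulr_sumr; apply: eq_bigr => i _; rewrite mxE mulrA. Qed.

Lemma dotDr u v w : dot u (v + w) = dot u v + dot u w.
Proof. by rewrite dotC dotDl !(dotC u). Qed.

Lemma dotZr t v w : dot v (t *: w) = t * dot v w.
Proof. by rewrite dotC dotZl dotC. Qed.

Lemma dotNl v w : dot (- v) w = - dot v w.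
Proof. by rewrite -scaleN1r dotZl mulN1r. Qed.

Lemma dotBl u v w : dot (u - v) w = dot u w - dot v w.
Proof. by rewrite dotDl dotNl. Qed.

Lemma dotBr u v w : dot w (u - v) = dot w u - dot w v.
Proof. by rewrite dotC dotBl !(dotC w). Qed.

Lemma dot_ge0 v : 0 <= dot v v.
Proof. by apply: sumr_ge0 => i _; rewrite -expr2 sqr_ge0. Qed.

Lemma enorm_ge0 v : 0 <= enorm v. Proof. exact: sqrtr_ge0. Qed.

Lemma sqr_enorm v : enorm v ^+ 2 = dot v v.
Proof. by rewrite sqr_sqrtr// dot_ge0. Qed.

Lemma enorm_eq0 v : (enorm v == 0) = (v == 0).
Proof.
apply/eqP/eqP => [/(congr1 (fun x => x ^+ 2))|->]; last first.
  by rewrite /enorm (_ : dot _ _ = 0) ?sqrtr0// /dot big1// => i _; rewrite mxE mul0r.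
rewrite sqr_enorm expr0n /= => /eqP.
rewrite psumr_eq0; last by move=> i _; rewrite -expr2 sqr_ge0.
move=> /allP h; apply/rowP => i; rewrite mxE.
by have := h i (mem_index_enum _); rewrite /= mulf_eq0 orbb => /eqP.
Qed.

Lemma enorm0 : enorm (0 : 'rV[R]_N) = 0.
Proof. by apply/eqP; rewrite enorm_eq0. Qed.

Lemma enormZ t v : enorm (t *: v) = `|t| * enorm v.
Proof.
by rewrite /enorm dotZl dotZr mulrA -expr2 sqrtrM ?sqr_ge0// sqrtr_sqr.
Qed.

Lemma enormN v : enorm (- v) = enorm v.
Proof. by rewrite -scaleN1r enormZ normrN1 mul1r. Qed.

Lemma enormB v w : enorm (v - w) = enorm (w - v).
Proof. by rewrite -enormN opprB. Qed.

Lemma dot_le_enorm v w : dot v w <= enorm v * enorm w.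
Proof.
have [->|w0] := eqVneq w 0.
  by rewrite enorm0 mulr0 -(scale0r 0) dotZr mul0r.
have [->|v0] := eqVneq v 0.
  by rewrite enorm0 mul0r -(scale0r 0) dotZl mul0r.
have vp : 0 < enorm v by rewrite lt_neqAle enorm_ge0 eq_sym enorm_eq0 v0.
have wp : 0 < enorm w by rewrite lt_neqAle enorm_ge0 eq_sym enorm_eq0 w0.
have := dot_ge0 (enorm w *: v - enorm v *: w).
rewrite dotBl !dotBr !dotZl !dotZr -!sqr_enorm (dotC w v).
set x := enorm v in vp *; set y := enorm w in wp *; set z := dot v w => h.
have {}h : 0 <= (2 * (x * y)) * (x * y - z) by nra.
rewrite -subr_ge0; move: h; rewrite pmulr_rge0//.
by rewrite mulr_gt0// mulr_gt0.
Qed.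

Lemma norm_dot_le v w : `|dot v w| <= enorm v * enorm w.
Proof.
rewrite ler_norml dot_le_enorm andbT lerNl -dotNl.
by rewrite -(enormN v) dot_le_enorm.
Qed.

Lemma ler_enormD v w : enorm (v + w) <= enorm v + enorm w.
Proof.
rewrite -(@ler_pXn2r _ 2)// ?nnegrE ?addr_ge0 ?enorm_ge0//.
rewrite sqr_enorm dotDl !dotDr (dotC w v) -!sqr_enorm.
have := dot_le_enorm v w; nra.
Qed.

Lemma ler_enormB v w : enorm (v - w) <= enorm v + enorm w.
Proof. by rewrite -(enormN w) ler_enormD. Qed.

Lemma ler_dist_enorm v w : `|enorm v - enorm w| <= enorm (v - w).
Proof.
rewrite ler_norml; apply/andP; split.
  by have := ler_enormD v (w - v); rewrite addrC subrK enormB; lra.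
by have := ler_enormD w (v - w); rewrite addrC subrK; lra.
Qed.

Lemma coord_le_enorm v i : `|v ord0 i| <= enorm v.
Proof.
rewrite -(@ler_pXn2r _ 2)// ?nnegrE ?enorm_ge0// sqr_enorm real_normK ?num_real//.
rewrite /dot (bigD1 i)//= -expr2 lerDl; apply: sumr_ge0 => j _.
by rewrite -expr2 sqr_ge0.
Qed.

Lemma enorm_le_sum v : enorm v <= \sum_i `|v ord0 i|.
Proof.
rewrite -(@ler_pXn2r _ 2)// ?nnegrE ?enorm_ge0 ?sumr_ge0// sqr_enorm.
rewrite expr2 mulr_suml; apply: ler_sum => i _.
apply: le_trans (ler_norm _) _; rewrite normrM ler_wpM2l//.
by rewrite (bigD1 i)//= lerDl sumr_ge0.
Qed.

End euclidean_norm.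

(** * Euclidean balls: measurability, positive volume, scaling *)

Section ball_volume.
Context {R : realType} {N : nat}.
Local Notation RR := (measurableTypeR R).
Local Notation mu := (borel_lebesgue_rV R N).

Lemma measurable_dot d (T : measurableType d) (v w : T -> 'rV[RR]_N) :
  measurable_fun [set: T] v -> measurable_fun [set: T] w ->
  measurable_fun [set: T] (fun x => dot (v x) (w x)).
Proof.
move=> mv mw; apply: measurable_sum => i; apply: measurable_funM.
- exact: (measurableT_comp (measurable_rV_coord (T := RR) i) mv).
- exact: (measurableT_comp (measurable_rV_coord (T := RR) i) mw).
Qed.

Lemma measurable_enorm d (T : measurableType d) (v : T -> 'rV[RR]_N) :
  measurable_fun [set: T] v -> measurable_fun [set: T] (fun x => enorm (v x)).
Proof.
move=> mv; apply: (measurableT_comp (f := @Num.sqrt R)); last exact: measurable_dot.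
apply: continuous_measurable_fun; exact: sqrt_continuous.
Qed.

Lemma measurable_eball (x : 'rV[RR]_N) r : measurable (eball x r : set 'rV[RR]_N).
Proof.
have m : measurable_fun [set: 'rV[RR]_N] (fun y : 'rV[RR]_N => enorm ((1 *: (y : 'rV[R]_N) - x)%R : 'rV[RR]_N)).
  by apply: measurable_enorm; exact: affine_measurable.
have := m measurableT `]-oo, r[%classic (measurable_itv _).
rewrite setTI; congr measurable; apply/seteqP; split => y;
  by rewrite /eball /= in_itv /= scale1r.
Qed.

Definition unit_ball_volume : R := fine (mu (eball 0 1)).

Lemma unit_ball_volumeE : mu (eball 0 1) = unit_ball_volume%:E.
Proof.
rewrite /unit_ball_volume fineK// ge0_fin_numE//.
apply: (@le_lt_trans _ _ (mu (obox (fun=> -1) (fun=> 1)))).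
  apply: le_measure; rewrite ?inE; [exact: measurable_eball|exact: measurable_obox|].
  move=> y; rewrite /eball /= subr0 => y1 i; rewrite -ltr_norml.
  exact: le_lt_trans (coord_le_enorm _ _) y1.
by rewrite obox_measure ?ltry// => _; lra.
Qed.

(** The cube of half-side 1/(N+1) lies in the ball, because the Euclidean norm is at most the sum of
    the |coordinates| and N/(N+1) < 1. *)
Lemma unit_ball_volume_gt0 : 0 < unit_ball_volume.
Proof.
have N0 : 0 < N.+1%:R :> R by rewrite ltr0n.
rewrite -lte_fin -unit_ball_volumeE.
apply: (@lt_le_trans _ _ (mu (obox (fun=> - N.+1%:R^-1) (fun=> N.+1%:R^-1)))).
  rewrite obox_measure; last by move=> _; rewrite ge0_cp // ltW// invr_gt0.
  rewrite lte_fin prodr_gt0// => i _; rewrite opprK addr_gt0// invr_gt0//.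
apply: le_measure; rewrite ?inE; [exact: measurable_obox|exact: measurable_eball|].
move=> y h; rewrite /eball /= subr0.
apply: le_lt_trans (enorm_le_sum _) _.
apply: (@le_lt_trans _ _ (\sum_(i < N) N.+1%:R^-1)).
  by apply: ler_sum => i _; have := h i; rewrite -ltr_norml => /ltW.
by rewrite sumr_const card_ord -[X in X < _]mulr_natl ltr_pdivrMr// mul1r ltr_nat.
Qed.

Lemma eball_volume (x : 'rV[RR]_N) r : 0 < r ->
  mu (eball x r) = (unit_ball_volume * r ^+ N)%:E.
Proof.
move=> r0.
pose f := (fun y => (\1_(eball x r : set 'rV[RR]_N) y)%:E) : 'rV[RR]_N -> \bar R.
have mf : measurable_fun [set: 'rV[RR]_N] f.
  by apply/measurable_EFinP; exact: measurable_indic (measurable_eball x r).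
have f0 y : (0 <= f y)%E by rewrite lee_fin.
have := affine_integral x r0 mf f0.
rewrite (_ : (fun y => f _) = fun y : 'rV[RR]_N => (\1_(eball 0 1 : set 'rV[RR]_N) y)%:E); last first.
  apply/funext => y; rewrite /f !indicE; congr ((nat_of_bool _)%:R%:E).
  rewrite !mem_setE -[RHS]/(enorm _ < 1) -[LHS]/(enorm _ < r).
  by rewrite addrK subr0 enormZ gtr0_norm// -ltr_pdivlMl// mulVf ?gt_eqF.
rewrite (integral_indic mu measurableT (measurable_eball 0 1)).
rewrite (integral_indic mu measurableT (measurable_eball x r)).
rewrite setIT [X in _ = (_ * mu X)%E -> _]setIT.
move=> h; have {h} := etrans (esym unit_ball_volumeE) h.
move=> h; rewrite mulrC EFinM h muleA -EFinM divff ?mul1e//.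
by rewrite gt_eqF// exprn_gt0.
Qed.

End ball_volume.

(** * Almost critical points *)

Section mountain_pass_algebra.
Variable R : realFieldType.
Implicit Types m c tau x y eta n k s : R.

(** A point below level m/2 that gains at most m/8 stays below 5m/8, whereas c - tau is at least
    7m/8. *)
Lemma low_value_algebra m c tau x y :
  x < m / 2 -> m <= c -> tau <= m / 8 -> 0 < m -> y - x <= m / 8 -> y < c - tau.
Proof. lra. Qed.

Lemma derivative_perturbation_algebra eta n x :
  eta / 4 * n <= eta / 4 * 1 -> - (eta / 4 * n) <= x - eta -> eta - eta / 4 <= x.
Proof. lra. Qed.

Lemma convex_bound_algebra k eta x y : k * (eta - eta / 4) <= k * y ->
  (1 - k) * (eta - eta / 4) <= (1 - k) * x -> eta - eta / 4 <= (1 - k) * x + k * y.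
Proof. lra. Qed.

(** A step of length s along slope 3 eta/4, with linearisation error s eta/4, lowers the value by s
    eta/2; this beats the 2 tau needed to pass from c + tau to c - tau. *)
Lemma descent_algebra x y z s eta n c tau : 0 < s * eta -> x < c + tau ->
  tau <= s * eta / 8 -> s * (eta - eta / 4) <= s * z -> eta / 4 * n <= eta / 4 * s ->
  y - x - - s * z <= eta / 4 * n -> y < c - tau.
Proof. lra. Qed.

End mountain_pass_algebra.

Section almost_critical_points.
Context {R : realType} {V : lmodType R} (W : set V).
Hypothesis WD : forall x y, W x -> W y -> W (x + y).
Hypothesis WZ : forall t x, W x -> W (t *: x).
Variable nrm : V -> R.
Hypothesis nrmD : forall x y, W x -> W y -> nrm (x + y) <= nrm x + nrm y.
Hypothesis nrmZ : forall t x, W x -> nrm (t *: x) = `|t| * nrm x.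
Variables (J : V -> R) (D : V -> V -> R).
Hypothesis D_linear : forall a b u v w, W u -> W v -> W w ->
  D u (a *: v + b *: w) = a * D u v + b * D u w.
Hypothesis J_cont : forall (M e : R), 0 < e -> exists2 d, 0 < d &
  forall u h, W u -> W h -> nrm u <= M -> nrm h <= d -> `|J (u + h) - J u| <= e.
Hypothesis J_diff : forall (M e : R), 0 < e -> exists2 d, 0 < d &
  forall u h, W u -> W h -> nrm u <= M -> nrm h <= d ->
    `|J (u + h) - J u - D u h| <= e * nrm h.
Hypothesis D_cont : forall (M e : R), 0 < e -> exists2 d, 0 < d &
  forall u h v, W u -> W h -> W v -> nrm u <= M -> nrm h <= d ->
    `|D (u + h) v - D u v| <= e * nrm v.
Hypothesis J_coercive : forall L, exists M, forall u, W u -> J u <= L -> nrm u <= M.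
Hypothesis J_bounded : forall M, exists B, forall u, W u -> nrm u <= M -> `|J u| <= B.
Variables (rho m : R) (e0 : V).
Hypothesis rho_gt0 : 0 < rho.
Hypothesis m_gt0 : 0 < m.
Hypothesis J_sphere : forall u, W u -> nrm u = rho -> m <= J u.
Hypothesis J0 : J 0 <= 0.
Hypothesis We0 : W e0.
Hypothesis e0_out : rho < nrm e0.
Hypothesis Je0 : J e0 <= 0.

(** [nrm] is a seminorm on [W], and the regularity of [J] and [D] is uniform on sets bounded for it.
    Working with approximate critical points postpones every compactness question to a single limit
    passage. *)
Definition almost_critical eta u := forall v, W v -> `|D u v| <= eta * nrm v.

Let W0 : W 0. Proof. by rewrite -(scale0r e0); exact: WZ. Qed.
Let WB x y : W x -> W y -> W (x - y).
Proof. by move=> ? ?; rewrite -scaleN1r; apply/WD/WZ. Qed.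
Let nrm0 : nrm 0 = 0.
Proof. by rewrite -(scale0r e0) nrmZ// normr0 mul0r. Qed.
Let nrmN x : W x -> nrm (- x) = nrm x.
Proof. by move=> Wx; rewrite -scaleN1r nrmZ// normrN1 mul1r. Qed.
Let nrm_ge0 x : W x -> 0 <= nrm x.
Proof.
move=> Wx; have := nrmD Wx (WB W0 Wx).
by rewrite sub0r subrr nrm0 nrmN//; lra.
Qed.
Let DZ t u v : W u -> W v -> D u (t *: v) = t * D u v.
Proof.
move=> Wu Wv; have := D_linear t 0 Wu Wv W0.
by rewrite scaler0 addr0 mul0r addr0.
Qed.

(** Rescaling a direction that violates the bound by eta / D u v gives slope exactly eta and norm at
    most 1; this normalised direction drives all descent steps. *)
Lemma not_almost_critical eta u : 0 < eta -> W u -> ~ almost_critical eta u ->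
  exists q, [/\ W q, nrm q <= 1 & D u q = eta].
Proof.
move=> eta0 Wu /existsNP[v /not_implyP[Wv /negP]]; rewrite -ltNge => h.
have Dn0 : D u v != 0.
  apply/eqP => D0; move: h; rewrite D0 normr0 ltNge.
  by rewrite mulr_ge0 ?nrm_ge0 ?ltW.
exists ((eta / D u v) *: v); split; [exact: WZ| |by rewrite DZ// divfK].
rewrite nrmZ// normrM normfV (gtr0_norm eta0) mulrAC ler_pdivrMr ?normr_gt0//.
by rewrite mul1r ltW.
Qed.

(** Along the segment the norm is a Lipschitz function of the parameter, so the intermediate value
    theorem applies. *)
Lemma nrm_segment_ivt x h : W x -> W h ->
  (nrm x <= rho <= nrm (x + h) \/ nrm (x + h) <= rho <= nrm x) ->
  exists2 t, 0 <= t <= 1 & nrm (x + t *: h) = rho.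
Proof.
move=> Wx Wh H.
have lip t s : nrm (x + t *: h) <= nrm (x + s *: h) + `|t - s| * nrm h.
  rewrite -nrmZ// (_ : x + t *: h = (x + s *: h) + (t - s) *: h).
    by apply: nrmD; [apply: WD => //|]; exact: WZ.
  by rewrite scalerBl -addrA; congr (_ + _); rewrite addrCA addrN addr0.
pose f t := nrm (x + t *: h).
have cf : {within `[0, 1], continuous f}.
  apply: continuous_subspaceT => t.
  apply/cvgrPdist_le => /= e egt0.
  have K0 : 0 < nrm h + 1 by have := nrm_ge0 Wh; lra.
  near=> s.
  have ts : `|t - s| <= e / (nrm h + 1).
    by near: s; apply: cvgr_dist_le; [exact: cvg_id|rewrite divr_gt0].
  have b : `|t - s| * nrm h <= e.
    apply: (@le_trans _ _ (`|t - s| * (nrm h + 1))).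
      by rewrite ler_wpM2l// lerDl.
    by rewrite -ler_pdivlMr.
  rewrite /f ler_norml; apply/andP; split.
    by have := lip s t; rewrite distrC; lra.
  by have := lip t s; lra.
have := @IVT R f 0 1 rho ler01 cf.
rewrite /f scale0r addr0 scale1r.
case=> [|t]; last by rewrite in_itv; exists t.
by case: H => /andP[h1 h2]; rewrite ge_min le_max h1 h2 ?orbT.
Unshelve. all: by end_near. Qed.

(** [P] is to be the closed ball or its closed exterior. If a point within s eta/4 of the infimum
    were not almost critical, the step - s q would lower J by s eta/2 without leaving [P], a
    contradiction. *)
Lemma almost_critical_min (P : set V) b eta : 0 < eta ->
  W b -> P b -> J b <= 0 ->
  (forall u h, W u -> W h -> P u -> ~ P (u + h) ->
     exists2 t, 0 <= t <= 1 & nrm (u + t *: h) = rho) ->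
  exists u, [/\ W u, P u, J u <= J b & almost_critical eta u].
Proof.
move=> eta0 Wb Pb Jb0 HP.
apply: contrapT => no.
have {}no u : W u -> P u -> J u <= J b -> ~ almost_critical eta u.
  by move=> ? ? ? ?; apply: no; exists u.
have [M HM] := J_coercive (J b).
have [B HB] := J_bounded M.
have [d1 d10 H1] := J_cont M (divr_gt0 m_gt0 (ltr0Sn R 1)).
have [d2 d20 H2] := J_diff M (divr_gt0 eta0 (ltr0Sn R 1)).
pose s := Num.min d1 d2.
have s0 : 0 < s by rewrite lt_min d10 d20.
pose S := [set J u | u in [set u | [/\ W u, P u & J u <= J b]]].
have infS : has_inf S.
  split; first by exists (J b), b.
  exists (- B) => _ [u [Wu Pu Ju] <-].
  by have := HB u Wu (HM u Wu Ju); rewrite ler_norml => /andP[].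
have se0 : 0 < s * eta / 4 by rewrite divr_gt0// mulr_gt0.
have [_ [u [Wu Pu Ju] <-] uinf] := inf_adherent se0 infS.
have [q [Wq q1 Dq]] := not_almost_critical eta0 Wu (no u Wu Pu Ju).
have nu := HM u Wu Ju.
have nsq t : 0 <= t <= 1 -> nrm ((- (t * s)) *: q) <= s.
  move=> /andP[t0 t1]; rewrite nrmZ// normrN ger0_norm ?mulr_ge0 ?(ltW s0)//.
  apply: (@le_trans _ _ (t * s * 1)); last by rewrite mulr1 ger_pMl.
  by rewrite ler_wpM2l// mulr_ge0// ltW.
(* Leaving [P] would mean meeting the sphere on the way, where J >= m; but J u <= 0 and J varies by
   at most m/2 along the step. *)
have Pn : P (u + (- s) *: q).
  apply: contrapT => /(HP _ _ Wu (WZ _ Wq) Pu)[t t01 nt].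
  have := H1 u (t *: (- s *: q)) Wu (WZ _ (WZ _ Wq)) nu.
  rewrite scalerA mulrN => /(_ (le_trans (nsq t t01) _)).
  rewrite ge_min lexx => /(_ isT).
  have := J_sphere (WD Wu (WZ _ (WZ _ Wq))) nt.
  rewrite scalerA mulrN ler_norml => h1 /andP[_ h2].
  by move: h1 h2 Ju Jb0 m_gt0; lra.
have ns := nsq 1; rewrite mul1r in ns.
have := H2 u (- s *: q) Wu (WZ _ Wq) nu.
have {}ns : nrm (- s *: q) <= s by apply: ns; lra.
move=> /(_ (le_trans ns _)); rewrite ge_min lexx orbT => /(_ isT).
rewrite DZ// Dq => h.
have {}h : J (u - s *: q) <= J u - s * eta / 2.
  move: h; rewrite scaleNr ler_norml => /andP[_].
  have : eta / 2 * nrm (- s *: q) <= eta / 2 * s by rewrite ler_pM2l// divr_gt0.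
  by rewrite scaleNr; lra.
have : inf S <= J (u + - s *: q).
  apply: ge_inf; first by case: infS.
  exists (u + - s *: q) => //; split => //; first by apply: WD => //; exact: WZ.
  by rewrite scaleNr (le_trans h)//; lra.
rewrite scaleNr; move: uinf h se0; lra.
Qed.

(* Polygonal lines with steps of length at most [r] lying below the level [t]: they replace the continuous
   paths of the usual mountain pass argument, so that no path space or deformation flow is needed. *)
Inductive chain (t r : R) : V -> V -> Prop :=
| chain_nil x : W x -> chain t r x x
| chain_cons x y z : W x -> W y -> nrm (y - x) <= r ->
    (forall k, 0 <= k <= 1 -> J (x + k *: (y - x)) < t) ->
    chain t r y z -> chain t r x z.

Lemma chain_trans t r x y z : chain t r x y -> chain t r y z -> chain t r x z.
Proof.
elim => [//|x' y' z' Wx Wy n h c IH] c'.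
by apply: chain_cons h (IH c').
Qed.

Lemma chain_le t t' r r' x y : t <= t' -> r <= r' -> chain t r x y -> chain t' r' x y.
Proof.
move=> tt rr; elim => [x' Wx|x' y' z' Wx Wy n h c IH]; first exact: chain_nil.
apply: (chain_cons Wx Wy) IH; first exact: le_trans rr.
by move=> k k01; exact: lt_le_trans (h k k01) tt.
Qed.

(** The length fixes the number of equal pieces; the induction peels off one piece at a time. *)
Lemma chain_segment t r x y : 0 < r -> W x -> W y ->
  (forall k, 0 <= k <= 1 -> J (x + k *: (y - x)) < t) -> chain t r x y.
Proof.
move=> r0 Wx Wy h.
have [n hn] : exists n : nat, nrm (y - x) <= n.+1%:R * r.
  exists (Num.truncn (nrm (y - x) / r)).
  by rewrite -ler_pdivrMr// ltW// truncnS_gt.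
elim: n => [|n IH] in x Wx h hn *.
  by rewrite mul1r in hn; apply: (chain_cons Wx Wy hn h); exact: chain_nil.
(* With n+2 pieces left, advance by the fraction 1/(n+2): the rest has (n+1)/(n+2) of the length. *)
pose k : R := n.+2%:R^-1.
have k0 : 0 < k by rewrite invr_gt0.
have k1 : k <= 1 by rewrite invf_le1// ler1n.
have Wz : W (x + k *: (y - x)) by apply/WD/WZ/WB.
have zx : x + k *: (y - x) - x = k *: (y - x) by rewrite addrAC subrr add0r.
have yz : y - (x + k *: (y - x)) = (1 - k) *: (y - x).
  by rewrite scalerBl scale1r opprD addrA.
apply: (chain_cons Wx Wz).
- rewrite zx nrmZ; last exact: WB.
  by rewrite gtr0_norm// mulrC ler_pdivrMr// mulrC.
- move=> s /andP[s0 s1]; rewrite zx scalerA; apply: h.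
  by rewrite mulr_ge0 ?(ltW k0)//= mulr_ile1// ltW.
- apply: IH => //.
  + move=> s /andP[s0 s1]; rewrite yz scalerA -addrA -scalerDl; apply: h.
    by apply/andP; split; nra.
  + rewrite yz nrmZ; last exact: WB.
    rewrite ger0_norm ?subr_ge0//.
    rewrite (_ : 1 - k = n.+1%:R / n.+2%:R); last first.
      apply: (mulIf (x := n.+2%:R)); first by rewrite pnatr_eq0.
      by rewrite mulfVK ?pnatr_eq0// mulrBl mul1r mulVf ?pnatr_eq0// -(natr1 n.+1) addrK.
    by rewrite mulrAC ler_pdivrMr// mulrAC -mulrA ler_pM2l.
Qed.

Lemma chain_refine t r r' x y : 0 < r' -> chain t r x y -> chain t r' x y.
Proof.
move=> r0; elim => [x' Wx|x' y' z' Wx Wy n h c IH]; first exact: chain_nil.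
by apply: chain_trans IH; exact: chain_segment.
Qed.

(** Some link passes from inside the sphere to outside and meets it, where J >= m. *)
Lemma chain_mountain t r x : chain t r x e0 -> nrm x <= rho -> m < t.
Proof.
move eq: e0 => z c; move: c eq; elim => [x' Wx' <-|x' y z' Wx Wy n h c IH ez] nx.
  by move: e0_out; rewrite ltNge nx.
have [ny|ny] := leP (nrm y) rho; first exact: IH.
have [|k k01 nk] := @nrm_segment_ivt x' (y - x') Wx (WB Wy Wx).
  by left; rewrite nx addrCA subrr addr0 ltW.
apply: le_lt_trans (h k k01).
by apply: J_sphere nk; apply/WD/WZ/WB.
Qed.

(** Let c be the infimum of the levels below which 0 and [e0] can be joined. Without almost critical
    points of level between m/2 and c + 1, moving every vertex x of a chain below c + tau to x - s
    q(x) gives a chain below c - tau with the same ends. The bound c + 1 does not depend on eta,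
    which a later limit requires. *)
Lemma almost_critical_mountain_pass : exists C, forall eta, 0 < eta ->
  exists u, [/\ W u, m / 2 <= J u, J u <= C & almost_critical eta u].
Proof.
have [B HB] := J_bounded (nrm e0).
(* The step bound 1 is arbitrary, since [chain_refine] changes it at no cost in level. *)
pose T := [set t | chain t 1 0 e0].
have T0 : T (B + 1).
  apply: chain_segment => // k /andP[k0 k1]; rewrite subr0 add0r.
  have := HB (k *: e0) (WZ _ We0).
  rewrite nrmZ// ger0_norm// -[leRHS]mul1r ler_wpM2r ?nrm_ge0// => /(_ isT).
  by rewrite ler_norml => /andP[_]; lra.
have Tm t : T t -> m < t by move=> /chain_mountain; apply; rewrite nrm0 ltW.
have infT : has_inf T by split; [exists (B + 1)|exists m => t /Tm /ltW].
pose c := inf T.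
have mc : m <= c by apply: lb_le_inf; [exists (B + 1)|move=> t /Tm /ltW].
exists (c + 1) => eta eta0.
apply: contrapT => no.
have {}no u : W u -> m / 2 <= J u -> J u <= c + 1 -> ~ almost_critical eta u.
  by move=> ? ? ? ?; apply: no; exists u.
have [M HM] := J_coercive (c + 1).
have [d1 d10 H1] := J_diff M (divr_gt0 eta0 (ltr0Sn R 3)).
have [d2 d20 H2] := D_cont M (divr_gt0 eta0 (ltr0Sn R 3)).
have [d3 d30 H3] := J_cont M (divr_gt0 m_gt0 (ltr0Sn R 7)).
(* The displacement s stays within reach of the linearisation ([d1]), the link length r within reach
   of the continuity of [D] ([d2]), and together they stay within reach of the continuity of [J]
   ([d3]). *)
pose s := Num.min d1 (d3 / 2).
have s0 : 0 < s by rewrite lt_min d10 divr_gt0.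
have sd1 : s <= d1 by rewrite ge_min lexx.
have sd3 : s <= d3 / 2 by rewrite ge_min lexx orbT.
pose r := Num.min d2 (d3 / 2).
have r0 : 0 < r by rewrite lt_min d20 divr_gt0.
have rd2 : r <= d2 by rewrite ge_min lexx.
have rd3 : r <= d3 / 2 by rewrite ge_min lexx orbT.
pose tau := Num.min 1 (Num.min (m / 8) (s * eta / 8)).
have se : 0 < s * eta by rewrite mulr_gt0.
have tau0 : 0 < tau by rewrite !lt_min ltr01 !divr_gt0.
have tau1 : tau <= 1 by rewrite ge_min lexx.
have taum : tau <= m / 8 by rewrite !ge_min lexx !orbT.
have taus : tau <= s * eta / 8 by rewrite !ge_min lexx !orbT.
(* A direction is chosen at each point independently, with no continuity in x. It is 0 below level
   m/2, so that the ends of the chain do not move. *)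
have /choice[q Hq] : forall x, exists q, W x -> J x <= c + 1 ->
    [/\ W q, nrm q <= 1, (J x < m / 2 -> q = 0) & (m / 2 <= J x -> D x q = eta)].
  move=> x; have [Wx|nWx] := pselect (W x); last by exists 0.
  have [Jx|nJx] := pselect (J x <= c + 1); last by exists 0.
  have [h|h] := ltP (J x) (m / 2).
    by exists 0 => _ _; split; rewrite ?nrm0 ?ler01// leNgt h.
  have [y [Wy y1 Dy]] := not_almost_critical eta0 Wx (no x Wx h Jx).
  by exists y => _ _; split=> //; rewrite ltNge h.
pose mv x := x - s *: q x.
have low x : W x -> J x < m / 2 -> mv x = x.
  move=> Wx Jx; have Jc : J x <= c + 1 by move: mc m_gt0 Jx; lra.
  by have [_ _ /(_ Jx) q0 _] := Hq x Wx Jc; rewrite /mv q0 scaler0 subr0.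
have seg x y : W x -> W y -> nrm (y - x) <= r ->
    (forall k, 0 <= k <= 1 -> J (x + k *: (y - x)) < c + tau) ->
    forall k, 0 <= k <= 1 -> J (mv x + k *: (mv y - mv x)) < c - tau.
  move=> Wx Wy xyr Jxy k /andP[k0 k1].
  have Jx : J x < c + tau by have := Jxy 0; rewrite scale0r addr0; apply; rewrite lexx ler01.
  have Jy : J y < c + tau by have := Jxy 1; rewrite scale1r addrCA subrr addr0; apply; rewrite lexx ler01.
  have Jx1 : J x <= c + 1 by apply: le_trans (ltW Jx) _; rewrite lerD2l.
  have Jy1 : J y <= c + 1 by apply: le_trans (ltW Jy) _; rewrite lerD2l.
  have [Wqx qx1 qx0 qxe] := Hq x Wx Jx1.
  have [Wqy qy1 qy0 qye] := Hq y Wy Jy1.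
  pose w := x + k *: (y - x).
  pose Q := (1 - k) *: q x + k *: q y.
  have Ww : W w by apply/WD/WZ/WB.
  have WQ : W Q by apply: WD; apply: WZ.
  have k1' : 0 <= 1 - k by rewrite subr_ge0.
  have Q1 : nrm Q <= 1.
    apply: le_trans (nrmD (WZ _ Wqx) (WZ _ Wqy)) _.
    rewrite !nrmZ// !ger0_norm//.
    apply: (@le_trans _ _ ((1 - k) * 1 + k * 1)); last by rewrite !mulr1 subrK.
    by apply: lerD; rewrite ler_wpM2l.
  (* On a moved link the point of parameter k is w - s Q, where w is the old point and Q the same
     convex combination of the two directions; linearity of [D w] then replaces continuity of q. *)
  have -> : mv x + k *: (mv y - mv x) = w + (- s) *: Q.
    rewrite /mv /w /Q opprD opprK [X in k *: X]addrACA scalerDr addrACA.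
    congr (_ + _); rewrite !scalerDr scalerN !scalerA -!scaleNr addrCA -scalerDl addrC.
    congr (_ *: _ + _ *: _); first by ring.
    by rewrite -[LHS]/(- k * s) mulrC mulrN mulNr.
  have nJw : J w < c + tau by apply: Jxy; rewrite k0 k1.
  have nw : nrm w <= M by apply: HM => //; apply: le_trans (ltW nJw) _; rewrite lerD2l.
  have nsQ : nrm (- s *: Q) <= s.
    rewrite nrmZ// normrN gtr0_norm// -[leRHS]mulr1.
    by rewrite ler_pM2l.
  have wx : nrm (w - x) <= r.
    rewrite /w addrAC subrr add0r nrmZ; last exact: WB.
    rewrite ger0_norm// (le_trans _ xyr)// -[leRHS]mul1r ler_wpM2r//.
    exact/nrm_ge0/WB.
  have wy : nrm (w - y) <= r.
    have -> : w - y = (- (1 - k)) *: (y - x).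
      rewrite /w scaleNr scalerBl scale1r opprB addrAC addrC; congr (_ + _).
      by rewrite opprB.
    rewrite nrmZ; last exact: WB.
    rewrite normrN ger0_norm// (le_trans _ xyr)// -[leRHS]mul1r ler_wpM2r//.
      exact/nrm_ge0/WB.
    by rewrite gerBl.
  (* If either end of the link is low, the whole moved link is low, whatever the direction at the
     other end. *)
  have lowcase z : W z -> J z <= c + 1 -> nrm (w - z) <= r -> J z < m / 2 ->
      J (w + - s *: Q) < c - tau.
    move=> Wz Jz wz zlow.
    have := H3 z (w - z + - s *: Q) Wz (WD (WB Ww Wz) (WZ _ WQ)) (HM _ Wz Jz).
    have -> : z + (w - z + - s *: Q) = w + - s *: Q by rewrite addrA [z + _]addrC subrK.
    have h : nrm (w - z + - s *: Q) <= d3.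
      apply: le_trans (nrmD (WB Ww Wz) (WZ _ WQ)) _.
      rewrite [leRHS]splitr; apply: lerD; [exact: le_trans wz rd3|exact: le_trans nsQ sd3].
    move=> /(_ h); rewrite ler_norml => /andP[_].
    exact: low_value_algebra zlow mc taum m_gt0.
  have [Jxl|Jxh] := ltP (J x) (m / 2); first exact: (lowcase x).
  have [Jyl|Jyh] := ltP (J y) (m / 2); first exact: (lowcase y).
  (* Both ends are high now; the slope eta along each direction drops by at most eta/4 between the
     vertex and w. *)
  have DwQ : eta - eta / 4 <= D w Q.
    have Dwz z v : W z -> J z <= c + 1 -> nrm (w - z) <= r -> W v -> nrm v <= 1 ->
        D z v = eta -> eta - eta / 4 <= D w v.
      move=> Wz Jz wz Wv v1 Dz.
      have := H2 z (w - z) v Wz (WB Ww Wz) Wv (HM _ Wz Jz) (le_trans wz rd2).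
      rewrite (addrC z) subrK Dz ler_norml => /andP[+ _].
      have : eta / 4 * nrm v <= eta / 4 * 1 by rewrite ler_pM2l// divr_gt0.
      exact: derivative_perturbation_algebra.
    have h1 := Dwz x _ Wx Jx1 wx Wqx qx1 (qxe Jxh).
    have h2 := Dwz y _ Wy Jy1 wy Wqy qy1 (qye Jyh).
    rewrite D_linear//.
    have : (1 - k) * (eta - eta / 4) <= (1 - k) * D w (q x) by rewrite ler_wpM2l.
    have : k * (eta - eta / 4) <= k * D w (q y) by rewrite ler_wpM2l.
    exact: convex_bound_algebra.
  have := H1 w (- s *: Q) Ww (WZ _ WQ) nw (le_trans nsQ sd1).
  rewrite DZ// ler_norml => /andP[_].
  have : eta / 4 * nrm (- s *: Q) <= eta / 4 * s by rewrite ler_pM2l// divr_gt0.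
  have : s * (eta - eta / 4) <= s * D w Q by rewrite ler_pM2l.
  exact: descent_algebra se nJw taus.
have [t Tt tc] := inf_adherent tau0 infT.
(* Moving both ends of a link lengthens it by at most 2 s. *)
have mvc x : chain (c + tau) r x e0 -> chain (c - tau) (r + s + s) (mv x) (mv e0).
  have nq z : W z -> J z < c + tau -> W (q z) /\ nrm (q z) <= 1.
    by move=> Wz Jz; have [|? ? _ _] := Hq z Wz _; [move: Jz tau1; lra|].
  have WJe : W e0 /\ J e0 < c + tau.
    split; first exact: We0.
    by apply: le_lt_trans Je0 _; apply: addr_gt0 => //; exact: lt_le_trans m_gt0 mc.
  move eqz : e0 WJe => z WJe ch; elim: ch WJe => [x' Wx' [_ Jx']|x' y z' Wx Wy n h ch IH WJz].
    by apply: chain_nil; have [? _] := nq x' Wx' Jx'; apply/WB/WZ.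
  have Jx : J x' < c + tau by have := h 0; rewrite scale0r addr0; apply; rewrite lexx ler01.
  have Jy : J y < c + tau by have := h 1; rewrite scale1r addrCA subrr addr0; apply; rewrite lexx ler01.
  have [Wqx qx1] := nq x' Wx Jx; have [Wqy qy1] := nq y Wy Jy.
  apply: chain_cons (IH WJz).
  - by apply/WB/WZ.
  - by apply/WB/WZ.
  - rewrite /mv opprD opprK addrACA -scaleNr.
    apply: le_trans (nrmD (WB Wy Wx) (WD (WZ _ Wqy) (WZ _ Wqx))) _.
    rewrite -addrA lerD//; apply: le_trans (nrmD (WZ _ Wqy) (WZ _ Wqx)) _.
    by rewrite !nrmZ// normrN gtr0_norm// lerD// ger_pMr.
  - exact: seg.
(* The ends have J <= 0 < m/2 and are fixed; refining the moved chain back to step 1 puts c - tau in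
   [T]. *)
have := mvc 0 (chain_le (ltW tc) (lexx _) (chain_refine r0 Tt)).
rewrite !low// => [/(chain_refine ltr01) h| |].
- have : c <= c - tau by apply: ge_inf => //; case: infT.
  by rewrite lerBrDr gerDl leNgt tau0.
- by apply: le_lt_trans Je0 _; rewrite divr_gt0.
- by apply: le_lt_trans J0 _; rewrite divr_gt0.
Qed.

End almost_critical_points.

(** * The vector field |z|^(p-2) z *)

Section vector_power.
Context {R : realType} {n : nat} (p : R).
Hypothesis p1 : 1 < p.
Implicit Types (x y : 'rV[R]_n) (s t : R).

Definition pflux x : 'rV[R]_n := enorm x `^ (p - 2) *: x.

Let p0 : 0 < p. Proof. by move: p1; lra. Qed.
Let pB1 : 0 < p - 1. Proof. by move: p1; lra. Qed.
Let p0w : 0 <= p. Proof. exact: ltW. Qed.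
Let pB1w : 0 <= p - 1. Proof. exact: ltW. Qed.

Lemma powR_sub2_mul s : 0 <= s -> s `^ (p - 2) * s = s `^ (p - 1).
Proof.
move=> s0; rewrite mulrC -(mulr_powRB1 s0 pB1); congr (_ * _ `^ _); ring.
Qed.

Lemma powR_sub1_mul s : 0 <= s -> s `^ (p - 1) * s = s `^ p.
Proof. by move=> s0; rewrite mulrC mulr_powRB1. Qed.

Lemma enorm_pflux x : enorm (pflux x) = enorm x `^ (p - 1).
Proof. by rewrite enormZ ger0_norm ?powR_ge0// powR_sub2_mul// enorm_ge0. Qed.

Lemma dot_pflux x : dot (pflux x) x = enorm x `^ p.
Proof.
by rewrite dotZl -sqr_enorm expr2 mulrA powR_sub2_mul ?enorm_ge0// powR_sub1_mul ?enorm_ge0.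
Qed.

(** Young's inequality with exponents p/(p-1) and p, applied to s^(p-1) and t. *)
Lemma young_powR s t : 0 <= s -> 0 <= t ->
  p * (s `^ (p - 1) * t) <= (p - 1) * s `^ p + t `^ p.
Proof.
move=> s0 t0.
have q0 : 0 < p / (p - 1) by rewrite divr_gt0.
have := @conjugate_powR R (s `^ (p - 1)) t (p / (p - 1)) p (powR_ge0 _ _) t0 q0 p0.
have -> : (p / (p - 1))^-1 + p^-1 = 1.
  by rewrite invf_div; field; rewrite gt_eqF.
move=> /(_ erefl); rewrite -powRrM.
have -> : (p - 1) * (p / (p - 1)) = p by field; rewrite gt_eqF.
rewrite -(ler_pM2l p0) => /le_trans; apply.
rewrite le_eqVlt; apply/orP; left; apply/eqP.
by field; rewrite !gt_eqF.
Qed.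

Lemma young_pflux x y : p * dot (pflux x) y <= (p - 1) * enorm x `^ p + enorm y `^ p.
Proof.
apply: le_trans (young_powR (enorm_ge0 x) (enorm_ge0 y)).
by rewrite ler_pM2l// -enorm_pflux dot_le_enorm.
Qed.

(** The gradient inequality for the convex function |x|^p, obtained from Young rather than from a
    derivative. *)
Lemma enorm_powR_convex x y :
  enorm x `^ p + p * dot (pflux x) (y - x) <= enorm y `^ p.
Proof. by have := young_pflux x y; rewrite dotBr dot_pflux; lra. Qed.

Lemma powR_sub2_continuous1 (e : R) : 0 < e -> exists k, [/\ 0 < k, k <= 2^-1 &
  forall s, `|s - 1| <= k -> `|s `^ (p - 2) - 1| <= e].
Proof.
move=> e0.
have d1 : derivable (fun s : R => s `^ (p - 2)) 1 1.
  by apply: derivable_powR; rewrite in_itv /= andbT.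
have c1 : {for 1, continuous (fun s : R => s `^ (p - 2))}.
  by apply: differentiable_continuous; apply/derivable1_diffP.
move: c1 => /cvgrPdist_le /(_ _ e0) /nbhs_ballP[k /= k0 hk].
exists (Num.min (k / 2) 2^-1); split.
- by rewrite lt_min divr_gt0//= invr_gt0.
- by rewrite ge_min lexx orbT.
- move=> s; rewrite le_min => /andP[sk _].
  have := hk s; rewrite /ball /= distrC powR1 (distrC 1); apply.
  by apply: le_lt_trans sk _; rewrite ltr_pdivrMr// ltr_pMr// ltr1n.
Qed.

(** A form valid for 1 < p < 2 and p >= 2 alike. If |x - y| > k |x|, both fluxes are controlled by
    |x - y|^(p-1); otherwise |y|/|x| is close to 1, and homogeneity with continuity of s^(p-2) at 1
    gives the small term. *)
Lemma pflux_continuity (e : R) : 0 < e -> exists2 C, 0 <= C & forall x y,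
  enorm (pflux x - pflux y) <= e * enorm x `^ (p - 1) + C * enorm (x - y) `^ (p - 1).
Proof.
move=> e0.
have e40 : 0 < e / 4 by rewrite divr_gt0.
have [k0 [k00 k02 Hk]] := powR_sub2_continuous1 e40.
pose k := Num.min k0 (e / 4).
have kp : 0 < k by rewrite lt_min k00.
have kk0 : k <= k0 by rewrite ge_min lexx.
have ke : k <= e / 4 by rewrite ge_min lexx orbT.
exists (k^-1 `^ (p - 1) + (k^-1 + 1) `^ (p - 1)); first by rewrite addr_ge0 ?powR_ge0.
move=> x y.
have [h|h] := leP (enorm (x - y)) (k * enorm x); last first.
  have hE : enorm x <= k^-1 * enorm (x - y) by rewrite ler_pdivlMl// ltW.
  apply: le_trans (ler_enormB _ _) _; rewrite !enorm_pflux.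
  rewrite -[leLHS]add0r lerD//; first by rewrite mulr_ge0 ?powR_ge0// ltW.
  have ki : 0 <= k^-1 by rewrite invr_ge0 ltW.
  rewrite mulrDl -!powRM ?addr_ge0 ?enorm_ge0//.
  apply: lerD; rewrite ge0_ler_powR// ?nnegrE ?mulr_ge0 ?addr_ge0 ?enorm_ge0//.
  have hy : enorm y <= enorm x + enorm (x - y).
    by have := ler_enormB x (x - y); rewrite opprB [x + _]addrC subrK.
  by apply: (le_trans hy); rewrite mulrDl mul1r lerD2r.
have [x0|x0] := eqVneq x 0.
  move: h; rewrite x0 enorm0 mulr0 => h.
  have : enorm (0 - y) = 0 by apply/le_anti; rewrite h enorm_ge0.
  move=> /eqP; rewrite enorm_eq0 sub0r oppr_eq0 => /eqP ->.
  rewrite subrr enorm0 addr_ge0// mulr_ge0 ?powR_ge0 ?addr_ge0 ?powR_ge0//.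
  exact: ltW.
have s0 : 0 < enorm x by rewrite lt_neqAle enorm_ge0 eq_sym enorm_eq0 x0.
pose r := enorm y / enorm x.
have yE : enorm y = r * enorm x by rewrite divfK// gt_eqF.
have r1 : `|r - 1| <= k.
  rewrite -(ler_pM2r s0) -[X in _ * X](gtr0_norm s0) -normrM mulrBl mul1r -yE.
  by apply: le_trans (ler_dist_enorm _ _) _; rewrite enormB.
have r0 : 0 <= r by rewrite divr_ge0 ?enorm_ge0.
have rk := Hk r (le_trans r1 kk0).
rewrite -[leLHS]addr0 lerD//; last by rewrite mulr_ge0 ?addr_ge0 ?powR_ge0.
have -> : pflux x - pflux y =
    enorm x `^ (p - 2) *: ((x - y) + (1 - r `^ (p - 2)) *: y).
  rewrite /pflux yE powRM ?enorm_ge0// scalerDr scalerBr scalerA.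
  rewrite -[RHS]addrA; congr (_ + _).
  by do 2 rewrite -[- (_ *: y)]scaleNr; rewrite -scalerDl; congr (_ *: _); ring.
rewrite enormZ ger0_norm ?powR_ge0//.
apply: (@le_trans _ _ (enorm x `^ (p - 2) * (e * enorm x))); last first.
  by rewrite mulrCA powR_sub2_mul ?enorm_ge0.
rewrite ler_wpM2l ?powR_ge0//.
apply: le_trans (ler_enormD _ _) _; rewrite enormZ (distrC 1).
have : `|r `^ (p - 2) - 1| * enorm y <= e / 4 * (2 * enorm x).
  rewrite ler_pM ?enorm_ge0// yE ler_pM2r//.
  by move: r1 kk0 k02; rewrite ler_norml => /andP[_]; lra.
have : k * enorm x <= e / 4 * enorm x by rewrite ler_pM2r.
move: h e0 s0; set a := enorm (x - y); set b := _ * enorm y; set c := enorm x.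
by move=> *; nra.
Qed.

(** Splits the monotonicity pairing into a radial part and an angular part, each of them
    nonnegative. *)
Lemma dot_pflux_sub x y : dot (pflux x - pflux y) (x - y) =
  (enorm x `^ (p - 1) - enorm y `^ (p - 1)) * (enorm x - enorm y) +
  (enorm x `^ (p - 2) + enorm y `^ (p - 2)) * (enorm x * enorm y - dot x y).
Proof.
rewrite dotBl !dotBr !dotZl -!sqr_enorm (dotC y x) -!powR_sub2_mul ?enorm_ge0//.
ring.
Qed.

Lemma powR_sub_mono s t : 0 <= s -> 0 <= t ->
  0 <= (s `^ (p - 1) - t `^ (p - 1)) * (s - t).
Proof.
move=> s0 t0; have [st|/ltW st] := leP s t.
- apply: mulr_le0; rewrite subr_le0//.
  by rewrite ge0_ler_powR ?nnegrE.
- apply: mulr_ge0; rewrite subr_ge0//.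
  by rewrite ge0_ler_powR ?nnegrE.
Qed.

Lemma dot_pflux_sub_ge0 x y : 0 <= dot (pflux x - pflux y) (x - y).
Proof.
rewrite dot_pflux_sub addr_ge0 ?powR_sub_mono ?enorm_ge0//.
by apply: mulr_ge0; [rewrite addr_ge0 ?powR_ge0|rewrite subr_ge0 dot_le_enorm].
Qed.

(** For p < 2 the pairing does not dominate |x - y|^p; the additive term in e makes one estimate
    serve all p. When that term does not suffice, x and y are separated on the scale of the larger
    norm t, and the radial or the angular part is at least a multiple of t^p. *)
Lemma pflux_monotone (e : R) : 0 < e -> exists2 C, 0 <= C & forall x y,
  enorm (x - y) `^ p <= e * (enorm x `^ p + enorm y `^ p) +
    C * dot (pflux x - pflux y) (x - y).
Proof.
move=> e0.
pose e1 := e `^ p^-1.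
have e10 : 0 < e1 by rewrite powR_gt0.
pose d := Num.min (e1 / 2) 2^-1.
have d0 : 0 < d by rewrite lt_min divr_gt0//= invr_gt0.
have de : d <= e1 / 2 by rewrite ge_min lexx.
have d2 : d <= 2^-1 by rewrite ge_min lexx orbT.
pose c := (1 - (1 - d) `^ (p - 1)) * d.
have c0 : 0 < c.
  have h : (1 - d) `^ (p - 1) < 1 `^ (p - 1).
    by rewrite gt0_ltr_powR ?nnegrE//; lra.
  by rewrite mulr_gt0// subr_gt0; move: h; rewrite powR1.
pose c' := 3 / 8 * e1 ^+ 2.
have c'0 : 0 < c' by rewrite mulr_gt0 ?exprn_gt0// divr_gt0.
pose C := 2 `^ p / Num.min c c'.
have m0 : 0 < Num.min c c' by rewrite lt_min c0.
have C0 : 0 <= C by rewrite divr_ge0 ?powR_ge0// ltW.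
exists C => // .
suff H x y : enorm x <= enorm y ->
    enorm (x - y) `^ p <= e * (enorm x `^ p + enorm y `^ p) +
    C * dot (pflux x - pflux y) (x - y).
  move=> x y; have [|/ltW] := leP (enorm x) (enorm y); first exact: H.
  move=> /H; rewrite enormB (addrC (enorm y `^ p)).
  by rewrite -(opprB x y) -(opprB (pflux x)) dotNl dotC dotNl opprK dotC.
move=> xy.
have [h|h] := leP (enorm (x - y) `^ p) (e * (enorm x `^ p + enorm y `^ p)).
  by rewrite -[leLHS]addr0 lerD// mulr_ge0// dot_pflux_sub_ge0.
rewrite -[leLHS]add0r lerD//; first by rewrite mulr_ge0 ?addr_ge0 ?powR_ge0 ?ltW.
set s := enorm x in xy h *; set t := enorm y in xy h *; set E := enorm (x - y) in h *.
have s0 : 0 <= s := enorm_ge0 x.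
have t0 : 0 <= t := enorm_ge0 y.
have E0 : 0 <= E := enorm_ge0 (x - y).
have Est : E <= s + t := ler_enormB x y.
have eE : e1 * t < E.
  rewrite ltNge; apply/negP => hE.
  have : E `^ p <= (e1 * t) `^ p.
    by rewrite ge0_ler_powR ?nnegrE ?mulr_ge0 ?(ltW e10)// ltW.
  rewrite powRM ?(ltW e10)// -powRrM mulVf ?gt_eqF// powRr1 ?(ltW e0)//.
  have es : 0 <= e * s `^ p by rewrite mulr_ge0 ?powR_ge0// ltW.
  by move: h es; clear; lra.
have tp : 0 < t.
  rewrite lt_neqAle t0 andbT eq_sym; apply/eqP => tz.
  by move: eE Est xy s0; rewrite tz mulr0; lra.
have E2 : E ^+ 2 = (s - t) ^+ 2 + 2 * (s * t - dot x y).
  by rewrite /E sqr_enorm dotBl !dotBr -!sqr_enorm (dotC y x) -/s -/t; ring.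
have Ep : E `^ p <= 2 `^ p * t `^ p.
  have Et : E <= 2 * t by move: Est xy; clear; lra.
  by rewrite -powRM// ge0_ler_powR// nnegrE mulr_ge0.
suff : Num.min c c' * t `^ p <= dot (pflux x - pflux y) (x - y).
  move=> hD; apply: le_trans Ep _; rewrite /C mulrAC -mulrA ler_wpM2l ?powR_ge0//.
  by rewrite ler_pdivlMr// mulrC.
rewrite dot_pflux_sub -/s -/t.
(* Either the norms differ by d t, and the radial part is at least c t^p; or (s - t)^2 <= E^2/4, so
   s t - dot x y >= 3/8 E^2 and the angular part is at least c' t^p. *)
have [hst|hst] := leP (d * t) (t - s).
  apply: (@le_trans _ _ (c * t `^ p)).
    by rewrite ler_wpM2r ?powR_ge0// ge_min lexx.
  rewrite -[leLHS]addr0 lerD//; last first.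
    by apply: mulr_ge0; [rewrite addr_ge0 ?powR_ge0|rewrite subr_ge0 dot_le_enorm].
  rewrite -[leRHS]mulrNN !opprB.
  have : s `^ (p - 1) <= (1 - d) `^ (p - 1) * t `^ (p - 1).
    have d1 : 0 <= 1 - d by rewrite subr_ge0 (le_trans d2)// invf_le1// ler1n.
    have sd : s <= (1 - d) * t by rewrite mulrBl mul1r lerBrDr addrC -lerBrDr.
    by rewrite -powRM// ge0_ler_powR// nnegrE mulr_ge0.
  move=> hs; rewrite /c -(powR_sub1_mul t0).
  rewrite (_ : _ * d * _ = (1 - (1 - d) `^ (p - 1)) * t `^ (p - 1) * (d * t)); last by ring.
  have c00 : 0 <= 1 - (1 - d) `^ (p - 1).
    by move: c0; rewrite pmulr_lgt0// => /ltW.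
  rewrite ler_pM ?mulr_ge0 ?powR_ge0 ?(ltW d0)//.
  by rewrite mulrBl mul1r lerD2l lerN2.
apply: (@le_trans _ _ (c' * t `^ p)).
  by rewrite ler_wpM2r ?powR_ge0// ge_min lexx orbT.
rewrite -[leLHS]add0r lerD ?powR_sub_mono//.
have hE : (s - t) ^+ 2 <= E ^+ 2 / 4.
  have : t - s <= E / 2.
    apply: le_trans (ltW hst) _; apply: (@le_trans _ _ (e1 / 2 * t)).
      by rewrite ler_pM2r.
    by move: eE; clear; lra.
  by move: xy E0; clear; nra.
have hq : 3 / 8 * E ^+ 2 <= s * t - dot x y by move: hE E2; clear; lra.
have hq2 : c' * t ^+ 2 <= s * t - dot x y.
  apply: le_trans hq; rewrite /c' -mulrA ler_pM2l ?divr_gt0// -exprMn.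
  by rewrite ler_pXn2r ?nnegrE ?mulr_ge0 ?(ltW e10)// ltW.
rewrite -powR_sub1_mul// -powR_sub2_mul// -mulrA -expr2 mulrCA.
apply: (@le_trans _ _ (t `^ (p - 2) * (s * t - dot x y))).
  by rewrite ler_wpM2l ?powR_ge0.
rewrite ler_wpM2r ?lerDr ?powR_ge0//.
by rewrite subr_ge0 dot_le_enorm.
Qed.

End vector_power.

(** * Volume of the unit ball *)

Section ball_volume_constant.
Context {R : realType}.
Local Notation RR := (measurableTypeR R).
Local Open Scope ereal_scope.

Lemma integral_prod_rV N (g : R -> R) (c : R) :
  measurable_fun [set: RR] (g : RR -> R) -> (forall x, 0 <= g x)%R ->
  \int[lebesgue_measure]_x (g x)%:E = c%:E ->
  \int[borel_lebesgue_rV R N]_x (\prod_(i < N) g (x ord0 i))%:E = (c ^+ N)%:E.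
Proof.
move=> mg g0 gc; elim: N => [|N IH].
  under eq_integral do rewrite big_ord0.
  by rewrite /= integral_cst//= diracT mul1e expr0.
have mprod n : measurable_fun [set: 'rV[RR]_n] (fun x : 'rV[RR]_n => (\prod_(i < n) g (x ord0 i))%R : R).
  apply: measurable_prod => i _; apply: measurableT_comp => //.
  exact: (measurable_rV_coord (T := RR)).
rewrite -[LHS]/(\int[pushforward (@lebesgue_measure R \x borel_lebesgue_rV R N) (@rV_cons R N)]_x
   (\prod_(i < N.+1) g (x ord0 i))%:E).
rewrite (@ge0_integral_pushforward _ _ _ _ R _ (@measurable_rV_cons R N))//; last 2 first.
  by apply/measurable_EFinP; exact: mprod.
  by move=> x _; rewrite lee_fin prodr_ge0.
have mF : measurable_fun [set: RR * 'rV[RR]_N]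
    (fun x => (g x.1 * \prod_(i < N) g (x.2 ord0 i))%:E).
  apply/measurable_EFinP; apply: measurable_funM.
    exact: measurableT_comp.
  exact: (measurableT_comp (mprod N)).
under eq_integral => x _.
  rewrite /= big_ord_recl /rV_cons mxE unlift_none /=.
  under eq_bigr => i _ do rewrite mxE liftK /=.
  over.
rewrite /= (fubini_tonelli1 _ mF); last first.
  by move=> x; rewrite lee_fin mulr_ge0// prodr_ge0.
rewrite /fubini_F /=.
under eq_integral => x _.
  under eq_integral => y _ do rewrite EFinM.
  rewrite ge0_integralZl//; first last.
  - by rewrite lee_fin.
  - by move=> y _; rewrite lee_fin prodr_ge0.
  - by apply/measurable_EFinP; exact: mprod.
  rewrite IH.
  over.
have c0 : 0 <= c%:E by rewrite -gc integral_ge0// => x _; rewrite lee_fin.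
rewrite /= ge0_integralZr//; first last.
- by rewrite lee_fin exprn_ge0.
- by move=> x _; rewrite lee_fin.
- exact/measurable_EFinP.
by rewrite gc -EFinM exprS.
Qed.

Lemma integral_gauss_rV N :
  \int[borel_lebesgue_rV R N]_x (expR (- dot x x))%:E = (pi `^ (N%:R / 2))%:E.
Proof.
under eq_integral => x _.
  rewrite /dot -sumrN expR_sum.
  under eq_bigr => i _ do rewrite -expr2 -[expR _]/(gauss_fun (x ord0 i)).
  over.
rewrite (integral_prod_rV _ _ _ integralT_gauss).
- by rewrite -powR12_sqrt ?pi_ge0// -powR_mulrn ?powR_ge0// -powRrM mulrC.
- exact: measurable_gauss_fun.
- by move=> x; exact: gauss_fun_ge0.
Qed.

Lemma integral_expRN_tail (a : R) : (0 <= a)%R ->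
  \int[lebesgue_measure]_(t in `]a, +oo[) (expR (- t))%:E = (expR (- a))%:E.
Proof.
move=> a0; rewrite integral_itv_obnd_cbnd.
rewrite (@ge0_continuous_FTC2y _ _ (fun x => - (expR (- x)))%R _ 0%R)//.
- by rewrite sub0e EFinN oppeK.
- apply: continuous_subspaceT => x.
  by apply: continuous_comp; [exact: continuousN|exact: continuous_expR].
- by rewrite -oppr0; apply: cvgN; exact: cvgr_expR.
- apply: cvgN; apply/cvg_at_right_filter.
  by apply: continuous_comp; [exact: continuousN|exact: continuous_expR].
- move=> x _; rewrite derive1E derive_val /=.
  by rewrite /GRing.scale /=; ring.
- by apply/measurable_EFinP; apply: measurableT_comp => //; exact: measurable_funN.
Qed.

(** The Gaussian integral is computed in two ways: write exp(-|x|^2) as the integral of exp(-t) over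
    t > |x|^2 and exchange; the section at t is the ball of radius sqrt t, of volume omega
    t^(N/2). *)
Lemma unit_ball_volume_Gamma N :
  (unit_ball_volume (N := N) * Gamma (1 + N%:R / 2) = pi `^ (N%:R / 2) :> R)%R.
Proof.
pose h (t : R) : \bar R := (\1_`]0%R, +oo[ t * expR (- t))%:E.
pose f (z : 'rV[RR]_N * RR) : \bar R :=
  (\1_(eball 0 (Num.sqrt z.2) : set 'rV[RR]_N) z.1 )%:E * h z.2.
have mh : measurable_fun [set: RR] h.
  apply/measurable_EFinP; apply: measurable_funM => //.
  by apply: measurableT_comp => //; exact: measurable_funN.
have mf : measurable_fun [set: 'rV[RR]_N * RR] f.
  apply: emeasurable_funM; last exact: measurableT_comp.
  pose A : set ('rV[RR]_N * RR) := [set z | enorm z.1 < Num.sqrt z.2]%R.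
  have mA : measurable A.
    have -> : A = (fun z : 'rV[RR]_N * RR => enorm z.1 < Num.sqrt z.2)%R @^-1` [set true].
      by apply/seteqP; split.
    rewrite -[X in measurable X]setTI; apply: measurable_fun_ltr => //.
    - exact: measurable_enorm.
    - apply: (measurableT_comp (f := @Num.sqrt R)) => //.
      apply: continuous_measurable_fun; exact: sqrt_continuous.
  rewrite (_ : (fun z => _) = fun z => (\1_A z)%:E); last first.
    apply/funext => z; rewrite !indicE; congr ((nat_of_bool _)%:R%:E).
    by rewrite !mem_setE -[LHS]/(enorm _ < _)%R subr0.
  by apply/measurable_EFinP; exact: measurable_indic.
have f0 z : 0 <= f z.
  by rewrite mule_ge0// lee_fin// mulr_ge0// expR_ge0.
have := fubini_tonelli (m1 := borel_lebesgue_rV R N) (m2 := lebesgue_measure) f mf f0.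
have -> : \int[borel_lebesgue_rV R N]_x \int[lebesgue_measure]_y f (x, y) =
    (pi `^ (N%:R / 2))%:E.
  rewrite -integral_gauss_rV; apply: eq_integral => x _.
  rewrite -integral_expRN_tail ?dot_ge0// [RHS]integral_mkcond.
  apply: eq_integral => t _; rewrite /f /h /patch /= !indicE.
  rewrite (_ : (t \in `]dot x x, +oo[%classic) =
    (x \in (eball 0 (Num.sqrt t) : set 'rV[RR]_N)) && (t \in `]0%R, +oo[%classic)).
    by case: (x \in _); case: (t \in _); rewrite ?mul0e ?mul1e ?mul0r ?mul1r.
  rewrite !mem_setE /= !in_itv /= !andbT -[X in X && _]/(enorm _ < _)%R subr0.
  have [t0|t0] := ltP 0%R t.
    by rewrite andbT -sqr_enorm -[in LHS](sqr_sqrtr (ltW t0)) ltr_pXn2r ?nnegrE ?enorm_ge0.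
  by rewrite andbF; apply/negbTE; rewrite -leNgt (le_trans t0)// dot_ge0.
under eq_integral => t _.
  rewrite /f /=.
  under eq_integral => x _ do rewrite muleC.
  rewrite ge0_integralZl//; first last.
  - by rewrite lee_fin mulr_ge0// expR_ge0.
  - by apply/measurable_EFinP; apply: measurable_indic; exact: measurable_eball.
  rewrite (integral_indic _ measurableT (measurable_eball _ _)) setIT.
  over.
move=> /esym.
have -> : \int[lebesgue_measure]_t (h t * borel_lebesgue_rV R N (eball 0 (Num.sqrt t))) =
    (unit_ball_volume (N := N))%:E *
    \int[lebesgue_measure]_(t in `]0%R, +oo[) (t `^ (1 + N%:R / 2 - 1) * expR (- t))%:E.
  rewrite -ge0_integralZl//; first last.
  - by rewrite lee_fin ltW// unit_ball_volume_gt0.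
  - by move=> t _; rewrite lee_fin mulr_ge0 ?powR_ge0 ?expR_ge0.
  - apply/measurable_EFinP; apply: measurable_funM.
      by apply: measurable_funTS; exact: measurable_powR.
    by apply: measurable_funTS; apply: measurableT_comp => //; exact: measurable_funN.
  rewrite [RHS]integral_mkcond; apply: eq_integral => t _.
  rewrite /patch /h indicE mem_setE /= in_itv /= andbT.
  case: ltP => [t0|_]; last by rewrite mul0r mul0e.
  rewrite mul1r eball_volume ?sqrtr_gt0// -!EFinM; congr EFin.
  rewrite -powR12_sqrt ?(ltW t0)// -powR_mulrn ?powR_ge0// -powRrM.
  rewrite (_ : 1 + N%:R / 2 - 1 = 2^-1 * N%:R)%R; last by ring.
  by ring.
move=> h1.
have : \int[lebesgue_measure]_(t in `]0%R, +oo[) (t `^ (1 + N%:R / 2 - 1) * expR (- t))%:E =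
  (pi `^ (N%:R / 2) / unit_ball_volume (R := R) (N := N))%:E.
  rewrite EFinM -h1 [RHS]muleC muleA -EFinM mulVf ?mul1e//.
  by rewrite gt_eqF// unit_ball_volume_gt0.
rewrite /Gamma /Rintegral => ->.
by rewrite /= mulrC divfK// gt_eqF// unit_ball_volume_gt0.
Qed.

Lemma inv_ball_volumeE N : inv_ball_volume N = (unit_ball_volume (N := N))^-1%R :> R.
Proof.
have w0 := unit_ball_volume_gt0 (R := R) (N := N).
have p0 : (0 < pi `^ (N%:R / 2) :> R)%R by rewrite powR_gt0// pi_gt0.
rewrite /inv_ball_volume -unit_ball_volume_Gamma invfM mulrCA divff ?mulr1//.
apply/eqP => G0; move: p0; rewrite -unit_ball_volume_Gamma G0 mulr0 ltxx //.
Qed.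

End ball_volume_constant.

(** * Integrals of negative powers of the Euclidean norm over a ball *)

Section radial_power.
Context {R : realType}.
Local Notation RR := (measurableTypeR R).

Lemma derivable1_continuous (f : R -> R) : (forall x, derivable f x 1) -> continuous f.
Proof. by move=> df x; apply/differentiable_continuous/derivable1_diffP. Qed.

Let continuous_expRM (b : R) : continuous (fun x : R => expR (b * x)).
Proof. by apply: derivable1_continuous => x; exact: ex_derive. Qed.

Local Open Scope ereal_scope.

Lemma integral_expR_itv (b s : R) : (0 < s)%R ->
  \int[lebesgue_measure]_(t in `[0%R, s]) (b * expR (b * t))%:E = (expR (b * s) - 1)%:E.
Proof.
move=> s0.
rewrite (@continuous_FTC2 _ _ (fun x => expR (b * x))%R)//.
- by rewrite mulr0 expR0 EFinB.
- by apply: continuous_subspaceT => x; apply: cvgMr; exact: continuous_expRM.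
- split.
  + by move=> x _; exact: ex_derive.
  + by apply/cvg_at_right_filter; exact: continuous_expRM.
  + by apply/cvg_at_left_filter; exact: continuous_expRM.
- move=> x _; rewrite derive1E derive_val /=.
  by rewrite /GRing.scale /=; ring.
Qed.

Lemma integral_expRN (k : R) : (0 < k)%R ->
  \int[lebesgue_measure]_(t in `[0%R, +oo[) (expR (- k * t))%:E = (k^-1)%:E.
Proof.
move=> k0.
rewrite (@ge0_continuous_FTC2y _ _ (fun x => - k^-1 * (expR (- k * x)))%R _ 0%R)//.
- by rewrite mulr0 expR0 mulr1 sub0e EFinN oppeK.
- by apply: continuous_subspaceT; exact: continuous_expRM.
- rewrite -[X in _ --> X](mulr0 (- k^-1)%R); apply: cvgMr.
  rewrite (_ : (fun x => expR (- k * x)) = fun x => expR (- (k * x))); last first.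
    by apply/funext => x; rewrite mulNr.
  apply: (@cvg_comp _ _ _ (fun x => k * x)%R (fun x => expR (- x))%R _ (pinfty_nbhs R)); last exact: cvgr_expR.
  exact: gt0_cvgMry.
- by apply/cvg_at_right_filter; apply: cvgMr; exact: continuous_expRM.
- move=> x _; rewrite derive1E derive_val /=.
  by rewrite /GRing.scale /=; field; rewrite gt_eqF.
Qed.

Variable N : nat.
Local Notation mu := (borel_lebesgue_rV R N).
Local Notation omega := (unit_ball_volume (R := R) (N := N)).

(* Writing [|w| = rho * exp (- s)] turns the power into
   [rho^-b (1 + \int_0^s b exp (b t) dt)], and the set [t < s] into the ball of
   radius [rho * exp (- t)]. *)
Lemma integral_ball_powRN (b rho : R) : (0 <= b)%R -> (b < N%:R)%R -> (0 < rho)%R ->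
  \int[mu]_(w in eball 0 rho) (enorm w `^ (- b))%:E <=
  (omega * N%:R / (N%:R - b) * (rho ^+ N * rho `^ (- b)))%:E.
Proof.
move=> b0 bN rho0.
have w0 : (0 < omega)%R by exact: unit_ball_volume_gt0.
pose A : set ('rV[RR]_N * RR) := [set z | enorm z.1 < rho * expR (- z.2)]%R.
have mA : measurable A.
  have -> : A = (fun z : 'rV[RR]_N * RR => enorm z.1 < rho * expR (- z.2))%R @^-1` [set true].
    by apply/seteqP; split.
  rewrite -[X in measurable X]setTI; apply: measurable_fun_ltr => //.
  - exact: measurable_enorm.
  - apply: measurable_funM => //; apply: measurableT_comp => //.
    by apply: measurable_funN; exact: measurable_snd.
pose k (t : R) : \bar R := (\1_`[0%R, +oo[ t * (b * expR (b * t)))%:E.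
have mk : measurable_fun [set: RR] k.
  apply/measurable_EFinP; apply: measurable_funM => //; apply: measurable_funM => //.
  by apply: measurableT_comp => //; exact: measurable_funM.
have k0 t : 0 <= k t by rewrite lee_fin !mulr_ge0// expR_ge0.
pose f (z : 'rV[RR]_N * RR) : \bar R := (\1_A z)%:E * k z.2.
have mf : measurable_fun [set: 'rV[RR]_N * RR] f.
  apply: emeasurable_funM; last exact: measurableT_comp.
  by apply/measurable_EFinP; exact: measurable_indic.
have f0 z : 0 <= f z by rewrite mule_ge0// lee_fin.
have mF : measurable_fun [set: 'rV[RR]_N] (fun w => \int[lebesgue_measure]_t f (w, t)).
  exact: (measurable_fun_fubini_tonelli_F f mf f0).
have pointwise (w : 'rV[RR]_N) : eball 0 rho w ->
    (enorm w `^ (- b))%:E <= (rho `^ (- b))%:E * (1 + \int[lebesgue_measure]_t f (w, t)).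
  rewrite /eball /= subr0 => wr.
  have I0 : 0 <= \int[lebesgue_measure]_t f (w, t) by apply: integral_ge0.
  (* At the origin the power reads 0, or 1 when b = 0; both are below the right-hand side. *)
  have [w00|wn0] := eqVneq (enorm w) 0%R.
    rewrite w00; have [->|bn0] := eqVneq b 0%R.
      by rewrite oppr0 !powRr0 mul1e leeDl.
    by rewrite powR0 ?oppr_eq0// mule_ge0 ?lee_fin ?powR_ge0// adde_ge0.
  have wp : (0 < enorm w)%R by rewrite lt_neqAle eq_sym wn0 enorm_ge0.
  pose s := ln (rho / enorm w).
  have s0 : (0 < s)%R by rewrite ln_gt0// ltr_pdivlMr// mul1r.
  have wE : enorm w = (rho * expR (- s))%R.
    by rewrite expRN /s lnK ?posrE ?divr_gt0// invf_div mulrC divfK// gt_eqF.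
  have -> : \int[lebesgue_measure]_t f (w, t) = (expR (b * s) - 1)%:E.
    rewrite -integral_expR_itv// -integral_itv_bndo_bndc; last first.
      apply/measurable_EFinP; apply: measurable_funTS.
      by apply: measurable_funM => //; apply: measurableT_comp => //; exact: measurable_funM.
    rewrite [RHS]integral_mkcond; apply: eq_integral => t _.
    rewrite /f /k /patch /= !indicE.
    rewrite (_ : (t \in `[0%R, s[%classic) = ((w, t) \in A) && (t \in `[0%R, +oo[%classic)).
      by case: (_ \in A); case: (_ \in _); rewrite ?mul1e ?mul0e ?mul1r ?mul0r.
    rewrite !mem_setE /= !in_itv /= andbT andbC; congr (_ && _).
    rewrite -[RHS]/(enorm w < rho * expR (- t))%R wE.
    by rewrite ltr_pM2l// ltr_expR ltrN2.
  rewrite -EFinD -EFinM lee_fin addrC subrK wE powRM ?expR_ge0 ?(ltW rho0)//.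
  by rewrite -expRM mulrNN (mulrC s).
apply: (@le_trans _ _ (\int[mu]_(w in eball 0 rho)
    ((rho `^ (- b))%:E * (1 + \int[lebesgue_measure]_t f (w, t))))).
  apply: ge0_le_integral => //.
  - exact: measurable_eball.
  - by move=> w _; rewrite lee_fin powR_ge0.
  - apply/measurable_EFinP; apply: measurable_funTS.
    apply: (measurableT_comp (measurable_powR _)).
    exact: measurable_enorm.
  - apply: measurable_funTS; apply: emeasurable_funM => //.
    exact: emeasurable_funD.
rewrite ge0_integralZl//; first last.
- by rewrite lee_fin powR_ge0.
- by move=> w _; apply: adde_ge0 => //; exact: integral_ge0.
- by apply: measurable_funTS; exact: emeasurable_funD.
- exact: measurable_eball.
rewrite ge0_integralD//; first last.
- by apply: measurable_funTS.
- by move=> w _; exact: integral_ge0.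
- exact: measurable_eball.
rewrite integral_cst ?mul1e; last exact: measurable_eball.
have V (s : R) : (0 < s)%R -> mu (eball 0 s) = (omega * s ^+ N)%:E.
  exact: eball_volume.
rewrite [X in _ * (X + _)]V//.
(* Exchanging leaves omega rho^N times the integral of b exp(-(N - b) t), that is b/(N - b); added
   to 1 this gives the factor N/(N - b). *)
have I2 : \int[mu]_(w in eball 0 rho) \int[lebesgue_measure]_t f (w, t) <=
    (omega * rho ^+ N * (b / (N%:R - b)))%:E.
  apply: (@le_trans _ _ (\int[mu]_w \int[lebesgue_measure]_t f (w, t))).
    apply: ge0_subset_integral => //; first exact: measurable_eball.
    by move=> w _; exact: integral_ge0.
  rewrite (fubini_tonelli f)//.
  under eq_integral => t _.
    rewrite /f /=.
    under eq_integral => w _ do rewrite muleC.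
    rewrite ge0_integralZl//; first last.
    - apply/measurable_EFinP.
      rewrite (_ : (fun w => _) = \1_(eball 0 (rho * expR (- t)) : set 'rV[RR]_N)).
        by apply: measurable_indic; exact: measurable_eball.
      apply/funext => w; rewrite !indicE; congr (nat_of_bool _)%:R.
      by rewrite !mem_setE -[RHS]/(enorm _ < _)%R subr0.
    rewrite (_ : (fun w => _) = fun w => (\1_(eball 0 (rho * expR (- t)) : set 'rV[RR]_N) w)%:E); last first.
      apply/funext => w; rewrite !indicE; congr (nat_of_bool _)%:R%:E.
      by rewrite !mem_setE -[RHS]/(enorm _ < _)%R subr0.
    rewrite (integral_indic _ measurableT (measurable_eball _ _)) setIT.
    rewrite [X in _ * X]V ?mulr_gt0 ?expR_gt0//.
    over.
  rewrite (_ : \int[_]_t _ = (omega * rho ^+ N * b)%:E *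
      \int[lebesgue_measure]_(t in `[0%R, +oo[) (expR (- (N%:R - b) * t))%:E).
    rewrite integral_expRN ?subr_gt0// -EFinM.
    by rewrite !mulrA.
  rewrite -ge0_integralZl//; first last.
  - by rewrite lee_fin !mulr_ge0 ?exprn_ge0 ?(ltW w0) ?(ltW rho0).
  - apply/measurable_EFinP; apply: measurable_funTS.
    by apply: measurableT_comp => //; exact: measurable_funM.
  rewrite [RHS]integral_mkcond; apply: eq_integral => t _.
  rewrite /k /patch indicE; case: (_ \in _); last by rewrite mul0r mul0e.
  rewrite mul1r -!EFinM; congr EFin.
  rewrite exprMn -expRM_natl (_ : - (N%:R - b) * t = b * t + N%:R * - t)%R ?expRD; ring.
apply: (@le_trans _ _ ((rho `^ (- b))%:E * ((omega * rho ^+ N)%:E + (omega * rho ^+ N * (b / (N%:R - b)))%:E))).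
  by rewrite lee_pmul2l ?fin_numE// ?lte_fin ?powR_gt0// leeD2l.
rewrite -EFinD -EFinM lee_fin le_eqVlt; apply/orP; left; apply/eqP.
by field; rewrite gt_eqF// subr_gt0.
Qed.

End radial_power.

(** * Smooth bump functions *)

Section smooth_functions.
Context {R : realType}.
Implicit Types (f g h : R -> R).

Fixpoint Cn (n : nat) h : Prop :=
  if n is m.+1 then (forall x, derivable h x 1) /\ Cn m (h^`()%classic)
  else continuous h.

Definition smooth1 h := forall n, Cn n h.

Lemma Cn_continuous n h : Cn n h -> continuous h.
Proof. by case: n => // n [/derivable1_continuous]. Qed.

Lemma CnW n h : Cn n.+1 h -> Cn n h.
Proof.
elim: n h => [h /Cn_continuous //|n IH h [dh ch]].
by split => //; exact: IH.
Qed.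

Lemma CnD n f g : Cn n f -> Cn n g -> Cn n (fun x => f x + g x).
Proof.
elim: n f g => [f g cf cg x|n IH f g [df cf] [dg cg]]; first exact: cvgD (cf x) (cg x).
split=> [x|]; first exact: derivableD (df x) (dg x).
rewrite (_ : _^`()%classic = fun x => f^`()%classic x + g^`()%classic x); first exact: IH.
by apply/funext => x; rewrite !derive1E deriveD.
Qed.

Lemma CnM n f g : Cn n f -> Cn n g -> Cn n (fun x => f x * g x).
Proof.
elim: n f g => [f g cf cg x|n IH f g cf cg]; first exact: cvgM (cf x) (cg x).
have [[df cdf] [dg cdg]] := (cf, cg).
split=> [x|]; first exact: derivableM (df x) (dg x).
rewrite (_ : _^`()%classic = fun x => f x * g^`()%classic x + g x * f^`()%classic x).
  by apply: CnD; apply: IH => //; exact: CnW.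
by apply/funext => x; rewrite !derive1E (deriveM (df x) (dg x)).
Qed.

Lemma Cn_cst n (c : R) : Cn n (fun=> c).
Proof.
elim: n c => [c|n IH c]; first exact: cst_continuous.
split=> [x|]; first exact: derivable_cst.
rewrite (_ : _^`()%classic = fun=> 0) //.
by apply/funext => x; exact: derive1_cst.
Qed.

Lemma Cn_affine n f (a b : R) : Cn n f -> Cn n (fun x => f (a * x + b)).
Proof.
elim: n f => [f cf x|n IH f [df cf]].
  apply: (@continuous_comp _ _ _ (fun x => a * x + b) f); last exact: cf.
  by apply: derivable1_continuous => y; exact: ex_derive.
have da x : derivable (fun x => a * x + b) x 1 by exact: ex_derive.
have -> : (fun x => f (a * x + b)) = f \o (fun x => a * x + b) by [].
split=> [x|].
  apply/derivable1_diffP; apply: differentiable_comp; apply/derivable1_diffP => //.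
rewrite (_ : _^`()%classic = fun x => (fun=> a) x * f^`()%classic (a * x + b)).
  by apply: CnM; [exact: Cn_cst|exact: (IH _ cf)].
apply/funext => x; rewrite derive1_comp// mulrC; congr (_ * _).
rewrite derive1E derive_val /= /GRing.scale /=; ring.
Qed.

(** The powers x^-k make the family stable under differentiation: the derivative is a combination of
    the members k+2 and k+1. *)
Definition expinv (k : nat) (x : R) : R :=
  if 0 < x then x ^- k * expR (- x^-1) else 0.

Lemma expinv_ge0 k x : 0 <= expinv k x.
Proof.
rewrite /expinv; case: ltP => // x0.
by rewrite mulr_ge0 ?expR_ge0// invr_ge0 exprn_ge0// ltW.
Qed.

Lemma expinv_le k x : expinv k x <= (k.+2)`!%:R * x ^+ 2.
Proof.
rewrite /expinv; case: ltP => x0; last by rewrite mulr_ge0 ?sqr_ge0.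
have := @expR_ge1Dxn R x^-1 k.+1.
rewrite invr_ge0 (ltW x0) => /(_ isT) h.
have F0 : 0 < (k.+2)`!%:R :> R by rewrite ltr0n fact_gt0.
have {}h : x^-1 ^+ k.+2 / (k.+2)`!%:R <= expR x^-1 by apply: le_trans h; rewrite lerDr.
rewrite expRN ler_pdivrMr ?expR_gt0//.
have xk : 0 < x ^+ k by rewrite exprn_gt0.
rewrite -ler_pdivrMl ?mulr_gt0 ?exprn_gt0//.
apply: le_trans h; rewrite le_eqVlt; apply/orP; left; apply/eqP.
rewrite exprVn -addn2 exprD; field.
by rewrite !gt_eqF.
Qed.

Lemma is_derive1_cvg f (x l : R) :
  (fun t : R => t^-1 *: (f (t *: (1 : R) + x) - f x)) @ 0^' --> l -> is_derive x 1 f l.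
Proof. by move=> fl; split; [apply/cvg_ex; exists l|exact: cvg_lim]. Qed.

Lemma is_derive_expinv k (x : R) :
  is_derive x 1 (expinv k) (expinv k.+2 x - k%:R * expinv k.+1 x).
Proof.
have [x0|x0|x0] := ltgtP x 0.
- rewrite /expinv !ifF ?ltNge ?(ltW x0)//= mulr0 subr0.
  apply: (@near_eq_is_derive _ _ _ (cst 0)) => //.
  by near=> y; rewrite /expinv ifF//; apply/negbTE; rewrite -leNgt; apply/ltW; near: y; exact: lt_nbhsl.
- have xn0 : x != 0 by rewrite gt_eqF.
  rewrite /expinv x0; apply: (@near_eq_is_derive _ _ _ (fun y : R => y ^- k * expR (- y^-1))) => //.
    by near=> y; rewrite /expinv ifT//; near: y; exact: lt_nbhsr.
  have dV : is_derive x 1 (fun y : R => y^-1) (- x ^- 2 *: 1) by exact: is_deriveV.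
  have dX := is_deriveX k dV.
  have dN : is_derive x 1 (fun y : R => - y^-1) (- (- x ^- 2 *: 1)) by exact: is_deriveN.
  have dE := @is_derive1_comp R expR (fun y : R => - y^-1) x _ _ (is_derive_expR _) dN.
  have := is_deriveM dX dE.
  rewrite (_ : (fun y : R => y ^- k * expR (- y^-1)) = (fun y : R => y^-1) ^+ k * (expR \o (fun y : R => - y^-1))); last first.
    by apply/funext => y; rewrite !fctE exprVn.
  move=> h; apply: (is_derive_eq h).
  rewrite !fctE /GRing.scale /= exprVn.
  case: k {dX h} => [|k]; first by rewrite !mul0r subr0 expr0; field.
  by rewrite !exprS /= exprVn; field; rewrite expf_neq0.
- rewrite x0 [expinv k.+2 0]/expinv [expinv k.+1 0]/expinv ltxx mulr0 subr0.
  apply: is_derive1_cvg; apply/cvgrPdist_le => /= e e0.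
  have F0 : 0 < (k.+2)`!%:R :> R by rewrite ltr0n fact_gt0.
  near=> h.
  have h0 : h != 0 by near: h; exact: nbhs_dnbhs_neq.
  rewrite sub0r normrN addr0 -[h%:A]/(h * 1) mulr1 /GRing.scale /=.
  rewrite [expinv k 0]/expinv ltxx subr0 normrM normfV ler_pdivrMl ?normr_gt0//.
  rewrite ger0_norm ?expinv_ge0//; apply: le_trans (expinv_le _ _) _.
  rewrite -real_normK ?num_real// expr2 mulrCA ler_pM2l ?normr_gt0//.
  rewrite mulrC -ler_pdivlMr//.
  near: h; apply: nbhs_dnbhs; apply/nbhs_normP; exists (e / (k.+2)`!%:R) => /=.
    by rewrite divr_gt0.
  by move=> y /=; rewrite sub0r normrN => /ltW.
Unshelve. all: by end_near. Qed.

Lemma smooth1_expinv k : smooth1 (expinv k).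
Proof.
move=> n; elim: n k => [|n IH] k.
  by apply: derivable1_continuous => x; have [] := is_derive_expinv k x.
split=> [x|]; first by have [] := is_derive_expinv k x.
rewrite (_ : _^`()%classic = fun x => expinv k.+2 x + (fun x => (fun=> - k%:R) x * expinv k.+1 x) x).
  by apply: CnD; [exact: IH|apply: CnM; [exact: Cn_cst|exact: IH]].
apply/funext => x; have [_] := is_derive_expinv k x.
by rewrite derive1E => ->; rewrite mulNr.
Qed.

(** These stay in [0, 1] and tend pointwise to the indicator of ]a, b[ as n grows, so dominated
    convergence does the work of mollifiers. *)
Definition bump (a b : R) (n : nat) (x : R) : R :=
  expinv 0 (n.+1%:R * (x - a)) * expinv 0 (n.+1%:R * (b - x)).

Lemma smooth1_bump a b n : smooth1 (bump a b n).
Proof.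
move=> m; apply: CnM.
- have := @Cn_affine m (expinv 0) n.+1%:R (- (n.+1%:R * a)) (smooth1_expinv 0 m).
  by under eq_fun do rewrite -mulrBr.
- have := @Cn_affine m (expinv 0) (- n.+1%:R) (n.+1%:R * b) (smooth1_expinv 0 m).
  by under eq_fun do rewrite mulNr addrC -mulrBr.
Qed.

Lemma expinv0_le1 x : expinv 0 x <= 1.
Proof.
rewrite /expinv; case: ltP => // x0; rewrite expr0 invr1 mul1r.
by rewrite -expR0 ler_expR lerNl oppr0 invr_ge0 ltW.
Qed.

Lemma bump_ge0 a b n x : 0 <= bump a b n x.
Proof. by rewrite mulr_ge0// expinv_ge0. Qed.

Lemma bump_le1 a b n x : bump a b n x <= 1.
Proof. by rewrite mulr_ile1// ?expinv_ge0 ?expinv0_le1. Qed.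

Lemma bump_out a b n x : ~~ (a < x < b) -> bump a b n x = 0.
Proof.
rewrite negb_and -!leNgt /bump /expinv => /orP[h|h].
  by rewrite ifF ?mul0r//; apply/negbTE; rewrite -leNgt pmulr_rle0// subr_le0.
by rewrite [in X in _ * X]ifF ?mulr0//; apply/negbTE; rewrite -leNgt pmulr_rle0// subr_le0.
Qed.

Lemma expinv0_cvg (y : R) : 0 < y -> (fun n => expinv 0 (n.+1%:R * y)) @ \oo --> (1 : R).
Proof.
move=> y0.
rewrite (_ : (fun n => _) = fun n => expR (- (n.+1%:R^-1 * y^-1))); last first.
  apply/funext => n; rewrite /expinv mulr_gt0// expr0 invr1 mul1r invfM //.
have h : (fun n : nat => - (n.+1%:R^-1 / y)) @ \oo --> (0 : R).
  by rewrite -oppr0 -(mul0r y^-1); apply: cvgN; apply: cvgMl; exact: cvg_harmonic.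
have := @cvg_comp _ _ _ (fun n : nat => - (n.+1%:R^-1 / y)) expR _ _ _ h (@continuous_expR R 0).
by rewrite expR0.
Qed.

Lemma bump_cvg a b x : (fun n => bump a b n x) @ \oo --> (\1_`]a, b[ x : R).
Proof.
rewrite indicE mem_setE /= in_itv /=.
have [/andP[ax xb]|nab] := boolP (a < x < b).
  rewrite -(mulr1 1%:R); apply: cvgM; apply: expinv0_cvg; by rewrite subr_gt0.
rewrite (_ : (fun n => _) = fun=> 0); first exact: cvg_cst.
by apply/funext => n; exact: bump_out.
Qed.

End smooth_functions.

(** * Products of one-variable bumps and the fundamental lemma *)

Section product_functions.
Context {R : realType} {N : nat}.
Local Notation RR := (measurableTypeR R).
Local Notation mu := (borel_lebesgue_rV R N).
Implicit Types (h : 'I_N -> R -> R).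

Definition prod_fun h (x : 'rV[R]_N) : R := \prod_i h i (x ord0 i).

(** A partial derivative of a product function is again a product function, so smoothness follows by
    induction on the list of derivatives. *)
Definition derive_at h (i : 'I_N) : 'I_N -> R -> R :=
  fun j => if j == i then (h i)^`()%classic else h j.

Lemma is_derive_prod_fun h i (x : 'rV[R]_N) : (forall j t, derivable (h j) t 1) ->
  is_derive x (delta_mx ord0 i : 'rV[R]_N) (prod_fun h) (prod_fun (derive_at h i) x).
Proof.
move=> dh.
pose C := \prod_(j | j != i) h j (x ord0 j).
have E (t : R) j : (t *: (delta_mx ord0 i : 'rV[R]_N) + x) ord0 j =
    t * (j == i)%:R + x ord0 j by rewrite mxE mxE mxE.
have H : (fun t : R => t^-1 *: (prod_fun h (t *: (delta_mx ord0 i : 'rV[R]_N) + x) - prod_fun h x))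
    @ 0^' --> prod_fun (derive_at h i) x.
  rewrite (_ : (fun t : R => _) =
      fun t : R => (t^-1 *: (h i (t *: (1 : R) + x ord0 i) - h i (x ord0 i))) * C); last first.
    apply/funext => t; rewrite -scalerAl; congr (_ *: _); rewrite mulrBl.
    rewrite {1}/prod_fun (bigD1 i)//= E eqxx -[t%:A]/(t * 1) !mulr1; congr (_ * _ - _).
      by apply: eq_bigr => j /negbTE ji; rewrite E ji mulr0 add0r.
    by rewrite /prod_fun (bigD1 i).
  rewrite (_ : prod_fun _ x = 'D_1 (h i) (x ord0 i) * C).
    by apply: cvgMl; exact: dh.
  rewrite /prod_fun (bigD1 i)//= /derive_at eqxx derive1E; congr (_ * _).
  by apply: eq_bigr => j /negbTE ->.
by split; [apply/cvg_ex; exists (prod_fun (derive_at h i) x)|exact: cvg_lim].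
Qed.

Lemma continuous_prod_fun h : (forall i, continuous (h i)) -> continuous (prod_fun h).
Proof.
move=> ch; rewrite /prod_fun; elim: (index_enum _) => [|i s IH].
  rewrite (_ : (fun _ => _) = cst 1); first exact: cst_continuous.
  by apply/funext => x; rewrite big_nil.
rewrite (_ : (fun _ => _) = fun x : 'rV[R]_N => h i (x ord0 i) * \prod_(j <- s) h j (x ord0 j)); last first.
  by apply/funext => x; rewrite big_cons.
move=> x; apply: cvgM (IH x).
apply: (@continuous_comp _ _ _ (fun y : 'rV[R]_N => y ord0 i) (h i)); last exact: ch.
exact: coord_continuous.
Qed.

Lemma smooth_prod_fun h : (forall i, smooth1 (h i)) -> smooth (prod_fun h).
Proof.
move=> sh s.
have dsh h' : (forall i, smooth1 (h' i)) -> forall j t, derivable (h' j) t 1.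
  by move=> sh' j t; have [] := sh' j 1%N.
suff [h' [sh' ->]] : exists h', (forall i, smooth1 (h' i)) /\
    foldr partial (prod_fun h) s = prod_fun h'.
  split=> [|i x]; first by apply: continuous_prod_fun => i; exact: (sh' i 0%N).
  by have [] := is_derive_prod_fun i x (dsh _ sh').
elim: s => [|i s [h' [sh' /= ->]]]; first by exists h.
exists (derive_at h' i); split=> [j|].
  by rewrite /derive_at; case: eqP => // _ n; have [] := sh' i n.+1.
apply/funext => x; rewrite /partial.
by have [_ ->] := is_derive_prod_fun i x (dsh _ sh').
Qed.

Lemma partial_prod_fun h i : (forall j, smooth1 (h j)) ->
  partial i (prod_fun h) = prod_fun (derive_at h i).
Proof.
move=> sh; apply/funext => x.
have dh j t : derivable (h j) t 1 by have [] := sh j 1%N.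
by rewrite /partial; have [_ ->] := is_derive_prod_fun i x dh.
Qed.

Lemma compact_box (a b : 'I_N -> R) :
  compact [set x : 'rV[R]_N | forall i, a i <= x ord0 i <= b i].
Proof.
have := @rV_compact R N (fun i => `[a i, b i]%classic) (fun i => @segment_compact R (a i) (b i)).
by congr compact; apply/seteqP; split => x h i; have := h i; rewrite /= in_itv.
Qed.

Lemma test_function_prod_fun h (a b : 'I_N -> R) : (forall i, smooth1 (h i)) ->
  (forall i t, ~~ (a i < t < b i) -> h i t = 0) -> test_function (prod_fun h).
Proof.
move=> sh h0; split; first exact: smooth_prod_fun.
have cK := @compact_box a b.
apply: (subclosed_compact (@closed_closure _ _) cK).
have /closure_id KE := compact_closed (@norm_hausdorff _ _) cK.
rewrite [X in _ `<=` X]KE; apply: closureS => x /= + i.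
apply: contraNT => nab; apply/eqP; rewrite /prod_fun (bigD1 i)//= h0 ?mul0r//.
by apply: contra nab => /andP[/ltW -> /ltW ->].
Qed.

Definition box_bump (a b : 'I_N -> R) n := prod_fun (fun i => bump (a i) (b i) n).

Lemma box_bump_test a b n : test_function (box_bump a b n).
Proof.
apply: test_function_prod_fun => [i|i t]; first exact: smooth1_bump.
exact: bump_out.
Qed.

Lemma box_bump01 a b n x : 0 <= box_bump a b n x <= 1.
Proof.
rewrite prodr_ge0/=; last by move=> i _; exact: bump_ge0.
rewrite -(big1_eq (idx := 1) (op := *%R) (index_enum 'I_N) xpredT).
by apply: ler_prod => i _; rewrite bump_ge0 bump_le1.
Qed.

Lemma box_bump_out a b n x : ~ obox a b x -> box_bump a b n x = 0.
Proof.
move=> nx; have /existsNP[i /negP nxi] := nx.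
by rewrite /box_bump /prod_fun (bigD1 i)//= bump_out// mul0r.
Qed.

Lemma box_bump_cvg a b x :
  (fun n => box_bump a b n x) @ \oo --> (\1_(obox a b : set 'rV[RR]_N) x : R).
Proof.
have -> : (\1_(obox a b : set 'rV[RR]_N) x : R) = \prod_i \1_`]a i, b i[ (x ord0 i).
  rewrite indicE; have [xab|nx] := pselect (obox a b x).
    rewrite mem_set// big1// => i _; rewrite indicE mem_set//=.
    by rewrite in_itv/= xab.
  rewrite memNset//; have /existsNP[i nxi] := nx.
  by rewrite (bigD1 i)//= indicE memNset ?mul0r//= in_itv.
rewrite /box_bump /prod_fun; elim: (index_enum _) => [|i s IH].
  rewrite big_nil (_ : (fun _ => _) = cst 1); first exact: cvg_cst.
  by apply/funext => n; rewrite big_nil.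
rewrite big_cons (_ : (fun _ => _) = fun n =>
  bump (a i) (b i) n (x ord0 i) * \prod_(j <- s) bump (a j) (b j) n (x ord0 j)); last first.
  by apply/funext => n; rewrite big_cons.
by apply: cvgM IH; exact: bump_cvg.
Qed.

Section fundamental_lemma.
Local Open Scope ereal_scope.
Variable g : 'rV[RR]_N -> R.
Hypothesis mg : measurable_fun [set: 'rV[RR]_N] g.
Variables (l r : 'I_N -> R).
Local Notation Q := (obox l r : set 'rV[RR]_N).
Hypothesis ig : mu.-integrable Q (EFin \o g).
Hypothesis g0 : forall a b n, obox a b `<=` Q ->
  \int[mu]_x (g x * box_bump a b n x)%:E = 0.

Let mQ : measurable Q. Proof. exact: measurable_obox. Qed.

(** The bumps of the box converge to its indicator and are bounded by 1. *)
Let integral_obox0 a b : obox a b `<=` Q -> \int[mu]_(x in obox a b) (g x)%:E = 0.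
Proof.
move=> abQ; have igab : mu.-integrable (obox a b) (EFin \o g).
  exact: (integrableS mQ (measurable_obox a b) abQ ig).
have mB : measurable (obox a b : set 'rV[RR]_N) := measurable_obox a b.
pose f_ n (x : 'rV[RR]_N) := (g x * box_bump a b n x)%:E.
pose G := (abse \o (EFin \o g)) \_ (obox a b).
have mb n : measurable_fun [set: 'rV[RR]_N] (box_bump a b n : 'rV[RR]_N -> R).
  apply: continuous_measurable_rV; apply: continuous_prod_fun => i.
  exact: (smooth1_bump (a i) (b i) n 0%N).
have iG : mu.-integrable setT G.
  rewrite -integrable_mkcond//; exact: integrable_abse igab.
rewrite integral_mkcond.
have [||||_ _] := @dominated_convergence _ _ _ mu setT measurableT f_
    ((EFin \o g) \_ (obox a b)) G _ _ _ iG.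
- by move=> n; apply/measurable_EFinP; exact: measurable_funM.
- apply/(measurable_restrictT _ mB); exact: measurable_int igab.
- apply: aeW => x _; rewrite /f_ /patch.
  have := @box_bump_cvg a b x; rewrite indicE.
  have [xb|xb] := boolP (x \in obox a b) => h.
  + apply: cvg_EFin; first exact: nearW.
    by rewrite -[X in _ --> X]mulr1; apply: cvgMr.
  + rewrite -[X in _ --> X]/(0%R%:E); apply: cvg_EFin; first exact: nearW.
    by rewrite -[X in _ --> X](mulr0 (g x)); apply: cvgMr.
- apply: aeW => x n _; rewrite /f_ /G /patch.
  have [xb|xb] := boolP (x \in obox a b).
  + rewrite /= lee_fin normrM ler_piMr//.
    by have /andP[? ?] := box_bump01 a b n x; rewrite ger0_norm.
  + by rewrite box_bump_out ?mulr0 ?abse0//; move=> /mem_set; exact/negP.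
rewrite (_ : (fun n => _) = cst 0); last by apply/funext => n; exact: g0.
by move=> h; exact: (cvg_unique _ h (cvg_cst _)).
Qed.

(** The Borel sets E over which g integrates to 0 on E intersected with [Q] form a Dynkin class
    containing the boxes. Staying inside one box [Q] asks for integrability and test functions there
    only. *)
Lemma fundamental_lemma_borel : {ae mu, forall x, Q x -> g x = 0%R}.
Proof.
have intE E : measurable E -> \int[mu]_(x in E `&` Q) (g x)%:E = 0.
  pose G := [set A : set 'rV[RR]_N | exists a b, A = obox a b].
  move=> mE; have : <<s G >> E by rewrite -measurable_rV_obox.
  have iQ S : measurable S -> mu.-integrable (S `&` Q) (EFin \o g).
    move=> mS; exact: (integrableS mQ (measurableI _ _ mS mQ) (@subIsetr _ _ _) ig).
  move: E {mE}; apply: (@dynkin_induction _ _ G (fun E => \int[mu]_(x in E `&` Q) (g x)%:E = 0)).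
  - exact: measurable_rV_obox.
  - exact: obox_setI_closed.
  - by rewrite setTI; exact: integral_obox0.
  - move=> S [a [b ->]]; have [a' [b' abE]] : exists a' b' : 'I_N -> R, obox a b `&` Q = obox a' b'.
      by apply: (@obox_setI_closed R N); [exists a, b|eexists; eexists].
    by rewrite abE; apply: integral_obox0; rewrite -abE; exact: subIsetr.
  - move=> S mS S0; have := integral_obox0 (@subset_refl _ Q).
    have {1}-> : Q = (S `&` Q) `|` (~` S `&` Q) by rewrite -setIUl setUCr setTI.
    rewrite integral_setU ?S0 ?add0e//.
    + exact: measurableI.
    + by apply: measurableI => //; exact: measurableC.
    + by apply: measurableT_comp => //; exact: measurable_funTS.
    + by apply/disj_setPS => x [[? _] [+ _]].
  - move=> F mF tF F0.
    rewrite setI_bigcupl integral_bigcup; first by rewrite eseries0// => n _ _; exact: F0.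
    + exact: trivIset_setIr.
    + by move=> n; exact: measurableI.
    + by rewrite -setI_bigcupl; apply: iQ; exact: bigcupT_measurable.
have := @integral_ae_eq _ _ _ mu Q mQ (cst 0) (EFin \o g) ig (measurable_cst _).
have hE : forall E, E `<=` Q -> measurable E -> \int[mu]_(x in E) (EFin \o g) x = \int[mu]_(x in E) cst 0 x.
  by move=> E EQ mE; rewrite integral0 -(intE E mE) setIidl.
by move=> /(_ hE); apply: filterS => x h Qx; have [] := h Qx.
Qed.

End fundamental_lemma.
End product_functions.

(** * Differences of bumps as integrals along a ray *)

Section rays.
Context {R : realType} {N : nat}.
Local Notation RR := (measurableTypeR R).
Local Notation mu := (borel_lebesgue_rV R N).

Lemma is_derive1_prod (I : eqType) (s : seq I) (f df : I -> R -> R) (t : R) : uniq s ->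
  (forall i, is_derive t 1 (f i) (df i t)) ->
  is_derive t 1 (fun t => \prod_(i <- s) f i t)
    (\sum_(i <- s) \prod_(j <- s) (if j == i then df j t else f j t)).
Proof.
move=> us dfi; elim: s us => [_|k s IH /= /andP[ks us]].
  rewrite big_nil (_ : (fun _ => _) = cst 1); first exact: is_derive_cst.
  by apply/funext => x; rewrite big_nil.
rewrite (_ : (fun _ => _) = f k * (fun t => \prod_(i <- s) f i t)); last first.
  by apply/funext => x; rewrite big_cons.
have h := is_deriveM (dfi k) (IH us).
apply: (is_derive_eq h).
rewrite big_cons big_cons eqxx addrC /GRing.scale /=; congr (_ + _).
  rewrite mulrC; congr (_ * _); apply: eq_big_seq => j js; case: eqP => // jk.
  by move: ks; rewrite -jk js.
rewrite mulr_sumr; apply: eq_big_seq => j js; rewrite big_cons; case: eqP => // jk.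
by move: ks; rewrite jk js.
Qed.

Variables (a b : 'I_N -> R) (n : nat).

(** Along a line the bump is a finite product of one-variable functions, so the product rule
    suffices and total differentiability is avoided. *)
Lemma is_derive_box_bump_ray (x z : 'rV[R]_N) (t : R) :
  is_derive t 1 (fun t => box_bump a b n (x - t *: z))
    (- \sum_i z ord0 i * partial i (box_bump a b n) (x - t *: z)).
Proof.
pose h i := bump (a i) (b i) n.
have sh i : smooth1 (h i) by exact: smooth1_bump.
pose f i (t : R) := h i (- z ord0 i * t + x ord0 i).
have E (s : R) j : (x - s *: z) ord0 j = - z ord0 j * s + x ord0 j.
  by rewrite !mxE addrC mulNr mulrC.
have df i : is_derive t 1 (f i) ((h i)^`()%classic (- z ord0 i * t + x ord0 i) * - z ord0 i).
  have d1 : is_derive t 1 (fun t : R => - z ord0 i * t + x ord0 i) (- z ord0 i).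
    by apply: is_derive_eq; rewrite /GRing.scale /=; ring.
  have d2 : is_derive (- z ord0 i * t + x ord0 i) 1 (h i) ((h i)^`()%classic (- z ord0 i * t + x ord0 i)).
    by rewrite derive1E; apply/derivableP; have [] := sh i 1%N.
  exact: (@is_derive1_comp R (h i) (fun t : R => - z ord0 i * t + x ord0 i)).
have := @is_derive1_prod _ (index_enum 'I_N) f (fun i s => (h i)^`()%classic (- z ord0 i * s + x ord0 i) * - z ord0 i) t (index_enum_uniq _) df.
rewrite (_ : (fun t => \prod_i f i t) = fun t => box_bump a b n (x - t *: z)); last first.
  by apply/funext => s; apply: eq_bigr => i _; rewrite E.
move=> D; apply: (is_derive_eq D).
rewrite -sumrN; apply: eq_bigr => i _.
rewrite partial_prod_fun// /prod_fun (bigD1 i)//= eqxx.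
rewrite [in RHS](bigD1 i)//= /derive_at eqxx E -mulNr [RHS]mulrCA mulrA; congr (_ * _).
by apply: eq_bigr => j /negbTE ->; rewrite E.
Qed.

Lemma continuous_partial_box_bump i : continuous (partial i (box_bump a b n)).
Proof. by have [sm _] := box_bump_test a b n; have [] := sm [:: i]. Qed.

Lemma box_bump_ray (x z : 'rV[R]_N) :
  box_bump a b n (x - z) - box_bump a b n x =
  \int[lebesgue_measure]_(t in `[0, 1])
      (- \sum_i z ord0 i * partial i (box_bump a b n) (x - t *: z)).
Proof.
pose F (t : R) := box_bump a b n (x - t *: z).
pose g (t : R) := - \sum_i z ord0 i * partial i (box_bump a b n) (x - t *: z).
have dF (t : R) : is_derive t 1 F (g t) by exact: is_derive_box_bump_ray x z t.
have cxz : continuous (fun t : R => x - t *: z).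
  by move=> t; apply: cvgB; [exact: cvg_cst|apply: cvgZl; exact: cvg_id].
have cg : continuous g.
  move=> t; apply: cvgN; apply: (cvg_big (op := +%R)) => [|i _]; first exact: add_continuous.
  apply: cvgMr.
  apply: (@continuous_comp _ _ _ (fun t : R => x - t *: z)); first exact: cxz.
  exact: continuous_partial_box_bump.
have cF : continuous F by apply: derivable1_continuous => t; have [] := dF t.
have -> : box_bump a b n (x - z) = F 1 by rewrite /F scale1r.
have -> : box_bump a b n x = F 0 by rewrite /F scale0r subr0.
have h1 : derivable_oo_LRcontinuous F 0 1.
  split; first by move=> t _; have [] := dF t.
    exact: cvg_at_right_filter (cF _).
  exact: cvg_at_left_filter (cF _).
rewrite /Rintegral (@continuous_FTC2 R g F 0 1 ltr01 (continuous_subspaceT cg) h1)//.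
by move=> t _; rewrite derive1E; have [] := dF t.
Qed.

End rays.

(** * Borel representatives *)

Section completion_ae.
Context d (T : measurableType d) (R : realType).
Variable mu : {sigma_finite_measure set T -> \bar R}.
Local Notation cT := (caratheodory_type (mu_ext mu)).
Local Notation cmu := (@completed_measure_extension _ _ _ mu).

Lemma completion_integral_EFin (g : T -> R) : measurable_fun [set: T] g ->
  (\int[cmu]_x (g x)%:E = \int[mu]_x (g x)%:E)%E.
Proof.
move=> mg; rewrite integralE [RHS]integralE; congr (_ - _)%E.
- apply: completion_integral => //; apply: measurable_funepos; exact/measurable_EFinP.
- apply: completion_integral => //; apply: measurable_funeneg; exact/measurable_EFinP.
Qed.

(** The completed measure is complete: a change on a null set preserves measurability. *)
Lemma completion_measurable_ae (g h : T -> R) : measurable_fun [set: cT] (g : cT -> R) ->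
  {ae mu, forall x, g x = h x} -> measurable_fun [set: cT] (h : cT -> R).
Proof.
move=> mg gh; apply/measurable_EFinP.
apply: (@ae_measurable_fun _ _ _ cmu (@measure_is_complete_caratheodory _ _ (mu_ext mu))
  setT (EFin \o g)).
  by apply/completion_negligible; apply: filterS gh => x /= ->.
exact/measurable_EFinP.
Qed.

Lemma completion_integral_ae (g h : T -> R) : measurable_fun [set: T] h ->
  {ae mu, forall x, g x = h x} ->
  (\int[cmu]_x (g x)%:E = \int[mu]_x (h x)%:E)%E.
Proof.
move=> mh gh; rewrite -completion_integral_EFin//.
have mh' := completion_measurable_fun (mu := mu) mh.
have mg' : measurable_fun [set: cT] (g : cT -> R).
  by apply: (completion_measurable_ae mh'); apply: filterS gh => x ->.
apply: ae_eq_integral; first exact: measurableT.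
- exact/measurable_EFinP.
- exact/measurable_EFinP.
- by apply/completion_negligible; apply: filterS gh => x /= ->.
Qed.

Lemma completion_integrable_ae (D : set T) (g h : T -> R) : measurable D -> measurable_fun [set: T] h ->
  {ae mu, forall x, g x = h x} ->
  cmu.-integrable D (EFin \o g) <-> mu.-integrable D (EFin \o h).
Proof.
move=> mD mh gh.
have mDL : measurable (D : set cT) := completion_measurable mu mD.
have mg : measurable_fun [set: cT] (g : cT -> R).
  apply: (completion_measurable_ae (completion_measurable_fun (mu := mu) mh)).
  by apply: filterS gh => x ->.
have E : (\int[cmu]_(x in D) `|(EFin \o g) x| = \int[mu]_(x in D) `|(EFin \o h) x|)%E.
  rewrite integral_mkcond [RHS]integral_mkcond.
  under eq_integral do rewrite restrict_EFin.
  under [RHS]eq_integral do rewrite restrict_EFin.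
  apply: completion_integral_ae.
  - by apply/(measurable_restrictT _ mD); apply: measurableT_comp => //; exact: measurable_funTS.
  - by apply: filterS gh => x gh; rewrite /patch gh.
split=> /integrableP[_ fin]; apply/integrableP; split; rewrite -?E// ?E//.
- by apply/measurable_EFinP; exact: measurable_funTS.
- by apply/measurable_EFinP; exact: measurable_funTS.
Qed.

Lemma Lfun_completion (p : R) (g h : T -> R) : 0 < p -> measurable_fun [set: T] h ->
  {ae mu, forall x, g x = h x} ->
  (g : cT -> R) \in Lfun cmu p%:E <-> mu.-integrable setT (EFin \o (fun x => `|h x| `^ p)).
Proof.
move=> p0 mh gh.
have mg : measurable_fun [set: cT] (g : cT -> R).
  apply: (completion_measurable_ae (completion_measurable_fun (mu := mu) mh)).
  by apply: filterS gh => x ->.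
have mhp : measurable_fun [set: T] (fun x => `|h x| `^ p).
  by apply: (measurableT_comp (measurable_powR p)); exact: measurableT_comp.
rewrite -(@completion_integrable_ae setT (fun x => `|g x| `^ p)) //; last first.
  by apply: filterS gh => x ->.
have E : (\int[cmu]_x `|(EFin \o (fun x => `|g x| `^ p)%R) x| =
   'N[cmu]_p%:E[EFin \o g] `^ p)%E.
  rewrite poweR_Lnorm ?gt_eqF//; apply: eq_integral => x _ /=.
  by rewrite ger0_norm ?powR_ge0// poweR_EFin.
split.
- rewrite inE => /andP[_ /[!inE] fn]; apply/integrableP; split.
    apply/measurable_EFinP.
    by apply: (measurableT_comp (measurable_powR p)); exact: measurableT_comp.
  by rewrite E; apply: poweR_lty; exact: fn.
- move=> /integrableP[_]; rewrite E => fin; rewrite inE; apply/andP; split; rewrite inE//.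
  change ('N[cmu]_p%:E[EFin \o g] < +oo)%E; move: fin.
  have := Lnorm_ge0 cmu p%:E (EFin \o g).
  set X := Lnorm _ _ _; case: X => [r|_|] //; rewrite ?ltry// poweRyr ?gt_eqF//.
Qed.

End completion_ae.

Section lebesgue_transfer.
Context {R : realType} {N : nat}.
Local Notation RR := (measurableTypeR R).
Local Notation mu := (borel_lebesgue_rV R N).
Local Notation LL := (caratheodory_type (mu_ext mu)).
Implicit Types (g h : 'rV[RR]_N -> R) (D : set 'rV[RR]_N).

Lemma leb_ae (P : 'rV[RR]_N -> Prop) :
  (\forall x \ae leb R N, P x) <-> {ae mu, forall x, P x}.
Proof. exact: completion_negligible. Qed.

Lemma leb_measurable_rep g : leb_measurable g ->
  exists h, measurable_fun [set: 'rV[RR]_N] h /\ {ae mu, forall x, g x = h x}.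
Proof.
move=> mg; have [N0 [mN0 N00 mh]] := @completion_fun _ _ _ mu g mg.
exists (fun x => g x * \1_(~` N0) x); split => //.
exists N0; split => // x /=; apply: contra_notP => nx.
by rewrite indicE mem_set//= mulr1.
Qed.

Lemma leb_Rintegral_ae g h : measurable_fun [set: 'rV[RR]_N] h ->
  {ae mu, forall x, g x = h x} ->
  \int[leb R N]_x g x = \int[mu]_x h x.
Proof. by move=> mh gh; congr fine; exact: completion_integral_ae. Qed.

Lemma leb_Rintegral_on D g h : measurable D -> measurable_fun [set: 'rV[RR]_N] h ->
  {ae mu, forall x, g x = h x} ->
  \int[leb R N]_(x in D) g x = \int[mu]_(x in D) h x.
Proof.
move=> mD mh gh; rewrite (Rintegral_mkcond (leb R N) D) (Rintegral_mkcond mu D).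
apply: leb_Rintegral_ae.
  by apply/(measurable_restrictT _ mD); exact: measurable_funTS.
by apply: filterS gh => x gh; rewrite /patch gh.
Qed.

Lemma leb_integrable_ae D g h : measurable D -> measurable_fun [set: 'rV[RR]_N] h ->
  {ae mu, forall x, g x = h x} ->
  (leb R N).-integrable D (EFin \o g) <-> mu.-integrable D (EFin \o h).
Proof. exact: completion_integrable_ae. Qed.

Lemma Lfun_leb (p : R) g h : 0 < p -> measurable_fun [set: 'rV[RR]_N] h ->
  {ae mu, forall x, g x = h x} ->
  g \in Lfun (leb R N) p%:E <-> mu.-integrable setT (EFin \o (fun x => `|h x| `^ p)).
Proof. exact: Lfun_completion. Qed.

End lebesgue_transfer.

(** * Cubes, test functions and local integrability *)

Section test_functions.
Context {R : realType} {N : nat}.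
Local Notation RR := (measurableTypeR R).
Local Notation mu := (borel_lebesgue_rV R N).
Implicit Types (phi : 'rV[R]_N -> R).

Definition cube (n : nat) : set 'rV[RR]_N := obox (fun=> - n%:R) (fun=> n%:R).

Lemma measurable_cube n : measurable (cube n).
Proof. exact: measurable_obox. Qed.

Lemma cube_lty n : (mu (cube n) < +oo)%E.
Proof.
rewrite /cube obox_measure; last by move=> i; rewrite ge0_cp.
by rewrite ltry.
Qed.

Lemma coord_le_norm (x : 'rV[R]_N) i : `|x ord0 i| <= `|x|.
Proof.
rewrite -[leRHS]/(mx_norm x) mx_normrE.
exact: (le_bigmax _ (fun ij : 'I_1 * 'I_N => `|x ij.1 ij.2|) (ord0, i)).
Qed.

Lemma bounded_sub_cube (A : set 'rV[R]_N) : bounded_set A -> exists n, A `<=` cube n.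
Proof.
move=> [M [_ HM]]; pose n := (Num.truncn (`|M| + 1)).+1.
exists n => x Ax i; rewrite -ltr_norml; apply: le_lt_trans (coord_le_norm x i) _.
apply: (@le_lt_trans _ _ (`|M| + 1)); last exact: truncnS_gt.
by apply: HM => //; rewrite (le_lt_trans (ler_norm M))// ltrDl.
Qed.

Lemma compact_sub_cube (K : set 'rV[R]_N) : compact K -> exists n, K `<=` cube n.
Proof. by move=> /compact_bounded; exact: bounded_sub_cube. Qed.

Lemma cube_cover : \bigcup_n cube n = [set: 'rV[RR]_N].
Proof.
apply/seteqP; split => // x _.
have [n xn] : exists n, [set x] `<=` cube n by apply: compact_sub_cube; exact: compact_set1.
by exists n => //; exact: xn.
Qed.

Lemma compact_measurable_rV (K : set 'rV[R]_N) : compact K -> measurable (K : set 'rV[RR]_N).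
Proof.
move=> cK; rewrite -(setCK K); apply: measurableC; apply: open_measurable_rV.
by apply: closed_openC; apply: compact_closed => //; exact: norm_hausdorff.
Qed.

Lemma sub_cube_compact n : exists2 K : set 'rV[R]_N, compact K & cube n `<=` K.
Proof.
exists [set x : 'rV[R]_N | forall i, - n%:R <= x ord0 i <= n%:R].
  exact: (@compact_box R N (fun=> - n%:R) (fun=> n%:R)).
by move=> x xn i; have /andP[/ltW -> /ltW ->] := xn i.
Qed.

Lemma test_function_continuous phi : test_function phi -> continuous phi.
Proof. by move=> [sphi _]; have [] := sphi [::]. Qed.

Lemma test_function_measurable phi : test_function phi ->
  measurable_fun [set: 'rV[RR]_N] (phi : 'rV[RR]_N -> R).
Proof. by move=> /test_function_continuous; exact: continuous_measurable_rV. Qed.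

Lemma test_function_partial i phi : test_function phi -> test_function (partial i phi).
Proof.
move=> [sphi cphi]; split.
  by move=> s; have := sphi (rcons s i); rewrite foldr_rcons.
apply: (subclosed_compact (@closed_closure _ _) cphi).
rewrite [X in _ `<=` X](closure_id _).1; last exact: closed_closure.
apply: closureS => x /= nz; apply: contrapT => nx.
have [_ dphi] := sphi [::].
have : is_derive x (delta_mx ord0 i : 'rV[R]_N) phi 0.
  apply: (@near_eq_is_derive _ _ _ (cst 0)) => //.
  have oC : open (~` closure [set x | phi x != 0]) by apply: closed_openC; exact: closed_closure.
  have := oC; rewrite openE => /(_ _ nx); rewrite /interior /=.
  apply: filterS => y ny /=; apply/esym/eqP; apply: contra_notT ny => py.
  exact: subset_closure.
by move=> [_ d0]; move: nz; rewrite /partial d0 eqxx.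
Qed.

Lemma test_function_bounded phi : test_function phi ->
  exists M n, forall x, `|phi x| <= M * \1_(cube n) x.
Proof.
move=> tphi; have [_ cphi] := tphi; have cont := test_function_continuous tphi.
have [n Kn] := compact_sub_cube cphi.
have : compact (phi @` closure [set x | phi x != 0]).
  by apply: continuous_compact cphi; exact: continuous_subspaceT.
move=> /compact_bounded [M [_ HM]]; exists (`|M| + 1), n => x.
have [->|px] := eqVneq (phi x) 0; first by rewrite normr0 mulr_ge0 ?indicE ?ler0n// addr_ge0.
have Kx : closure [set x | phi x != 0] x by exact: subset_closure.
rewrite indicE mem_set ?mulr1; last exact: Kn.
by apply: HM; [rewrite (le_lt_trans (ler_norm M))// ltrDl|exists x].
Qed.

Lemma integrable_mul_test (g : 'rV[RR]_N -> R) phi : measurable_fun [set: 'rV[RR]_N] g ->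
  (forall n, mu.-integrable (cube n) (EFin \o g)) -> test_function phi ->
  mu.-integrable setT (EFin \o (fun x => g x * phi x)).
Proof.
move=> mg ig tphi; have [M [n bphi]] := test_function_bounded tphi.
have mQ := measurable_cube n.
have iG : mu.-integrable setT ((fun x => M%:E * (EFin \o g) x)%E \_ (cube n)).
  by rewrite -integrable_mkcond//; exact: integrableZl.
apply: le_integrable iG => //.
  apply/measurable_EFinP; apply: measurable_funM => //; exact: test_function_measurable.
move=> x _ /=; rewrite /patch normrM; have := bphi x; rewrite indicE.
case: ifPn => xn h; last first.
  by rewrite abse0 lee_fin (le_trans (ler_wpM2l (normr_ge0 _) h))// mulr0 mulr0.
rewrite lee_fin normrM mulrC ler_wpM2r//; move: h; rewrite mulr1 => /le_trans; apply.
exact: ler_norm.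
Qed.

(** On a set of finite measure |g| <= 1 + |g|^p is enough; Hoelder's inequality is not called
    for. *)
Lemma integrable_powR_bounded (p : R) (g : 'rV[RR]_N -> R) (D : set 'rV[RR]_N) : 1 <= p ->
  measurable_fun [set: 'rV[RR]_N] g -> measurable D -> (mu D < +oo)%E ->
  mu.-integrable setT (EFin \o (fun x => `|g x| `^ p)) -> mu.-integrable D (EFin \o g).
Proof.
move=> p1 mg mD fD ig.
have i1 : mu.-integrable D (EFin \o (fun x => 1 + `|g x| `^ p)).
  apply: (@integrableD _ _ _ mu D mD (cst 1%:E) (EFin \o (fun x => `|g x| `^ p))); last exact: integrableS ig.
  apply/integrableP; split=> //; rewrite integral_cst//= normr1 mul1e//.
apply: le_integrable i1 => //; first by apply/measurable_EFinP; exact: measurable_funTS.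
move=> x _; rewrite lee_fin.
have [g1|g1] := leP `|g x| 1.
  by rewrite (le_trans g1)// (le_trans _ (ler_norm _))// lerDl powR_ge0.
rewrite (le_trans _ (ler_norm _))// -[leLHS]add0r lerD//.
by rewrite -[leLHS]powRr1// ler_powR// ltW.
Qed.

End test_functions.

(** * Sobolev functions *)

Section weak_gradient_transfer.
Context {R : realType} {N : nat}.
Local Notation RR := (measurableTypeR R).
Local Notation mu := (borel_lebesgue_rV R N).
Local Notation LL := (caratheodory_type (mu_ext mu)).
Implicit Types (u g : 'rV[RR]_N -> R) (G : 'rV[RR]_N -> 'rV[RR]_N) (p : R).

Lemma loc_integrable_measurable u : loc_integrable u -> leb_measurable u.
Proof.
move=> lu.
have mc (n : nat) : measurable (cube n : set LL).
  exact: (@completion_measurable _ _ _ mu _ (measurable_cube n)).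
rewrite /leb_measurable -[X in measurable_fun X](@cube_cover R N).
have [_ h] := @measurable_fun_bigcup _ _ LL RR (fun n => cube n : set LL) u mc.
apply: h => n.
have [K cK nK] := @sub_cube_compact R N n.
have mK : measurable (K : set LL).
  exact: (@completion_measurable _ _ _ mu _ (compact_measurable_rV cK)).
apply: (measurable_funS mK nK); apply/measurable_EFinP.
exact: measurable_int (lu K cK).
Qed.

Lemma loc_integrable_rep u g : measurable_fun [set: 'rV[RR]_N] g ->
  {ae mu, forall x, u x = g x} ->
  loc_integrable u <-> forall n, mu.-integrable (cube n) (EFin \o g).
Proof.
move=> mg ug; split=> [lu n|ig K cK].
  have [K cK nK] := @sub_cube_compact R N n.
  have mK := compact_measurable_rV cK.
  apply: (integrableS mK (measurable_cube n) nK).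
  by apply/(leb_integrable_ae mK mg ug); exact: lu.
have [n Kn] := compact_sub_cube cK.
have mK := compact_measurable_rV cK.
apply/(leb_integrable_ae mK mg ug).
exact: (integrableS (measurable_cube n) mK Kn (ig n)).
Qed.

Lemma fundamental_lemma g : measurable_fun [set: 'rV[RR]_N] g ->
  (forall n, mu.-integrable (cube n) (EFin \o g)) ->
  (forall phi, test_function phi -> \int[mu]_x (g x * phi x) = 0) ->
  {ae mu, forall x, g x = 0}.
Proof.
move=> mg ig g0.
have H n : {ae mu, forall x, cube n x -> g x = 0}.
  apply: (@fundamental_lemma_borel R N g mg _ _ (ig n)) => // a b k _.
  have tb := box_bump_test a b k.
  have fin := integrable_fin_num measurableT (integrable_mul_test mg ig tb).
  by rewrite -[LHS](fineK fin) [fine _](g0 _ tb).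
have := @ae_foralln _ _ _ mu _ H.
apply: filterS => x hx; have : [set: 'rV[RR]_N] x by [].
by rewrite -cube_cover => -[n _ /hx].
Qed.

Lemma ae_mulr (g1 g2 h : 'rV[RR]_N -> R) : {ae mu, forall x, g1 x = g2 x} ->
  {ae mu, forall x, g1 x * h x = g2 x * h x}.
Proof. by apply: filterS => x ->. Qed.

Lemma ae_rowP G1 G2 : (forall i, {ae mu, forall x, G1 x ord0 i = G2 x ord0 i}) ->
  {ae mu, forall x, G1 x = G2 x}.
Proof.
move=> H; have : {ae mu, forall x, forall i, G1 x ord0 i = G2 x ord0 i}.
  by apply: filter_forall => i; exact: H.
by apply: filterS => x h; apply/rowP.
Qed.

(** The Borel representatives of the difference integrate to 0 against every test function. *)
Lemma weak_gradient_unique u G1 G2 : is_weak_gradient u G1 -> is_weak_gradient u G2 ->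
  {ae mu, forall x, G1 x = G2 x}.
Proof.
move=> [_ H1] [_ H2].
have H i : {ae mu, forall x, G1 x ord0 i = G2 x ord0 i}.
  have [l1 e1] := H1 i; have [l2 e2] := H2 i.
  have [h1 [mh1 g1]] := leb_measurable_rep (loc_integrable_measurable l1).
  have [h2 [mh2 g2]] := leb_measurable_rep (loc_integrable_measurable l2).
  have i1 := (loc_integrable_rep mh1 g1).1 l1.
  have i2 := (loc_integrable_rep mh2 g2).1 l2.
  have := @fundamental_lemma (fun x => h1 x - h2 x) (measurable_funB mh1 mh2).
  have ii n : mu.-integrable (cube n) (EFin \o (fun x => h1 x - h2 x)).
    exact: (integrableB (measurable_cube n) (i1 n) (i2 n)).
  move=> /(_ ii); have e phi : test_function phi -> \int[mu]_x ((h1 x - h2 x) * phi x) = 0.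
    move=> tphi; under eq_Rintegral do rewrite mulrBl.
    rewrite RintegralB//; try exact: integrable_mul_test.
    have mphi := test_function_measurable tphi.
    rewrite -(@leb_Rintegral_ae _ _ (fun x => G1 x ord0 i * phi x)); last first.
      by apply: filterS g1 => x ->.
      exact: measurable_funM.
    rewrite -(@leb_Rintegral_ae _ _ (fun x => G2 x ord0 i * phi x)); last first.
      by apply: filterS g2 => x ->.
      exact: measurable_funM.
    by apply/eqP; rewrite subr_eq0 -eqr_opp -e1// e2.
  move=> /(_ e); apply: filterS3 g1 g2 => x -> -> /eqP; rewrite subr_eq0 => /eqP; exact.
exact: ae_rowP.
Qed.

(* W^{1,p} with the function and its weak gradient given by Borel representatives. *)
Definition sobolev p u G : Prop :=
  [/\ measurable_fun [set: 'rV[RR]_N] u, measurable_fun [set: 'rV[RR]_N] G,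
     mu.-integrable setT (EFin \o (fun x => `|u x| `^ p)),
     mu.-integrable setT (EFin \o (fun x => enorm (G x) `^ p)) &
     forall i phi, test_function phi ->
       \int[mu]_x (u x * partial i phi x) = - \int[mu]_x (G x ord0 i * phi x)].

Lemma measurable_coord G (i : 'I_N) : measurable_fun [set: 'rV[RR]_N] G ->
  measurable_fun [set: 'rV[RR]_N] (fun x => G x ord0 i).
Proof.
by move=> mG; apply: (measurableT_comp (@measurable_rV_coord _ RR N i) mG).
Qed.

Lemma enorm_powR_le_sum p (x : 'rV[R]_N) : 0 < p ->
  enorm x `^ p <= N%:R `^ p * \sum_i `|x ord0 i| `^ p.
Proof.
move=> p0; have [i0|n0] := pselect (exists i : 'I_N, True); last first.
  have -> : enorm x = 0.
    apply/eqP; rewrite eq_le enorm_ge0 andbT (le_trans (enorm_le_sum x))//.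
    by rewrite big1// => i; case: n0; exists i.
  by rewrite powR0 ?gt_eqF// mulr_ge0 ?powR_ge0// sumr_ge0// => i _; exact: powR_ge0.
have [i0' _] := i0; have [i _ imax] := @arg_maxP _ _ 'I_N i0' xpredT (fun i => `|x ord0 i|) isT.
apply: (@le_trans _ _ ((N%:R * `|x ord0 i|) `^ p)).
  rewrite ge0_ler_powR ?nnegrE ?enorm_ge0 ?mulr_ge0 ?(ltW p0)//.
  apply: le_trans (enorm_le_sum x) _.
  apply: (@le_trans _ _ (\sum_(j < N) `|x ord0 i|)).
    by apply: ler_sum => j _; exact: imax.
  by rewrite sumr_const card_ord mulr_natl.
rewrite powRM ?ler_wpM2l ?powR_ge0// (bigD1 i)//= lerDl.
by rewrite sumr_ge0// => j _; exact: powR_ge0.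
Qed.

Lemma coord_integrable p G i : 0 < p -> measurable_fun [set: 'rV[RR]_N] G ->
  mu.-integrable setT (EFin \o (fun x => enorm (G x) `^ p)) ->
  mu.-integrable setT (EFin \o (fun x => `|G x ord0 i| `^ p)).
Proof.
move=> p0 mG; apply: le_integrable => //.
  apply/measurable_EFinP; apply: (measurableT_comp (measurable_powR p)).
  by apply: measurableT_comp => //; exact: measurable_coord.
move=> x _ /=; rewrite lee_fin (ger0_norm (powR_ge0 _ _)) (ger0_norm (powR_ge0 _ _)).
by rewrite ge0_ler_powR ?nnegrE ?enorm_ge0 ?(ltW p0)// coord_le_enorm.
Qed.

Lemma measurable_enorm_powR p G : measurable_fun [set: 'rV[RR]_N] G ->
  measurable_fun [set: 'rV[RR]_N] (fun x => enorm (G x) `^ p).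
Proof.
move=> mG; apply: (measurableT_comp (measurable_powR p)).
exact: measurable_enorm.
Qed.

Lemma enorm_integrable p G : 0 < p -> measurable_fun [set: 'rV[RR]_N] G ->
  (forall i, mu.-integrable setT (EFin \o (fun x => `|G x ord0 i| `^ p))) ->
  mu.-integrable setT (EFin \o (fun x => enorm (G x) `^ p)).
Proof.
move=> p0 mG iG.
have iS : mu.-integrable setT (fun x => (N%:R `^ p)%:E *
    \sum_(i <- index_enum 'I_N) (EFin \o (fun x => `|G x ord0 i| `^ p)%R) x)%E.
  by apply: integrableZl => //; apply: integrable_sum.
apply: le_integrable iS => //; first by apply/measurable_EFinP; exact: measurable_enorm_powR.
move=> x _ /=; rewrite sumEFin -EFinM lee_fin (ger0_norm (powR_ge0 _ _)).
exact: le_trans (enorm_powR_le_sum _ p0) (ler_norm _).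
Qed.

Lemma sobolev_cube p u G : 1 <= p -> sobolev p u G ->
  (forall n, mu.-integrable (cube n) (EFin \o u)) /\
  (forall i n, mu.-integrable (cube n) (EFin \o (fun x => G x ord0 i))).
Proof.
move=> p1 [mu_ mG iu iG _]; have p0 : 0 < p by exact: lt_le_trans p1.
have mC n := @measurable_cube R N n; have fC n := @cube_lty R N n.
split=> [n|i n]; apply: integrable_powR_bounded p1 _ (mC n) (fC n) _ => //.
  exact: measurable_coord.
exact: coord_integrable.
Qed.

Lemma measurable_row (g : 'I_N -> 'rV[RR]_N -> R) :
  (forall i, measurable_fun [set: 'rV[RR]_N] (g i)) ->
  measurable_fun [set: 'rV[RR]_N] (fun x => \row_i g i x : 'rV[RR]_N).
Proof.
move=> mg; apply: measurable_fun_rV => i.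
by under eq_fun do rewrite mxE; exact: mg.
Qed.

Lemma sobolev_is_weak_gradient p u u' G' : 1 <= p -> sobolev p u' G' ->
  {ae mu, forall x, u x = u' x} -> is_weak_gradient u G'.
Proof.
move=> p1 so uu'; have [mu' mG' iu' iG' so5] := so.
have [lu lG] := sobolev_cube p1 so.
split; first exact/(loc_integrable_rep mu' uu').
move=> i; split; first by apply/(loc_integrable_rep (measurable_coord i mG')); [exact: nearW|exact: lG].
move=> phi tphi; have mphi := test_function_measurable tphi.
have mpphi := test_function_measurable (test_function_partial i tphi).
rewrite (@leb_Rintegral_ae _ _ _ (fun x => u' x * partial i phi x)).
- rewrite so5//; congr (- _); rewrite (@leb_Rintegral_ae _ _ _ (fun x => G' x ord0 i * phi x))//.
    by apply: measurable_funM => //; exact: measurable_coord.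
  exact: nearW.
- exact: measurable_funM.
- by apply: filterS uu' => x ->.
Qed.

(** [weak_gradient u] is an arbitrary choice; as some weak gradient exists, the choice is one, and
    uniqueness identifies it almost everywhere with the Borel gradient. *)
Lemma sobolev_W1p p u u' G' : 1 <= p -> sobolev p u' G' ->
  {ae mu, forall x, u x = u' x} ->
  W1p p u /\ {ae mu, forall x, weak_gradient u x = G' x}.
Proof.
move=> p1 so uu'; have [mu' mG' iu' iG' so5] := so.
have p0 : 0 < p by exact: lt_le_trans p1.
have wg := sobolev_is_weak_gradient p1 so uu'.
split; last by apply: (@weak_gradient_unique u) => //; apply: getPex; exists G'.
split; first exact/(Lfun_leb p0 mu' uu').
exists G' => // i; apply/(Lfun_leb p0 (measurable_coord i mG')); first exact: nearW.
exact: coord_integrable.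
Qed.

Lemma W1p_sobolev p u : 1 <= p -> W1p p u ->
  exists u' G', [/\ sobolev p u' G', {ae mu, forall x, u x = u' x} &
    {ae mu, forall x, weak_gradient u x = G' x}].
Proof.
move=> p1 [Lu [G wG LG]]; have p0 : 0 < p by exact: lt_le_trans p1.
have mLu : leb_measurable u by move: Lu; rewrite inE => /andP[/[!inE]].
have [u' [mu' uu']] := leb_measurable_rep mLu.
have mLG i : leb_measurable (fun x => G x ord0 i).
  by have := LG i; rewrite inE => /andP[/[!inE]].
have /choice[g Hg] := fun i => leb_measurable_rep (mLG i).
pose G' : 'rV[RR]_N -> 'rV[RR]_N := fun x => \row_i g i x.
have mG' : measurable_fun [set: 'rV[RR]_N] G' by apply: measurable_row => i; have [] := Hg i.
have GG' i : {ae mu, forall x, G x ord0 i = G' x ord0 i}.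
  by have [_] := Hg i; apply: filterS => x ->; rewrite mxE.
have GG'a : {ae mu, forall x, G x = G' x} by exact: ae_rowP.
have so : sobolev p u' G'.
  split => //.
  - exact/(Lfun_leb p0 mu' uu').
  - apply: enorm_integrable => // i.
    by apply/(Lfun_leb p0 (measurable_coord i mG') (GG' i)).
  - move=> i phi tphi; have mphi := test_function_measurable tphi.
    have mpphi := test_function_measurable (test_function_partial i tphi).
    have [_ /(_ i)[_ /(_ phi tphi)]] := wG.
    rewrite (@leb_Rintegral_ae _ _ _ (fun x => u' x * partial i phi x)).
    + move=> ->; congr (- _); apply: leb_Rintegral_ae.
        by apply: measurable_funM => //; exact: measurable_coord.
      exact: ae_mulr (GG' i).
    + exact: measurable_funM.
    + by apply: filterS uu' => x ->.
exists u', G'; split => //.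
have wu : is_weak_gradient u (weak_gradient u) by apply: getPex; exists G.
apply: filterS2 (weak_gradient_unique wu wG) GG'a => x -> //.
Qed.

End weak_gradient_transfer.

(** * Morrey's inequality *)

Section translations.
Context {R : realType} {N : nat}.
Local Notation RR := (measurableTypeR R).
Local Notation mu := (borel_lebesgue_rV R N).
Local Notation nu := (@lebesgue_measure R).

Lemma cube_shift m (z : 'rV[R]_N) : exists m', forall x t, `|t| <= 1 ->
  cube m x -> cube m' (x + t *: z).
Proof.
exists (m + (Num.truncn `|z|).+1)%N => x t t1 xm i.
have := xm i; rewrite -!ltr_norml !mxE => xmi.
apply: le_lt_trans (ler_normD _ _) _; rewrite natrD ltr_leD//.
rewrite normrM (le_trans (ler_wpM2r (normr_ge0 _) t1))// mul1r.
by rewrite (le_trans (coord_le_norm z i))// ltW// truncnS_gt.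
Qed.

Lemma shift_measurable (b : 'rV[R]_N) : measurable_fun [set: 'rV[RR]_N] (fun x : 'rV[RR]_N => x + b : 'rV[RR]_N).
Proof.
by have := @affine_measurable R N 1 b; under eq_fun do rewrite scale1r.
Qed.

Lemma shift_ge0_integral (b : 'rV[R]_N) (f : 'rV[RR]_N -> \bar R) :
  measurable_fun [set: 'rV[RR]_N] f -> (forall x, 0 <= f x)%E ->
  (\int[mu]_x f (x + b)%R = \int[mu]_x f x)%E.
Proof.
move=> mf f0; have := @affine_integral R N 1 b f.
under eq_integral do rewrite scale1r.
by rewrite expr1n invr1 mul1e => ->.
Qed.

Lemma shift_integral (b : 'rV[R]_N) (g : 'rV[RR]_N -> R) :
  measurable_fun [set: 'rV[RR]_N] g ->
  (\int[mu]_x (g (x + b)%R)%:E = \int[mu]_x (g x)%:E)%E.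
Proof.
move=> mg; rewrite integralE [RHS]integralE; congr (_ - _)%E.
- have mp : measurable_fun [set: 'rV[RR]_N] (EFin \o g)^\+%E.
    by apply: measurable_funepos; exact/measurable_EFinP.
  rewrite -[RHS](shift_ge0_integral b mp (funepos_ge0 _)).
  by apply: eq_integral => x _; rewrite !funeposE.
- have mp : measurable_fun [set: 'rV[RR]_N] (EFin \o g)^\-%E.
    by apply: measurable_funeneg; exact/measurable_EFinP.
  rewrite -[RHS](shift_ge0_integral b mp (funeneg_ge0 _)).
  by apply: eq_integral => x _; rewrite !funenegE.
Qed.

Lemma shift_integrable (b : 'rV[R]_N) (g : 'rV[RR]_N -> R) :
  measurable_fun [set: 'rV[RR]_N] g -> mu.-integrable setT (EFin \o g) ->
  mu.-integrable setT (EFin \o (fun x => g (x + b))).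
Proof.
move=> mg /integrableP[_ fin]; have ms := shift_measurable b; apply/integrableP; split.
  by apply/measurable_EFinP; apply: (measurableT_comp mg ms).
apply: le_lt_trans fin; rewrite le_eqVlt; apply/orP; left; apply/eqP.
apply: (@shift_ge0_integral b (fun x => `|(EFin \o g) x|%E)) => //.
by apply: measurableT_comp => //; exact/measurable_EFinP.
Qed.

Lemma measurable_ray (z : 'rV[R]_N) : measurable_fun [set: 'rV[RR]_N * RR]
  (fun xt : 'rV[RR]_N * RR => xt.1 + xt.2 *: z : 'rV[RR]_N).
Proof.
apply: measurable_fun_rV => i; under eq_fun do rewrite !mxE.
apply: measurable_funD.
  exact: (measurableT_comp (@measurable_rV_coord _ RR N i) measurable_fst).
by apply: measurable_funM => //; exact: measurable_snd.
Qed.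

Lemma slab_integrable (f : 'rV[RR]_N * RR -> R) (C : R) :
  measurable_fun [set: 'rV[RR]_N * RR] f ->
  (forall t, \int[mu]_x `|f (x, t)|%:E <= (C * \1_`[0, 1] t)%:E)%E ->
  (mu \x nu)%E.-integrable setT (EFin \o f).
Proof.
move=> mf fC; apply/integrable21ltyP; first exact/measurable_EFinP.
apply: (@le_lt_trans _ _ (\int[nu]_t (C * \1_`[0, 1] t)%:E)%E).
  apply: ge0_le_integral => //.
  - by move=> t _; exact: integral_ge0.
  - apply: (@measurable_fun_fubini_tonelli_G _ _ 'rV[RR]_N RR R mu (fun xt => `|f xt|%:E)) => //.
    by apply/measurable_EFinP; exact: measurableT_comp.
  - apply/measurable_EFinP; apply: measurable_funM => //.
  - by move=> t _; exact: fC.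
have i01 := integrableZl measurableT C (@integrable_indic_itv R 0 1 true false).
exact: integrable_lty i01.
Qed.

Lemma measurable_indic01 : measurable_fun [set: 'rV[RR]_N * RR]
  (fun xt : 'rV[RR]_N * RR => \1_`[0, 1] xt.2 : R).
Proof.
apply: (@measurableT_comp _ _ _ _ _ _ (\1_`[0, 1] : RR -> R)) => //.
Qed.

Lemma integrable_indicM (g : 'rV[RR]_N -> R) (D : set 'rV[RR]_N) : measurable D ->
  mu.-integrable D (EFin \o g) -> mu.-integrable setT (EFin \o (fun x => g x * \1_D x)).
Proof.
move=> mD; rewrite integrable_mkcond//; congr (integrable _ _ _); apply/funext => x /=.
by rewrite /patch indicE; case: ifPn => _ /=; rewrite ?mulr1 ?mulr0.
Qed.

Lemma slab_integrable_bound (f : 'rV[RR]_N * RR -> R) (h : RR -> 'rV[RR]_N -> 'rV[RR]_N) (A : 'rV[RR]_N -> R) :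
  measurable_fun [set: 'rV[RR]_N * RR] f -> mu.-integrable setT (EFin \o A) ->
  measurable_fun [set: 'rV[RR]_N] A -> (forall x, 0 <= A x) ->
  (forall t x, `|f (x, t)| <= A (h t x) * \1_`[0, 1] t) ->
  (forall t, exists b, forall x, h t x = x + b) ->
  (mu \x nu)%E.-integrable setT (EFin \o f).
Proof.
move=> mf iA mA A0 fA hb; apply: (@slab_integrable f (\int[mu]_x A x) mf) => t.
have [b hE] := hb t.
have mAt : measurable_fun [set: 'rV[RR]_N] (fun x => A (h t x)).
  under eq_fun do rewrite hE; exact: (measurableT_comp mA (shift_measurable b)).
apply: (@le_trans _ _ (\int[mu]_x (A (h t x) * \1_`[0, 1] t)%:E)%E).
  apply: ge0_le_integral => //.
  - apply/measurable_EFinP; apply: measurableT_comp => //.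
    exact: (measurableT_comp mf (measurable_pair2 _)).
  - by apply/measurable_EFinP; exact: measurable_funM.
  - by move=> x _; rewrite lee_fin.
under eq_integral do rewrite EFinM hE.
have iAb : mu.-integrable setT (EFin \o (fun x => A (x + b))) by exact: shift_integrable.
rewrite integralZr// [X in (X * _)%E](shift_integral b mA).
by rewrite EFinM fineK//; exact: integrable_fin_num.
Qed.

(** g is only locally integrable, but w vanishes off a cube and |t| <= 1, so all the translates
    involved live in one larger cube; there an integrable majorant independent of t exists. *)
Lemma slab_shift_integrable (z : 'rV[R]_N) (g w : 'rV[RR]_N -> R) (M : R) m :
  measurable_fun [set: 'rV[RR]_N] g -> measurable_fun [set: 'rV[RR]_N] w ->
  (forall n, mu.-integrable (cube n) (EFin \o g)) -> (forall x, `|w x| <= M * \1_(cube m) x) ->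
  (mu \x nu)%E.-integrable setT
     (EFin \o (fun xt : 'rV[RR]_N * RR => \1_`[0, 1] xt.2 * (g (xt.1 + xt.2 *: z) * w xt.1))) /\
  (mu \x nu)%E.-integrable setT
     (EFin \o (fun xt : 'rV[RR]_N * RR => \1_`[0, 1] xt.2 * (g xt.1 * w (xt.1 - xt.2 *: z)))).
Proof.
move=> mg mw ig bw; have [m' hm'] := cube_shift m z.
have mQ := @measurable_cube R N m'.
pose A x := `|M * g x| * \1_(cube m') x.
have mA : measurable_fun [set: 'rV[RR]_N] A.
  apply: measurable_funM; first by apply: measurableT_comp => //; exact: measurable_funM.
  exact: measurable_indic.
have A0 x : 0 <= A x by rewrite /A mulr_ge0// indicE ler0n.
have iA : mu.-integrable setT (EFin \o A).
  apply: integrable_indicM => //; apply: (@integrable_norm _ _ _ mu _ (fun x => M * g x)).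
  exact: (@integrableZl _ _ _ mu _ mQ M (EFin \o g)).
have M0 x : `|w x| <= `|M| * \1_(cube m) x.
  by apply: le_trans (bw x) _; rewrite ler_wpM2r ?indicE ?ler0n// ler_norm.
have mi := measurable_indic01.
have mr1 := measurable_ray z; have mr2 := measurable_ray (- z).
have key (t : RR) (x y : 'rV[RR]_N) : (cube m y -> `|t| <= 1 -> cube m' x) ->
    `|\1_`[0, 1] t * (g x * w y)| <= A x * \1_`[0, 1] t.
  move=> xy; rewrite indicE; have [|_] := boolP (t \in _); last by rewrite mul0r mulr0 normr0.
  rewrite inE/= in_itv/= => /andP[t0 t1]; rewrite mul1r mulr1 /A !normrM.
  have := M0 y; rewrite indicE; have [|ny] := boolP (y \in cube m).
    rewrite inE => ym; rewrite indicE mem_set ?mulr1; last by apply: xy => //; rewrite ger0_norm.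
    by move=> h; rewrite mulrC ler_wpM2r.
  rewrite mulr0 normr_le0 => /eqP ->; rewrite normr0 mulr0.
  by rewrite !mulr_ge0// indicE ler0n.
split.
- apply: (@slab_integrable_bound _ (fun t x => x + t *: z) A) => //.
  + apply: measurable_funM => //; apply: measurable_funM; first exact: (measurableT_comp mg mr1).
    exact: (measurableT_comp mw measurable_fst).
  + by move=> t x; apply: key => xm t1; exact: hm'.
  + by move=> t; exists (t *: z).
- apply: (@slab_integrable_bound _ (fun t x => x) A) => //.
  + apply: measurable_funM => //; apply: measurable_funM; first exact: (measurableT_comp mg measurable_fst).
    by under eq_fun do rewrite -scalerN; exact: (measurableT_comp mw mr2).
  + by move=> t x; apply: key => xm t1; rewrite -(subrK (t *: z) x); exact: hm'.
  + by move=> t; exists 0 => x; rewrite addr0.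
Qed.

End translations.

(** * Increments of a Sobolev function along segments *)

Section segment_inequality.
Context {R : realType} {N : nat}.
Local Notation RR := (measurableTypeR R).
Local Notation mu := (borel_lebesgue_rV R N).
Local Notation nu := (@lebesgue_measure R).

Definition bounded_supported (g : 'rV[RR]_N -> R) :=
  exists M m, forall x, `|g x| <= M * \1_(cube m) x.

Lemma bounded_supportedD g h : bounded_supported g -> bounded_supported h ->
  bounded_supported (fun x => g x + h x).
Proof.
move=> [M [m gM]] [M' [m' hM]]; exists (`|M| + `|M'|), (maxn m m') => x.
have le k : (k <= maxn m m')%N -> cube k x -> cube (maxn m m') x.
  move=> kle kx i; have := kx i; rewrite -!ltr_norml => /lt_le_trans; apply.
  by rewrite ler_nat.
have key (K : R) k : (k <= maxn m m')%N -> K * \1_(cube k) x <= `|K| * \1_(cube (maxn m m')) x.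
  move=> kle; apply: (@le_trans _ _ (`|K| * \1_(cube k) x)).
    by rewrite ler_wpM2r ?ler_norm// indicE ler0n.
  rewrite ler_wpM2l// !indicE ler_nat; have [xk|//] := boolP (x \in cube k).
  by rewrite (mem_set (le _ kle (set_mem xk))).
rewrite (le_trans (ler_normD _ _))// mulrDl lerD//.
  by rewrite (le_trans (gM x))// key// leq_maxl.
by rewrite (le_trans (hM x))// key// leq_maxr.
Qed.

Lemma bounded_supportedZ c g : bounded_supported g -> bounded_supported (fun x => c * g x).
Proof.
move=> [M [m gM]]; exists (`|c| * M), m => x.
by rewrite normrM -mulrA ler_wpM2l.
Qed.

Lemma bounded_supported_sum (I : Type) (s : seq I) (g : I -> 'rV[RR]_N -> R) :
  (forall i, bounded_supported (g i)) -> bounded_supported (fun x => \sum_(i <- s) g i x).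
Proof.
move=> bg; elim: s => [|i s IH].
  by exists 0, 0%N => x; rewrite big_nil normr0 mul0r.
by under eq_fun do rewrite big_cons; exact: bounded_supportedD.
Qed.

Lemma partial_translate i (phi : 'rV[R]_N -> R) w x :
  partial i (fun y => phi (y - w)) x = partial i phi (x - w).
Proof.
rewrite /partial /derive; apply: (congr1 (fun F : R -> R => lim (F @ 0^'))).
by apply/funext => h /=; rewrite addrA.
Qed.

Lemma box_bump_translate a b n (w : 'rV[R]_N) : (fun y => box_bump a b n (y - w)) =
  box_bump (fun i => a i + w ord0 i) (fun i => b i + w ord0 i) n.
Proof.
apply/funext => y; apply: eq_bigr => i _; rewrite /bump !mxE.
by congr (expinv 0 (_ * _) * expinv 0 (_ * _)); ring.
Qed.

Lemma abse_fine_le (y : \bar R) : (`|(fine y)%:E| <= `|y|)%E.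
Proof. by case: y => [r||] //=; rewrite normr0 leey. Qed.

Variables (p : R) (u : 'rV[RR]_N -> R) (G : 'rV[RR]_N -> 'rV[RR]_N).
Hypotheses (p1 : 1 <= p) (so : sobolev p u G).

Let mU : measurable_fun [set: 'rV[RR]_N] u. Proof. by have [] := so. Qed.
Let mG : measurable_fun [set: 'rV[RR]_N] G. Proof. by have [] := so. Qed.

Section direction.
Variable z : 'rV[R]_N.

Let dG (x : 'rV[RR]_N) := dot (G x) z.

Let mdG : measurable_fun [set: 'rV[RR]_N] dG.
Proof. by apply: measurable_dot. Qed.

Let iU n : mu.-integrable (cube n) (EFin \o u).
Proof. by have [] := sobolev_cube p1 so. Qed.

Let idG n : mu.-integrable (cube n) (EFin \o dG).
Proof.
have [_ iG] := sobolev_cube p1 so.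
rewrite (_ : EFin \o dG = fun x => \sum_(i <- index_enum 'I_N) ((z ord0 i)%:E * (EFin \o (fun x => G x ord0 i)) x)%E).
  apply: integrable_sum => [|i _]; first exact: measurable_cube.
  by apply: integrableZl; [exact: measurable_cube|exact: iG].
apply/funext => x; rewrite /= /dG /dot -sumEFin; apply: eq_bigr => i _.
by rewrite -EFinM mulrC.
Qed.

Section bump.
Variables (a b : 'I_N -> R) (k : nat).
Let phi := box_bump a b k.
Let psi (x : 'rV[RR]_N) := - \sum_i z ord0 i * partial i phi x.

Let tphi : test_function phi. Proof. exact: box_bump_test. Qed.

Let cpsi : continuous (psi : 'rV[R]_N -> R).
Proof.
have cp i (_ : true) : continuous (fun x : 'rV[R]_N => z ord0 i * partial i phi x).
  have c := test_function_continuous (test_function_partial i tphi).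
  by move=> x; apply: cvgMr; [exact: nbhs_filter|exact: c].
have ca : continuous (fun x : R * R => x.1 + x.2) by exact: add_continuous.
have h := @continuous_big R 'I_N +%R 0 xpredT ca 'rV[R]_N (index_enum 'I_N) _ cp.
by move=> x; apply: cvgN; [exact: nbhs_filter|exact: h].
Qed.

Let bpsi : bounded_supported psi.
Proof.
rewrite /psi; under eq_fun do rewrite -mulN1r.
apply: bounded_supportedZ; apply: bounded_supported_sum => i; apply: bounded_supportedZ.
exact: test_function_bounded (test_function_partial i tphi).
Qed.

(** The weak gradient identity tested with the translate of [phi], then a shift of variable.
    Translates of box bumps are box bumps. *)
Let weak_translate (w : 'rV[R]_N) :
  (\int[mu]_x (u x * psi (x - w))%:E = \int[mu]_x (dG (x + w) * phi x)%:E)%E.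
Proof.
have [_ _ _ _ sw] := so; have [_ iG] := sobolev_cube p1 so.
pose phiw := fun y => phi (y - w).
have tw : test_function phiw by rewrite /phiw box_bump_translate; exact: box_bump_test.
have mw := test_function_measurable tw.
have mD : measurable_fun [set: 'rV[RR]_N] (fun x => dG x * phiw x) by exact: measurable_funM.
rewrite -[RHS](shift_integral (- w)); last first.
  apply: measurable_funM; first exact: (measurableT_comp mdG (shift_measurable w)).
  exact: test_function_measurable.
under [RHS]eq_integral do rewrite subrK.
have iu i : mu.-integrable setT (EFin \o (fun x => u x * partial i phiw x)).
  by apply: integrable_mul_test => //; exact: test_function_partial.
have ig i : mu.-integrable setT (EFin \o (fun x => G x ord0 i * phiw x)).
  by apply: integrable_mul_test => //; exact: measurable_coord.
transitivity (\int[mu]_x \sum_(i <- index_enum 'I_N) ((- z ord0 i)%:E * (EFin \o (fun x => u x * partial i phiw x)%R) x))%E.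
  apply: eq_integral => x _; rewrite /psi mulrN mulr_sumr -sumrN -sumEFin.
  apply: eq_bigr => i _; rewrite /= -EFinM partial_translate; congr (_%:E); ring.
transitivity (\int[mu]_x \sum_(i <- index_enum 'I_N) ((z ord0 i)%:E * (EFin \o (fun x => G x ord0 i * phiw x)%R) x))%E; last first.
  apply: eq_integral => x _; rewrite /dG /dot mulr_suml -sumEFin.
  by apply: eq_bigr => i _; rewrite /= -EFinM; congr (_%:E); rewrite /phiw; ring.
rewrite integral_sum//; last by move=> i; exact: integrableZl.
rewrite integral_sum//; last by move=> i; exact: integrableZl.
apply: eq_bigr => i _; rewrite !integralZl//.
have := sw i _ tw; rewrite /Rintegral => e.
rewrite -(fineK (integrable_fin_num measurableT (iu i))) [fine _]e.
by rewrite -(fineK (integrable_fin_num measurableT (ig i))) -!EFinM mulrNN.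
Qed.

(** phi(x - z) - phi(x) is the integral of [psi] along the ray; Fubini and [weak_translate] with w =
    t z move the derivative onto u. *)
Lemma bump_difference :
  (\int[mu]_x (u x * (phi (x - z) - phi x))%:E =
   \int[mu]_x \int[nu]_t (\1_`[0, 1] t * (dG (x + t *: z) * phi x))%:E)%E.
Proof.
have [M [m bM]] := bpsi; have [M' [m' bM']] := test_function_bounded tphi.
have mpsi : measurable_fun [set: 'rV[RR]_N] psi by exact: continuous_measurable_rV.
have mphi := test_function_measurable tphi.
have [_ iK] := slab_shift_integrable z mU mpsi iU bM.
have [iL _] := slab_shift_integrable z mdG mphi idG bM'.
transitivity (\int[mu]_x \int[nu]_t (\1_`[0, 1] t * (u x * psi (x - t *: z)))%:E)%E.
  apply: eq_integral => x _; rewrite box_bump_ray.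
  have ci : nu.-integrable `[0, 1]%classic (EFin \o (fun t : RR => psi (x - t *: z))).
    apply: continuous_compact_integrable; first exact: segment_compact.
    apply: continuous_subspaceT => t.
    apply: (@continuous_comp _ _ _ (fun t : R => x - t *: z)); last exact: cpsi.
    by apply: cvgB; [exact: cvg_cst|apply: cvgZ; [exact: cvg_id|exact: cvg_cst]].
  have m01 : measurable (`[0, 1]%classic : set RR) by exact: measurable_itv.
  rewrite EFinM /Rintegral fineK; last exact: (integrable_fin_num m01 ci).
  rewrite -integralZl// integral_mkcond; apply: eq_integral => t _.
  by rewrite patchE indicE; case: ifPn => _; rewrite ?mul1r ?mul0r.
rewrite (Fubini iK) (Fubini iL); apply: eq_integral => t _.
under eq_integral do rewrite /= EFinM.
under [RHS]eq_integral do rewrite /= EFinM.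
rewrite indicE; case: (t \in _); last first.
  by under eq_integral do rewrite mul0e; under [RHS]eq_integral do rewrite mul0e.
by under eq_integral do rewrite mul1e; under [RHS]eq_integral do rewrite mul1e; exact: weak_translate.
Qed.

End bump.

(** By testing with bumps, for a.e. x the increment u(x + z) - u(x) equals the integral over [0, 1]
    of the pairing of G(x + t z) with z; Cauchy-Schwarz concludes. No approximation of u by smooth
    functions is involved. *)
Lemma sobolev_segment : {ae mu, forall x, (`|u (x + z) - u x|%:E <=
  \int[nu]_(t in `[0%R, 1%R]) (enorm (G (x + t *: z)) * enorm z)%:E)%E}.
Proof.
(* The cut-off to a cube makes the integrand integrable on the product; the fundamental lemma is
   local, so nothing is lost. *)
pose L n (xt : 'rV[RR]_N * RR) := \1_`[0, 1] xt.2 * (dG (xt.1 + xt.2 *: z) * \1_(cube n) xt.1).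
have mC n := @measurable_cube R N n.
have iL n : (mu \x nu)%E.-integrable setT (EFin \o L n).
  apply: (slab_shift_integrable z mdG _ idG _ (M := 1) (m := n)).1.
    exact: measurable_indic.
  by move=> x; rewrite mul1r indicE normr_nat.
pose F n x := (\int[nu]_t (L n (x, t))%:E)%E.
have iF n : mu.-integrable setT (EFin \o (fine \o F n)).
  have h := integrable_fubini_F (iL n).
  apply: le_integrable h => //.
    apply/measurable_EFinP; apply: measurableT_comp; first exact: fine_measurable.
    exact: measurable_fubini_F (iL n).
  move=> x _; exact: abse_fine_le.
have mF n : measurable_fun [set: 'rV[RR]_N] (fine \o F n).
  by apply/measurable_EFinP; exact: measurable_int (iF n).
have ms := shift_measurable z.
have mUz : measurable_fun [set: 'rV[RR]_N] (fun x => u (x + z)).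
  exact: (measurableT_comp mU ms).
have iUz n : mu.-integrable (cube n) (EFin \o (fun x => u (x + z))).
  apply: integrable_powR_bounded p1 mUz (mC n) (cube_lty _) _.
  have [_ _ iup _ _] := so.
  apply: (@shift_integrable _ _ z (fun x => `|u x| `^ p)) => //.
  by apply: (measurableT_comp (measurable_powR p)); exact: measurableT_comp.
pose g n (x : 'rV[RR]_N) := u (x + z) - u x - fine (F n x).
have mg n : measurable_fun [set: 'rV[RR]_N] (g n).
  exact: (measurable_funB (measurable_funB mUz mU) (mF n)).
have ig n : mu.-integrable (cube n) (EFin \o g n).
  have h1 : mu.-integrable (cube n) (EFin \o (fun x => u (x + z) - u x)).
    exact: (integrableB (mC n) (iUz n) (iU n)).
  exact: (integrableB (mC n) h1 (integrableS measurableT (mC n) (@subsetT _ _) (iF n))).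
have H n : {ae mu, forall x, cube n x -> g n x = 0}.
  apply: (@fundamental_lemma_borel R N (g n) (mg n) _ _ (ig n)) => a b k sub.
  set phi := box_bump a b k.
  have tphi : test_function phi by exact: box_bump_test.
  have mphi := test_function_measurable tphi.
  have i1 : mu.-integrable setT (EFin \o (fun x => u (x + z) * phi x)) by exact: integrable_mul_test.
  have i2 : mu.-integrable setT (EFin \o (fun x => u x * phi x)) by exact: integrable_mul_test.
  have i3 : mu.-integrable setT (EFin \o (fun x => fine (F n x) * phi x)).
    apply: (integrable_mul_test (mF n)) => // m.
    exact: (integrableS measurableT (@measurable_cube R N m) (@subsetT _ _) (iF n)).
  have phi0 x : ~ cube n x -> phi x = 0.
    by move=> nx; apply: box_bump_out => h; apply: nx; exact: sub.
  have E3 : (\int[mu]_x (fine (F n x) * phi x)%:E = \int[mu]_x (u x * (phi (x - z) - phi x))%:E)%E.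
    rewrite bump_difference -/phi; apply: ae_eq_integral => //.
    - exact: measurable_int i3.
    - have [M' [m' bM']] := test_function_bounded tphi.
      exact: measurable_fubini_F (slab_shift_integrable z mdG mphi idG bM').1.
    - apply: filterS (ae_integrable1 (iL n)) => x iLx _ /=.
      have [xn|nx] := pselect (cube n x); last first.
        rewrite (phi0 _ nx) mulr0; under eq_integral do rewrite mulr0 mulr0.
        by rewrite integral0.
      have -> : (\int[nu]_t (\1_`[0%R, 1%R] t * (dG (x + t *: z) * phi x))%:E =
                 \int[nu]_t ((EFin \o (fun t => L n (x, t))) t * (phi x)%:E))%E.
        apply: eq_integral => t _; rewrite -EFinM; congr (_%:E).
        by rewrite /L /= [\1_(cube n) x]indicE mem_set// mulr1 mulrA.
      rewrite integralZr//.
      rewrite EFinM fineK//; exact: (integrable_fin_num measurableT iLx).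
  have E1 : (\int[mu]_x (u (x + z)%R * phi x)%:E = \int[mu]_x (u x * phi (x - z))%:E)%E.
    have m3 : measurable_fun [set: 'rV[RR]_N] (fun x => u x * phi (x - z)).
      apply: measurable_funM => //; exact: (measurableT_comp mphi (shift_measurable _)).
    by rewrite -(shift_integral z m3); apply: eq_integral => x _; rewrite addrK.
  have i4 : mu.-integrable setT (EFin \o (fun x => u x * phi (x - z))).
    apply: (integrable_mul_test mU iU (phi := fun x => phi (x - z))).
    by rewrite box_bump_translate; exact: box_bump_test.
  have E4 : (\int[mu]_x (u x * (phi (x - z) - phi x))%:E =
     \int[mu]_x (u (x + z)%R * phi x)%:E - \int[mu]_x (u x * phi x)%:E)%E.
    rewrite E1 -integralB_EFin//; apply: eq_integral => x _.
    by rewrite -EFinB mulrBr.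
  under eq_integral do rewrite /g mulrBl mulrBl EFinB.
  have i12 : mu.-integrable setT (EFin \o (fun x => u (x + z) * phi x - u x * phi x)).
    exact: (integrableB measurableT i1 i2).
  have := integralB_EFin measurableT i12 i3.
  move=> -> ; have := integralB_EFin measurableT i1 i2.
  move=> e; rewrite [X in (X - _)%E]e E3 E4 subee// fin_numB.
  by rewrite !(integrable_fin_num measurableT).
have := @ae_foralln _ _ _ mu _ H; apply: filterS => x hx.
have [n _ xn] : (\bigcup_n cube n) x by rewrite cube_cover.
have /eqP := hx n xn; rewrite /g subr_eq0 => /eqP ->.
apply: (@le_trans _ _ `|F n x|%E); first exact: abse_fine_le.
have mr : measurable_fun [set: RR] (fun t : RR => L n (x, t)).
  have /measurable_EFinP mL := measurable_int _ (iL n).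
  exact: (measurableT_comp mL (measurable_pair1 x)).
apply: le_trans (le_abse_integral nu measurableT _) _; first exact/measurable_EFinP.
rewrite [leRHS]integral_mkcond; apply: ge0_le_integral => //.
- by apply/measurable_EFinP; exact: measurableT_comp.
- have m01 : measurable (`[0, 1]%classic : set RR) by exact: measurable_itv.
  apply/(measurable_restrictT _ m01); apply: measurable_funTS.
  apply/measurable_EFinP; apply: measurable_funM => //; apply: measurable_enorm.
  apply: (measurableT_comp mG).
  exact: (measurableT_comp (measurable_ray z) (measurable_pair1 x)).
- move=> t _; rewrite patchE /L /=; case: ifPn => [t01|/negbTE nt].
    by rewrite indicE t01 mul1r indicE mem_set// mulr1 lee_fin norm_dot_le.
  by rewrite [X in `|X * _|]indicE nt mul0r normr0.
Qed.

End direction.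
End segment_inequality.

(** * Averaging segment integrals over a ball *)

Section radial_kernel.
Context {R : realType} {N : nat}.
Local Notation RR := (measurableTypeR R).
Local Notation mu := (borel_lebesgue_rV R N).
Local Notation nu := (@lebesgue_measure R).

Lemma integral_powN_itv (s : R) : (0 < N)%N -> 0 < s < 1 ->
  (\int[nu]_(t in `[s, 1%R]) (t ^- N.+1)%:E <= (s ^- N / N%:R)%:E)%E.
Proof.
move=> N0 /andP[s0 s1].
have Np : 0 < N%:R :> R by rewrite ltr0n.
pose F (t : R) := - (t^-1 ^+ N / N%:R).
have dF (t : R) : 0 < t -> is_derive t 1 F (t ^- N.+1).
  move=> t0; have tn : t != 0 by rewrite gt_eqF.
  have dV : is_derive t 1 (fun y : R => y^-1) (- t ^- 2 *: 1) by exact: is_deriveV.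
  have dX := is_deriveX N dV.
  have dZ := is_deriveZ (- N%:R^-1) dX.
  rewrite (_ : F = - N%:R^-1 \*: (fun y : R => y^-1) ^+ N); last first.
    apply/funext => y; change (- (y^-1 ^+ N / N%:R) = - N%:R^-1 * ((fun y : R => y^-1) ^+ N) y).
    by rewrite fctE mulNr mulrC.
  apply: (is_derive_eq dZ).
  rewrite /GRing.scale /=; case: N N0 Np {F dX dZ} => // n _ Np.
  by rewrite exprVn !exprS /=; field; rewrite tn expf_neq0//= natr1 gt_eqF.
have cg : {within `[s, 1], continuous (fun t : R => t ^- N.+1)}.
  apply: continuous_in_subspaceT => t; rewrite inE/= in_itv/= => /andP[st _].
  have tn : t != 0 by rewrite gt_eqF// (lt_le_trans s0).
  apply: cvgV; first by rewrite expf_neq0.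
  exact: exprn_continuous.
have cF (t : R) : 0 < t -> {for t, continuous F}.
  move=> t0; apply: differentiable_continuous; apply/derivable1_diffP.
  by have [] := dF t t0.
have h1 : derivable_oo_LRcontinuous F s 1.
  split.
  - move=> t; rewrite in_itv/= => /andP[st _].
    by have [] := dF t (lt_trans s0 st).
  - exact: cvg_at_right_filter (cF _ s0).
  - exact: cvg_at_left_filter (cF _ ltr01).
rewrite (continuous_FTC2 s1 cg h1); last first.
  move=> t; rewrite in_itv/= => /andP[st _].
  by rewrite derive1E; have [] := dF t (lt_trans s0 st).
rewrite -EFinB lee_fin /F opprK addrC exprVn lerBlDr lerDl.
by rewrite invr1 expr1n mul1r invr_ge0 ltW.
Qed.

Variables (rho : R) (g : 'rV[RR]_N -> R).
Hypotheses (rho0 : 0 < rho) (N0 : (0 < N)%N).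
Hypotheses (mg : measurable_fun [set: 'rV[RR]_N] g) (g0 : forall x, 0 <= g x).
Local Notation B := (eball 0 rho : set 'rV[RR]_N).

Let A : set ('rV[RR]_N * RR) := [set wt | enorm wt.1 < wt.2 * rho].

Let mA : measurable A.
Proof.
rewrite -[A]setTI; apply: (@measurable_lte _ ('rV[RR]_N * RR)%type R setT measurableT
  (fun wt => (enorm wt.1)%:E) (fun wt => (wt.2 * rho)%:E)).
  by apply/measurable_EFinP; apply: measurable_enorm; exact: measurable_fst.
by apply/measurable_EFinP; apply: measurable_funM => //; exact: measurable_snd.
Qed.

Let memA w t : ((w, t) \in A) = (enorm w < t * rho).
Proof. by apply/idP/idP; rewrite inE. Qed.

(** The integrand after w = t z: dz is t^-N dw, |z| is |w|/t, and |z| < rho becomes |w| < t rho.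
    Hence the exponent -(N+1). *)
Let K (w : 'rV[RR]_N) (t : RR) : R :=
  \1_`]0, 1] t * (\1_A (w, t) * (t `^ (- N.+1%:R) * (g w * enorm w))).

Let indic_ge0 T (E : set T) x : 0 <= \1_E x :> R.
Proof. by rewrite indicE ler0n. Qed.

Let K_ge0 w t : 0 <= K w t.
Proof. by rewrite /K !mulr_ge0 ?enorm_ge0 ?powR_ge0. Qed.

Lemma mem_eball0 r (x : 'rV[R]_N) : (x \in eball 0 r) = (enorm x < r).
Proof. by apply/idP/idP; rewrite inE /eball /= subr0. Qed.

(** Only t between |w|/rho and 1 contributes, and the integral of t^-(N+1) there is at most
    (rho/|w|)^N / N. Multiplied by |w|, this produces the kernel |w|^(1-N). *)
Let integral_K w :
  (\int[nu]_t (K w t)%:E <= (rho ^+ N / N%:R * (\1_B w * (g w * enorm w `^ (1 - N%:R))))%:E)%E.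
Proof.
have Np : 0 < N%:R :> R by rewrite ltr0n.
have rhs0 : 0 <= rho ^+ N / N%:R * (\1_B w * (g w * enorm w `^ (1 - N%:R))).
  by rewrite !mulr_ge0 ?invr_ge0 ?exprn_ge0 ?powR_ge0 ?(ltW rho0) ?(ltW Np).
have [w0|wn0] := eqVneq (enorm w) 0.
  rewrite (_ : (fun t => _) = cst 0%E) ?integral0 ?lee_fin//.
  by apply/funext => t; rewrite /K w0 !mulr0.
have w0 : 0 < enorm w by rewrite lt_neqAle eq_sym wn0 enorm_ge0.
have KE t : K w t = if (0 < t) && (t <= 1) && (enorm w < t * rho) then
    (g w * enorm w) * t ^- N.+1 else 0.
  rewrite /K !indicE memA mem_setE /= in_itv /=.
  case: (boolP (0 < t)) => t0 /=; last by rewrite mul0r.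
  case: (t <= 1) => /=; last by rewrite mul0r.
  case: (enorm w < t * rho); last by rewrite mul0r mulr0.
  by rewrite !mul1r powR_invn ?ltW// mulrC.
have [wr|rw] := ltP (enorm w) rho; last first.
  rewrite (_ : (fun t => _) = cst 0%E) ?integral0 ?lee_fin//.
  apply/funext => t; rewrite KE; case: ifPn => // /andP[/andP[t0 t1]].
  by rewrite ltNge (le_trans _ rw)// ler_piMl// ltW.
pose s := enorm w / rho.
have s01 : 0 < s < 1 by rewrite divr_gt0//= ltr_pdivrMr// mul1r.
have m1 : measurable (`[s, 1]%classic : set RR) by exact: measurable_itv.
apply: (@le_trans _ _ ((g w * enorm w)%:E * \int[nu]_(t in `[s, 1%R]) (t ^- N.+1)%:E)%E); last first.
  apply: (@le_trans _ _ ((g w * enorm w)%:E * (s ^- N / N%:R)%:E)%E).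
    rewrite lee_wpmul2l ?lee_fin ?mulr_ge0 ?enorm_ge0//.
    exact: integral_powN_itv.
  rewrite -EFinM lee_fin indicE mem_eball0 wr mul1r.
  rewrite powRD ?wn0 ?implybT// powRr1 ?enorm_ge0// powR_invn ?enorm_ge0//.
  by rewrite /s expr_div_n invf_div le_eqVlt; apply/orP; left; apply/eqP; ring.
have itE : (\int[nu]_(t in `[s, 1%R]) (t ^- N.+1)%:E = \int[nu]_(t in `[s, 1%R]) (t `^ (- N.+1%:R))%:E)%E.
  apply: eq_integral => t; rewrite inE/= in_itv/= => /andP[st _].
  by rewrite powR_invn// (le_trans _ st)// ltW//; have /andP[] := s01.
have mp : measurable_fun `[s, 1]%classic (fun t : RR => (t `^ (- N.+1%:R))%:E).
  apply/measurable_EFinP; apply: measurable_funTS; exact: measurable_powR.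
rewrite itE -ge0_integralZl_EFin//; last 2 first.
- by move=> t _; rewrite lee_fin powR_ge0.
- by rewrite mulr_ge0 ?enorm_ge0.
rewrite [leRHS]integral_mkcond; apply: ge0_le_integral => //.
- by move=> t _; rewrite lee_fin.
- apply/measurable_EFinP; apply: measurable_funM => //.
  apply: measurable_funM; last by apply: measurable_funM => //; exact: measurable_powR.
  apply: (@measurableT_comp _ _ _ _ _ _ (\1_A : _ -> R)); first exact: measurable_indic.
  exact: measurable_pair1.
- by apply/(measurable_restrictT _ m1); exact: measurable_funeM.
- move=> t _; rewrite KE patchE; case: ifPn => [/andP[/andP[t0 t1] wt]|_].
    have ts : t \in (`[s, 1]%classic : set RR) by rewrite inE/= in_itv/= t1 andbT ler_pdivrMr// ltW.
    by rewrite ts powR_invn// ltW.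
  by case: ifPn => // _; rewrite -EFinM lee_fin !mulr_ge0 ?enorm_ge0 ?powR_ge0.
Qed.

(** Tonelli, the dilation w = t z for each fixed t, Tonelli again, then [integral_K]. Excluding t =
    0 makes every dilation invertible. *)
Lemma radial_kernel :
  (\int[mu]_z ((\1_B z)%:E * \int[nu]_(t in `]0%R, 1%R]) (g (t *: (z : 'rV[R]_N)) * enorm z)%:E) <=
   (rho ^+ N / N%:R)%:E * \int[mu]_w (\1_B w * (g w * enorm w `^ (1 - N%:R)))%:E)%E.
Proof.
have mB : measurable B by exact: measurable_eball.
have m01 : measurable (`]0, 1]%classic : set RR) by exact: measurable_itv.
have mscale : measurable_fun [set: 'rV[RR]_N * RR] (fun zt : 'rV[RR]_N * RR => zt.2 *: zt.1 : 'rV[RR]_N).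
  apply: measurable_fun_rV => i; under eq_fun do rewrite mxE.
  apply: measurable_funM; first exact: measurable_snd.
  exact: (measurableT_comp (@measurable_rV_coord _ RR N i) measurable_fst).
have mz : measurable_fun [set: 'rV[RR]_N * RR] (fun zt : 'rV[RR]_N * RR => enorm zt.1).
  by apply: measurable_enorm; exact: measurable_fst.
pose H (zt : 'rV[RR]_N * RR) : R := \1_B zt.1 * (\1_`]0, 1] zt.2 * (g (zt.2 *: zt.1) * enorm zt.1)).
have mB1 : measurable_fun [set: 'rV[RR]_N * RR] (fun zt : 'rV[RR]_N * RR => \1_B zt.1 : R).
  by apply: (@measurableT_comp _ _ _ _ _ _ (\1_B : _ -> R)) => //; exact: measurable_indic.
have m012 : measurable_fun [set: 'rV[RR]_N * RR] (fun zt : 'rV[RR]_N * RR => \1_`]0, 1] zt.2 : R).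
  by apply: (@measurableT_comp _ _ _ _ _ _ (\1_`]0, 1] : RR -> R)) => //; exact: measurable_indic.
have mH : measurable_fun [set: 'rV[RR]_N * RR] H.
  by apply: measurable_funM => //; apply: measurable_funM => //; apply: measurable_funM => //; exact: measurableT_comp.
have H0 zt : 0 <= H zt by rewrite !mulr_ge0 ?enorm_ge0.
have mK : measurable_fun [set: 'rV[RR]_N * RR] (fun wt => K wt.1 wt.2).
  apply: measurable_funM => //; apply: measurable_funM.
    by rewrite (_ : (fun _ => _) = \1_A); [exact: measurable_indic|apply/funext => -[]].
  apply: measurable_funM; first exact: (measurableT_comp (measurable_powR _) measurable_snd).
  by apply: measurable_funM => //; exact: (measurableT_comp mg measurable_fst).
have E1 : (\int[mu]_z ((\1_B z)%:E * \int[nu]_(t in `]0%R, 1%R]) (g (t *: (z : 'rV[R]_N)) * enorm z)%:E) =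
    \int[mu]_z \int[nu]_t (H (z, t))%:E)%E.
  apply: eq_integral => z _; rewrite integral_mkcond -ge0_integralZl_EFin//.
  - apply: eq_integral => t _; rewrite patchE /H /= [\1_`]0, 1] t]indicE.
    by case: (t \in _); rewrite ?mul1r -?EFinM ?mul0r ?mulr0 // mule0.
  - by move=> t _; rewrite patchE; case: ifP => // _; rewrite lee_fin mulr_ge0 ?enorm_ge0.
  - apply/(measurable_restrictT _ m01); apply: measurable_funTS; apply/measurable_EFinP.
    apply: measurable_funM => //; apply: (measurableT_comp mg).
    exact: (measurableT_comp mscale (measurable_pair1 z)).
rewrite E1 (@fubini_tonelli _ _ _ _ _ mu nu (EFin \o H)); last 2 first.
- exact/measurable_EFinP.
- by move=> x; rewrite lee_fin.
have E2 : (\int[nu]_t \int[mu]_z (EFin \o H) (z, t) = \int[nu]_t \int[mu]_w (K w t)%:E)%E.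
  apply: eq_integral => t _.
  have [t01|nt] := boolP (t \in (`]0, 1]%classic : set RR)); last first.
    by congr integral; apply/funext => z; rewrite /= /H /K /= [\1_`]0, 1] t]indicE (negbTE nt) !mul0r ?mulr0.
  move: (t01); rewrite inE/= in_itv/= => /andP[t0 t1].
  pose f (w : 'rV[RR]_N) := (\1_A (w, t) * (g w * (t^-1 * enorm w)))%:E.
  have mf : measurable_fun [set: 'rV[RR]_N] f.
    apply/measurable_EFinP; apply: measurable_funM.
      apply: (@measurableT_comp _ _ _ _ _ _ (\1_A : _ -> R)); first exact: measurable_indic.
      exact: measurable_pair2.
    by apply: measurable_funM => //; apply: measurable_funM => //; exact: measurable_enorm.
  have f0 w : (0 <= f w)%E by rewrite lee_fin !mulr_ge0 ?enorm_ge0 ?invr_ge0 ?(ltW t0).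
  have tE (z : 'rV[R]_N) : enorm (t *: z) = t * enorm z by rewrite enormZ gtr0_norm.
  transitivity (\int[mu]_z f ((t *: (z : 'rV[R]_N) + 0)%R : 'rV[RR]_N))%E.
    apply: eq_integral => z _; rewrite addr0 /f /= /H /= [\1_`]0, 1] t]indicE t01 mul1r tE mulKf ?gt_eqF//.
    congr (_ * _)%:E; rewrite !indicE mem_eball0; by rewrite memA tE ltr_pM2l.
  rewrite (@affine_integral R N t 0 f t0 mf f0) -ge0_integralZl_EFin// ?invr_ge0 ?exprn_ge0 ?(ltW t0)//.
  apply: eq_integral => w _; rewrite -EFinM; congr (_%:E); rewrite /K [\1_`]0, 1] t]indicE t01 mul1r.
  by rewrite powR_invn ?ltW// exprS invfM; ring.
rewrite E2 -(@fubini_tonelli _ _ _ _ _ mu nu (fun wt => (K wt.1 wt.2)%:E)); last 2 first.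
- exact/measurable_EFinP.
- by move=> x; rewrite lee_fin.
have mr : measurable_fun [set: 'rV[RR]_N] (fun w => (\1_B w * (g w * enorm w `^ (1 - N%:R)))%:E).
  apply/measurable_EFinP; apply: measurable_funM; first exact: measurable_indic.
  by apply: measurable_funM => //; apply: measurable_enorm_powR.
rewrite -ge0_integralZl_EFin; first last.
- by rewrite mulr_ge0 ?exprn_ge0 ?invr_ge0 ?(ltW rho0).
- exact: mr.
- by move=> w _; rewrite lee_fin !mulr_ge0 ?powR_ge0.
- exact: measurableT.
apply: ge0_le_integral; first exact: measurableT.
- by move=> w _; apply: integral_ge0 => t _; rewrite lee_fin.
- apply: (@measurable_fun_fubini_tonelli_F _ _ 'rV[RR]_N RR R nu (fun wt => (K wt.1 wt.2)%:E)).
  + exact/measurable_EFinP.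
  + by move=> x; rewrite lee_fin.
- exact: measurable_funeM.
- by move=> w _; rewrite -EFinM; exact: integral_K.
Qed.

End radial_kernel.

(** * Morrey's estimate on a ball *)

Section morrey.
Context {R : realType} {N : nat}.
Local Notation RR := (measurableTypeR R).
Local Notation mu := (borel_lebesgue_rV R N).
Local Notation nu := (@lebesgue_measure R).
Local Notation omega := (unit_ball_volume (R := R) (N := N)).

Lemma ae_imply (P Q : 'rV[RR]_N -> Prop) : (forall x, P x -> Q x) ->
  {ae mu, forall x, P x} -> {ae mu, forall x, Q x}.
Proof. by move=> PQ; apply: filterS. Qed.

Lemma hoelder_le (p : R) (g h : 'rV[RR]_N -> R) (I J : R) : 1 < p ->
  measurable_fun [set: 'rV[RR]_N] g -> (forall x, 0 <= g x) ->
  measurable_fun [set: 'rV[RR]_N] h -> (forall x, 0 <= h x) ->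
  (\int[mu]_x (g x `^ p)%:E <= I%:E)%E ->
  (\int[mu]_x (h x `^ (p / (p - 1)))%:E <= J%:E)%E ->
  (\int[mu]_w (h w * g w)%:E <= (I `^ p^-1 * J `^ ((p - 1) / p))%:E)%E.
Proof.
move=> p1 mg g0 mh h0 gI hJ.
have p0 : 0 < p by exact: lt_trans p1.
have p10 : 0 < p - 1 by rewrite subr_gt0.
pose q := p / (p - 1); have q0 : 0 < q by rewrite divr_gt0.
have pq : p^-1 + q^-1 = 1 by rewrite /q invf_div; field; rewrite gt_eqF.
have -> : (p - 1) / p = q^-1 by rewrite /q invf_div.
have := hoelder mu mg mh p0 q0 pq; rewrite Lnorm1 => H.
apply: (@le_trans _ _ ('N[mu]_p%:E[EFin \o g] * 'N[mu]_q%:E[EFin \o h])%E).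
  apply: le_trans H; rewrite le_eqVlt; apply/orP; left; apply/eqP; apply: eq_integral => w _ /=.
  by rewrite (ger0_norm (mulr_ge0 (g0 w) (h0 w))) mulrC.
have Lle (r : R) (f : 'rV[RR]_N -> R) (K : R) : 0 < r -> (forall x, 0 <= f x) ->
    (\int[mu]_x (f x `^ r)%:E <= K%:E)%E -> ('N[mu]_r%:E[EFin \o f] <= (K `^ r^-1)%:E)%E.
  move=> r0 f0 fK; rewrite unlock (_ : integral _ _ _ = \int[mu]_w (f w `^ r)%:E)%E; last first.
    by apply: eq_integral => w _; rewrite /= ger0_norm.
  have i0 : (0 <= \int[mu]_w (f w `^ r)%:E)%E.
    by apply: integral_ge0 => w _; rewrite lee_fin powR_ge0.
  rewrite -poweR_EFin; apply: gt0_ler_poweR => //; first by rewrite invr_ge0 ltW.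
    by rewrite in_itv/= leey i0.
  by rewrite in_itv/= leey (le_trans i0).
by rewrite [leRHS]EFinM; apply: lee_pmul; rewrite ?Lnorm_ge0//; exact: Lle.
Qed.

Lemma hoelder_ball (p rho : R) (g : 'rV[RR]_N -> R) (I : R) : (0 < N)%N -> N%:R < p -> 0 < rho ->
  measurable_fun [set: 'rV[RR]_N] g -> (forall x, 0 <= g x) ->
  (\int[mu]_x (g x `^ p)%:E <= I%:E)%E ->
  (\int[mu]_w (\1_(eball 0 rho : set 'rV[RR]_N) w * (g w * enorm w `^ (1 - N%:R)))%:E <=
   (I `^ p^-1 * (omega * N%:R / (N%:R - (N%:R - 1) * (p / (p - 1))) *
     (rho ^+ N * rho `^ (- ((N%:R - 1) * (p / (p - 1)))))) `^ ((p - 1) / p))%:E)%E.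
Proof.
move=> N0 Np rho0 mg g0 gI.
have N1 : 1 <= N%:R :> R by rewrite ler1n.
have p1 : 1 < p by exact: le_lt_trans Np.
have p10 : 0 < p - 1 by rewrite subr_gt0.
pose q := p / (p - 1); have q0 : 0 < q by rewrite divr_gt0// (lt_trans _ p1).
pose b := (N%:R - 1) * q.
have b0 : 0 <= b by rewrite mulr_ge0 ?subr_ge0 ?(ltW q0).
(* This is where p > N enters: it is equivalent to (N-1) p/(p-1) < N, the condition for the dual
   power of the kernel to be integrable at 0. *)
have bN : b < N%:R by rewrite /b /q mulrA ltr_pdivrMr//; nra.
pose B := (eball 0 rho : set 'rV[RR]_N).
have mB : measurable B by exact: measurable_eball.
pose h (w : 'rV[RR]_N) : R := \1_B w * enorm w `^ (1 - N%:R).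
have mh : measurable_fun [set: 'rV[RR]_N] h.
  apply: measurable_funM; first exact: measurable_indic.
  exact: (measurable_enorm_powR _ (@measurable_id _ _ setT)).
have h0 w : 0 <= h w by rewrite mulr_ge0 ?powR_ge0// indicE ler0n.
apply: le_trans (hoelder_le p1 mg g0 mh h0 gI _).
  rewrite le_eqVlt; apply/orP; left; apply/eqP; apply: eq_integral => w _.
  by rewrite /h; congr (_%:E); ring.
have -> : (\int[mu]_w (h w `^ q)%:E = \int[mu]_(w in B) (enorm w `^ (- b))%:E)%E.
  rewrite [RHS]integral_mkcond; apply: eq_integral => w _.
  rewrite patchE /h indicE; case: ifPn => _; last by rewrite mul0r powR0 ?gt_eqF.
  by rewrite mul1r -powRrM /b -mulNr opprB.
exact: integral_ball_powRN.
Qed.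

(** rho^N / N comes from [radial_kernel]; the other factor bounds the norm of |w|^(1-N) in
    L^(p/(p-1)) of the ball. *)
Definition morrey_const (p rho : R) : R :=
  rho ^+ N / N%:R * (omega * N%:R / (N%:R - (N%:R - 1) * (p / (p - 1))) *
     (rho ^+ N * rho `^ (- ((N%:R - 1) * (p / (p - 1)))))) `^ ((p - 1) / p).

Variables (p : R) (u : 'rV[RR]_N -> R) (G : 'rV[RR]_N -> 'rV[RR]_N).
Hypotheses (N0 : (0 < N)%N) (Np : N%:R < p) (so : sobolev p u G).

Let p1 : 1 <= p.
Proof. by rewrite (le_trans _ (ltW Np))// ler1n. Qed.

Let mU : measurable_fun [set: 'rV[RR]_N] u. Proof. by have [] := so. Qed.
Let mG : measurable_fun [set: 'rV[RR]_N] G. Proof. by have [] := so. Qed.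

Let S (xz : 'rV[RR]_N * 'rV[RR]_N) : \bar R :=
  (\int[nu]_t (\1_`]0%R, 1%R] t * (enorm (G (xz.1 + t *: (xz.2 : 'rV[R]_N))) * enorm xz.2))%:E)%E.

Let mS : measurable_fun [set: 'rV[RR]_N * 'rV[RR]_N] S.
Proof.
apply: (@measurable_fun_fubini_tonelli_F _ _ ('rV[RR]_N * 'rV[RR]_N)%type RR R nu
  (fun y => (\1_`]0%R, 1%R] y.2 * (enorm (G (y.1.1 + y.2 *: (y.1.2 : 'rV[R]_N))) * enorm y.1.2))%:E)).
  apply/measurable_EFinP; apply: measurable_funM.
    apply: (@measurableT_comp _ _ _ _ _ _ (\1_`]0, 1] : RR -> R)); last exact: measurable_snd.
    exact: measurable_indic.
  have m11 : measurable_fun [set: ('rV[RR]_N * 'rV[RR]_N) * RR] (fun y : ('rV[RR]_N * 'rV[RR]_N) * RR => y.1.1).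
    exact: (measurableT_comp measurable_fst measurable_fst).
  have m12 : measurable_fun [set: ('rV[RR]_N * 'rV[RR]_N) * RR] (fun y : ('rV[RR]_N * 'rV[RR]_N) * RR => y.1.2).
    exact: (measurableT_comp measurable_snd measurable_fst).
  apply: measurable_funM; last exact: measurable_enorm.
  apply: measurable_enorm; apply: (measurableT_comp mG).
  apply: measurable_fun_rV => i; under eq_fun do rewrite !mxE.
  apply: measurable_funD; first exact: (measurableT_comp (@measurable_rV_coord _ RR N i) m11).
  apply: measurable_funM; first exact: measurable_snd.
  exact: (measurableT_comp (@measurable_rV_coord _ RR N i) m12).
by move=> y; rewrite lee_fin !mulr_ge0 ?enorm_ge0// indicE ler0n.
Qed.

Let S_ge0 xz : (0 <= S xz)%E.
Proof.
by apply: integral_ge0 => t _; rewrite lee_fin !mulr_ge0 ?enorm_ge0// indicE ler0n.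
Qed.

Let mshift : measurable_fun [set: 'rV[RR]_N * 'rV[RR]_N]
  (fun xz : 'rV[RR]_N * 'rV[RR]_N => u ((xz.1 : 'rV[R]_N) + xz.2)).
Proof.
apply: (measurableT_comp mU); apply: measurable_fun_rV => i; under eq_fun do rewrite !mxE.
apply: measurable_funD; first exact: (measurableT_comp (@measurable_rV_coord _ RR N i) measurable_fst).
exact: (measurableT_comp (@measurable_rV_coord _ RR N i) measurable_snd).
Qed.

Let D (xz : 'rV[RR]_N * 'rV[RR]_N) : \bar R := `|u ((xz.1 : 'rV[R]_N) + xz.2) - u xz.1|%:E.

Let mD : measurable_fun [set: 'rV[RR]_N * 'rV[RR]_N] D.
Proof.
apply/measurable_EFinP; apply: measurableT_comp => //; apply: measurable_funB => //.
exact: (measurableT_comp mU measurable_fst).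
Qed.

(** [sobolev_segment] has an exceptional set of x for each z. The set of bad pairs is measurable and
    has null sections in x, so by Tonelli almost every section in z is null as well. *)
Let segment_bound : {ae mu, forall x, {ae mu, forall z, (D (x, z) <= S (x, z))%E}}.
Proof.
pose bad : set ('rV[RR]_N * 'rV[RR]_N) := [set xz | (S xz < D xz)%E].
have mbad : measurable bad.
  by rewrite -[bad]setTI; exact: (measurable_lte measurableT mS mD).
pose f (xz : 'rV[RR]_N * 'rV[RR]_N) : \bar R := (\1_bad xz)%:E.
have mf : measurable_fun [set: 'rV[RR]_N * 'rV[RR]_N] f by apply/measurable_EFinP; exact: measurable_indic.
have f0 xz : (0 <= f xz)%E by rewrite lee_fin indicE ler0n.
have zsec z : (\int[mu]_x f (x, z) = 0)%E.
  rewrite -(@integral0 _ _ R mu setT); apply: ae_eq_integral => //.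
    exact: (measurableT_comp mf (measurable_pair2 z)).
  apply: ae_imply (sobolev_segment p1 so z) => x h _.
  rewrite /f indicE memNset//; apply/negP; rewrite -leNgt.
  apply: le_trans h _; rewrite le_eqVlt; apply/orP; left; apply/eqP.
  rewrite -integral_itv_obnd_cbnd; last first.
    apply: measurable_funTS; apply/measurable_EFinP; apply: measurable_funM => //.
    apply: measurable_enorm; apply: (measurableT_comp mG).
    exact: (measurableT_comp (measurable_ray z) (measurable_pair1 x)).
  rewrite integral_mkcond; apply: eq_integral => t _; rewrite patchE indicE.
  by case: (t \in _); rewrite ?mul1r ?mul0r.
have := @fubini_tonelli _ _ _ _ _ mu mu f mf f0.
under [X in _ = X -> _]eq_integral do rewrite zsec.
rewrite integral0 => E.
have mF : measurable_fun [set: 'rV[RR]_N] (fun x => \int[mu]_z f (x, z))%E.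
  exact: (@measurable_fun_fubini_tonelli_F _ _ 'rV[RR]_N 'rV[RR]_N R mu f).
have := (@ae_eq_integral_abs _ _ R mu setT measurableT _ mF).1.
have -> : (\int[mu]_x `|\int[mu]_z f (x, z)| = 0)%E.
  rewrite -[RHS]E; apply: eq_integral => x _; rewrite gee0_abs//.
  by apply: integral_ge0 => z _.
move=> /(_ erefl); apply: filterS => x /(_ I) fx.
have mfx : measurable_fun [set: 'rV[RR]_N] (fun z => f (x, z)).
  exact: (measurableT_comp mf (measurable_pair1 x)).
have := (@ae_eq_integral_abs _ _ R mu setT measurableT _ mfx).1.
have -> : (\int[mu]_z `|f (x, z)| = 0)%E.
  by rewrite -[RHS]fx; apply: eq_integral => z _; rewrite gee0_abs.
move=> /(_ erefl); apply: filterS => z /(_ I) /eqP.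
rewrite /f eqe indicE pnatr_eq0 eqb0 notin_setE /bad /= => /negP.
by rewrite -leNgt.
Qed.

Lemma morrey (rho : R) : 0 < rho ->
  {ae mu, forall x, (\int[mu]_(z in eball 0 rho) `|u ((x : 'rV[R]_N) + z) - u x|%:E <=
    (morrey_const p rho * (\int[mu]_y (enorm (G y) `^ p)) `^ p^-1)%:E)%E}.
Proof.
move=> rho0; apply: filterS segment_bound => x hx.
pose B := (eball 0 rho : set 'rV[RR]_N).
have mB : measurable B by exact: measurable_eball.
have mbx : measurable_fun [set: 'rV[RR]_N] (fun z : 'rV[RR]_N => (\1_B z)%:E : \bar R).
  by apply/measurable_EFinP; exact: measurable_indic.
have Dx0 z : (0 <= D (x, z))%E by rewrite lee_fin.
have B0 z : (0 <= (\1_B z)%:E :> \bar R)%E by rewrite lee_fin indicE ler0n.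
apply: (@le_trans _ _ (\int[mu]_z ((\1_B z)%:E * S (x, z)))%E).
  rewrite integral_mkcond; apply: ae_ge0_le_integral => //.
  - by move=> z _; rewrite patchE; case: ifP.
  - apply/(measurable_restrictT _ mB); apply: measurable_funTS.
    exact: (measurableT_comp mD (measurable_pair1 x)).
  - by move=> z _; exact: mule_ge0.
  - apply: emeasurable_funM => //; exact: (measurableT_comp mS (measurable_pair1 x)).
  - apply: filterS hx => z hz _; rewrite patchE indicE.
    by case: (z \in B); rewrite ?mul1e ?mul0e.
pose g (w : 'rV[RR]_N) := enorm (G ((w : 'rV[R]_N) + x)).
have mg : measurable_fun [set: 'rV[RR]_N] g.
  apply: measurable_enorm; exact: (measurableT_comp mG (shift_measurable x)).
have g0 w : 0 <= g w by exact: enorm_ge0.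
have RK := radial_kernel rho0 N0 mg g0.
apply: le_trans (le_trans _ RK) _.
  rewrite le_eqVlt; apply/orP; left; apply/eqP; apply: eq_integral => z _.
  congr (_ * _)%E; rewrite integral_mkcond; apply: eq_integral => t _.
  rewrite patchE /g indicE addrC; by case: (t \in _); rewrite ?mul1r ?mul0r.
rewrite /morrey_const -mulrA [leRHS]EFinM lee_wpmul2l ?lee_fin ?mulr_ge0 ?invr_ge0 ?exprn_ge0 ?(ltW rho0)//.
rewrite mulrC; apply: hoelder_ball => //.
have [_ _ _ iG _] := so.
have mGp : measurable_fun [set: 'rV[RR]_N] (fun y => enorm (G y) `^ p) by exact: measurable_enorm_powR.
rewrite [leLHS](shift_integral x mGp) /Rintegral fineK//.
exact: (integrable_fin_num measurableT iG).
Qed.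

End morrey.

(** * The embedding with its constant *)

Section sup_bound.
Context {R : realType} {N : nat}.
Local Notation RR := (measurableTypeR R).
Local Notation mu := (borel_lebesgue_rV R N).
Local Notation omega := (unit_ball_volume (R := R) (N := N)).

(** Hoelder for two terms; the factor is attained at x = y and becomes the factor 2^((p-1)/p) of
    k_a. *)
Lemma powR_add_le (p x y : R) : 1 < p -> 0 <= x -> 0 <= y ->
  (x + y) `^ p <= 2 `^ (p - 1) * (x `^ p + y `^ p).
Proof.
move=> p1 x0 y0; have p0 : 0 < p by exact: lt_trans p1.
have p10 : 0 < p - 1 by rewrite subr_gt0.
have := @hoelder2 R x y 1 1 p (p / (p - 1)) x0 y0 ler01 ler01 p0 (divr_gt0 p0 p10).
have -> : p^-1 + (p / (p - 1))^-1 = 1 by rewrite invf_div; field; rewrite gt_eqF.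
move=> /(_ erefl); rewrite !mulr1 !powR1 => h.
have -> : 2 `^ (p - 1) * (x `^ p + y `^ p) = ((x `^ p + y `^ p) `^ p^-1 * 2 `^ (p / (p - 1))^-1) `^ p.
  rewrite powRM ?powR_ge0// -!powRrM mulVf ?gt_eqF// powRr1 ?addr_ge0 ?powR_ge0// mulrC.
  by congr (_ * 2 `^ _); rewrite invf_div; field; rewrite gt_eqF.
by rewrite ge0_ler_powR ?nnegrE ?addr_ge0 ?mulr_ge0 ?powR_ge0 ?(ltW p0).
Qed.

(** [W] is the volume of the ball and [C] its Morrey constant. After p-th powers the coefficients of
    U and g are 1/W and (C/W)^p; the last hypothesis is the balance that makes both terms multiples
    of g + am U. *)
Lemma sup_bound_algebra (p am U g W C t : R) : 1 < p -> 0 < am -> 0 <= U -> 0 <= g ->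
  0 < W -> 0 <= C -> 0 <= t -> t <= U `^ p^-1 * W `^ ((p - 1) / p) / W + C / W * g `^ p^-1 ->
  (C / W) `^ p = (am * W)^-1 ->
  t `^ p <= 2 `^ (p - 1) / (am * W) * (g + am * U).
Proof.
move=> p1 am0 U0 g0 W0 C0 t0 h MR.
have p0 : 0 < p by exact: lt_trans p1.
have pn : p != 0 by rewrite gt_eqF.
have X0 : 0 <= U `^ p^-1 * W `^ ((p - 1) / p) / W by rewrite !mulr_ge0 ?invr_ge0 ?powR_ge0 ?(ltW W0).
have CW0 : 0 <= C / W by rewrite divr_ge0// ltW.
have Y0 : 0 <= C / W * g `^ p^-1 by rewrite mulr_ge0// powR_ge0.
have Wi0 : 0 <= W^-1 by rewrite invr_ge0 ltW.
apply: (@le_trans _ _ ((U `^ p^-1 * W `^ ((p - 1) / p) / W + C / W * g `^ p^-1) `^ p)).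
  by rewrite ge0_ler_powR ?nnegrE ?addr_ge0 ?(ltW p0).
apply: le_trans (powR_add_le p1 X0 Y0) _.
have gE : (g `^ p^-1) `^ p = g by rewrite -powRrM mulVf// powRr1.
have UE : (U `^ p^-1) `^ p = U by rewrite -powRrM mulVf// powRr1.
have WE : (W `^ ((p - 1) / p)) `^ p = W `^ p / W.
  by rewrite -powRrM divfK// powRB ?powRr1 ?(ltW W0)// gt_eqF// implybT.
have WiE : (W^-1) `^ p = (W `^ p)^-1.
  by rewrite -powR_inv1 ?(ltW W0)// -powRrM mulN1r powRN.
rewrite (powRM _ CW0 (powR_ge0 _ _)) MR gE (powRM _ (mulr_ge0 (powR_ge0 _ _) (powR_ge0 _ _)) Wi0).
rewrite (powRM _ (powR_ge0 _ _) (powR_ge0 _ _)) UE WE WiE.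
have Wp0 : W `^ p != 0 by rewrite gt_eqF// powR_gt0.
rewrite le_eqVlt; apply/orP; left; apply/eqP; field.
by rewrite Wp0 !gt_eqF.
Qed.

(** An identity between products of real powers, hence a rational identity between logarithms; the
    hypothesis on ln r is the choice of radius that yields the balance. *)
Lemma morrey_ratio_algebra (p n om r am rN : R) : 0 < n -> 1 < p -> 0 < p - n -> 0 < om ->
  0 < r -> 0 < am -> 0 < rN -> ln rN = n * ln r ->
  ln r = (ln n + (p - 1) * (ln (p - n) - ln (p - 1)) - ln am) / p ->
  ((rN / n * (om * n / ((p - n) / (p - 1)) * (rN * r `^ (- ((n - 1) * (p / (p - 1)))))) `^
     ((p - 1) / p)) / (om * rN)) `^ p = (am * (om * rN))^-1.
Proof.
move=> n0 p1 pn om0 r0 am0 rN0 lrN lr.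
have p0 : 0 < p by exact: lt_trans p1.
have p10 : 0 < p - 1 by rewrite subr_gt0.
have lM (x y : R) : 0 < x -> 0 < y -> ln (x * y) = ln x + ln y by move=> *; rewrite lnM.
have lD (x y : R) : 0 < x -> 0 < y -> ln (x / y) = ln x - ln y.
  by move=> x0 y0; rewrite lM ?invr_gt0// lnV.
have e0 : 0 < (p - n) / (p - 1) by exact: divr_gt0.
have on0 : 0 < om * n by exact: mulr_gt0.
set A := om * n / _; have A0 : 0 < A by exact: divr_gt0.
have lA : ln A = ln om + ln n - (ln (p - n) - ln (p - 1)).
  by rewrite /A (lD _ _ on0 e0) (lM _ _ om0 n0) (lD _ _ pn p10).
clearbody A; set c := - (_ * _).
have rc0 : 0 < r `^ c by exact: powR_gt0.
have B0 : 0 < rN * r `^ c by exact: mulr_gt0.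
have lB : ln (rN * r `^ c) = n * ln r + c * ln r by rewrite (lM _ _ rN0 rc0) lrN ln_powR.
set B := rN * r `^ c in B0 lB *; clearbody B.
have AB0 : 0 < A * B by exact: mulr_gt0.
have Z0 : 0 < (A * B) `^ ((p - 1) / p) by exact: powR_gt0.
have lZ : ln ((A * B) `^ ((p - 1) / p)) = (p - 1) / p * (ln A + ln B).
  by rewrite ln_powR (lM _ _ A0 B0).
set Z := _ `^ _ in Z0 lZ *; clearbody Z.
have rn0 : 0 < rN / n by exact: divr_gt0.
have M0 : 0 < rN / n * Z by exact: mulr_gt0.
have W0 : 0 < om * rN by exact: mulr_gt0.
have Q0 : 0 < rN / n * Z / (om * rN) by exact: divr_gt0.
have aW0 : 0 < am * (om * rN) by exact: mulr_gt0.
apply: ln_inj; [by rewrite posrE powR_gt0|by rewrite posrE invr_gt0|].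
rewrite ln_powR (lnV aW0) (lD _ _ M0 W0) (lM _ _ rn0 Z0) (lD _ _ rN0 n0) (lM _ _ am0 W0) (lM _ _ om0 rN0).
rewrite lZ lA lB lrN lr /c; field.
by rewrite !gt_eqF.
Qed.

Variables (p : R).
Hypotheses (N0 : (0 < N)%N) (Np : N%:R < p).

Let p1 : 1 < p.
Proof. by rewrite (le_lt_trans _ Np)// ler1n. Qed.

Section one_function.
Variables (u : 'rV[RR]_N -> R) (G : 'rV[RR]_N -> 'rV[RR]_N).
Hypotheses (so : sobolev p u G).

Let mU : measurable_fun [set: 'rV[RR]_N] u. Proof. by have [] := so. Qed.
Let U := \int[mu]_x (`|u x| `^ p).

Lemma integral_ball_le (y : 'rV[R]_N) rho : 0 < rho ->
  (\int[mu]_(z in eball y rho) `|u z|%:E <=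
   (U `^ p^-1 * (omega * rho ^+ N) `^ ((p - 1) / p))%:E)%E.
Proof.
move=> rho0; pose B := (eball y rho : set 'rV[RR]_N).
have mB : measurable B by exact: measurable_eball.
have q0 : 0 < p / (p - 1) by rewrite divr_gt0 ?subr_gt0// (lt_trans _ p1).
have -> : (\int[mu]_(z in eball y rho) `|u z|%:E = \int[mu]_z (\1_B z * `|u z|)%:E)%E.
  rewrite integral_mkcond; apply: eq_integral => z _; rewrite patchE indicE.
  by case: (z \in B); rewrite ?mul1r ?mul0r.
have [_ _ iu _ _] := so.
apply: hoelder_le => //.
- exact: measurableT_comp.
- by rewrite /U /Rintegral fineK//; exact: (integrable_fin_num measurableT iu).
- have <- : mu B = (omega * rho ^+ N)%:E by exact: eball_volume.
  rewrite -[X in (_ <= mu X)%E]setIT -(@integral_indic _ _ _ mu setT measurableT B mB).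
  rewrite le_eqVlt; apply/orP; left; apply/eqP; apply: eq_integral => z _.
  rewrite indicE; case: (z \in B); first by rewrite powR1.
  by rewrite powR0// gt_eqF.
Qed.

Let g := \int[mu]_x (enorm (G x) `^ p).

(** Integrate |u(x)| <= |u(x + z)| + |u(x + z) - u(x)| over z in the ball: Hoelder bounds the first
    term, Morrey the second. *)
Lemma sup_bound_radius rho : 0 < rho ->
  {ae mu, forall x, omega * rho ^+ N * `|u x| <=
     U `^ p^-1 * (omega * rho ^+ N) `^ ((p - 1) / p) + @morrey_const R N p rho * g `^ p^-1}.
Proof.
move=> rho0; apply: ae_imply (morrey N0 Np so rho0) => x hx.
pose B := (eball 0 rho : set 'rV[RR]_N).
have mB : measurable B by exact: measurable_eball.
have Bx : (\int[mu]_(z in B) `|u ((z : 'rV[R]_N) + x)|%:E = \int[mu]_(z in eball x rho) `|u z|%:E)%E.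
  rewrite integral_mkcond [RHS]integral_mkcond.
  rewrite -(@shift_ge0_integral _ _ x ((fun z => `|u z|%:E) \_ (eball x rho))).
  - apply: eq_integral => z _; rewrite !patchE; congr (if _ then _ else _).
    by apply/idP/idP; rewrite !inE /B /eball /= subr0 addrK.
  - have mBx : measurable (eball x rho : set 'rV[RR]_N) by exact: measurable_eball.
    apply/(measurable_restrictT _ mBx); apply: measurable_funTS; apply/measurable_EFinP.
    exact: measurableT_comp.
  - by move=> z; rewrite patchE; case: ifP => // _; rewrite lee_fin.
have H : (\int[mu]_(z in B) `|u x|%:E <=
   \int[mu]_(z in B) (`|u ((z : 'rV[R]_N) + x)|%:E + `|u ((x : 'rV[R]_N) + z) - u x|%:E))%E.
  have ms : measurable_fun [set: 'rV[RR]_N] (fun z : 'rV[RR]_N => u ((z : 'rV[R]_N) + x)).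
    exact: (measurableT_comp mU (shift_measurable x)).
  apply: ge0_le_integral => //.
  - apply: measurable_funTS; apply/measurable_EFinP; apply: measurable_funD.
      exact: measurableT_comp.
    apply: measurableT_comp => //; apply: measurable_funB => //.
    by under eq_fun do rewrite addrC; exact: ms.
  - move=> z _; rewrite -EFinD lee_fin addrC [x + z]addrC.
    rewrite -{1}(subKr (u ((z : 'rV[R]_N) + x)) (u x)) (le_trans (ler_normB _ _))// addrC.
    by rewrite lerD.
rewrite integral_cst//= [mu B]eball_volume// ge0_integralD// in H; last 2 first.
- apply: measurable_funTS; apply/measurable_EFinP; apply: measurableT_comp => //.
  exact: (measurableT_comp mU (shift_measurable x)).
- apply: measurable_funTS; apply/measurable_EFinP; apply: measurableT_comp => //.
  apply: measurable_funB => //; under eq_fun do rewrite addrC.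
  exact: (measurableT_comp mU (shift_measurable x)).
rewrite -lee_fin mulrC EFinM; apply: le_trans H _; rewrite EFinD; apply: leeD => //.
by rewrite Bx; exact: integral_ball_le.
Qed.

Variable am : R.
Hypothesis am0 : 0 < am.

(* The radius for which the gradient term and the function term of the averaged Morrey bound combine into a
   multiple of the energy; [sup_const] is then the constant k_a^p of the statement. *)
Definition sup_radius : R := (N%:R * ((p - N%:R) / (p - 1)) `^ (p - 1) / am) `^ p^-1.

Definition sup_const : R := 2 `^ (p - 1) / (omega * am * sup_radius ^+ N).

Let pN0 : 0 < p - N%:R. Proof. by rewrite subr_gt0. Qed.
Let p10 : 0 < p - 1. Proof. by rewrite subr_gt0. Qed.
Let p0 : 0 < p. Proof. exact: lt_trans p1. Qed.
Let n0 : 0 < N%:R :> R. Proof. by rewrite ltr0n. Qed.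
Let om0 : 0 < omega. Proof. exact: unit_ball_volume_gt0. Qed.

Lemma sup_radius_gt0 : 0 < sup_radius.
Proof. by rewrite powR_gt0// !mulr_gt0 ?invr_gt0 ?powR_gt0 ?divr_gt0. Qed.

Lemma sup_const_gt0 : 0 < sup_const.
Proof.
by rewrite divr_gt0 ?powR_gt0 ?ltr0n// !mulr_gt0 ?exprn_gt0 ?sup_radius_gt0.
Qed.

Lemma ln_sup_radius : ln sup_radius =
  (ln N%:R + (p - 1) * (ln (p - N%:R) - ln (p - 1)) - ln am) / p.
Proof.
rewrite /sup_radius ln_powR mulrC lnM ?posrE ?invr_gt0 ?mulr_gt0 ?powR_gt0 ?divr_gt0//.
rewrite lnV ?posrE// lnM ?posrE ?powR_gt0 ?divr_gt0// ln_powR lnM ?posrE ?invr_gt0//.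
by rewrite lnV ?posrE.
Qed.

Let morrey_ratio : (@morrey_const R N p sup_radius / (omega * sup_radius ^+ N)) `^ p =
  (am * (omega * sup_radius ^+ N))^-1.
Proof.
have r0 := sup_radius_gt0.
have E : N%:R - (N%:R - 1) * (p / (p - 1)) = (p - N%:R) / (p - 1) by field; rewrite gt_eqF.
rewrite /morrey_const E; apply: morrey_ratio_algebra => //; first exact: exprn_gt0.
  by rewrite lnXn// mulr_natl.
exact: ln_sup_radius.
Qed.

Lemma sup_bound : {ae mu, forall x, `|u x| `^ p <= sup_const * (g + am * U)}.
Proof.
have r0 := sup_radius_gt0.
apply: ae_imply (sup_bound_radius r0) => x.
set W := omega * sup_radius ^+ N; set C := morrey_const _ _ => h.
have W0 : 0 < W by rewrite mulr_gt0 ?exprn_gt0.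
have U0 : 0 <= U by apply: Rintegral_ge0 => y _; rewrite powR_ge0.
have g0 : 0 <= g by apply: Rintegral_ge0 => y _; rewrite powR_ge0.
have C0 : 0 <= C.
  have e0 : 0 <= N%:R - (N%:R - 1) * (p / (p - 1)).
    have -> : N%:R - (N%:R - 1) * (p / (p - 1)) = (p - N%:R) / (p - 1) by field; rewrite gt_eqF.
    by rewrite divr_ge0 ?ltW.
  by rewrite /C /morrey_const mulr_ge0 ?powR_ge0// mulr_ge0 ?exprn_ge0 ?invr_ge0 ?(ltW r0) ?(ltW n0).
have {}h : `|u x| <= U `^ p^-1 * W `^ ((p - 1) / p) / W + C / W * g `^ p^-1.
  rewrite -(ler_pM2l W0); apply: le_trans h _; rewrite mulrDr lerD//.
    by rewrite [leRHS]mulrC divfK// gt_eqF.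
  by rewrite mulrA [W * _]mulrC divfK// gt_eqF.
have MR : (C / W) `^ p = (am * W)^-1 by exact: morrey_ratio.
have -> : sup_const = 2 `^ (p - 1) / (am * W).
  by rewrite /sup_const /W mulrA [am * omega]mulrC.
clearbody W C.
exact: (sup_bound_algebra p1 am0 U0 g0 W0 C0 (normr_ge0 _) h MR).
Qed.

End one_function.
End sup_bound.

(** * Almost everywhere compactness *)

Section ae_compactness.
Context {R : realType} {N : nat}.
Local Notation RR := (measurableTypeR R).
Local Notation mu := (borel_lebesgue_rV R N).
Local Notation omega := (unit_ball_volume (R := R) (N := N)).

(** Tychonoff gives a cluster point L of the sequence n -> a(., n) in a product of segments;
    choosing an index at least n whose first n+1 coordinates are within 1/(n+1) of L gives
    convergence of each coordinate. [phi] tends to infinity but need not increase. *)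
Lemma diagonal_extraction (a : nat -> nat -> R) (b : nat -> R) :
  (forall j n, `|a j n| <= b j) ->
  exists phi : nat -> nat, (forall n, (n <= phi n)%N) /\
    forall j, cvgn (fun n => a j (phi n)).
Proof.
move=> ab.
have cK := @tychonoff nat (fun=> R) (fun j => `[- b j, b j]%classic)
  (fun j => @segment_compact R (- b j) (b j)).
pose F := (fun n => (fun j => a j n) : forall j : nat, R) @ \oo.
have FK : F [set f | forall j, `[- b j, b j]%classic (f j)].
  by exists 0%N => // n _ j /=; rewrite in_itv/= -ler_norml.
have [L [_ cL]] := cK F _ FK.
have H n : exists m, (n <= m)%N /\ forall j, (j <= n)%N -> `|a j m - L j| < n.+1%:R^-1.
  have FA : F [set f | exists2 m, (n <= m)%N & f = (fun j => a j m)].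
    by exists n => // m /= nm; exists m.
  have nB : nbhs L [set f : forall j : nat, R | forall i : 'I_n.+1, `|f i - L i| < n.+1%:R^-1].
    apply: (filter_forall (F := nbhs L)) => i.
    have := @proj_continuous nat (fun=> R) i L.
    move=> /(_ [set y | `|y - L i| < n.+1%:R^-1]); apply.
    apply/nbhs_normP; exists n.+1%:R^-1 => /=; first by rewrite invr_gt0.
    by move=> y /=; rewrite distrC.
  have [f [[m nm ->] hf]] := cL _ _ FA nB.
  by exists m; split => // j jn; exact: (hf (Ordinal (jn : (j < n.+1)%N))).
have [phi hphi] := choice H.
exists phi; split=> [n|j]; first by have [] := hphi n.
apply/cvg_ex; exists (L j); apply/cvgrPdist_lt => /= e e0.
near=> n.
have [_ /(_ j)] := hphi n; rewrite distrC => h; apply: lt_le_trans (h _) _.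
  by near: n; exact: nbhs_infty_ge.
rewrite invf_ple ?posrE// (le_trans (ltW (truncnS_gt _)))// ler_nat ltnS.
by near: n; exact: nbhs_infty_ge.
Unshelve. all: by end_near. Qed.

Variables (p : R).
Hypotheses (N0 : (0 < N)%N) (Np : N%:R < p).

Let p1 : 1 < p.
Proof. by rewrite (le_lt_trans _ Np)// ler1n. Qed.
Let n0 : 0 < N%:R :> R. Proof. by rewrite ltr0n. Qed.
Let om0 : 0 < omega. Proof. exact: unit_ball_volume_gt0. Qed.

Lemma sobolev_ball_integrable u G (y : 'rV[R]_N) (q : R) : 0 < q -> sobolev p u G ->
  mu.-integrable (eball y q) (EFin \o u).
Proof.
move=> q0 [mU _ iU _ _]; apply: integrable_powR_bounded (ltW p1) mU _ _ iU.
  exact: measurable_eball.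
by rewrite eball_volume// ltry.
Qed.

(** The ball of radius q about y lies in the ball of radius 2q about x, so Morrey at x compares u(x)
    with an integral over a ball whose centre can be taken in a countable set. *)
Lemma ball_mean_dist u G (x y : 'rV[R]_N) (q : R) : 0 < q -> sobolev p u G ->
  enorm (x - y) < q ->
  (\int[mu]_(z in eball 0 (q + q)%R) `|u ((x : 'rV[R]_N) + z) - u x|%:E <=
    (@morrey_const R N p (q + q) * (\int[mu]_z (enorm (G z) `^ p)) `^ p^-1)%:E)%E ->
  `|omega * q ^+ N * u x - \int[mu]_(z in eball y q) u z| <=
    @morrey_const R N p (q + q) * (\int[mu]_z (enorm (G z) `^ p)) `^ p^-1.
Proof.
move=> q0 so xy h; have [mU _ _ _ _] := so.
have iB := sobolev_ball_integrable y q0 so.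
have mB : measurable (eball y q : set 'rV[RR]_N) by exact: measurable_eball.
have mB2 : measurable (eball x (q + q) : set 'rV[RR]_N) by exact: measurable_eball.
have mB0 : measurable (eball 0 (q + q) : set 'rV[RR]_N) by exact: measurable_eball.
have muB : mu (eball y q) = (omega * q ^+ N)%:E by exact: eball_volume.
have iC : mu.-integrable (eball y q) (EFin \o cst (u x)).
  apply/integrableP; split; first by apply/measurable_EFinP; exact: measurable_cst.
  have h0 := @integral_cst _ _ R mu (eball y q) mB `|u x|%:E.
  apply: (@le_lt_trans _ _ (`|u x|%:E * mu (eball y q))%E); first by rewrite -h0.
  by rewrite muB ltry.
have -> : omega * q ^+ N * u x = \int[mu]_(z in eball y q) u x.
  have h0 := Rintegral_cst mu mB (u x).
  rewrite [RHS]h0 [LHS]mulrC; exact: (congr1 (fun t => u x * t) (esym (congr1 fine muB))).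
rewrite -RintegralB//.
have iD : mu.-integrable (eball y q) (EFin \o (fun z => u x - u z)) by exact: (integrableB mB iC iB).
apply: le_trans (le_normr_Rintegral mB iD) _.
have mD : measurable_fun [set: 'rV[RR]_N] (fun z => `|u x - u z|).
  by apply: measurableT_comp => //; exact: measurable_funB.
rewrite -lee_fin /Rintegral fineK; last exact: (integrable_fin_num mB (integrable_norm iD)).
apply: le_trans h.
apply: (@le_trans _ _ (\int[mu]_(z in eball x (q + q)%R) `|u x - u z|%:E)%E).
  apply: ge0_subset_integral => //.
    by apply: measurable_funTS; exact/measurable_EFinP.
  move=> z; rewrite /eball /= => zy.
  have -> : z - x = (z - y) - (x - y) by rewrite opprB addrA subrK.
  by rewrite (le_lt_trans (ler_enormB _ _))// ltrD.
rewrite le_eqVlt; apply/orP; left; apply/eqP.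
rewrite integral_mkcond [RHS]integral_mkcond.
rewrite -(@shift_ge0_integral _ _ x ((fun z => `|u x - u z|%:E) \_ (eball x (q + q)))).
- apply: eq_integral => z _; rewrite !patchE [z + x]addrC distrC.
  have -> : ((x + z : 'rV[R]_N) \in (eball x (q + q) : set 'rV[RR]_N)) =
            ((z : 'rV[R]_N) \in (eball 0 (q + q) : set 'rV[RR]_N)) => //.
  by apply/idP/idP; rewrite !inE /eball /= subr0 addrAC subrr add0r.
- by apply/(measurable_restrictT _ mB2); apply: measurable_funTS; exact/measurable_EFinP.
- by move=> z; rewrite patchE; case: ifP => // _; rewrite lee_fin.
Qed.

(** Relative to the volume q^N, the Morrey constant is a multiple of q^((p-N)/p), which tends to 0
    because p > N. *)
Lemma morrey_const_small (K e : R) : 0 <= K -> 0 < e -> exists2 q0 : R, 0 < q0 &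
  forall q, 0 < q -> q <= q0 -> @morrey_const R N p (q + q) * K < e * (omega * q ^+ N).
Proof.
move=> K0 e0.
have p10 : 0 < p - 1 by rewrite subr_gt0.
have p0 : 0 < p by exact: lt_trans p1.
have pN0 : 0 < p - N%:R by rewrite subr_gt0.
have E : N%:R - (N%:R - 1) * (p / (p - 1)) = (p - N%:R) / (p - 1) by field; rewrite gt_eqF.
pose A := omega * N%:R / ((p - N%:R) / (p - 1)).
have A0 : 0 < A by apply: divr_gt0; [exact: mulr_gt0|exact: divr_gt0].
pose s := (p - N%:R) / p; have s0 : 0 < s by rewrite divr_gt0.
pose B := 2 ^+ N / N%:R * (A `^ ((p - 1) / p) * 2 `^ s) * K + 1.
have B0 : 0 < B.
  by rewrite ltr_wpDl// !mulr_ge0 ?invr_ge0 ?powR_ge0 ?exprn_ge0 ?(ltW n0).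
have cE q : 0 < q -> @morrey_const R N p (q + q) * K = (q ^+ N * q `^ s) * (B - 1).
  move=> q0; rewrite /morrey_const E -/A /B addrK (_ : q + q = 2 * q); last by ring.
  have Q0 : 0 < 2 * q by rewrite mulr_gt0.
  have Qn : 2 * q != 0 by rewrite gt_eqF.
  rewrite -powR_mulrn ?(ltW Q0)// -powRD; last by rewrite Qn implybT.
  rewrite powRM ?powR_ge0 ?(ltW A0)// -powRrM.
  have -> : (N%:R + - ((N%:R - 1) * (p / (p - 1)))) * ((p - 1) / p) = s.
    by rewrite E /s; field; rewrite !gt_eqF.
  rewrite powR_mulrn ?(ltW Q0)// exprMn [(2 * q) `^ s]powRM ?(ltW q0)//.
  by move: (2 ^+ N) (q ^+ N) => c1 c2; ring.
exists ((e * omega / B) `^ s^-1); first by rewrite powR_gt0// divr_gt0// mulr_gt0.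
move=> q q0 qle; rewrite cE//.
have qs : q `^ s <= e * omega / B.
  have -> : e * omega / B = ((e * omega / B) `^ s^-1) `^ s.
    by rewrite -powRrM mulVf ?gt_eqF// powRr1// divr_ge0 ?mulr_ge0 ?(ltW e0) ?(ltW om0) ?(ltW B0).
  by rewrite ge0_ler_powR ?nnegrE ?powR_ge0 ?(ltW s0) ?(ltW q0).
have qn : 0 < q ^+ N by rewrite exprn_gt0.
have -> : e * (omega * q ^+ N) = q ^+ N * (e * omega) by ring.
rewrite -mulrA ltr_pM2l//.
apply: (@lt_le_trans _ _ (q `^ s * B)); last by rewrite -ler_pdivlMr.
by rewrite ltr_pM2l ?powR_gt0// ltrBlDr ltrDl.
Qed.

(** Takes the place of a compact embedding. Along a subsequence the integrals over countably many
    balls all converge; at almost every x, Morrey approximates u_n(x) by such an average uniformly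
    in n, so the values form a Cauchy sequence. *)
Lemma sobolev_ae_compact (un : nat -> 'rV[RR]_N -> R) (Gn : nat -> 'rV[RR]_N -> 'rV[RR]_N) (M : R) :
  (forall n, sobolev p (un n) (Gn n)) ->
  (forall n, \int[mu]_x (`|un n x| `^ p) <= M) ->
  (forall n, \int[mu]_x (enorm (Gn n x) `^ p) <= M) ->
  exists phi u, [/\ (forall n, (n <= phi n)%N), measurable_fun [set: 'rV[RR]_N] u &
    {ae mu, forall x, (fun n => un (phi n) x) @ \oo --> (u x : R)}].
Proof.
move=> so uM GM.
have p0 : 0 < p by exact: lt_trans p1.
have ip0 : 0 <= p^-1 by rewrite invr_ge0 ltW.
have U0 n : 0 <= \int[mu]_x (`|un n x| `^ p) by apply: Rintegral_ge0 => x _; rewrite powR_ge0.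
have G0 n : 0 <= \int[mu]_x (enorm (Gn n x) `^ p) by apply: Rintegral_ge0 => x _; rewrite powR_ge0.
have M0 : 0 <= M by exact: le_trans (U0 0%N) (uM 0%N).
(* Rounding coordinates down to multiples of 1/(k+1) moves a point by at most N/(k+1), which is less
   than this radius. *)
pose q k : R := N.+1%:R / k.+1%:R.
have q0 k : 0 < q k by rewrite divr_gt0 ?ltr0n.
pose y k (v : 'rV[int]_N) : 'rV[R]_N := \row_i ((v ord0 i)%:~R / k.+1%:R).
pose a j n := if unpickle j is Some kv then
    \int[mu]_(z in eball (y kv.1 kv.2) (q kv.1)) un n z else 0.
pose b j := if unpickle j is Some kv then
    M `^ p^-1 * (omega * q (kv : nat * 'rV[int]_N).1 ^+ N) `^ ((p - 1) / p) else 0.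
have ab j n : `|a j n| <= b j.
  rewrite /a /b; case: (unpickle j) => [[k v]|]; last by rewrite normr0.
  have iB := sobolev_ball_integrable (y k v) (q0 k) (so n).
  have mB : measurable (eball (y k v) (q k) : set 'rV[RR]_N) by exact: measurable_eball.
  apply: le_trans (le_normr_Rintegral mB iB) _.
  rewrite -lee_fin /Rintegral fineK; last exact: (integrable_fin_num mB (integrable_norm iB)).
  apply: le_trans (integral_ball_le N0 Np (so n) _ (q0 k)) _.
  rewrite lee_fin ler_wpM2r ?powR_ge0//.
  by rewrite ge0_ler_powR ?nnegrE.
have [phi [phile acvg]] := diagonal_extraction ab.
have bd : {ae mu, forall x, forall k n, (\int[mu]_(z in eball 0 (q k + q k)%R) `|un n ((x : 'rV[R]_N) + z) - un n x|%:E <=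
    (@morrey_const R N p (q k + q k) * (\int[mu]_z (enorm (Gn n z) `^ p)) `^ p^-1)%:E)%E}.
  apply: ae_foralln => k; apply: ae_foralln => n.
  by apply: (morrey N0 Np (so n)); rewrite addr_gt0.
have {}bd : {ae mu, forall x, cvgn (fun n => un (phi n) x)}.
  apply: ae_imply bd => x hx; apply: cauchy_cvg; apply: cauchy_exP => e e0.
  have [r r0 hr] := morrey_const_small (powR_ge0 M p^-1) (divr_gt0 e0 (ltr0n _ 3%N)).
  have [k kr] : exists k, q k <= r.
    exists (Num.truncn (N.+1%:R / r)); rewrite /q ler_pdivrMr ?ltr0n// mulrC -ler_pdivrMr//.
    by rewrite ltW// truncnS_gt.
  have {}hr := hr _ (q0 k) kr.
  pose W := omega * q k ^+ N; have W0 : 0 < W by rewrite mulr_gt0 ?exprn_gt0.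
  have k0 : 0 < k.+1%:R :> R by rewrite ltr0n.
  pose v : 'rV[int]_N := \row_i Num.floor (x ord0 i * k.+1%:R).
  have xy : enorm ((x : 'rV[R]_N) - y k v) < q k.
    apply: le_lt_trans (enorm_le_sum _) _.
    apply: (@le_lt_trans _ _ (\sum_(i < N) k.+1%:R^-1)); last first.
      by rewrite sumr_const card_ord -[X in X < _]mulr_natl ltr_pM2r ?invr_gt0// ltr_nat.
    apply: ler_sum => i _; rewrite !mxE.
    have fl := floor_le (x ord0 i * k.+1%:R); have fg := floorD1_gt (x ord0 i * k.+1%:R).
    rewrite ger0_norm; last by rewrite subr_ge0 ler_pdivrMr.
    rewrite lerBlDr -(ler_pM2r k0) mulrDl mulVf ?gt_eqF// divfK ?gt_eqF// addrC.
    by move: fg; rewrite intrD => /ltW.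
  have dist n : `|W * un n x - a (pickle (k, v)) n| < e / 3 * W.
    rewrite /a pickleK /=; apply: le_lt_trans (ball_mean_dist (q0 k) (so n) xy (hx k n)) _.
    apply: le_lt_trans hr; rewrite ler_wpM2l//; last by rewrite ge0_ler_powR ?nnegrE.
    have e1 : N%:R - (N%:R - 1) * (p / (p - 1)) = (p - N%:R) / (p - 1).
      by field; rewrite gt_eqF// subr_gt0.
    have qq : 0 <= q k + q k by rewrite ltW// addr_gt0.
    by rewrite /morrey_const mulr_ge0 ?powR_ge0// divr_ge0 ?exprn_ge0.
  have /cvg_ex[l al] := acvg (pickle (k, v)).
  have cauchya : exists n0, forall n, (n0 <= n)%N ->
      `|a (pickle (k, v)) (phi n0) - a (pickle (k, v)) (phi n)| < e / 3 * W.
    have e6 : 0 < e / 3 * W / 2 by apply: divr_gt0 => //; apply: mulr_gt0 => //; exact: divr_gt0.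
    move/cvgrPdist_lt : al => /(_ _ e6)[n1 _ hn1]; exists n1 => n n1n.
    have h1 := hn1 n1 (leqnn _); have h2 := hn1 n n1n.
    rewrite /= in h1 h2.
    have -> : a (pickle (k, v)) (phi n1) - a (pickle (k, v)) (phi n) =
       (l - a (pickle (k, v)) (phi n)) - (l - a (pickle (k, v)) (phi n1)) by ring.
    rewrite (le_lt_trans (ler_normB _ _))//; lra.
  have [n0' hn0] := cauchya.
  exists (un (phi n0') x); exists n0' => // n n0n /=; rewrite /ball /=.
  rewrite -(ltr_pM2l W0) -[X in X * `|_|](ger0_norm (ltW W0)) -normrM.
  have := hn0 n n0n; have := dist (phi n); have := dist (phi n0').
  set A := a _ _; set B := a _ _; set C := W * _; set D := W * _ => h1 h2 h3.
  rewrite mulrBr -/C -/D.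
  have -> : C - D = (C - A) + (A - B) - (D - B) by ring.
  rewrite (le_lt_trans (ler_normB _ _))// (le_lt_trans (lerD (ler_normD _ _) (lexx _)))//.
  lra.
have [N1 [mN1 N10 sub]] := bd.
pose v n x := un (phi n) x * \1_(~` N1) x.
have mv n : measurable_fun [set: 'rV[RR]_N] (v n).
  apply: measurable_funM; first by have [] := so (phi n).
  by apply: measurable_indic; exact: measurableC.
have cv x : cvgn (fun n => v n x).
  have [xN|xN] := pselect (N1 x).
    rewrite (_ : (fun n => v n x) = cst 0); first exact: is_cvg_cst.
    by apply/funext => n; rewrite /v indicE memNset ?mulr0//= => /(_ xN).
  rewrite (_ : (fun n => v n x) = fun n => un (phi n) x).
    by apply: contrapT => nc; apply: xN; exact: sub.
  by apply/funext => n; rewrite /v indicE mem_set ?mulr1.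
exists phi, (fun x => lim ((fun n => v n x) @ \oo)); split => //.
  apply: (@measurable_fun_cvg _ _ R setT v) => // x _; exact: cv.
exists N1; split => // x /=; apply: contra_notP => xN.
have := cv x; rewrite (_ : (fun n => v n x) = fun n => un (phi n) x) => [h|]; first exact: h.
by apply/funext => n; rewrite /v indicE mem_set ?mulr1.
Qed.

End ae_compactness.

(** * The energy *)

Lemma scale_convex_decomposition (R : realFieldType) (V : lmodType R) (w v : V) (al be : R) :
  0 < al -> 0 < be ->
  w + v = (al + be) *: ((al / (al + be)) *: (al^-1 *: w) + (be / (al + be)) *: (be^-1 *: v)).
Proof.
move=> al0 be0; rewrite scalerDr !scalerA; congr (_ + _).
  by rewrite -[LHS]scale1r; congr (_ *: _); field; rewrite !gt_eqF// addr_gt0.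
by rewrite -[LHS]scale1r; congr (_ *: _); field; rewrite !gt_eqF// addr_gt0.
Qed.

Lemma flux_algebra (R : realFieldType) (e X Y Z T : R) :
  X <= e / 2 * Y -> Z <= T -> T <= e / 2 * Y -> X + Z <= e * Y.
Proof. lra. Qed.

Lemma convex_algebra (R : realFieldType) (p A B X Y : R) :
  A + p * - X <= B -> A - B - p * Y <= p * (X - Y).
Proof. lra. Qed.

Section energy.
Context {R : realType} {N : nat}.
Local Notation RR := (measurableTypeR R).
Local Notation mu := (borel_lebesgue_rV R N).
Variables (p : R) (a : 'rV[RR]_N -> R) (am aM : R).
Hypotheses (p1 : 1 < p) (ma : measurable_fun [set: 'rV[RR]_N] a).
Hypotheses (am0 : 0 < am) (ama : forall x, am <= a x) (aaM : forall x, a x <= aM).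

(* W^{1,p} is handled as a set of pairs (function, weak gradient): such pairs form a left module on which
   the energy is defined everywhere, without choosing weak gradients. *)
Definition field_pair : Type := (('rV[RR]_N -> R^o) * ('rV[RR]_N -> 'rV[R]_N))%type.
HB.instance Definition _ := GRing.Lmodule.on field_pair.
Local Notation V := field_pair.
Implicit Types (w h v : V) (x : 'rV[RR]_N).

Let p0 : 0 < p. Proof. exact: lt_trans p1. Qed.
Let a0 x : 0 <= a x. Proof. exact: le_trans (ltW am0) (ama x). Qed.

Definition in_sobolev : set V := [set w | sobolev p w.1 w.2].
Local Notation W := in_sobolev.

(** Scalars as row vectors of length 1, so that the estimates on |z|^(p-2) z cover the zero-order
    term too. *)
Let sc (t : R) : 'rV[R]_1 := const_mx t.

Let dot_sc s t : dot (sc s) (sc t) = s * t.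
Proof. by rewrite /dot big_ord1 !mxE. Qed.

Let enorm_sc t : enorm (sc t) = `|t|.
Proof. by rewrite /enorm dot_sc -expr2 sqrtr_sqr. Qed.

Let scB s t : sc s - sc t = sc (s - t).
Proof. by apply/rowP => i; rewrite !mxE. Qed.

Let pflux_sc t : pflux p (sc t) = sc (`|t| `^ (p - 2) * t).
Proof. by apply/rowP => i; rewrite /pflux enorm_sc !mxE. Qed.

Definition energy_density w x := enorm (w.2 x) `^ p + a x * `|w.1 x| `^ p.
Definition flux_density w v x :=
  dot (pflux p (w.2 x)) (v.2 x) + a x * (`|w.1 x| `^ (p - 2) * w.1 x * v.1 x).
(** Majorant of the flux density, homogeneous of degree p-1 in w and 1 in v; homogeneity is what
    turns Young's inequality into Hoelder's. *)
Definition hoelder_density w v x :=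
  enorm (w.2 x) `^ (p - 1) * enorm (v.2 x) + a x * (`|w.1 x| `^ (p - 1) * `|v.1 x|).
Local Notation ed := energy_density.
Local Notation fl := flux_density.
Local Notation hd := hoelder_density.

Let flE w v x : fl w v x = dot (pflux p (w.2 x)) (v.2 x) +
  a x * dot (pflux p (sc (w.1 x))) (sc (v.1 x)).
Proof. by rewrite pflux_sc dot_sc. Qed.

Let edE w x : ed w x = enorm (w.2 x) `^ p + a x * enorm (sc (w.1 x)) `^ p.
Proof. by rewrite enorm_sc. Qed.

Lemma energy_density_ge0 w x : 0 <= ed w x.
Proof. by rewrite addr_ge0 ?powR_ge0// mulr_ge0 ?powR_ge0. Qed.

Lemma hoelder_density_ge0 w v x : 0 <= hd w v x.
Proof. by rewrite addr_ge0 ?mulr_ge0 ?powR_ge0 ?enorm_ge0. Qed.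

Lemma energy_densityZ t w x : ed (t *: w) x = `|t| `^ p * ed w x.
Proof.
by rewrite /ed /= enormZ normrM !powRM ?enorm_ge0// mulrDr mulrCA.
Qed.

Lemma young_hoelder_density w v x : p * hd w v x <= (p - 1) * ed w x + ed v x.
Proof.
have h1 := young_powR p1 (enorm_ge0 (w.2 x)) (enorm_ge0 (v.2 x)).
have h2 := ler_wpM2l (a0 x) (young_powR p1 (normr_ge0 (w.1 x)) (normr_ge0 (v.1 x))).
rewrite /hd /ed; move: (enorm _ `^ _ * _) (`|_| `^ _ * `|_|) h1 h2.
move: (enorm _ `^ p) (enorm _ `^ p) (`|_| `^ p) (`|_| `^ p) (a x).
by move=> A B C D E X Y; lra.
Qed.

Lemma flux_density_le w v x : `|fl w v x| <= hd w v x.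
Proof.
rewrite flE; apply: le_trans (ler_normD _ _) _; apply: lerD.
  by rewrite -enorm_pflux// norm_dot_le.
rewrite normrM (ger0_norm (a0 x)) ler_wpM2l//.
by apply: le_trans (norm_dot_le _ _) _; rewrite enorm_pflux// !enorm_sc.
Qed.

Lemma energy_density_convex w v x : ed w x + p * fl w (v - w) x <= ed v x.
Proof.
rewrite !edE flE /=.
have h1 := enorm_powR_convex p1 (w.2 x) (v.2 x).
have h2 := ler_wpM2l (a0 x) (enorm_powR_convex p1 (sc (w.1 x)) (sc (v.1 x))).
rewrite scB in h2.
move: (dot _ _) (dot _ _) (enorm _ `^ p) (enorm _ `^ p) (enorm _ `^ p) (enorm _ `^ p) (a x) h1 h2.
by move=> *; lra.
Qed.

Lemma flux_densityD w u v s t x : fl w (s *: u + t *: v) x = s * fl w u x + t * fl w v x.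
Proof.
rewrite /fl; have -> : (s *: u + t *: v).1 x = s * u.1 x + t * v.1 x by [].
have -> : (s *: u + t *: v).2 x = s *: u.2 x + t *: v.2 x by [].
by rewrite dotDr !dotZr; ring.
Qed.

Lemma flux_density_continuity (e : R) : 0 < e -> exists2 C, 0 <= C & forall w h v x,
  `|fl (w + h) v x - fl w v x| <= e * hd w v x + C * hd h v x.
Proof.
move=> e0.
have [C1 C10 H1] := @pflux_continuity R N p p1 e e0.
have [C2 C20 H2] := @pflux_continuity R 1 p p1 e e0.
exists (C1 + C2); first exact: addr_ge0.
move=> w h v x; rewrite !flE.
have -> (A B C D E : R) : A + E * B - (C + E * D) = (A - C) + E * (B - D) by ring.
rewrite -!dotBl; apply: le_trans (ler_normD _ _) _.
have h1 : `|dot (pflux p ((w + h).2 x) - pflux p (w.2 x)) (v.2 x)| <=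
    (e * enorm (w.2 x) `^ (p - 1) + C1 * enorm (h.2 x) `^ (p - 1)) * enorm (v.2 x).
  apply: le_trans (norm_dot_le _ _) _; apply: ler_wpM2r; first exact: enorm_ge0.
  rewrite enormB; apply: le_trans (H1 _ _) _; rewrite lerD2l//.
  by rewrite -enormN opprB /= -[(w.2 + h.2) x]/(w.2 x + h.2 x) addrAC subrr add0r.
have h2 : `|dot (pflux p (sc ((w + h).1 x)) - pflux p (sc (w.1 x))) (sc (v.1 x))| <=
    (e * `|w.1 x| `^ (p - 1) + C2 * `|h.1 x| `^ (p - 1)) * `|v.1 x|.
  apply: le_trans (norm_dot_le _ _) _; rewrite enorm_sc ler_wpM2r//.
  rewrite enormB; apply: le_trans (H2 _ _) _; rewrite scB !enorm_sc lerD2l//.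
  by rewrite -normrN opprB /= -[(w.1 + h.1) x]/(w.1 x + h.1 x) addrAC subrr add0r.
rewrite normrM (ger0_norm (a0 x)); have {h2} := ler_wpM2l (a0 x) h2.
have c1 : 0 <= C2 * (enorm (h.2 x) `^ (p - 1) * enorm (v.2 x)).
  by rewrite !mulr_ge0 ?powR_ge0 ?enorm_ge0.
have c2 : 0 <= C1 * (a x * (`|h.1 x| `^ (p - 1) * `|v.1 x|)).
  by rewrite !mulr_ge0 ?powR_ge0.
rewrite /hd.
move: h1 c1 c2; move: (`|dot _ _|) (`|dot _ _|) => X Y.
by nra.
Qed.

Lemma flux_density_monotone (e : R) : 0 < e -> exists2 C, 0 <= C & forall w v x,
  ed (w - v) x <= e * (ed w x + ed v x) + C * (fl w (w - v) x - fl v (w - v) x).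
Proof.
move=> e0.
have [C1 C10 H1] := @pflux_monotone R N p p1 e e0.
have [C2 C20 H2] := @pflux_monotone R 1 p p1 e e0.
exists (C1 + C2); first exact: addr_ge0.
move=> w v x; rewrite !flE !edE /=.
have h1 := H1 (w.2 x) (v.2 x); have h2 := ler_wpM2l (a0 x) (H2 (sc (w.1 x)) (sc (v.1 x))).
rewrite scB in h2.
have g1 := dot_pflux_sub_ge0 p1 (w.2 x) (v.2 x).
have g2 := dot_pflux_sub_ge0 p1 (sc (w.1 x)) (sc (v.1 x)).
rewrite scB in g2.
rewrite -[(w.2 - v.2) x]/(w.2 x - v.2 x) -[(w.1 - v.1) x]/(w.1 x - v.1 x).
rewrite !dotBl in h1 h2 g1 g2.
move: (dot _ _) (dot _ _) (dot _ _) (dot _ _) h1 h2 g1 g2 => D1 D2 D3 D4.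
move: (a x) (a0 x) (enorm _ `^ p) (enorm _ `^ p) (enorm _ `^ p) (enorm _ `^ p) (enorm _ `^ p) (enorm _ `^ p).
move=> A A0 X1 X2 X3 X4 X5 X6 h1 h2 g1 g2.
have k1 : 0 <= C2 * (D4 - D3) by exact: mulr_ge0.
have k2 : 0 <= C1 * (A * (D2 - D1)) by rewrite !mulr_ge0.
by lra.
Qed.

Lemma measurable_energy_density w : measurable_fun [set: 'rV[RR]_N] w.1 ->
  measurable_fun [set: 'rV[RR]_N] w.2 -> measurable_fun [set: 'rV[RR]_N] (ed w).
Proof.
move=> m1 m2; apply: measurable_funD; first exact: measurable_enorm_powR.
apply: measurable_funM => //; apply: (measurableT_comp (measurable_powR p)).
exact: measurableT_comp.
Qed.

Lemma measurable_hoelder_density w v : W w -> W v ->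
  measurable_fun [set: 'rV[RR]_N] (hd w v).
Proof.
move=> [mw1 mw2 _ _ _] [mv1 mv2 _ _ _]; apply: measurable_funD.
  by apply: measurable_funM; [exact: measurable_enorm_powR|exact: measurable_enorm].
apply: measurable_funM => //; apply: measurable_funM; last exact: measurableT_comp.
by apply: (measurableT_comp (measurable_powR _)); exact: measurableT_comp.
Qed.

Lemma measurable_flux_density w v : W w -> W v ->
  measurable_fun [set: 'rV[RR]_N] (fl w v).
Proof.
move=> [mw1 mw2 _ _ _] [mv1 mv2 _ _ _]; apply: measurable_funD.
  rewrite /pflux; under eq_fun do rewrite dotZl.
  by apply: measurable_funM; [exact: measurable_enorm_powR|exact: measurable_dot].
apply: measurable_funM => //; apply: measurable_funM => //; apply: measurable_funM => //.
by apply: (measurableT_comp (measurable_powR _)); exact: measurableT_comp.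
Qed.

Lemma energy_density_integrable w : W w -> mu.-integrable setT (EFin \o ed w).
Proof.
move=> [m1 m2 i1 i2 _].
have iS : mu.-integrable setT (EFin \o (fun x => enorm (w.2 x) `^ p + aM * `|w.1 x| `^ p)).
  apply: (@integrableD _ _ _ mu setT measurableT (EFin \o (fun x => enorm (w.2 x) `^ p))
    (EFin \o (fun x => aM * `|w.1 x| `^ p))) => //.
  exact: (@integrableZl _ _ _ mu setT measurableT aM (EFin \o (fun x => `|w.1 x| `^ p))).
apply: le_integrable iS => //.
  by apply/measurable_EFinP; exact: measurable_energy_density.
move=> x _; rewrite /= lee_fin ger0_norm ?energy_density_ge0//.
by rewrite (le_trans _ (ler_norm _))// /ed lerD2l ler_wpM2r ?powR_ge0.
Qed.

Lemma hoelder_density_integrable w v : W w -> W v -> mu.-integrable setT (EFin \o hd w v).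
Proof.
move=> Ww Wv.
have iS : mu.-integrable setT (fun x => p^-1%:E * (((p - 1)%:E * (EFin \o ed w) x) + (EFin \o ed v) x))%E.
  apply: integrableZl => //; apply: integrableD => //; last exact: energy_density_integrable.
  by apply: integrableZl => //; exact: energy_density_integrable.
apply: le_integrable iS => //.
  by apply/measurable_EFinP; exact: measurable_hoelder_density.
move=> x _; change ((`|hd w v x|%:E <= `|p^-1 * ((p - 1) * ed w x + ed v x)|%:E)%E).
rewrite lee_fin ger0_norm ?hoelder_density_ge0// (le_trans _ (ler_norm _))// ler_pdivlMl//.
exact: young_hoelder_density.
Qed.

Lemma flux_density_integrable w v : W w -> W v -> mu.-integrable setT (EFin \o fl w v).
Proof.
move=> Ww Wv; apply: le_integrable (hoelder_density_integrable Ww Wv) => //.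
  by apply/measurable_EFinP; exact: measurable_flux_density.
by move=> x _; rewrite /= lee_fin (ger0_norm (hoelder_density_ge0 _ _ _)) flux_density_le.
Qed.

Definition energy w := \int[mu]_x ed w x.
Definition flux w v := \int[mu]_x fl w v x.
Definition energy_norm w := energy w `^ p^-1.
Local Notation nrm := energy_norm.

Lemma energy_ge0 w : 0 <= energy w.
Proof. by apply: Rintegral_ge0 => x _; exact: energy_density_ge0. Qed.

Lemma energy_norm_ge0 w : 0 <= nrm w. Proof. exact: powR_ge0. Qed.

Lemma energy_norm_powR w : nrm w `^ p = energy w.
Proof. by rewrite -powRrM mulVf ?gt_eqF// powRr1// energy_ge0. Qed.

Lemma energy_norm_le w K : 0 <= K -> energy w <= K `^ p -> nrm w <= K.
Proof.
move=> K0 h; have -> : K = (K `^ p) `^ p^-1 by rewrite -powRrM mulfV ?gt_eqF// powRr1.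
by rewrite ge0_ler_powR ?nnegrE ?energy_ge0 ?powR_ge0 ?invr_ge0 ?(ltW p0).
Qed.

Lemma energyZ t w : W w -> energy (t *: w) = `|t| `^ p * energy w.
Proof.
move=> Ww; rewrite /energy; under eq_Rintegral do rewrite energy_densityZ.
by rewrite RintegralZl//; exact: energy_density_integrable.
Qed.

Lemma sobolevD w v : W w -> W v -> W (w + v).
Proof.
move=> Ww Wv; have [m1 m2 i1 i2 H1] := Ww; have [m1' m2' i1' i2' H2] := Wv.
have mD1 : measurable_fun [set: 'rV[RR]_N] (w + v).1 by exact: measurable_funD.
have mD2 : measurable_fun [set: 'rV[RR]_N] (w + v).2.
  apply: measurable_fun_rV => i.
  rewrite (_ : (fun x => _) = fun x => w.2 x ord0 i + v.2 x ord0 i); last first.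
    by apply/funext => x; rewrite -[(w + v).2 x]/(w.2 x + v.2 x) mxE.
  by apply: measurable_funD; exact: measurable_coord.
have pD (s t : R) : 0 <= s -> 0 <= t -> (s + t) `^ p <= 2 `^ (p - 1) * (s `^ p + t `^ p).
  exact: powR_add_le.
have iD (f g r : 'rV[RR]_N -> R) : measurable_fun [set: 'rV[RR]_N] r -> (forall x, 0 <= f x) -> (forall x, 0 <= g x) ->
    (forall x, 0 <= r x <= f x + g x) ->
    mu.-integrable setT (EFin \o (fun x => f x `^ p)) -> mu.-integrable setT (EFin \o (fun x => g x `^ p)) ->
    mu.-integrable setT (EFin \o (fun x => r x `^ p)).
  move=> mr f0 g0 rfg fi gi.
  have iS : mu.-integrable setT (fun x => (2 `^ (p - 1))%:E *
      ((EFin \o (fun x => f x `^ p)%R) x + (EFin \o (fun x => g x `^ p)%R) x))%E.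
    by apply: integrableZl => //; exact: integrableD.
  apply: le_integrable iS => //.
    by apply/measurable_EFinP; apply: (measurableT_comp (measurable_powR p)).
  move=> x _.
  change ((`|r x `^ p|%:E <= `|2 `^ (p - 1) * (f x `^ p + g x `^ p)|%:E)%E).
  rewrite lee_fin (ger0_norm (powR_ge0 _ _)).
  have /andP[r0 rle] := rfg x.
  rewrite (le_trans _ (ler_norm _))// (le_trans _ (pD _ _ (f0 x) (g0 x)))//.
  by rewrite ge0_ler_powR ?nnegrE ?addr_ge0 ?(ltW p0).
split; [exact: mD1|exact: mD2| | |].
- apply: (iD (fun x => `|w.1 x|) (fun x => `|v.1 x|)) => //; first exact: measurableT_comp.
  by move=> x; rewrite normr_ge0 ler_normD.
- apply: (iD (fun x => enorm (w.2 x)) (fun x => enorm (v.2 x))); last 2 first.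
  + exact: i2.
  + exact: i2'.
  + exact: measurable_enorm.
  + by move=> x; exact: enorm_ge0.
  + by move=> x; exact: enorm_ge0.
  + by move=> x; rewrite enorm_ge0 ler_enormD.
- move=> i phi tphi; have tp := test_function_partial i tphi.
  have [c1 c2] := sobolev_cube (ltW p1) Ww; have [c1' c2'] := sobolev_cube (ltW p1) Wv.
  rewrite (_ : (fun x => _) = fun x => w.1 x * partial i phi x + v.1 x * partial i phi x); last first.
    by apply/funext => x; rewrite -mulrDl.
  rewrite RintegralD//; try exact: integrable_mul_test.
  rewrite H1// H2// -opprD -RintegralD//; try (apply: integrable_mul_test => //; exact: measurable_coord).
  congr (- _); apply: eq_Rintegral => x _; rewrite -mulrDl.
  by rewrite -[(w + v).2 x]/(w.2 x + v.2 x) mxE.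
Qed.

Lemma sobolevZ t w : W w -> W (t *: w).
Proof.
move=> Ww; have [m1 m2 i1 i2 H1] := Ww.
have m1' : measurable_fun [set: 'rV[RR]_N] (t *: w).1 by exact: measurable_funM.
have m2' : measurable_fun [set: 'rV[RR]_N] (t *: w).2.
  apply: measurable_fun_rV => i.
  rewrite (_ : (fun x => _) = fun x => t * w.2 x ord0 i); last first.
    by apply/funext => x; rewrite -[(t *: w).2 x]/(t *: w.2 x) mxE.
  by apply: measurable_funM => //; exact: measurable_coord.
split; [exact: m1'|exact: m2'| | |].
- rewrite (_ : _ \o _ = fun x => (`|t| `^ p)%:E * (EFin \o (fun x => `|w.1 x| `^ p)%R) x)%E; last first.
    apply/funext => x; change ((`|t * w.1 x| `^ p)%:E = (`|t| `^ p * `|w.1 x| `^ p)%:E).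
    by rewrite normrM powRM.
  exact: integrableZl.
- rewrite (_ : _ \o _ = fun x => (`|t| `^ p)%:E * (EFin \o (fun x => enorm (w.2 x) `^ p)%R) x)%E; last first.
    apply/funext => x.
    change ((enorm (t *: w.2 x) `^ p)%:E = (`|t| `^ p * enorm (w.2 x) `^ p)%:E).
    by rewrite enormZ powRM ?enorm_ge0.
  exact: integrableZl.
- move=> i phi tphi; have tp := test_function_partial i tphi.
  have [c1 c2] := sobolev_cube (ltW p1) Ww.
  rewrite (_ : (fun x => _) = fun x => t * (w.1 x * partial i phi x)); last first.
    by apply/funext => x; rewrite mulrA.
  rewrite RintegralZl//; last exact: integrable_mul_test.
  rewrite H1// mulrN -RintegralZl//; last by apply: integrable_mul_test => //; exact: measurable_coord.
  congr (- _); apply: eq_Rintegral => x _.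
  by rewrite -[(t *: w).2 x]/(t *: w.2 x) mxE mulrA.
Qed.

Lemma sobolevB w v : W w -> W v -> W (w - v).
Proof. by move=> Ww Wv; rewrite -scaleN1r; apply: sobolevD => //; exact: sobolevZ. Qed.

(** Apply the gradient inequality at the combination z towards w and towards v; the two linear terms
    cancel, as s (w - z) + t (v - z) = 0. *)
Lemma energy_convex s t w v : 0 <= s -> 0 <= t -> s + t = 1 -> W w -> W v ->
  energy (s *: w + t *: v) <= s * energy w + t * energy v.
Proof.
move=> s0 t0 st Ww Wv; pose z := s *: w + t *: v.
have Wz : W z by apply: sobolevD; exact: sobolevZ.
rewrite -RintegralZl//; last exact: energy_density_integrable.
rewrite -RintegralZl//; last exact: energy_density_integrable.
have iw : mu.-integrable setT (EFin \o (fun x => s * ed w x)).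
  exact: (@integrableZl _ _ _ mu setT measurableT s _ (energy_density_integrable Ww)).
have iv : mu.-integrable setT (EFin \o (fun x => t * ed v x)).
  exact: (@integrableZl _ _ _ mu setT measurableT t _ (energy_density_integrable Wv)).
rewrite -RintegralD//; apply: le_Rintegral => //.
- exact: energy_density_integrable.
- exact: (@integrableD _ _ _ mu setT measurableT _ _ iw iv).
move=> x _.
have h1 := energy_density_convex z w x; have h2 := energy_density_convex z v x.
have : fl z (s *: (w - z) + t *: (v - z)) x = 0.
  rewrite !scalerBr addrACA -opprD -scalerDl st scale1r subrr.
  by have := flux_densityD z 0 0 0 0 x; rewrite !scale0r addr0 !mul0r addr0.
rewrite flux_densityD; move: h1 h2 s0 t0 st; rewrite -/z.
move: (fl _ _ _) (fl _ _ _) (ed _ _) (ed _ _) (ed _ _) => A B C E G h1 h2 s0 t0 st h.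
have k1 := ler_wpM2l s0 h1; have k2 := ler_wpM2l t0 h2.
have -> : G = s * G + t * G by rewrite -mulrDl st mul1r.
have : p * (s * B + t * A) = 0 by rewrite h mulr0.
by move: k1 k2; rewrite !mulrDr; move=> k1 k2 k3; lra.
Qed.

Lemma energy_flux_convex w v : W w -> W v -> energy w + p * flux w (v - w) <= energy v.
Proof.
move=> Ww Wv; have i1 := energy_density_integrable Ww; have i2 := energy_density_integrable Wv.
have i3 := flux_density_integrable Ww (sobolevB Wv Ww).
have i4 : mu.-integrable setT (EFin \o (fun x => p * fl w (v - w) x)).
  exact: (@integrableZl _ _ _ mu setT measurableT p _ i3).
rewrite /energy /flux -RintegralZl// -RintegralD//; apply: le_Rintegral => //.
  exact: (@integrableD _ _ _ mu setT measurableT _ _ i1 i4).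
by move=> x _; exact: energy_density_convex.
Qed.

Lemma energy_normZ t w : W w -> nrm (t *: w) = `|t| * nrm w.
Proof.
move=> Ww; rewrite /energy_norm energyZ// powRM ?powR_ge0 ?energy_ge0//.
by rewrite -powRrM mulfV ?gt_eqF// powRr1.
Qed.

Lemma energy_sup_bound w : N%:R < p -> (0 < N)%N -> W w ->
  {ae mu, forall x, `|w.1 x| <= sup_const (N := N) p am `^ p^-1 * nrm w}.
Proof.
move=> Np N0 Ww.
have [m1 m2 i1 i2 H1] := Ww.
have := sup_bound N0 Np Ww am0; apply: ae_imply => x h.
have hE : \int[mu]_x enorm (w.2 x) `^ p + am * \int[mu]_x `|w.1 x| `^ p <= energy w.
  have i3 : mu.-integrable setT (EFin \o (fun x => am * `|w.1 x| `^ p)).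
    exact: (@integrableZl _ _ _ mu setT measurableT am _ i1).
  rewrite -RintegralZl// -RintegralD//; apply: le_Rintegral => //.
  - exact: (@integrableD _ _ _ mu setT measurableT _ _ i2 i3).
  - exact: energy_density_integrable.
  - by move=> y _; rewrite lerD2l ler_wpM2r ?powR_ge0.
have s0 : 0 < sup_const (N := N) p am by exact: sup_const_gt0.
have pV (s : R) : 0 <= s -> s = (s `^ p) `^ p^-1.
  by move=> s0'; rewrite -powRrM mulfV ?gt_eqF// powRr1.
rewrite [leLHS]pV// /energy_norm -powRM ?energy_ge0 ?(ltW s0)//.
apply: ge0_ler_powR; rewrite ?nnegrE ?powR_ge0 ?invr_ge0 ?(ltW p0)//.
  by rewrite mulr_ge0 ?(ltW s0) ?energy_ge0.
by apply: le_trans h _; apply: ler_wpM2l hE; exact: ltW.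
Qed.

Local Opaque energy energy_norm.

Let energy_normalized w al : W w -> 0 < al -> nrm w <= al -> energy (al^-1 *: w) <= 1.
Proof.
move=> Ww al0 wal; rewrite energyZ// -energy_norm_powR (gtr0_norm (_ : 0 < al^-1)) ?invr_gt0//.
rewrite -powRM ?invr_ge0 ?(ltW al0) ?energy_norm_ge0//.
have q0 : 0 <= al^-1 * nrm w by rewrite mulr_ge0 ?energy_norm_ge0 ?invr_ge0 ?(ltW al0).
have -> : 1 = 1 `^ p :> R by rewrite powR1.
apply: ge0_ler_powR; rewrite ?nnegrE ?(ltW p0)//.
by rewrite mulrC ler_pdivrMr// mul1r.
Qed.

(** The set of energy at most 1 is convex, and the norm is its gauge. Adding e/2 to each norm keeps
    the divisors positive. *)
Lemma energy_normD w v : W w -> W v -> nrm (w + v) <= nrm w + nrm v.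
Proof.
move=> Ww Wv; apply/ler_addgt0Pr => e e0.
pose al := nrm w + e / 2; pose be := nrm v + e / 2.
have al0 : 0 < al by rewrite ltr_wpDl ?energy_norm_ge0// divr_gt0.
have be0 : 0 < be by rewrite ltr_wpDl ?energy_norm_ge0// divr_gt0.
have -> : nrm w + nrm v + e = al + be by rewrite /al /be addrACA -splitr.
have wal : nrm w <= al by rewrite lerDl ltW// divr_gt0.
have vbe : nrm v <= be by rewrite lerDl ltW// divr_gt0.
clearbody al be; have ab0 : 0 < al + be by exact: addr_gt0.
have h1 := energy_normalized Ww al0 wal; have h2 := energy_normalized Wv be0 vbe.
apply: energy_norm_le; first exact: ltW.
rewrite (scale_convex_decomposition w v al0 be0).
have Wz : W (al^-1 *: w) by exact: sobolevZ.
have Wz' : W (be^-1 *: v) by exact: sobolevZ.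
rewrite energyZ; last by apply: sobolevD; exact: sobolevZ.
rewrite (gtr0_norm ab0) -[leRHS]mulr1; apply: ler_wpM2l; first exact: powR_ge0.
have s0 : 0 <= al / (al + be) by rewrite divr_ge0 ?ltW.
have t0 : 0 <= be / (al + be) by rewrite divr_ge0 ?ltW.
have st : al / (al + be) + be / (al + be) = 1 by rewrite -mulrDl mulfV// gt_eqF.
apply: le_trans (energy_convex s0 t0 st Wz Wz') _.
rewrite -[leRHS]st; apply: lerD; rewrite -[leRHS]mulr1.
  exact: ler_wpM2l s0 _ _ h1.
exact: ler_wpM2l t0 _ _ h2.
Qed.

Let hoelder_densityZ s t w v x : 0 < s -> 0 < t ->
  hd (s *: w) (t *: v) x = s `^ (p - 1) * t * hd w v x.
Proof.
move=> s0 t0; rewrite /hd -[(s *: w).2 x]/(s *: w.2 x) -[(s *: w).1 x]/(s * w.1 x).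
rewrite -[(t *: v).2 x]/(t *: v.2 x) -[(t *: v).1 x]/(t * v.1 x).
rewrite !enormZ !normrM !(gtr0_norm s0, gtr0_norm t0).
rewrite !powRM ?enorm_ge0 ?(ltW s0)//; ring.
Qed.

(** Scale both arguments to energy at most 1, where Young gives ((p - 1) + 1)/p = 1, and scale
    back. *)
Lemma hoelder_density_le w v al : W w -> W v -> 0 < al -> nrm w <= al ->
  \int[mu]_x hd w v x <= al `^ (p - 1) * nrm v.
Proof.
move=> Ww Wv al0 wal; apply/ler_addgt0Pr => e e0.
have c0 : 0 < al `^ (p - 1) by exact: powR_gt0.
pose be := nrm v + e / al `^ (p - 1).
have be0 : 0 < be by rewrite ltr_wpDl ?energy_norm_ge0// divr_gt0.
have -> : al `^ (p - 1) * nrm v + e = al `^ (p - 1) * be.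
  by rewrite mulrDr [in RHS]mulrCA mulfV ?gt_eqF// mulr1.
have h1 := energy_normalized Ww al0 wal.
have h2 : energy (be^-1 *: v) <= 1 by apply: energy_normalized => //; rewrite lerDl ltW// divr_gt0.
have W1 : W (al^-1 *: w) by exact: sobolevZ.
have W2 : W (be^-1 *: v) by exact: sobolevZ.
have : p * \int[mu]_x hd (al^-1 *: w) (be^-1 *: v) x <= (p - 1) * 1 + 1.
  apply: (@le_trans _ _ ((p - 1) * energy (al^-1 *: w) + energy (be^-1 *: v))); last first.
    by apply: lerD h2; apply: ler_wpM2l h1; rewrite subr_ge0 ltW.
  rewrite -RintegralZl//; last exact: hoelder_density_integrable.
  rewrite -RintegralZl//; last exact: energy_density_integrable.
  have iw : mu.-integrable setT (EFin \o (fun x => (p - 1) * ed (al^-1 *: w) x)).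
    exact: (@integrableZl _ _ _ mu setT measurableT (p - 1) _ (energy_density_integrable W1)).
  have iv := energy_density_integrable W2.
  rewrite -RintegralD//; apply: le_Rintegral => //.
  - exact: (@integrableZl _ _ _ mu setT measurableT p _ (hoelder_density_integrable W1 W2)).
  - exact: (@integrableD _ _ _ mu setT measurableT _ _ iw iv).
  by move=> x _; exact: young_hoelder_density.
rewrite mulr1 subrK -[leRHS]mulr1 ler_pM2l//.
under eq_Rintegral do rewrite hoelder_densityZ ?invr_gt0//.
rewrite RintegralZl//; last exact: hoelder_density_integrable.
rewrite -{1}[al]powRr1 ?(ltW al0)// -powRN -powRrM mulN1r.
by rewrite powRN -invfM mulrC ler_pdivrMr ?mulr_gt0// mul1r.
Qed.

Lemma flux_le w v al : W w -> W v -> 0 < al -> nrm w <= al ->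
  `|flux w v| <= al `^ (p - 1) * nrm v.
Proof.
move=> Ww Wv al0 wal; apply: le_trans (hoelder_density_le Ww Wv al0 wal).
have i1 := flux_density_integrable Ww Wv; have i2 := hoelder_density_integrable Ww Wv.
apply: le_trans (le_normr_Rintegral _ _) _ => //.
apply: le_Rintegral => //; first exact: (integrable_norm i1).
by move=> x _; exact: flux_density_le.
Qed.

Lemma fluxD w u v s t : W w -> W u -> W v ->
  flux w (s *: u + t *: v) = s * flux w u + t * flux w v.
Proof.
move=> Ww Wu Wv; rewrite /flux.
have iu := flux_density_integrable Ww Wu; have iv := flux_density_integrable Ww Wv.
under eq_Rintegral do rewrite flux_densityD.
rewrite RintegralD ?RintegralZl//.
- exact: (@integrableZl _ _ _ mu setT measurableT s _ iu).
- exact: (@integrableZl _ _ _ mu setT measurableT t _ iv).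
Qed.

Lemma flux_continuous (M e : R) : 0 < e -> exists2 d, 0 < d &
  forall u h v, W u -> W h -> W v -> nrm u <= M -> nrm h <= d ->
    `|flux (u + h) v - flux u v| <= e * nrm v.
Proof.
move=> e0; pose M1 := Num.max 1 M.
have M10 : 0 < M1 by rewrite lt_max ltr01.
have c0 : 0 < M1 `^ (p - 1) by exact: powR_gt0.
have e10 : 0 < e / 2 / M1 `^ (p - 1) by rewrite !divr_gt0.
have [C C0 HC] := flux_density_continuity e10.
have C10 : 0 < C + 1 by rewrite ltr_wpDl.
(* Chosen so that C d^(p-1) <= e/2; [C + 1] keeps the quotient positive when C = 0. *)
pose d := (e / 2 / (C + 1)) `^ (p - 1)^-1.
have p10 : 0 < p - 1 by rewrite subr_gt0.
have d0 : 0 < d by rewrite powR_gt0// !divr_gt0.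
have dE : d `^ (p - 1) = e / 2 / (C + 1).
  by rewrite -powRrM mulVf ?gt_eqF// powRr1// ltW// !divr_gt0.
exists d => // u h v Wu Wh Wv uM hd'.
have Wuh := sobolevD Wu Wh.
have i1 := flux_density_integrable Wuh Wv; have i2 := flux_density_integrable Wu Wv.
have j1 := hoelder_density_integrable Wu Wv; have j2 := hoelder_density_integrable Wh Wv.
have k1 : mu.-integrable setT (EFin \o (fun x => e / 2 / M1 `^ (p - 1) * hd u v x)).
  exact: (@integrableZl _ _ _ mu setT measurableT (e / 2 / M1 `^ (p - 1)) _ j1).
have k2 : mu.-integrable setT (EFin \o (fun x => C * hd h v x)).
  exact: (@integrableZl _ _ _ mu setT measurableT C _ j2).
have i3 : mu.-integrable setT (EFin \o (fun x => fl (u + h) v x - fl u v x)).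
  exact: (@integrableB _ _ _ mu setT measurableT _ _ i1 i2).
rewrite /flux -RintegralB//; apply: le_trans (le_normr_Rintegral _ _) _ => //.
apply: (@le_trans _ _ (\int[mu]_x (e / 2 / M1 `^ (p - 1) * hd u v x + C * hd h v x))).
  apply: le_Rintegral => //; first exact: (integrable_norm i3).
  exact: (@integrableD _ _ _ mu setT measurableT _ _ k1 k2).
rewrite RintegralD// !RintegralZl//.
have uM1 : nrm u <= M1 by rewrite le_max uM orbT.
have q1 := hoelder_density_le Wu Wv M10 uM1.
have q2 := hoelder_density_le Wh Wv d0 hd'.
have {}q1 := ler_wpM2l (ltW e10) q1; have {}q2 := ler_wpM2l C0 q2.
rewrite mulrA divfK ?gt_eqF// in q1.
have q3 : C * (d `^ (p - 1) * nrm v) <= e / 2 * nrm v.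
  rewrite mulrA ler_wpM2r ?energy_norm_ge0// dE mulrA ler_pdivrMr// mulrC ler_wpM2l ?lerDl//.
  by rewrite ltW// divr_gt0.
exact: flux_algebra q1 q2 q3.
Qed.

(** The gradient inequality at u and at u + h places the remainder between 0 and p times the change
    of the flux in the direction h, so continuity of the flux suffices. *)
Lemma energy_differentiable (M e : R) : 0 < e -> exists2 d, 0 < d &
  forall u h, W u -> W h -> nrm u <= M -> nrm h <= d ->
    `|energy (u + h) - energy u - p * flux u h| <= e * nrm h.
Proof.
move=> e0; have [d d0 H] := flux_continuous M (divr_gt0 e0 p0).
exists d => // u h Wu Wh uM hd'.
have Wuh := sobolevD Wu Wh.
have h1 := energy_flux_convex Wu Wuh; have h2 := energy_flux_convex Wuh Wu.
rewrite addrAC subrr add0r in h1.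
rewrite opprD addrA subrr add0r in h2.
have h3 : flux (u + h) (- h) = - flux (u + h) h.
  have := fluxD (-1) 0 Wuh Wh Wh.
  by rewrite scaleN1r scale0r addr0 mulN1r mul0r addr0.
rewrite h3 in h2.
have h4 := le_trans (ler_norm _) (H u h h Wu Wh Wh uM hd').
rewrite -subr_ge0 opprD addrA in h1; rewrite (ger0_norm h1).
apply: (@le_trans _ _ (p * (flux (u + h) h - flux u h))).
  exact: convex_algebra h2.
by rewrite mulrC -ler_pdivlMr// mulrAC.
Qed.

End energy.

(** * The nonlinear term *)

Lemma min_max_dist {R : realDomainType} (x y c : R) :
  Num.min x y <= c <= Num.max x y -> `|c - x| <= `|y - x|.
Proof.
have [xy|/ltW yx] := leP x y => /andP[h1 h2].
  by rewrite !ger0_norm ?subr_ge0// lerD2r.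
by rewrite !ler0_norm ?subr_le0// lerN2 lerD2r.
Qed.

Section primitive_of_continuous.
Context {R : realType}.
Local Notation leb1 := (@lebesgue_measure R).

Lemma heine_cantor_segment (g : R -> R) (s e : R) : continuous g -> 0 < e ->
  exists2 d, 0 < d & forall x y, `|x| <= s -> `|x - y| <= d -> `|g x - g y| <= e.
Proof.
move=> cg e0.
have cK := @segment_compact R (- s) s.
have /near_covering_withinP cov := (iffLR (compact_near_coveringP _) cK).
have := cov R (0 : R)^'+ (fun d x => forall y, `|x - y| <= d -> `|g x - g y| <= e) _.
case=> [x xs|d /= d0 H].
  have e20 : 0 < e / 2 by rewrite divr_gt0.
  have /cvgrPdist_le /(_ _ e20) /nbhs_normP[r /= r0 Hr] := cg x.
  exists (ball x (r / 2), [set d : R | d < r / 2]).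
    split; first by apply: nbhsx_ballx; rewrite divr_gt0.
    by apply: nbhs_right_lt; rewrite divr_gt0.
  move=> [x' d'] [/= xx' dr] _ y x'y.
  have h1 := Hr x'; have h2 := Hr y.
  have xr : `|x - x'| < r by apply: lt_le_trans xx' _; rewrite ler_pdivrMr// ler_peMr ?ler1n// ltW.
  have yr : `|x - y| < r.
    rewrite (splitr r) -(subrK x' x) -addrA; apply: le_lt_trans (ler_normD _ _) _.
    by apply: ltrD => //; exact: le_lt_trans dr.
  rewrite (splitr e) -(subrK (g x) (g x')) -addrA; apply: le_trans (ler_normD _ _) _.
  by apply: lerD; [rewrite distrC; exact: h1|exact: h2].
exists (d / 2); first by rewrite divr_gt0.
move=> x y xs xy; have := H (d / 2).
rewrite /= sub0r normrN gtr0_norm ?divr_gt0// ltr_pdivrMr// ltr_pMr// ltr1n => /(_ isT).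
by apply => //=; rewrite ?in_itv/= -?ler_norml ?divr_gt0.
Qed.

Let integrable_segment (g : R -> R) a b : continuous g -> leb1.-integrable `[a, b] (EFin \o g).
Proof.
by move=> cg; apply: continuous_compact_integrable; [exact: segment_compact|exact: continuous_subspaceT].
Qed.

Let signed_integral (g : R -> R) (t : R) : R :=
  if 0 <= t then \int[leb1]_(xi in `[0, t]) g xi else - \int[leb1]_(xi in `[t, 0]) g xi.

Let segment_split (g : R -> R) a b c : continuous g -> a <= b -> b <= c ->
  \int[leb1]_(xi in `[a, c]) g xi = \int[leb1]_(xi in `[a, b]) g xi + \int[leb1]_(xi in `[b, c]) g xi.
Proof.
move=> cg ab bc; have := @Rintegral_itvB R g (BLeft a) (BRight c) b (integrable_segment a c cg).
rewrite !bnd_simp => /(_ ab bc) h.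
rewrite -[LHS](subrK (\int[leb1]_(xi in `[a, b]) g xi)) h addrC; congr (_ + _).
apply: Rintegral_itv_obnd_cbnd; apply: integrableS (integrable_segment b c cg) => //.
by apply: subset_itvr; rewrite bnd_simp.
Qed.

Let signed_integralB (g : R -> R) a b : continuous g -> a <= b ->
  signed_integral g b - signed_integral g a = \int[leb1]_(xi in `[a, b]) g xi.
Proof.
move=> cg ab; rewrite /signed_integral.
have [a0|a0] := leP 0 a; have [b0|b0] := leP 0 b.
- by rewrite (segment_split cg a0 ab) addrC addKr.
- by move: (lt_le_trans b0 a0); rewrite ltNge ab.
- by rewrite opprK addrC -segment_split// ltW.
- by rewrite opprK addrC (segment_split cg ab (ltW b0)) addrK.
Qed.

(** The average lies between the minimum and the maximum, both attained, so the intermediate value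
    theorem finds it. *)
Let integral_mean (g : R -> R) a b : continuous g -> a <= b ->
  exists2 s, a <= s <= b & \int[leb1]_(xi in `[a, b]) g xi = g s * (b - a).
Proof.
move=> cg; rewrite le_eqVlt => /predU1P[<-|ab].
  by exists a; rewrite ?lexx// set_itv1 Rintegral_set1 subrr mulr0.
have cg' := @continuous_subspaceT _ _ `[a, b] _ cg.
have [M Mab HM] := EVT_max (ltW ab) cg'.
have [m mab Hm] := EVT_min (ltW ab) cg'.
have ig := integrable_segment a b cg.
have ba0 : 0 < b - a by rewrite subr_gt0.
have cst (k : R) : \int[leb1]_(xi in `[a, b]) k = k * (b - a).
  have := @Rintegral_cst _ _ R leb1 `[a, b]%classic (measurable_itv _) k.
  by rewrite /= => ->; rewrite lebesgue_measure_itv/= lte_fin ab.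
have icst (k : R) : leb1.-integrable `[a, b] (EFin \o fun=> k).
  by apply: integrable_segment => x; exact: cst_continuous.
pose v := (\int[leb1]_(xi in `[a, b]) g xi) / (b - a).
have v1 : g m <= v.
  rewrite ler_pdivlMr// -cst; by apply: le_Rintegral.
have v2 : v <= g M.
  rewrite ler_pdivrMr// -cst; by apply: le_Rintegral.
have [mM|Mm] := leP m M.
  have cmM := @continuous_subspaceT _ _ `[m, M] _ cg.
  have [|s] := @IVT R g m M v mM cmM.
    by rewrite ge_min le_max v1 v2 orbT.
  rewrite in_itv/= => /andP[ms sM] gs.
  exists s; last by rewrite gs /v divfK// gt_eqF.
  move: mab Mab; rewrite !in_itv/= => /andP[am _] /andP[_ Mb].
  by rewrite (le_trans am ms) (le_trans sM Mb).
have cmM := @continuous_subspaceT _ _ `[M, m] _ cg.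
have [|s] := @IVT R g M m v (ltW Mm) cmM.
  by rewrite ge_min le_max v1 v2 orbT.
rewrite in_itv/= => /andP[ms sM] gs.
exists s; last by rewrite gs /v divfK// gt_eqF.
move: mab Mab; rewrite !in_itv/= => /andP[_ Mb] /andP[am _].
by rewrite (le_trans am ms) (le_trans sM Mb).
Qed.

Variable (N : nat) (f : 'rV[R]_N -> R -> R).

Lemma primitive0 x : primitive f x 0 = 0.
Proof. by rewrite /primitive lexx set_itv1 Rintegral_set1. Qed.

Lemma primitive_mvt x a b : continuous (f x) ->
  exists2 s, Num.min a b <= s <= Num.max a b &
    primitive f x b - primitive f x a = f x s * (b - a).
Proof.
move=> cg; have [ab|/ltW ba] := leP a b.
  by have [s sab h] := integral_mean cg ab; exists s => //; rewrite -h -signed_integralB.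
have [s sab h] := integral_mean cg ba; exists s => //.
by rewrite -opprB -[in RHS]opprB mulrN -h -signed_integralB.
Qed.

Lemma primitive_le x (s h t : R) : continuous (f x) -> (forall t, `|t| <= s -> `|f x t| <= h) ->
  `|t| <= s -> `|primitive f x t| <= s * h.
Proof.
move=> cg Hh ts; have [c cab] := primitive_mvt 0 t cg.
rewrite primitive0 !subr0 => ->; rewrite normrM mulrC.
have ct : `|c| <= `|t|.
  by have := min_max_dist cab; rewrite !subr0.
by apply: ler_pM => //; apply: Hh; exact: le_trans ts.
Qed.

Lemma primitive_continuous x : continuous (f x) -> continuous (primitive f x).
Proof.
move=> cg t; apply/cvgrPdist_le => /= e e0.
have [d d0 H] := heine_cantor_segment (`|t| + 1) cg ltr01.
near=> y.
have ty : `|t - y| <= Num.min 1 (Num.min d (e / (`|f x t| + 1))).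
  near: y; apply: cvgr_dist_le; first exact: cvg_id.
  by rewrite !lt_min ltr01 d0 divr_gt0// ltr_wpDl.
move: ty; rewrite !le_min => /and3P[ty1 tyd tye].
have [c cab ->] := primitive_mvt y t cg.
have tc : `|t - c| <= `|t - y|.
  by rewrite distrC [leRHS]distrC; apply: min_max_dist; rewrite minC maxC.
have fc : `|f x c| <= `|f x t| + 1.
  have := H t c _ (le_trans tc tyd); rewrite lerDl ler01 => /(_ isT) h.
  by rewrite -lerBlDl; apply: le_trans h; rewrite distrC; exact: lerB_dist.
rewrite normrM (le_trans (ler_wpM2r (normr_ge0 _) fc))//.
by rewrite -ler_pdivlMl 1?mulrC// ltr_wpDl.
Unshelve. all: by end_near. Qed.

End primitive_of_continuous.

Lemma fraction_approx {R : realType} (t : R) : (Num.floor (n.+1%:R * t))%:~R / n.+1%:R @[n --> \oo] --> t.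
Proof.
apply/cvgrPdist_le => /= e e0; near=> n.
have n0 : 0 < n.+1%:R :> R by [].
have -> : t - (Num.floor (n.+1%:R * t))%:~R / n.+1%:R = (n.+1%:R * t - (Num.floor (n.+1%:R * t))%:~R) / n.+1%:R.
  by rewrite mulrBl mulrAC mulfV ?gt_eqF// mul1r.
have h1 := floor_le (n.+1%:R * t); have h2 := floorD1_gt (n.+1%:R * t).
rewrite normrM normfV (gtr0_norm n0) ler_pdivrMr// ger0_norm ?subr_ge0//.
apply: (@le_trans _ _ 1); first by move: h2; rewrite intrD => h2; rewrite lerBlDl ltW.
rewrite -ler_pdivrMl// mulr1 (@le_trans _ _ n%:R)// ?ler_nat//; near: n; exact: nbhs_infty_ger.
Unshelve. all: by end_near. Qed.

(** * Superposition with a Caratheodory function *)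

Section superposition.
Context {R : realType} {d} {T : measurableType d}.
Local Notation RR := (measurableTypeR R).
Variable f : T -> R -> R.
Hypotheses (mf : forall t, measurable_fun [set: T] (f ^~ t)) (cf : forall x, continuous (f x)).

(** Rounding u down to multiples of 1/(n+1) leaves countably many values, each using one measurable
    section of f; continuity in t passes to the limit. *)
Lemma measurable_superposition (u : T -> R) : measurable_fun [set: T] u ->
  measurable_fun [set: T] (fun x => f x (u x)).
Proof.
move=> mU.
pose k n x : int := Num.floor (n.+1%:R * u x).
pose g n x := f x ((k n x)%:~R / n.+1%:R).
have mk n (z : int) : measurable [set x | k n x = z].
  rewrite (_ : [set x | _] = (fun x => n.+1%:R * u x) @^-1` `[z%:~R, z%:~R + 1[); last first.
    apply/seteqP; split => x /=; rewrite in_itv/=.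
      by move=> <-; have := floor_itv (n.+1%:R * u x); rewrite intrD.
    by move=> h; apply: floor_def; rewrite intrD.
  rewrite -[X in measurable X]setTI; apply: (measurable_funM (measurable_cst _) mU) => //.
have mg n : measurable_fun [set: T] (g n).
  move=> _ Y mY; rewrite setTI.
  rewrite (_ : _ @^-1` _ = \bigcup_(z in [set: int])
      ([set x | k n x = z] `&` (f ^~ (z%:~R / n.+1%:R)) @^-1` Y)); last first.
    apply/seteqP; split => [x Yx|x [z _ [<- ]]//].
    by exists (k n x).
  apply: countable_bigcupT_measurable => // z; apply: measurableI => //.
  by rewrite -[X in measurable X]setTI; exact: mf.
apply: (@measurable_fun_cvg _ _ _ setT g (fun x => f x (u x)) mg) => x _.
apply: continuous_cvg; first exact: cf.
exact: fraction_approx.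
Qed.

End superposition.

Section ae_integral.
Context {R : realType} {d} {T : measurableType d} (mu : {measure set T -> \bar R}).

Lemma ae_le_integrable (g h : T -> R) : measurable_fun [set: T] g ->
  mu.-integrable setT (EFin \o h) -> {ae mu, forall x, `|g x| <= h x} ->
  mu.-integrable setT (EFin \o g).
Proof.
move=> mg ih gh; apply/integrableP; split; first exact/measurable_EFinP.
have mh : measurable_fun [set: T] h by apply/measurable_EFinP; exact: measurable_int ih.
have /integrableP[_] := ih; apply: le_lt_trans.
apply: ae_ge0_le_integral => //.
- by apply/measurable_EFinP; exact: measurableT_comp.
- by apply/measurable_EFinP; exact: measurableT_comp.
- by move: gh; apply: filterS => x h1 _; rewrite /= lee_fin (le_trans h1)// ler_norm.
Qed.

Lemma ae_le_Rintegral (g h : T -> R) : mu.-integrable setT (EFin \o g) ->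
  mu.-integrable setT (EFin \o h) -> {ae mu, forall x, g x <= h x} ->
  \int[mu]_x g x <= \int[mu]_x h x.
Proof.
move=> ig ih gh.
have mg : measurable_fun [set: T] g by apply/measurable_EFinP; exact: measurable_int ig.
have mh : measurable_fun [set: T] h by apply/measurable_EFinP; exact: measurable_int ih.
rewrite -subr_ge0 -RintegralB//.
have -> : \int[mu]_x (h x - g x) = \int[mu]_x `|h x - g x|.
  congr fine; apply: ae_eq_integral => //.
  - by apply/measurable_EFinP; exact: measurable_funB.
  - by apply/measurable_EFinP; apply: measurableT_comp => //; exact: measurable_funB.
  - by move: gh; apply: filterS => x h1 _; rewrite ger0_norm// subr_ge0.
by apply: Rintegral_ge0 => x _.
Qed.

End ae_integral.

Lemma measurable_invr {R : realType} :
  measurable_fun [set: measurableTypeR R] (GRing.inv : R -> R).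
Proof.
have -> : GRing.inv = (fun x : R => if x == 0 then 0 else x^-1).
  by apply/funext => x; case: eqP => [->|//]; rewrite invr0.
apply: measurable_fun_if => //=.
  by apply: measurable_fun_eqr => //.
rewrite setTI (_ : _ @^-1` _ = ~` [set 0 : R]); last first.
  by apply/seteqP; split => x /=; [move=> /negbT/eqP|move=> /eqP/negbTE].
apply: open_continuous_measurable_fun; first exact/closed_openC/accessible_closed_set1/hausdorff_accessible/Rhausdorff.
by move=> x /set_mem/eqP x0; exact: inv_continuous.
Qed.

Section caratheodory.
Context {R : realType} {N : nat}.
Local Notation RR := (measurableTypeR R).
Local Notation mu := (borel_lebesgue_rV R N).
Variables (f : 'rV[RR]_N -> R -> R) (h : R -> 'rV[RR]_N -> R).
Hypotheses (mf : forall t, measurable_fun [set: 'rV[RR]_N] (f ^~ t)) (cf : forall x, continuous (f x)).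
Hypotheses (ih : forall s : R, 0 < s -> mu.-integrable setT (EFin \o h s)).
Hypotheses (fh : forall (s : R) x (t : R), 0 < s -> `|t| <= s -> `|f x t| <= h s x).
Local Notation F := (primitive f).
Implicit Types (u v k : 'rV[RR]_N -> R) (s e : R).

Lemma ae_imply2 (P Q S : 'rV[RR]_N -> Prop) : (forall x, P x -> Q x -> S x) ->
  {ae mu, forall x, P x} -> {ae mu, forall x, Q x} -> {ae mu, forall x, S x}.
Proof. by move=> PQ; apply: filterS2. Qed.

Let h0 (s : R) x : 0 < s -> 0 <= h s x.
Proof. by move=> s0; apply: le_trans (fh x s0 (_ : `|0| <= s)) => //; rewrite normr0 ltW. Qed.

(** Joint measurability of f comes from superposition with the second projection; Tonelli is then
    applied to the positive and negative parts. *)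
Let measurable_partial_integral (D : set RR) : measurable D ->
  measurable_fun [set: 'rV[RR]_N] (fun x => \int[lebesgue_measure]_(s in D) f x s).
Proof.
move=> mD; pose phi (z : 'rV[RR]_N * RR) : R := f z.1 z.2 * \1_D z.2.
have mphi : measurable_fun setT phi.
  apply: measurable_funM.
    apply: (@measurable_superposition R _ _ (fun (z : 'rV[RR]_N * RR) t => f z.1 t)).
    - by move=> t; apply: (measurableT_comp (mf t)).
    - by move=> z; exact: cf.
    - exact: measurable_snd.
  by apply: measurableT_comp measurable_snd; exact: measurable_indic.
apply: (measurableT_comp (fine_measurable measurableT)).
rewrite (_ : (fun x => _) = fun x => (\int[lebesgue_measure]_s ((EFin \o phi)^\+ (x, s)) -
    \int[lebesgue_measure]_s ((EFin \o phi)^\- (x, s)))%E); last first.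
  apply/funext => x; rewrite integral_mkcond integralE.
  have e s : ((fun s => (f x s)%:E) \_ D) s = (phi (x, s))%:E.
    by rewrite patchE /phi /= [\1_D s]indicE; case: ifP => sD; rewrite /= ?mulr1 ?mulr0.
  by congr (_ - _)%E; apply: eq_integral => s _; rewrite !(funeposE, funenegE) e.
apply: emeasurable_funB.
- apply: (@measurable_fun_fubini_tonelli_F _ _ _ _ _ lebesgue_measure ((EFin \o phi)^\+)%E) => //.
  by apply: measurable_funepos; exact/measurable_EFinP.
- apply: (@measurable_fun_fubini_tonelli_F _ _ _ _ _ lebesgue_measure ((EFin \o phi)^\-)%E) => //.
  by apply: measurable_funeneg; exact/measurable_EFinP.
Qed.

Lemma measurable_primitive t : measurable_fun [set: 'rV[RR]_N] (F ^~ t).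
Proof.
rewrite /primitive; case: (0 <= t); first exact: measurable_partial_integral.
by apply: measurableT_comp => //; exact: measurable_partial_integral.
Qed.

Lemma measurable_primitive_superposition u : measurable_fun [set: 'rV[RR]_N] u ->
  measurable_fun [set: 'rV[RR]_N] (fun x => F x (u x)).
Proof.
by apply: measurable_superposition; [exact: measurable_primitive|move=> x; exact: primitive_continuous].
Qed.

(** An L^1 modulus of continuity of superposition, uniform over functions bounded by s. It is stated
    for every measurable [r] below some oscillation of f, so that the supremum of the oscillations,
    whose measurability would need a proof, never appears. If it failed for every delta = 1/(n+1),
    functions r_n would tend to 0 a.e. by uniform continuity on [-s, s], below 2 h_s, against
    dominated convergence. *)
Lemma superposition_modulus (s e : R) : 0 < s -> 0 < e -> exists2 delta, 0 < delta &
  forall r : 'rV[RR]_N -> R, measurable_fun [set: 'rV[RR]_N] r ->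
    {ae mu, forall x, exists y z, [/\ `|y| <= s, `|z| <= s, `|y - z| <= delta &
      `|r x| <= `|f x y - f x z|]} ->
    mu.-integrable setT (EFin \o r) /\ \int[mu]_x `|r x| <= e.
Proof.
move=> s0 e0.
pose P (delta : R) (r : 'rV[RR]_N -> R) := {ae mu, forall x, exists y z, [/\ `|y| <= s, `|z| <= s, `|y - z| <= delta &
      `|r x| <= `|f x y - f x z|]}.
have i2h : mu.-integrable setT (EFin \o (fun x => 2 * h s x)).
  exact: (@integrableZl _ _ _ mu setT measurableT 2 _ (ih s0)).
have dom delta r : P delta r -> {ae mu, forall x, `|r x| <= 2 * h s x}.
  apply: ae_imply => x [y [z [ys zs _ rx]]]; apply: le_trans rx _.
  by apply: le_trans (ler_normB _ _) _; rewrite mulrDl !mul1r lerD ?fh.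
have int delta r : measurable_fun setT r -> P delta r -> mu.-integrable setT (EFin \o r).
  by move=> mr Pr; apply: ae_le_integrable i2h (dom _ _ Pr).
apply: contrapT => no.
have /choice[r Hr] : forall n, exists r : 'rV[RR]_N -> R,
    [/\ measurable_fun [set: 'rV[RR]_N] r, P n.+1%:R^-1 r & e < \int[mu]_x `|r x|].
  move=> n; apply: contrapT => no'; apply: no; exists n.+1%:R^-1; first by rewrite invr_gt0.
  move=> r mr Pr; split; first exact: int mr Pr.
  by rewrite leNgt; apply/negP => er; apply: no'; exists r.
have [||||| _ _ lim] := @dominated_convergence _ _ R mu setT measurableT
    (fun n => EFin \o (fun x => `|r n x|)) (cst 0)%E (EFin \o (fun x => 2 * h s x)).
- by move=> n; apply/measurable_EFinP; apply: measurableT_comp => //; have [] := Hr n.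
- exact: measurable_cst.
- have /ae_foralln H : forall n, {ae mu, forall x, exists y z, [/\ `|y| <= s, `|z| <= s,
      `|y - z| <= n.+1%:R^-1 & `|r n x| <= `|f x y - f x z|]}.
    by move=> n; have [] := Hr n.
  apply: ae_imply H => x Hx _; apply: cvg_EFin; first by near=> n.
  apply/cvgrPdist_le => /= eps eps0.
  have [dl dl0 Hdl] := heine_cantor_segment s (@cf x) eps0.
  near=> n; have [y [z [ys zs yz ryz]]] := Hx n.
  rewrite sub0r normrN normr_id (le_trans ryz)// Hdl//.
  apply: le_trans yz _; rewrite invf_ple ?posrE//.
  by rewrite (@le_trans _ _ n%:R)// ?ler_nat//; near: n; exact: nbhs_infty_ger.
- exact: i2h.
- have /ae_foralln H : forall n, {ae mu, forall x, `|r n x| <= 2 * h s x}.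
    by move=> n; have [_ /dom] := Hr n.
  by apply: ae_imply H => x Hx n _; rewrite /= lee_fin normr_id.
have : ((fun n => \int[mu]_x `|r n x|) @ \oo --> (0 : R)).
  have -> : (0 : R) = fine (\int[mu]_x (cst 0 x))%E by rewrite integral0.
  apply: fine_cvg; rewrite integral0; move: lim; rewrite integral0.
  exact.
move=> /cvgrPdist_lt /(_ _ e0)[n _ /(_ n (leqnn _))] /=.
have [_ _ en] := Hr n; rewrite sub0r normrN ger0_norm; last by apply: Rintegral_ge0.
by rewrite ltNge ltW.
Unshelve. all: by end_near. Qed.

Definition potential (u : 'rV[RR]_N -> R) := \int[mu]_x F x (u x).

Lemma primitive_integrable u s : 0 < s -> measurable_fun [set: 'rV[RR]_N] u ->
  {ae mu, forall x, `|u x| <= s} -> mu.-integrable setT (EFin \o (fun x => F x (u x))).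
Proof.
move=> s0 mU us.
have isS : mu.-integrable setT (EFin \o (fun x => s * h s x)).
  exact: (@integrableZl _ _ _ mu setT measurableT s _ (ih s0)).
apply: (ae_le_integrable _ isS); first exact: measurable_primitive_superposition.
apply: ae_imply us => x us; apply: (primitive_le (@cf x) _ us) => t ts; exact: fh.
Qed.

Lemma potential_bounded s : 0 < s -> exists B, forall u, measurable_fun [set: 'rV[RR]_N] u ->
  {ae mu, forall x, `|u x| <= s} -> `|potential u| <= B.
Proof.
move=> s0; have isS : mu.-integrable setT (EFin \o (fun x => s * h s x)).
  exact: (@integrableZl _ _ _ mu setT measurableT s _ (ih s0)).
exists (\int[mu]_x (s * h s x)) => u mU us.
have iF := primitive_integrable s0 mU us.
apply: le_trans (le_normr_Rintegral _ iF) _ => //.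
apply: ae_le_Rintegral isS _; first exact: (integrable_norm iF).
by apply: ae_imply us => x us; apply: (primitive_le (@cf x) _ us) => t ts; exact: fh.
Qed.

Lemma nonlinearity_integrable u v s K : 0 < s -> measurable_fun [set: 'rV[RR]_N] u ->
  measurable_fun [set: 'rV[RR]_N] v -> {ae mu, forall x, `|u x| <= s} ->
  {ae mu, forall x, `|v x| <= K} ->
  mu.-integrable setT (EFin \o (fun x => f x (u x) * v x)).
Proof.
move=> s0 mU mv us vK.
have isS : mu.-integrable setT (EFin \o (fun x => `|K| * h s x)).
  exact: (@integrableZl _ _ _ mu setT measurableT `|K| _ (ih s0)).
apply: (ae_le_integrable _ isS).
  by apply: measurable_funM => //; exact: measurable_superposition.
apply: (ae_imply2 _ us vK) => x us' vK'.
by rewrite normrM mulrC ler_pM ?fh// (le_trans vK')// ler_norm.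
Qed.

(** By the mean value property the remainder is v(x) times an oscillation of f between u(x) and a
    point at distance at most |v(x)|. [K] is a sup bound of v, so the error is measured in the sup
    norm. *)
Lemma potential_differentiable (s e : R) : 0 < s -> 0 < e -> exists2 delta, 0 < delta &
  forall u v K, 0 <= K -> measurable_fun [set: 'rV[RR]_N] u -> measurable_fun [set: 'rV[RR]_N] v ->
    {ae mu, forall x, `|u x| <= s} -> {ae mu, forall x, `|v x| <= K} -> K <= delta ->
    `|potential (fun x => u x + v x) - potential u - \int[mu]_x (f x (u x) * v x)| <= e * K.
Proof.
move=> s0 e0; have s10 : 0 < s + 1 by rewrite addr_gt0.
have [dl dl0 H] := superposition_modulus s10 e0.
exists (Num.min 1 dl); first by rewrite lt_min ltr01.
move=> u v K K0 mU mv us vK; rewrite le_min => /andP[K1 Kdl].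
have mUv : measurable_fun [set: 'rV[RR]_N] (fun x => u x + v x) by exact: measurable_funD.
have us1 : {ae mu, forall x, `|u x| <= s + 1} by apply: ae_imply us => x; lra.
have uvs : {ae mu, forall x, `|u x + v x| <= s + 1}.
  apply: (ae_imply2 _ us vK) => x us' vK'; apply: le_trans (ler_normD _ _) _.
  by apply: lerD => //; exact: le_trans K1.
have i1 := primitive_integrable s10 mUv uvs.
have i2 := primitive_integrable s10 mU us1.
have i3 := nonlinearity_integrable s10 mU mv us1 vK.
(* Where v vanishes the quotient is 0 by the convention on division, and the remainder is 0 as
   well. *)
pose r x := (F x (u x + v x) - F x (u x) - f x (u x) * v x) / v x.
have mr : measurable_fun [set: 'rV[RR]_N] r.
  apply: measurable_funM; last exact: (measurableT_comp measurable_invr).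
  apply: measurable_funB; last by apply: measurable_funM => //; exact: measurable_superposition.
  by apply: measurable_funB; exact: measurable_primitive_superposition.
have rE x : F x (u x + v x) - F x (u x) - f x (u x) * v x = r x * v x.
  rewrite /r; have [->|v0] := eqVneq (v x) 0; last by rewrite divfK.
  by rewrite addr0 subrr !mulr0 subrr.
have [|ir re] := H r mr.
  apply: (ae_imply2 _ us vK) => x us' vK'.
  have [v0|v0] := eqVneq (v x) 0.
    exists 0, 0; rewrite /r v0 invr0 mulr0 !subrr !normr0; split => //; exact: ltW.
  have [c cab hc] := primitive_mvt (u x) (u x + v x) (@cf x).
  have cu : `|c - u x| <= `|v x|.
    by have := min_max_dist cab; rewrite addrAC subrr add0r.
  exists c, (u x); split.
  - rewrite -(subrK (u x) c) addrC; apply: le_trans (ler_normD _ _) _.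
    by apply: lerD => //; apply: le_trans cu (le_trans vK' K1).
  - by apply: le_trans us' _; rewrite lerDl.
  - exact: le_trans cu (le_trans vK' Kdl).
  - by rewrite /r hc addrAC subrr add0r -mulrBl mulfK.
have iB : mu.-integrable setT (EFin \o (fun x => F x (u x + v x) - F x (u x))).
  exact: (@integrableB _ _ _ mu setT measurableT _ _ i1 i2).
have iR : mu.-integrable setT (EFin \o (fun x => F x (u x + v x) - F x (u x) - f x (u x) * v x)).
  exact: (@integrableB _ _ _ mu setT measurableT _ _ iB i3).
rewrite /potential -RintegralB// -RintegralB//.
apply: le_trans (le_normr_Rintegral _ iR) _ => //.
have ir' : mu.-integrable setT (EFin \o (fun x => K * `|r x|)).
  exact: (@integrableZl _ _ _ mu setT measurableT K _ (integrable_norm ir)).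
apply: (@le_trans _ _ (\int[mu]_x (K * `|r x|))).
  apply: ae_le_Rintegral ir' _; first exact: (integrable_norm iR).
  by apply: ae_imply vK => x vK; rewrite rE normrM mulrC ler_wpM2r.
by rewrite RintegralZl//; [rewrite mulrC ler_wpM2r|exact: (integrable_norm ir)].
Qed.

Lemma nonlinearity_continuous s e : 0 < s -> 0 < e -> exists2 delta, 0 < delta &
  forall u k v K L, 0 <= L -> measurable_fun [set: 'rV[RR]_N] u ->
    measurable_fun [set: 'rV[RR]_N] k -> measurable_fun [set: 'rV[RR]_N] v ->
    {ae mu, forall x, `|u x| <= s} -> {ae mu, forall x, `|k x| <= K} -> K <= delta ->
    {ae mu, forall x, `|v x| <= L} ->
    `|\int[mu]_x (f x (u x + k x) * v x) - \int[mu]_x (f x (u x) * v x)| <= e * L.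
Proof.
move=> s0 e0; have s10 : 0 < s + 1 by rewrite addr_gt0.
have [dl dl0 H] := superposition_modulus s10 e0.
exists (Num.min 1 dl); first by rewrite lt_min ltr01.
move=> u k v K L L0 mU mk mv us kK; rewrite le_min => /andP[K1 Kdl] vL.
have mUk : measurable_fun [set: 'rV[RR]_N] (fun x => u x + k x) by exact: measurable_funD.
have us1 : {ae mu, forall x, `|u x| <= s + 1} by apply: ae_imply us => x /le_trans; apply; rewrite lerDl.
have uks : {ae mu, forall x, `|u x + k x| <= s + 1}.
  apply: (ae_imply2 _ us kK) => x us' kK'; apply: le_trans (ler_normD _ _) _.
  by apply: lerD => //; exact: le_trans K1.
have i1 := nonlinearity_integrable s10 mUk mv uks vL.
have i2 := nonlinearity_integrable s10 mU mv us1 vL.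
pose r x := f x (u x + k x) - f x (u x).
have mr : measurable_fun [set: 'rV[RR]_N] r by apply: measurable_funB; exact: measurable_superposition.
have [|ir re] := H r mr.
  apply: (ae_imply2 _ (ae_imply2 (fun x => @conj _ _) us1 uks) kK) => x [us' uks'] kK'.
  exists (u x + k x), (u x); split => //.
  by rewrite addrAC subrr add0r; exact: le_trans kK' Kdl.
have iB : mu.-integrable setT (EFin \o (fun x => f x (u x + k x) * v x - f x (u x) * v x)).
  exact: (@integrableB _ _ _ mu setT measurableT _ _ i1 i2).
rewrite -RintegralB//; apply: le_trans (le_normr_Rintegral _ iB) _ => //.
have ir' : mu.-integrable setT (EFin \o (fun x => L * `|r x|)).
  exact: (@integrableZl _ _ _ mu setT measurableT L _ (integrable_norm ir)).
apply: (@le_trans _ _ (\int[mu]_x (L * `|r x|))).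
  apply: ae_le_Rintegral ir' _; first exact: (integrable_norm iB).
  by apply: ae_imply vL => x vL; rewrite -mulrBl normrM mulrC ler_wpM2r.
by rewrite RintegralZl//; [rewrite mulrC ler_wpM2r|exact: (integrable_norm ir)].
Qed.

End caratheodory.

(** * The functional *)

Lemma cancel_algebra (R : realFieldType) (e l k t : R) : l != 0 -> k != 0 ->
  e / 2 / (l * k) * (k * t) = e / 2 * t / l.
Proof. by move=> l0 k0; field; rewrite l0 k0. Qed.

Section functional.
Context {R : realType} {N : nat}.
Local Notation RR := (measurableTypeR R).
Local Notation mu := (borel_lebesgue_rV R N).
Variables (p : R) (a : 'rV[RR]_N -> R) (am aM : R).
Hypotheses (p1 : 1 < p) (ma : measurable_fun [set: 'rV[RR]_N] a).
Hypotheses (am0 : 0 < am) (ama : forall x, am <= a x) (aaM : forall x, a x <= aM).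
Hypotheses (N0 : (0 < N)%N) (Np : N%:R < p).
Variables (f : 'rV[RR]_N -> R -> R) (h : R -> 'rV[RR]_N -> R).
Hypotheses (mf : forall t, measurable_fun [set: 'rV[RR]_N] (f ^~ t)) (cf : forall x, continuous (f x)).
Hypotheses (ih : forall s : R, 0 < s -> mu.-integrable setT (EFin \o h s)).
Hypotheses (fh : forall (s : R) x (t : R), 0 < s -> `|t| <= s -> `|f x t| <= h s x).
Variable lam : R.
Hypothesis lam0 : 0 < lam.

Local Notation V := (@field_pair R N).
Local Notation W := (in_sobolev (N := N) p).
Local Notation nrm := (energy_norm p a).
Local Notation F := (primitive f).
Implicit Types (u v w k : V) (M e : R).

Definition functional w := energy p a w / p - lam * potential f w.1.
Definition functional_diff w v :=
  flux p a w v - lam * \int[mu]_x (f x (w.1 x) * v.1 x).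
Local Notation J := functional.
Local Notation D := functional_diff.

Let p0 : 0 < p. Proof. exact: lt_trans p1. Qed.

Definition sup_embedding := sup_const (N := N) p am `^ p^-1.
Local Notation kap := sup_embedding.

Let kap0 : 0 < kap.
Proof. by apply: powR_gt0; exact: sup_const_gt0. Qed.

Let nrm0 w : 0 <= nrm w. Proof. exact: energy_norm_ge0. Qed.

Lemma sup_embedding_le w M : W w -> nrm w <= M -> {ae mu, forall x, `|w.1 x| <= kap * M}.
Proof.
move=> Ww wM; have := energy_sup_bound p1 ma am0 ama aaM Np N0 Ww.
by apply: ae_imply => x /le_trans; apply; rewrite ler_pM2l.
Qed.

Let mW w : W w -> measurable_fun [set: 'rV[RR]_N] w.1. Proof. by case. Qed.

Let int_nonlin w v : W w -> W v ->
  mu.-integrable setT (EFin \o (fun x => f x (w.1 x) * v.1 x)).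
Proof.
move=> Ww Wv; have s0 : 0 < kap * (nrm w + 1) by rewrite mulr_gt0// ltr_wpDl.
apply: (nonlinearity_integrable mf cf ih fh s0 (mW Ww) (mW Wv)).
  by apply: sup_embedding_le => //; rewrite lerDl.
exact: sup_embedding_le (lexx _).
Qed.

(** Meant for a difference g of two members of a bounded sequence: the weight depends on M alone
    while g tends to 0. *)
Lemma nonlinearity_le w (g : 'rV[RR]_N -> R) M : 0 < M -> W w -> nrm w <= M ->
  measurable_fun [set: 'rV[RR]_N] g ->
  mu.-integrable setT (EFin \o (fun x => h (kap * M) x * `|g x|)) ->
  `|\int[mu]_x (f x (w.1 x) * g x)| <= \int[mu]_x (h (kap * M) x * `|g x|).
Proof.
move=> M0 Ww wM mg ig; have s0 : 0 < kap * M by rewrite mulr_gt0.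
have le : {ae mu, forall x, `|f x (w.1 x) * g x| <= h (kap * M) x * `|g x|}.
  apply: ae_imply (sup_embedding_le Ww wM) => x wx.
  by rewrite normrM ler_wpM2r// fh.
have iF : mu.-integrable setT (EFin \o (fun x => f x (w.1 x) * g x)).
  apply: (ae_le_integrable _ ig le); apply: measurable_funM => //.
  by apply: measurable_superposition => //; exact: mW.
apply: le_trans (le_normr_Rintegral _ iF) _ => //.
exact: ae_le_Rintegral (integrable_norm iF) ig le.
Qed.

Lemma functional_diff_linear s t u v w : W u -> W v -> W w ->
  D u (s *: v + t *: w) = s * D u v + t * D u w.
Proof.
move=> Wu Wv Ww; rewrite /D (fluxD p1 ma am0 ama aaM)//.
have i1 := int_nonlin Wu Wv; have i2 := int_nonlin Wu Ww.
have -> : \int[mu]_x (f x (u.1 x) * (s *: v + t *: w).1 x) =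
    s * \int[mu]_x (f x (u.1 x) * v.1 x) + t * \int[mu]_x (f x (u.1 x) * w.1 x).
  rewrite -RintegralZl// -RintegralZl// -RintegralD//.
  - by apply: eq_Rintegral => x _; rewrite -[(s *: v + t *: w).1 x]/(s * v.1 x + t * w.1 x) mulrDr mulrCA [in X in _ + X]mulrCA.
  - exact: (@integrableZl _ _ _ mu setT measurableT s _ i1).
  - exact: (@integrableZl _ _ _ mu setT measurableT t _ i2).
by rewrite mulrDr opprD !mulrBr [lam * (s * _)]mulrCA [lam * (t * _)]mulrCA addrACA.
Qed.

Let D_bound M : exists2 B, 0 <= B & forall u v, W u -> W v -> nrm u <= M ->
  `|D u v| <= B * nrm v.
Proof.
pose M1 := Num.max 1 M; have M10 : 0 < M1 by rewrite lt_max ltr01.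
have s0 : 0 < kap * M1 by rewrite mulr_gt0.
have I0 : 0 <= \int[mu]_x h (kap * M1) x.
  by apply: Rintegral_ge0 => x _; apply: le_trans (fh x s0 (_ : `|0| <= _)) => //; rewrite normr0 ltW.
exists (M1 `^ (p - 1) + lam * (kap * \int[mu]_x h (kap * M1) x)).
  by rewrite addr_ge0 ?powR_ge0// !mulr_ge0// ltW.
move=> u v Wu Wv uM; have uM1 : nrm u <= M1 by rewrite le_max uM orbT.
have h1 := flux_le p1 ma am0 ama aaM Wu Wv M10 uM1.
have ihM : mu.-integrable setT (EFin \o (fun x => kap * nrm v * h (kap * M1) x)).
  exact: (@integrableZl _ _ _ mu setT measurableT (kap * nrm v) _ (ih s0)).
have le : {ae mu, forall x, `|f x (u.1 x) * v.1 x| <= kap * nrm v * h (kap * M1) x}.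
  apply: ae_imply2 _ (sup_embedding_le Wu uM1) (sup_embedding_le Wv (lexx _)) => x ux vx.
  by rewrite normrM mulrC ler_pM// fh.
have iF := int_nonlin Wu Wv.
have h2 : `|\int[mu]_x (f x (u.1 x) * v.1 x)| <= kap * nrm v * \int[mu]_x h (kap * M1) x.
  apply: le_trans (le_normr_Rintegral _ iF) _ => //.
  rewrite -RintegralZl//; last exact: ih.
  exact: ae_le_Rintegral (integrable_norm iF) ihM le.
rewrite /D; apply: le_trans (ler_normB _ _) _; rewrite normrM (gtr0_norm lam0) mulrDl.
apply: lerD => //; rewrite -mulrA ler_pM2l// mulrAC; exact: h2.
Qed.

Lemma functional_differentiable M e : 0 < e -> exists2 d, 0 < d &
  forall u k, W u -> W k -> nrm u <= M -> nrm k <= d ->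
    `|J (u + k) - J u - D u k| <= e * nrm k.
Proof.
move=> e0; pose M1 := Num.max 1 M; have M10 : 0 < M1 by rewrite lt_max ltr01.
have s0 : 0 < kap * M1 by rewrite mulr_gt0.
have e10 : 0 < p * (e / 2) by rewrite mulr_gt0// divr_gt0.
have lk0 : 0 < lam * kap by rewrite mulr_gt0.
(* The sup bound is kap times the norm and the potential is multiplied by lam; dividing by both
   leaves e/2. *)
have e20 : 0 < e / 2 / (lam * kap) by rewrite !divr_gt0.
have [d1 d10 H1] := energy_differentiable p1 ma am0 ama aaM M1 e10.
have [d2 d20 H2] := potential_differentiable mf cf ih fh s0 e20.
exists (Num.min d1 (d2 / kap)); first by rewrite lt_min d10 divr_gt0.
move=> u k Wu Wk uM; rewrite le_min => /andP[kd1 kd2].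
have uM1 : nrm u <= M1 by rewrite le_max uM orbT.
have h1 := H1 u k Wu Wk uM1 kd1.
have h2 : `|potential f (u + k).1 - potential f u.1 - \int[mu]_x (f x (u.1 x) * k.1 x)| <=
    e / 2 / (lam * kap) * (kap * nrm k).
  apply: H2 => //; [by rewrite mulr_ge0// ltW|exact: mW|exact: mW| | |].
  - exact: sup_embedding_le.
  - exact: sup_embedding_le.
  - by rewrite mulrC -ler_pdivlMr.
have -> : J (u + k) - J u - D u k = (energy p a (u + k) - energy p a u - p * flux p a u k) / p -
    lam * (potential f (u + k).1 - potential f u.1 - \int[mu]_x (f x (u.1 x) * k.1 x)).
  by rewrite /J /D; move: (potential f _) (potential f _) (energy p a _) (energy p a _) (flux p a _ _) (\int[_]_x _) => *; field; rewrite gt_eqF.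
apply: le_trans (ler_normB _ _) _; rewrite !normrM (gtr0_norm lam0) normfV (gtr0_norm p0).
rewrite (splitr e) mulrDl; apply: lerD.
  by rewrite ler_pdivrMr// (le_trans h1)// -mulrA [leRHS]mulrC.
rewrite mulrC -ler_pdivlMr//; apply: le_trans h2 _.
by rewrite cancel_algebra ?gt_eqF.
Qed.

Lemma functional_continuous M e : 0 < e -> exists2 d, 0 < d &
  forall u k, W u -> W k -> nrm u <= M -> nrm k <= d -> `|J (u + k) - J u| <= e.
Proof.
move=> e0; have [d d0 H] := functional_differentiable M ltr01.
have [B B0 HB] := D_bound M.
have B10 : 0 < B + 1 by rewrite ltr_wpDl.
exists (Num.min d (e / (B + 1))); first by rewrite lt_min d0 divr_gt0.
move=> u k Wu Wk uM; rewrite le_min => /andP[kd ke].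
rewrite -(subrK (D u k) (J (u + k) - J u)); apply: le_trans (ler_normD _ _) _.
apply: le_trans (lerD (H u k Wu Wk uM kd) (HB u k Wu Wk uM)) _.
by rewrite -mulrDl addrC mulrC -ler_pdivlMr.
Qed.

Lemma functional_diff_continuous M e : 0 < e -> exists2 d, 0 < d &
  forall u k v, W u -> W k -> W v -> nrm u <= M -> nrm k <= d ->
    `|D (u + k) v - D u v| <= e * nrm v.
Proof.
move=> e0; pose M1 := Num.max 1 M; have M10 : 0 < M1 by rewrite lt_max ltr01.
have s0 : 0 < kap * M1 by rewrite mulr_gt0.
have e10 : 0 < e / 2 by rewrite divr_gt0.
have lk0 : 0 < lam * kap by rewrite mulr_gt0.
have e20 : 0 < e / 2 / (lam * kap) by rewrite !divr_gt0.
have [d1 d10 H1] := flux_continuous p1 ma am0 ama aaM M1 e10.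
have [d2 d20 H2] := nonlinearity_continuous mf cf ih fh s0 e20.
exists (Num.min d1 (d2 / kap)); first by rewrite lt_min d10 divr_gt0.
move=> u k v Wu Wk Wv uM; rewrite le_min => /andP[kd1 kd2].
have uM1 : nrm u <= M1 by rewrite le_max uM orbT.
have h1 := H1 u k v Wu Wk Wv uM1 kd1.
have h2 : `|\int[mu]_x (f x ((u + k).1 x) * v.1 x) - \int[mu]_x (f x (u.1 x) * v.1 x)| <=
    e / 2 / (lam * kap) * (kap * nrm v).
  apply: (H2 u.1 k.1 v.1 (kap * nrm k)); [by rewrite mulr_ge0// ltW|exact: mW|exact: mW|exact: mW| | | |].
  - exact: sup_embedding_le.
  - exact: sup_embedding_le.
  - by rewrite mulrC -ler_pdivlMr.
  - exact: sup_embedding_le.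
have -> : D (u + k) v - D u v = (flux p a (u + k) v - flux p a u v) -
    lam * (\int[mu]_x (f x ((u + k).1 x) * v.1 x) - \int[mu]_x (f x (u.1 x) * v.1 x)).
  by rewrite /D mulrBr opprB addrACA addrA [in RHS]opprB addrA addrAC -!addrA; congr (_ + _); rewrite addrCA.
apply: le_trans (ler_normB _ _) _; rewrite normrM (gtr0_norm lam0).
rewrite (splitr e) mulrDl; apply: lerD => //.
rewrite mulrC -ler_pdivlMr//; apply: le_trans h2 _.
by rewrite cancel_algebra ?gt_eqF.
Qed.

Lemma functional_bounded M : exists B, forall u, W u -> nrm u <= M -> `|J u| <= B.
Proof.
pose M1 := Num.max 1 M; have M10 : 0 < M1 by rewrite lt_max ltr01.
have s0 : 0 < kap * M1 by rewrite mulr_gt0.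
have [B HB] := potential_bounded mf cf ih fh s0.
exists (M1 `^ p / p + lam * B) => u Wu uM.
have uM1 : nrm u <= M1 by rewrite le_max uM orbT.
rewrite /J; apply: le_trans (ler_normB _ _) _; rewrite !normrM (gtr0_norm lam0) normfV (gtr0_norm p0).
apply: lerD; last by rewrite ler_pM2l// HB//; [exact: mW|exact: sup_embedding_le].
rewrite ler_pM2r ?invr_gt0// -(energy_norm_powR p1 am0 ama) ger0_norm ?powR_ge0//.
by rewrite ge0_ler_powR ?nnegrE ?(ltW p0)// ltW.
Qed.

Hypothesis F_sub : forall eps : R, 0 < eps -> exists2 delta : R, 0 < delta &
  {ae mu, forall x, forall t, delta < `|t| -> `|F x t| <= eps * `|t| `^ p}.

(** Where |u| > d, sublinearity of F relative to |t|^p absorbs the potential into half of the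
    energy; where |u| <= d it is at most d h_d, of fixed integral. *)
Lemma functional_coercive L : exists M, forall u, W u -> J u <= L -> nrm u <= M.
Proof.
(* With this value lam times the large part is at most am/(2p) times the integral of |u|^p, hence at
   most half of energy / p. *)
have e0 : 0 < am / (2 * p * lam) by rewrite divr_gt0// !mulr_gt0.
have [d d0 Hd] := F_sub e0.
pose C := d * \int[mu]_x h d x.
pose K := Num.max 0 (2 * p * (L + lam * C)).
exists (K `^ p^-1) => u Wu JL.
have [m1 m2 i1 i2 _] := Wu.
apply: (energy_norm_le p1 am0 ama); first exact: powR_ge0.
rewrite -powRrM mulVf ?gt_eqF// powRr1; last by rewrite le_max lexx.
suff : energy p a u <= 2 * p * (L + lam * C) by move=> ?; rewrite le_max orbC; apply/orP; left.
have iF : mu.-integrable setT (EFin \o (fun x => F x (u.1 x))).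
  have s0 : 0 < kap * (nrm u + 1) by rewrite mulr_gt0// ltr_wpDl.
  apply: (primitive_integrable mf cf ih fh s0 m1).
  by apply: sup_embedding_le => //; rewrite lerDl.
have j1 : mu.-integrable setT (EFin \o (fun x => am / (2 * p * lam) * `|u.1 x| `^ p)).
  exact: (@integrableZl _ _ _ mu setT measurableT (am / (2 * p * lam)) _ i1).
have j2 : mu.-integrable setT (EFin \o (fun x => d * h d x)).
  exact: (@integrableZl _ _ _ mu setT measurableT d _ (ih d0)).
have j3 : mu.-integrable setT (EFin \o (fun x => am * `|u.1 x| `^ p)).
  exact: (@integrableZl _ _ _ mu setT measurableT am _ i1).
have hd0 x : 0 <= h d x.
  by apply: le_trans (fh x d0 (_ : `|0| <= d)) => //; rewrite normr0 ltW.
have h1 : potential f u.1 <= am / (2 * p * lam) * \int[mu]_x `|u.1 x| `^ p + C.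
  rewrite /C -RintegralZl// -RintegralZl//; last exact: ih.
  rewrite -RintegralD//; apply: ae_le_Rintegral => //.
    exact: (@integrableD _ _ _ mu setT measurableT _ _ j1 j2).
  apply: ae_imply Hd => x Hx; apply: le_trans (ler_norm _) _.
  have [ud|ud] := ltP d `|u.1 x|.
    by apply: le_trans (Hx _ ud) _; rewrite lerDl mulr_ge0// ltW.
  apply: (@le_trans _ _ (d * h d x)); last by rewrite lerDr mulr_ge0 ?powR_ge0// ltW.
  by apply: (primitive_le (@cf x) _ ud) => t td; exact: fh.
have h2 : am * \int[mu]_x `|u.1 x| `^ p <= energy p a u.
  rewrite -RintegralZl//; apply: le_Rintegral => //.
    exact: (energy_density_integrable ma am0 ama aaM Wu).
  by move=> x _; rewrite /energy_density -[leLHS]add0r lerD ?powR_ge0// ler_wpM2r ?powR_ge0.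
clear K; clearbody C; move: JL; rewrite /J; move: h1 h2.
move: (energy p a u) (potential f u.1) (\int[mu]_x `|u.1 x| `^ p) C => E P I C0 h1 h2 JL.
have h3 : lam * P <= am * I / (2 * p) + lam * C0.
  apply: le_trans (ler_wpM2l (ltW lam0) h1) _; rewrite mulrDr lerD2r le_eqVlt; apply/orP; left; apply/eqP.
  by field; rewrite !gt_eqF.
have h4 : am * I / (2 * p) <= E / (2 * p) by rewrite ler_pM2r// invr_gt0 mulr_gt0.
have h5 : E / p = E / (2 * p) + E / (2 * p) by field; rewrite gt_eqF.
have : E / (2 * p) <= L + lam * C0 by move: JL h3 h4; rewrite h5; move: (E / (2 * p)) (am * I / (2 * p)) (lam * P) (lam * C0) => *; lra.
by rewrite ler_pdivrMr ?mulr_gt0// mulrC.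
Qed.

End functional.

(** With t_k the geometric tail 2 C / 2^k, a - t is nondecreasing and a + t nonincreasing; monotone
    convergence then applies to a - t. *)
Lemma geometric_cvg (R : realType) (a : nat -> R) (C : R) :
  (forall k, `|a k.+1 - a k| <= C / 2 ^+ k) -> cvgn a.
Proof.
move=> aC; pose t (k : nat) : R := 2 * C * 2^-1 ^+ k.
have tS k : t k.+1 = t k - C / 2 ^+ k.
  by rewrite /t exprS exprVn; move: (2 ^+ k)^-1 => X; field.
have ndb : nondecreasing_seq (fun k => a k - t k).
  apply/nondecreasing_seqP => k; rewrite tS.
  by have := aC k; rewrite ler_norml => /andP[+ _]; move: (C / _) (a _) (a _) (t k) => X Y Z T; lra.
have nia : nonincreasing_seq (fun k => a k + t k).
  apply/nonincreasing_seqP => k; rewrite tS.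
  by have := aC k; rewrite ler_norml => /andP[_]; move: (C / _) (a _) (a _) (t k) => X Y Z T; lra.
have C0 : 0 <= C by have := le_trans (normr_ge0 _) (aC 0%N); rewrite expr0 divr1.
have cb : cvgn (fun k => a k - t k).
  apply: nondecreasing_is_cvgn => //; exists (a 0%N + t 0%N) => _ [k _ <-].
  apply: le_trans (nia 0%N k (leq0n _)); rewrite lerD2l -subr_ge0 opprK.
  by rewrite addr_ge0// !mulr_ge0// exprn_ge0.
have ct : cvgn t by apply/cvg_ex; exists 0; apply: (@cvg_geometric R (2 * C) 2^-1); rewrite ger0_norm// invf_lt1// ltr1n.
rewrite (_ : a = (fun k => a k - t k) \+ t); first exact: is_cvgD.
by apply/funext => k /=; rewrite subrK.
Qed.

(** * Almost everywhere limits of rapidly converging sequences *)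

Section ae_convergence.
Context {R : realType} {d} {T : measurableType d} (mu : {measure set T -> \bar R}).

Lemma ae_cvg_measurable (v : nat -> T -> R) : (forall n, measurable_fun [set: T] (v n)) ->
  {ae mu, forall x, cvgn (fun n => v n x)} ->
  exists2 u : T -> R, measurable_fun [set: T] u & {ae mu, forall x, v n x @[n --> \oo] --> u x}.
Proof.
move=> mv [B [mB B0 sub]].
pose w n x := v n x * \1_(~` B) x.
have mw n : measurable_fun [set: T] (w n).
  by apply: measurable_funM => //; apply: measurable_indic; exact: measurableC.
have wE x : ~ B x -> (fun n => w n x) = (fun n => v n x).
  by move=> xB; apply/funext => n; rewrite /w [\1__ x]indicE mem_set ?mulr1.
have cw x : cvgn (fun n => w n x).
  have [xB|xB] := pselect (B x).
    rewrite (_ : (fun n => w n x) = cst 0); first exact: is_cvg_cst.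
    by apply/funext => n; rewrite /w [\1__ x]indicE memNset ?mulr0//= => /(_ xB).
  by rewrite wE//; apply: contrapT => nc; apply: xB; exact: sub.
exists (fun x => lim ((fun n => w n x) @ \oo)).
  by apply: (@measurable_fun_cvg _ _ R setT w) => // x _; exact: cw.
exists B; split => // x /=; apply: contra_notP => xB.
by have := cw x; rewrite wE.
Qed.

Lemma ae_fatou (g_ : nat -> T -> R) (g : T -> R) (e : \bar R) :
  (forall n, measurable_fun [set: T] (g_ n)) -> measurable_fun [set: T] g ->
  (forall n x, 0 <= g_ n x) -> (forall x, 0 <= g x) ->
  {ae mu, forall x, g_ n x @[n --> \oo] --> g x} ->
  (forall n, (\int[mu]_x (g_ n x)%:E <= e)%E) -> (\int[mu]_x (g x)%:E <= e)%E.
Proof.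
move=> mg_ mg g_0 g0 cg ge.
have mE n : measurable_fun [set: T] (fun x => (g_ n x)%:E) by exact/measurable_EFinP.
apply: (@le_trans _ _ (\int[mu]_x limn_einf (fun n => (g_ n x)%:E))%E).
  apply: ae_ge0_le_integral => //.
  - by move=> x _; rewrite lee_fin.
  - exact/measurable_EFinP.
  - by move=> x _; rewrite limn_einf_lim; apply: lime_ge; [exact: is_cvg_einfs|];
      apply: nearW => n; apply: le_ereal_inf_tmp => _ [m /= _ <-]; rewrite lee_fin.
  - rewrite (_ : (fun x => _) = fun x => - limn_esup (fun n => - (g_ n x)%:E))%E; last first.
      by apply/funext => x; rewrite -limn_einfN; congr limn_einf; apply/funext => n; rewrite /comp oppeK.
    apply: measurableT_comp => //; apply: measurable_fun_limn_esup => // n.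
    exact: measurableT_comp.
  - move: cg; apply: filterS => x cg _.
    have cE : (g_ n x)%:E @[n --> \oo] --> (g x)%:E by apply: cvg_EFin => //; exact: nearW.
    rewrite is_cvg_limn_einfE; last by apply/cvg_ex; exists (g x)%:E.
    by move/cvg_lim : cE => ->.
apply: le_trans (fatou mu measurableT mE _) _; first by move=> n x _; rewrite lee_fin.
rewrite limn_einf_lim; apply: lime_le; first exact: is_cvg_einfs.
apply: nearW => n; apply: le_trans (ge n); apply: ereal_inf_lbound; exists n => //=.
Qed.

(** The series of (2^k g_k)^p has integral at most the sum of 2^-(k+1), so it is finite almost
    everywhere, and each term is bounded by its sum. *)
Lemma ae_geometric (p : R) (g : nat -> T -> R) : 0 < p ->
  (forall k, measurable_fun [set: T] (g k)) -> (forall k x, 0 <= g k x) ->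
  (forall k, (\int[mu]_x (g k x `^ p)%:E <= ((2 ^+ k)^-1 `^ p / 2 ^+ k.+1)%:E)%E) ->
  {ae mu, forall x, exists C, forall k, g k x <= C / 2 ^+ k}.
Proof.
move=> p0 mg g0 gI.
have c0 k : 0 < 2 ^+ k :> R by exact: exprn_gt0.
pose s k x := (((2 ^+ k) * g k x) `^ p)%:E.
have ms k : measurable_fun [set: T] (s k).
  by apply/measurable_EFinP; apply: (measurableT_comp (measurable_powR p)); exact: measurable_funM.
have s0 k x : (0 <= s k x)%E by rewrite lee_fin powR_ge0.
have mS : measurable_fun [set: T] (fun x => \sum_(k <oo) s k x)%E by exact: ge0_emeasurable_sum.
have iS : mu.-integrable setT (fun x => \sum_(k <oo) s k x)%E.
  apply/integrableP; split => //.
  under eq_integral do rewrite gee0_abs ?nneseries_ge0//.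
  rewrite integral_nneseries//.
  apply: (@le_lt_trans _ _ (\sum_(k <oo) (1 / (2 ^ k.+1)%:R)%:E)%E).
    apply: lee_nneseries => [k _ _|k _]; first exact: integral_ge0.
    under eq_integral do rewrite /s powRM// ?(ltW (c0 _))// EFinM.
    rewrite ge0_integralZl//; last 2 first.
    - by apply/measurable_EFinP; apply: (measurableT_comp (measurable_powR p)).
    - by move=> x _; rewrite lee_fin powR_ge0.
    apply: le_trans (lee_wpmul2l _ (gI k)) _; first by rewrite lee_fin powR_ge0.
    rewrite -EFinM lee_fin mulrA -powRM ?invr_ge0 ?(ltW (c0 _))// mulfV ?gt_eqF// powR1.
    by rewrite natrX.
  by apply: le_lt_trans (epsilon_trick0 xpredT ler01) _; exact: ltry.
have := integrable_ae measurableT iS; apply: filterS => x /(_ I) fS.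
exists (fine (\sum_(k <oo) s k x)%E `^ p^-1) => k.
have le : (((2 ^+ k) * g k x) `^ p) <= fine (\sum_(k <oo) s k x)%E.
  rewrite -lee_fin fineK//; apply: le_trans (nneseries_lim_ge k.+1 _) => //.
  by rewrite big_nat_recr//= leeDr// sume_ge0.
rewrite ler_pdivlMr// mulrC.
have q0 : 0 <= 2 ^+ k * g k x by rewrite mulr_ge0// ltW.
have -> : 2 ^+ k * g k x = ((2 ^+ k * g k x) `^ p) `^ p^-1.
  by rewrite -powRrM mulfV ?gt_eqF// powRr1.
by apply: ge0_ler_powR; rewrite ?nnegrE ?powR_ge0 ?invr_ge0 ?(ltW p0)//; exact: le_trans (powR_ge0 _ _) le.
Qed.

End ae_convergence.

Lemma norm_powR_continuous {R : realType} (p : R) : 0 < p -> continuous (fun t : R => `|t| `^ p).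
Proof.
move=> p0 t; have [->|t0] := eqVneq t 0.
  apply/cvgrPdist_le => /= e e0.
  near=> s; rewrite normr0 powR0 ?gt_eqF// sub0r normrN ger0_norm ?powR_ge0//.
  have -> : e = (e `^ p^-1) `^ p by rewrite -powRrM mulVf ?gt_eqF// powRr1// ltW.
  apply: ge0_ler_powR; rewrite ?nnegrE ?powR_ge0// ?(ltW p0)//.
  rewrite -normrN -[- s]add0r; near: s; apply: cvgr_dist_le; first exact: cvg_id.
  exact: powR_gt0.
apply: (@continuous_comp _ _ _ (fun t : R => `|t|) (fun s => s `^ p)); first exact: norm_continuous.
apply/differentiable_continuous/derivable1_diffP/derivable_powR.
by rewrite in_itv/= andbT normr_gt0.
Unshelve. all: by end_near. Qed.

(** * Closedness of W^(1,p) under the energy norm *)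

Section completeness.
Context {R : realType} {N : nat}.
Local Notation RR := (measurableTypeR R).
Local Notation mu := (borel_lebesgue_rV R N).
Variables (p : R) (a : 'rV[RR]_N -> R) (am aM : R).
Hypotheses (p1 : 1 < p) (ma : measurable_fun [set: 'rV[RR]_N] a).
Hypotheses (am0 : 0 < am) (ama : forall x, am <= a x) (aaM : forall x, a x <= aM).
Local Notation V := (@field_pair R N).
Local Notation W := (in_sobolev (N := N) p).
Local Notation ed := (energy_density p a).

Let p0 : 0 < p. Proof. exact: lt_trans p1. Qed.

Lemma energyE (w : V) : W w -> (\int[mu]_x (ed w x)%:E)%E = (energy p a w)%:E.
Proof.
move=> Ww; have iw := energy_density_integrable ma am0 ama aaM Ww.
by rewrite /energy /Rintegral fineK//; exact: integrable_fin_num iw.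
Qed.

Lemma energy_density_integrableP (w : V) (e : R) : measurable_fun [set: 'rV[RR]_N] w.1 ->
  measurable_fun [set: 'rV[RR]_N] w.2 -> (\int[mu]_x (ed w x)%:E <= e%:E)%E ->
  [/\ mu.-integrable setT (EFin \o (fun x => `|w.1 x| `^ p)),
     mu.-integrable setT (EFin \o (fun x => enorm (w.2 x) `^ p)),
     am * \int[mu]_x (`|w.1 x| `^ p) <= e & \int[mu]_x (enorm (w.2 x) `^ p) <= e].
Proof.
move=> m1 m2 we.
have mE : measurable_fun [set: 'rV[RR]_N] (ed w) by exact: measurable_energy_density.
have ie : mu.-integrable setT (EFin \o ed w).
  apply/integrableP; split; first exact/measurable_EFinP.
  have e0 x : 0 <= ed w x by exact: (energy_density_ge0 p am0 ama).
  under eq_integral do rewrite /= (ger0_norm (e0 _)).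
  by apply: le_lt_trans we _; exact: ltry.
have le1 x : am * `|w.1 x| `^ p <= ed w x.
  by rewrite /energy_density -[leLHS]add0r lerD ?powR_ge0// ler_wpM2r ?powR_ge0.
have le2 x : enorm (w.2 x) `^ p <= ed w x.
  by rewrite /energy_density lerDl mulr_ge0 ?powR_ge0//; exact: le_trans (ltW am0) (ama x).
have edle : \int[mu]_x ed w x <= e.
  by rewrite -lee_fin /Rintegral fineK//; exact: integrable_fin_num ie.
have i1 : mu.-integrable setT (EFin \o (fun x => `|w.1 x| `^ p)).
  have i2 : mu.-integrable setT (EFin \o (fun x => am^-1 * ed w x)).
    exact: (@integrableZl _ _ _ mu setT measurableT am^-1 _ ie).
  apply: le_integrable i2 => //.
    apply/measurable_EFinP; apply: (measurableT_comp (measurable_powR p)); exact: measurableT_comp.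
  move=> x _; rewrite /= lee_fin (ger0_norm (powR_ge0 _ _)) (le_trans _ (ler_norm _))//.
  by rewrite ler_pdivlMl.
have i2 : mu.-integrable setT (EFin \o (fun x => enorm (w.2 x) `^ p)).
  apply: le_integrable ie => //.
    by apply/measurable_EFinP; exact: measurable_enorm_powR.
  by move=> x _; rewrite /= lee_fin (ger0_norm (powR_ge0 _ _)) (le_trans _ (ler_norm _)).
split => //; last by apply: le_trans edle; apply: le_Rintegral.
apply: le_trans edle; rewrite -RintegralZl//; apply: le_Rintegral => //.
exact: (@integrableZl _ _ _ mu setT measurableT am _ i1).
Qed.

Lemma energy_density_cvg (v : nat -> V) (w : V) x : (v n).1 x @[n --> \oo] --> w.1 x ->
  (forall i, (v n).2 x ord0 i @[n --> \oo] --> w.2 x ord0 i) ->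
  ed (v n) x @[n --> \oo] --> ed w x.
Proof.
move=> c1 c2; have cp (g : nat -> R) (l : R) : g n @[n --> \oo] --> l -> (forall n, 0 <= g n) -> 0 <= l ->
    g n `^ p @[n --> \oo] --> l `^ p.
  move=> gl g0 l0.
  have := cvg_comp _ _ gl (norm_powR_continuous p0 (x := l)).
  rewrite (ger0_norm l0); apply: cvg_trans; apply: near_eq_cvg; apply: nearW => n.
  by rewrite /= ger0_norm.
apply: cvgD.
  apply: cp; [|by move=> n; exact: enorm_ge0|exact: enorm_ge0].
  rewrite /enorm; apply: continuous_cvg; first exact: sqrt_continuous.
  rewrite /dot; apply: (cvg_big (op := +%R)) => [|i _].
    exact: add_continuous.
  by apply: cvgM.
by apply: cvgMr; apply: cp => //; exact: cvg_norm.
Qed.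

(** Continuity of integration against a test function in L^p: split at |g| = eta, using |g| <= eta
    on the cube or |g| <= eta^(1-p) |g|^p. *)
Lemma test_small (phi : 'rV[R]_N -> R) (e : R) : test_function phi -> 0 < e -> exists2 del : R, 0 < del &
  forall g : 'rV[RR]_N -> R, measurable_fun [set: 'rV[RR]_N] g ->
    mu.-integrable setT (EFin \o (fun x => `|g x| `^ p)) ->
    \int[mu]_x (`|g x| `^ p) <= del ->
    mu.-integrable setT (EFin \o (fun x => g x * phi x)) /\ `|\int[mu]_x (g x * phi x)| <= e.
Proof.
move=> tphi e0; have [K [n phiK]] := test_function_bounded tphi.
pose K1 := Num.max 1 K; have K10 : 0 < K1 by rewrite lt_max ltr01.
have {}phiK x : `|phi x| <= K1 * \1_(cube n) x.
  apply: le_trans (phiK x) _; rewrite ler_wpM2r ?le_max ?lexx ?orbT//.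
have mc := @measurable_cube R N n.
have fc : mu (cube n) \is a fin_num by rewrite ge0_fin_numE ?cube_lty.
pose c := fine (mu (cube n)).
have c0 : 0 <= c by rewrite fine_ge0.
have c10 : 0 < c + 1 by rewrite ltr_wpDl.
pose eta := e / 2 / (K1 * (c + 1)).
have eta0 : 0 < eta by rewrite !divr_gt0// mulr_gt0.
pose A := K1 * eta `^ (1 - p).
have A0 : 0 < A by rewrite mulr_gt0 ?powR_gt0.
exists (e / 2 / A); first by rewrite !divr_gt0.
move=> g mg ig gdel.
have ic : mu.-integrable setT (EFin \o (\1_(cube n) : 'rV[RR]_N -> R)).
  apply/integrableP; split; first by apply/measurable_EFinP; exact: measurable_indic.
  under eq_integral do rewrite /= ger0_norm ?indicE ?ler0n//.
  have := @integral_indic _ _ R mu setT measurableT (cube n) mc.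
  by rewrite setIT /= => ->; exact: cube_lty.
have i1 : mu.-integrable setT (EFin \o (fun x => K1 * eta * \1_(cube n) x)).
  exact: (@integrableZl _ _ _ mu setT measurableT (K1 * eta) _ ic).
have i2 : mu.-integrable setT (EFin \o (fun x => A * `|g x| `^ p)).
  exact: (@integrableZl _ _ _ mu setT measurableT A _ ig).
have i3 : mu.-integrable setT (EFin \o (fun x => K1 * eta * \1_(cube n) x + A * `|g x| `^ p)).
  exact: (@integrableD _ _ _ mu setT measurableT _ _ i1 i2).
have le x : `|g x * phi x| <= K1 * eta * \1_(cube n) x + A * `|g x| `^ p.
  rewrite normrM; apply: le_trans (ler_wpM2l (normr_ge0 _) (phiK x)) _.
  have i0 : 0 <= \1_(cube n) x :> R by rewrite [\1__ x]indicE ler0n.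
  have i1' : \1_(cube n) x <= 1 :> R by rewrite [\1__ x]indicE lern1 leq_b1.
  have [ge|eg] := leP `|g x| eta.
    rewrite mulrCA -mulrA -[leLHS]addr0 lerD//; last by rewrite mulr_ge0 ?powR_ge0// ltW.
    by rewrite ler_pM2l// ler_wpM2r.
  apply: (@le_trans _ _ (A * `|g x| `^ p)); last first.
    by rewrite lerDr; apply: mulr_ge0 => //; apply: mulr_ge0; exact: ltW.
  rewrite mulrCA /A -mulrA ler_pM2l//.
  apply: (@le_trans _ _ `|g x|); first by rewrite ler_piMr.
  have g0 : 0 < `|g x| by exact: lt_trans eg.
  rewrite -[leLHS]powRr1// -{1}(subrK p 1) powRD; last by apply/implyP => _; rewrite gt_eqF.
  rewrite ler_pM2r ?powR_gt0// -opprB !powRN lef_pV2 ?posrE ?powR_gt0//.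
  by apply: ge0_ler_powR; rewrite ?nnegrE ?subr_ge0 ?ltW.
have mgp : measurable_fun [set: 'rV[RR]_N] (fun x => g x * phi x).
  by apply: measurable_funM => //; exact: test_function_measurable.
have igp : mu.-integrable setT (EFin \o (fun x => g x * phi x)).
  apply: le_integrable i3 => //; first exact/measurable_EFinP.
  by move=> x _; rewrite /= lee_fin (le_trans (le x))// ler_norm.
split => //; apply: le_trans (le_normr_Rintegral _ igp) _ => //.
apply: (@le_trans _ _ (K1 * eta * c + A * \int[mu]_x (`|g x| `^ p))).
  have -> : K1 * eta * c = \int[mu]_x (K1 * eta * \1_(cube n) x).
    rewrite RintegralZl//; congr (_ * _); rewrite /c /Rintegral.
    have := @integral_indic _ _ R mu setT measurableT (cube n) mc.
    by rewrite setIT => <-.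
  rewrite -RintegralZl// -RintegralD//; apply: le_Rintegral => //.
  exact: (integrable_norm igp).
rewrite (splitr e); apply: lerD.
  have -> : K1 * eta * c = e / 2 * (c / (c + 1)).
    by rewrite /eta; clearbody c K1; field; rewrite !gt_eqF.
  by rewrite ger_pMr ?divr_gt0// ler_pdivrMr// mul1r lerDl.
by rewrite mulrC -ler_pdivlMr.
Qed.

(** The limit u of the functions is given, so only the gradient needs a limit: along a rapidly
    Cauchy subsequence the gradients converge almost everywhere. Fatou bounds the energy of the
    limit, and [test_small] carries the weak gradient identity over. *)
Lemma sobolev_complete (v : nat -> V) (u : 'rV[RR]_N -> R) (M : R) : (forall n, W (v n)) ->
  (forall n, energy p a (v n) <= M) ->
  (forall e, 0 < e -> exists n0, forall n m, (n0 <= n)%N -> (n0 <= m)%N ->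
    energy p a (v n - v m) <= e) ->
  measurable_fun [set: 'rV[RR]_N] u ->
  {ae mu, forall x, (v n).1 x @[n --> \oo] --> u x} ->
  exists2 w, W w & forall e, 0 < e -> exists n0, forall n, (n0 <= n)%N -> energy p a (v n - w) <= e.
Proof.
move=> Wv vM cauchy mu_ cu.
have c0 k : 0 < (2 ^+ k)^-1 `^ p / 2 ^+ k.+1 :> R.
  by rewrite divr_gt0 ?powR_gt0 ?invr_gt0 ?exprn_gt0.
have [n0 Hn0] := choice (fun k => cauchy _ (c0 k)).
(* At least n0(j) for all j <= k and at least k: consecutive indices both pass the k-th Cauchy
   threshold, and the indices tend to infinity. *)
pose psi k := (\sum_(j < k.+1) n0 j + k)%N.
have psi_ge k j : (j <= k)%N -> (n0 j <= psi k)%N.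
  move=> jk; rewrite /psi (bigD1 (Ordinal (jk : (j < k.+1)%N)))//= -addnA; exact: leq_addr.
have psik k : (k <= psi k)%N by exact: leq_addl.
pose s k := v (psi k).
have Ws k : W (s k) by exact: Wv.
have ms2 k : measurable_fun [set: 'rV[RR]_N] (s k).2 by have [] := Ws k.
have ms1 k : measurable_fun [set: 'rV[RR]_N] (s k).1 by have [] := Ws k.
have geo : {ae mu, forall x, exists C, forall k, enorm ((s k.+1 - s k).2 x) <= C / 2 ^+ k}.
  apply: (@ae_geometric R _ _ mu p (fun k x => enorm ((s k.+1 - s k).2 x)) p0).
  - by move=> k; have [_ m2 _ _ _] := sobolevB p1 (Ws k.+1) (Ws k); exact: measurable_enorm.
  - by move=> k x; exact: enorm_ge0.
  - move=> k; apply: (@le_trans _ _ (energy p a (s k.+1 - s k))%:E); last first.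
      by rewrite lee_fin; apply: Hn0; apply: psi_ge.
    have Wd := sobolevB p1 (Ws k.+1) (Ws k); have [d1 d2 _ _ _] := Wd.
    rewrite -energyE//; apply: ge0_le_integral => //.
    + by move=> x _; rewrite lee_fin powR_ge0.
    + by apply/measurable_EFinP; exact: measurable_enorm_powR.
    + by apply/measurable_EFinP; exact: measurable_energy_density.
    + move=> x _; rewrite lee_fin /energy_density lerDl mulr_ge0 ?powR_ge0//.
      exact: le_trans (ltW am0) (ama x).
have /choice[G HG] : forall i : 'I_N, exists g : 'rV[RR]_N -> R, measurable_fun [set: 'rV[RR]_N] g /\
    {ae mu, forall x, (s k).2 x ord0 i @[k --> \oo] --> g x}.
  move=> i; have [|g mg cg] := @ae_cvg_measurable R _ _ mu (fun k x => (s k).2 x ord0 i) (fun k => measurable_coord i (ms2 k)).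
    apply: ae_imply geo => x [C HC]; apply: (@geometric_cvg _ _ C) => k.
    apply: le_trans (HC k); have := coord_le_enorm ((s k.+1 - s k).2 x) i.
    by rewrite -[(s k.+1 - s k).2 x]/((s k.+1).2 x - (s k).2 x) !mxE.
  by exists g.
pose w : V := (u, fun x => \row_i G i x).
have mw2 : measurable_fun [set: 'rV[RR]_N] w.2 by apply: measurable_row => i; have [] := HG i.
have cG : {ae mu, forall x, forall i, (s k).2 x ord0 i @[k --> \oo] --> w.2 x ord0 i}.
  have H i : {ae mu, forall x, (s k).2 x ord0 i @[k --> \oo] --> w.2 x ord0 i}.
    by have [_] := HG i; apply: ae_imply => x; rewrite mxE.
  by apply: filter_forall => i; exact: H.
have psioo : psi n @[n --> \oo] --> \oo.
  by move=> A [n _ An]; exists n => // k /= nk; apply: An; exact: leq_trans (psik k).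
have cs : {ae mu, forall x, (s k).1 x @[k --> \oo] --> u x}.
  by apply: ae_imply cu => x cx; exact: (cvg_comp _ _ psioo cx).
have ed0 z x : 0 <= ed z x by exact: (energy_density_ge0 p am0 ama).
have wM : (\int[mu]_x (ed w x)%:E <= M%:E)%E.
  apply: (@ae_fatou R _ _ mu (fun k => ed (s k))) => //.
  - by move=> n; apply: measurable_energy_density.
  - exact: measurable_energy_density.
  - apply: (ae_imply2 _ cs cG) => x c1 c2; exact: energy_density_cvg.
  - by move=> n; rewrite energyE ?lee_fin; [exact: vM|exact: Ws].
have [iw1 iw2 _ _] := energy_density_integrableP (w := w) mu_ mw2 wM.
have mdw n : measurable_fun [set: 'rV[RR]_N] (v n - w).1 /\ measurable_fun [set: 'rV[RR]_N] (v n - w).2.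
  have [m1 m2 _ _ _] := Wv n; split; first exact: measurable_funB.
  rewrite (_ : (v n - w).2 = fun x => \row_i ((v n).2 x ord0 i - G i x)); last first.
    by apply/funext => x; apply/rowP => i; rewrite -[(v n - w).2 x]/((v n).2 x - w.2 x) !mxE.
  apply: measurable_row => i; apply: measurable_funB; [exact: measurable_coord|by have [] := HG i].
(* Fatou with n fixed, along a tail of the subsequence, turns the Cauchy bound into a bound on the
   distance to the limit. *)
have lim e : 0 < e -> exists n1, forall n, (n1 <= n)%N -> (\int[mu]_x (ed (v n - w) x)%:E <= e%:E)%E.
  move=> e0; have [n1 Hn1] := cauchy _ e0; exists n1 => n n1n.
  have [md1 md2] := mdw n.
  apply: (@ae_fatou R _ _ mu (fun k => ed (v n - s (k + n1)%N))) => //.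
  - by move=> k; have [d1 d2 _ _ _] := sobolevB p1 (Wv n) (Ws (k + n1)%N); exact: measurable_energy_density.
  - exact: measurable_energy_density.
  - apply: (ae_imply2 _ cs cG) => x c1 c2; apply: energy_density_cvg.
      by apply: cvgB; [exact: cvg_cst|rewrite (cvg_shiftn n1 (fun k => (s k).1 x) _)].
    move=> i; rewrite -[(v n - w).2 x]/((v n).2 x - w.2 x).
    have -> : ((v n).2 x - w.2 x) ord0 i = (v n).2 x ord0 i - w.2 x ord0 i by rewrite !mxE.
    rewrite (_ : (fun k => _) = fun k => (v n).2 x ord0 i - (s (k + n1)%N).2 x ord0 i); last first.
      by apply/funext => k; rewrite -[(v n - s (k + n1)%N).2 x]/((v n).2 x - (s (k + n1)%N).2 x) !mxE.
    by apply: cvgB; [exact: cvg_cst|rewrite (cvg_shiftn n1 (fun k => (s k).2 x ord0 i) _)].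
  - move=> k; rewrite energyE; last exact: sobolevB.
    by rewrite lee_fin; apply: Hn1 => //; apply: leq_trans (psik _); exact: leq_addl.
have iG i : mu.-integrable setT (EFin \o (fun x => `|w.2 x ord0 i| `^ p)) by exact: coord_integrable.
have Ww : W w.
  split => // i phi tphi.
  have tp := test_function_partial i tphi.
  have cubeU : forall n, mu.-integrable (cube n) (EFin \o u).
    by move=> n; apply: (@integrable_powR_bounded _ _ p) => //; [exact: ltW|exact: measurable_cube|exact: cube_lty].
  have cubeG : forall n, mu.-integrable (cube n) (EFin \o (fun x => w.2 x ord0 i)).
    by move=> n; apply: (@integrable_powR_bounded _ _ p) => //; [exact: ltW|exact: measurable_coord|exact: measurable_cube|exact: cube_lty].
  apply/eqP; rewrite -subr_eq0 opprK -normr_le0; apply/ler_addgt0Pr => e e0; rewrite add0r.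
  have e20 : 0 < e / 2 by rewrite divr_gt0.
  have [d1 d10 H1] := test_small tp e20.
  have [d2 d20 H2] := test_small tphi e20.
  have [n Hn] := lim (Num.min (am * d1) d2) ltac:(by rewrite lt_min d20 mulr_gt0).
  have {Hn} := Hn n (leqnn _); set z := v n - w => zle.
  have [mz1 mz2] := mdw n; rewrite -/z in mz1 mz2.
  have [iz1 iz2 le1 le2] := energy_density_integrableP mz1 mz2 zle.
  have izi := coord_integrable i p0 mz2 iz2.
  have mzi := measurable_coord i mz2.
  have b1 : \int[mu]_x (`|z.1 x| `^ p) <= d1.
    by rewrite -(ler_pM2l am0); apply: le_trans le1 _; rewrite ge_min lexx.
  have b2 : \int[mu]_x (`|z.2 x ord0 i| `^ p) <= d2.
    apply: (@le_trans _ _ (Num.min (am * d1) d2)); last by rewrite ge_min lexx orbT.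
    apply: le_trans le2; apply: le_Rintegral => // x _.
    by apply: ge0_ler_powR; rewrite ?nnegrE ?enorm_ge0 ?(ltW p0)//; exact: coord_le_enorm.
  have [j1 k1] := H1 _ mz1 iz1 b1; have [j2 k2] := H2 _ mzi izi b2.
  have [_ _ _ _ id] := Wv n.
  have [cv1 cv2] := sobolev_cube (ltW p1) (Wv n).
  have [mv1 mv2 _ _ _] := Wv n.
  have l1 : mu.-integrable setT (EFin \o (fun x => (v n).1 x * partial i phi x)) by exact: integrable_mul_test.
  have l2 : mu.-integrable setT (EFin \o (fun x => (v n).2 x ord0 i * phi x)).
    by apply: integrable_mul_test => //; exact: measurable_coord.
  have -> : \int[mu]_x (w.1 x * partial i phi x) =
      \int[mu]_x ((v n).1 x * partial i phi x) - \int[mu]_x (z.1 x * partial i phi x).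
    rewrite -RintegralB//; apply: eq_Rintegral => x _.
    by rewrite -[z.1 x]/((v n).1 x - w.1 x) -mulrBl opprB addrC subrK.
  have -> : \int[mu]_x (w.2 x ord0 i * phi x) =
      \int[mu]_x ((v n).2 x ord0 i * phi x) - \int[mu]_x (z.2 x ord0 i * phi x).
    rewrite -RintegralB//; apply: eq_Rintegral => x _.
    have -> : z.2 x ord0 i = (v n).2 x ord0 i - w.2 x ord0 i.
      by rewrite -[z.2 x]/((v n).2 x - w.2 x) !mxE.
    by rewrite -mulrBl opprB addrC subrK.
  rewrite id// addrACA [- _ + _]addrC subrr add0r -opprD normrN (splitr e).
  by apply: le_trans (ler_normD _ _) _; exact: lerD.
exists w => // e e0; have [n1 Hn1] := lim e e0; exists n1 => n n1n.
rewrite -lee_fin -energyE; last exact: sobolevB.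
exact: Hn1.
Qed.

End completeness.

(** * The Palais-Smale condition *)

Section palais_smale.
Context {R : realType} {N : nat}.
Local Notation RR := (measurableTypeR R).
Local Notation mu := (borel_lebesgue_rV R N).
Variables (p : R) (a : 'rV[RR]_N -> R) (am aM : R).
Hypotheses (p1 : 1 < p) (ma : measurable_fun [set: 'rV[RR]_N] a).
Hypotheses (am0 : 0 < am) (ama : forall x, am <= a x) (aaM : forall x, a x <= aM).
Hypotheses (N0 : (0 < N)%N) (Np : N%:R < p).
Variables (f : 'rV[RR]_N -> R -> R) (h : R -> 'rV[RR]_N -> R).
Hypotheses (mf : forall t, measurable_fun [set: 'rV[RR]_N] (f ^~ t)) (cf : forall x, continuous (f x)).
Hypotheses (ih : forall s : R, 0 < s -> mu.-integrable setT (EFin \o h s)).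
Hypotheses (fh : forall (s : R) x (t : R), 0 < s -> `|t| <= s -> `|f x t| <= h s x).
Variable lam : R.
Hypothesis lam0 : 0 < lam.

Local Notation V := (@field_pair R N).
Local Notation W := (in_sobolev (N := N) p).
Local Notation nrm := (energy_norm p a).
Local Notation D := (functional_diff p a f lam).
Local Notation kap := (sup_embedding (N := N) p am).

Let p0 : 0 < p. Proof. exact: lt_trans p1. Qed.

Let kap0 : 0 < kap.
Proof. by apply: powR_gt0; exact: sup_const_gt0. Qed.

Let h_ge0 (s : R) x : 0 < s -> 0 <= h s x.
Proof. by move=> s0; apply: le_trans (fh x s0 (_ : `|0| <= s)) => //; rewrite normr0 ltW. Qed.

Let weighted_integrable (s K : R) (g : 'rV[RR]_N -> R) : 0 < s -> measurable_fun [set: 'rV[RR]_N] g ->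
  {ae mu, forall x, `|g x| <= K} -> mu.-integrable setT (EFin \o (fun x => h s x * `|g x|)).
Proof.
move=> s0 mg gK.
have ik : mu.-integrable setT (EFin \o (fun x => K * h s x)).
  exact: (@integrableZl _ _ _ mu setT measurableT K _ (ih s0)).
apply: (ae_le_integrable _ ik).
  apply: measurable_funM; last exact: measurableT_comp.
  by apply/measurable_EFinP; exact: measurable_int (ih s0).
apply: ae_imply gK => x gK; rewrite ger0_norm; last by rewrite mulr_ge0// h_ge0.
by rewrite mulrC ler_wpM2r// h_ge0.
Qed.

(* Testing with [un m - un n] controls the difference of the fluxes, hence the energy of [un m - un n] by
   strong monotonicity. *)
Lemma palais_smale (un : nat -> V) (M : R) : 0 < M -> (forall n, W (un n)) ->
  (forall n, nrm (un n) <= M) ->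
  (forall n v, W v -> `|D (un n) v| <= n.+1%:R^-1 * nrm v) ->
  exists2 w, W w & forall e, 0 < e -> exists n, nrm (un n - w) <= e /\ n.+1%:R^-1 <= e.
Proof.
move=> M0 Wu uM Du.
have MpE n : energy p a (un n) <= M `^ p.
  rewrite -(energy_norm_powR p1 am0 ama); apply: ge0_ler_powR; rewrite ?nnegrE ?(ltW p0) ?energy_norm_ge0//.
  exact: ltW.
have bounds n : [/\ mu.-integrable setT (EFin \o (fun x => `|(un n).1 x| `^ p)),
     mu.-integrable setT (EFin \o (fun x => enorm ((un n).2 x) `^ p)),
     am * \int[mu]_x (`|(un n).1 x| `^ p) <= M `^ p & \int[mu]_x (enorm ((un n).2 x) `^ p) <= M `^ p].
  have [m1 m2 _ _ _] := Wu n; apply: (energy_density_integrableP (w := un n) ma am0 ama m1 m2).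
  by rewrite (energyE ma am0 ama aaM (Wu n)) lee_fin.
pose B := Num.max (M `^ p / am) (M `^ p).
have [phi [u [phin mU cu]]] := @sobolev_ae_compact R N p N0 Np (fun n => (un n).1) (fun n => (un n).2) B Wu
  (fun n => ltac:(by have [_ _ h1 _] := bounds n; rewrite le_max ler_pdivlMr// mulrC h1))
  (fun n => ltac:(by have [_ _ _ h1] := bounds n; rewrite le_max h1 orbT)).
pose v n := un (phi n).
have Wv n : W (v n) by exact: Wu.
have vM n : nrm (v n) <= M by exact: uM.
have Dv n z : W z -> `|D (v n) z| <= n.+1%:R^-1 * nrm z.
  move=> Wz; apply: le_trans (Du _ _ Wz) _; rewrite ler_wpM2r ?energy_norm_ge0//.
  by rewrite lef_pV2 ?posrE// ler_nat ltnS.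
have s0 : 0 < kap * M by rewrite mulr_gt0.
have vs n : {ae mu, forall x, `|(v n).1 x| <= kap * M}.
  exact: (sup_embedding_le p1 ma am0 ama aaM N0 Np (Wv n) (vM n)).
have mv n : measurable_fun [set: 'rV[RR]_N] (v n).1 by have [] := Wv n.
have vas : {ae mu, forall x, forall n, `|(v n).1 x| <= kap * M} by exact/ae_foralln.
have us : {ae mu, forall x, `|u x| <= kap * M}.
  apply: (ae_imply2 _ cu vas) => x cx bx.
  apply/ler_addgt0Pr => e e0; have /cvgrPdist_le /(_ _ e0)[n _ /(_ n (leqnn _)) /= un_] := cx.
  rewrite -(subrK ((v n).1 x) (u x)) addrC; apply: le_trans (ler_normD _ _) _.
  by apply: lerD => //; exact: bx.
have dif n : {ae mu, forall x, `|(v n).1 x - u x| <= 2 * (kap * M)}.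
  apply: (ae_imply2 _ (vs n) us) => x h1 h2; apply: le_trans (ler_normB _ _) _.
  by rewrite mulrDl !mul1r lerD.
have mdif n : measurable_fun [set: 'rV[RR]_N] (fun x => (v n).1 x - u x) by exact: measurable_funB.
have idif n := weighted_integrable s0 (mdif n) (dif n).
(* All functions are bounded by kap M, so a fixed multiple of h dominates; this is the only use of
   the a.e. limit before completeness. *)
have lim0 : \int[mu]_x (h (kap * M) x * `|(v n).1 x - u x|) @[n --> \oo] --> (0 : R).
  have i2 : mu.-integrable setT (EFin \o (fun x => 2 * (kap * M) * h (kap * M) x)).
    exact: (@integrableZl _ _ _ mu setT measurableT (2 * (kap * M)) _ (ih s0)).
  have [||||| _ _ lim] := @dominated_convergence _ _ R mu setT measurableT
      (fun n => EFin \o (fun x => h (kap * M) x * `|(v n).1 x - u x|)) (cst 0)%E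
      (EFin \o (fun x => 2 * (kap * M) * h (kap * M) x)).
  - by move=> n; exact: measurable_int (idif n).
  - exact: measurable_cst.
  - apply: ae_imply cu => x cx _; apply: cvg_EFin; first exact: nearW.
    rewrite [X in _ --> X](_ : 0 = h (kap * M) x * `|u x - u x|); last by rewrite subrr normr0 mulr0.
    by apply: cvgMr; apply: cvg_norm; apply: cvgB => //; exact: cvg_cst.
  - exact: i2.
  - have /ae_foralln da := dif; apply: ae_imply da => x da n _.
    rewrite /= lee_fin ger0_norm; last by rewrite mulr_ge0// h_ge0.
    by rewrite mulrC ler_wpM2r// h_ge0.
  have -> : (0 : R) = fine (\int[mu]_x (cst 0 x))%E by rewrite integral0.
  apply: fine_cvg; rewrite integral0; move: lim; rewrite integral0.
  exact.
have cauchy e : 0 < e -> exists n0, forall n m, (n0 <= n)%N -> (n0 <= m)%N ->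
    energy p a (v n - v m) <= e.
  move=> e0.
  (* The two energies in the monotonicity estimate are each at most M^p, so their term is at most
     e/2; [th] does the same for the flux term. *)
  have c0 : 0 < e / 2 / (2 * M `^ p) by rewrite !divr_gt0// mulr_gt0// powR_gt0.
  have [C C0 HC] := flux_density_monotone p1 am0 ama c0.
  have C10 : 0 < C + 1 by rewrite ltr_wpDl.
  pose th := e / 2 / (C + 1).
  have th0 : 0 < th by rewrite !divr_gt0.
  have t1 : 0 < th / 2 / (4 * M) by rewrite !divr_gt0// mulr_gt0.
  have t2 : 0 < th / 2 / (4 * lam) by rewrite !divr_gt0// mulr_gt0.
  have /cvgrPdist_le /(_ _ t2)[n1 _ Hn1] := lim0.
  have [n2 Hn2] : exists n2 : nat, forall n, (n2 <= n)%N -> n.+1%:R^-1 <= th / 2 / (4 * M).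
    exists (Num.truncn ((th / 2 / (4 * M))^-1)) => n n2n.
    rewrite invf_ple ?posrE// ltW//; apply: lt_le_trans (truncnS_gt _) _.
    by rewrite ler_nat ltnS.
  exists (maxn n1 n2) => n m; rewrite !geq_max => /andP[n1n n2n] /andP[n1m n2m].
  pose z := v n - v m; have Wz : W z by exact: sobolevB.
  have zM : nrm z <= 2 * M.
    rewrite /z -scaleN1r; apply: le_trans (energy_normD p1 ma am0 ama aaM (Wv n) (sobolevZ p1 (-1) (Wv m))) _.
    by rewrite (energy_normZ p1 ma am0 ama aaM)// normrN1 mul1r mulrDl !mul1r lerD.
  (* Flux = D + lam times the nonlinear integral: the first is small by almost criticality and nrm z
     <= 2 M, the second by [lim0] at n and m. *)
  have flux_small k : (n1 <= k)%N -> (n2 <= k)%N -> `|flux p a (v k) z| <= th / 2.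
    move=> n1k n2k.
    have -> : flux p a (v k) z = D (v k) z + lam * \int[mu]_x (f x ((v k).1 x) * z.1 x).
      by rewrite /functional_diff subrK.
    apply: le_trans (ler_normD _ _) _; rewrite [leRHS]splitr; apply: lerD.
      apply: le_trans (Dv k z Wz) _.
      apply: (@le_trans _ _ (th / 2 / (4 * M) * (2 * M))); first by rewrite ler_pM// ?energy_norm_ge0// Hn2.
      by rewrite le_eqVlt; apply/orP; left; apply/eqP; field; rewrite gt_eqF.
    rewrite normrM (gtr0_norm lam0).
    have mz : measurable_fun [set: 'rV[RR]_N] z.1 by have [] := Wz.
    have zE x : z.1 x = ((v n).1 x - u x) - ((v m).1 x - u x).
      by rewrite opprB addrA subrK.
    have zb : {ae mu, forall x, `|z.1 x| <= kap * (2 * M)}.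
      exact: (sup_embedding_le p1 ma am0 ama aaM N0 Np Wz zM).
    have iz := weighted_integrable s0 mz zb.
    have h1 := nonlinearity_le p1 ma am0 ama aaM N0 Np mf cf fh M0 (Wv k) (vM k) mz iz.
    have h2 : \int[mu]_x (h (kap * M) x * `|z.1 x|) <=
        \int[mu]_x (h (kap * M) x * `|(v n).1 x - u x|) + \int[mu]_x (h (kap * M) x * `|(v m).1 x - u x|).
      rewrite -RintegralD//; apply: le_Rintegral => //.
        exact: (@integrableD _ _ _ mu setT measurableT _ _ (idif n) (idif m)).
      move=> x _; rewrite -mulrDr ler_wpM2l ?h_ge0// zE; exact: ler_normB.
    have small j : (n1 <= j)%N -> \int[mu]_x (h (kap * M) x * `|(v j).1 x - u x|) <= th / 2 / (4 * lam).
      by move=> /Hn1 /=; rewrite sub0r normrN => /(le_trans (ler_norm _)).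
    apply: (@le_trans _ _ (lam * (th / 2 / (4 * lam) + th / 2 / (4 * lam)))).
      rewrite ler_pM2l//; apply: le_trans h1 _; apply: le_trans h2 _.
      by apply: lerD; exact: small.
    by rewrite le_eqVlt; apply/orP; left; apply/eqP; field; rewrite gt_eqF.
  have ien := energy_density_integrable ma am0 ama aaM (Wv n).
  have iem := energy_density_integrable ma am0 ama aaM (Wv m).
  have ifn := flux_density_integrable p1 ma am0 ama aaM (Wv n) Wz.
  have ifm := flux_density_integrable p1 ma am0 ama aaM (Wv m) Wz.
  have iD := @integrableD _ _ _ mu setT measurableT _ _ ien iem.
  have iB := @integrableB _ _ _ mu setT measurableT _ _ ifn ifm.
  have jD : mu.-integrable setT (EFin \o (fun x => e / 2 / (2 * M `^ p) * (energy_density p a (v n) x + energy_density p a (v m) x))).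
    exact: (@integrableZl _ _ _ mu setT measurableT (e / 2 / (2 * M `^ p)) _ iD).
  have jB : mu.-integrable setT (EFin \o (fun x => C * (flux_density p a (v n) z x - flux_density p a (v m) z x))).
    exact: (@integrableZl _ _ _ mu setT measurableT C _ iB).
  have key : energy p a z <= e / 2 / (2 * M `^ p) * (energy p a (v n) + energy p a (v m)) +
      C * (flux p a (v n) z - flux p a (v m) z).
    rewrite /energy /flux -RintegralD// -RintegralB// -RintegralZl// -RintegralZl// -RintegralD//.
    apply: le_Rintegral => //.
    - exact: (energy_density_integrable ma am0 ama aaM Wz).
    - exact: (@integrableD _ _ _ mu setT measurableT _ _ jD jB).
    - by move=> x _; exact: HC.
  apply: le_trans key _; rewrite [leRHS]splitr; apply: lerD.
    apply: (@le_trans _ _ (e / 2 / (2 * M `^ p) * (M `^ p + M `^ p))).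
      by rewrite ler_pM2l//; apply: lerD; exact: MpE.
    by rewrite le_eqVlt; apply/orP; left; apply/eqP; have := powR_gt0 p M0; move: (M `^ p) => X X0; field; rewrite gt_eqF.
  apply: (@le_trans _ _ (C * (th / 2 + th / 2))).
    rewrite ler_wpM2l//; apply: le_trans (ler_norm _) _; apply: le_trans (ler_normB _ _) _.
    by apply: lerD; exact: flux_small.
  by rewrite -splitr /th mulrA ler_pdivrMr// mulrC ler_pM2l ?divr_gt0// lerDl.
have [w Ww Hw] := sobolev_complete p1 ma am0 ama aaM Wv (fun n => MpE (phi n)) cauchy mU cu.
exists w => // e e0.
have ep : 0 < e `^ p by exact: powR_gt0.
have [n1 Hn1] := Hw _ ep.
(* The second argument makes 1/(phi n + 1) <= e, since phi n >= n. *)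
pose n := maxn n1 (Num.truncn e^-1).
exists (phi n); split.
  by apply: (energy_norm_le p1 am0 ama); [exact: ltW|apply: Hn1; exact: leq_maxl].
rewrite invf_ple ?posrE// ltW//; apply: lt_le_trans (truncnS_gt _) _.
by rewrite ler_nat ltnS (leq_trans _ (phin n))// leq_maxr.
Qed.

End palais_smale.

(** * Three critical points *)

Section three_critical_points.
Context {R : realType} {V : lmodType R} (W : set V).
Hypothesis WD : forall x y, W x -> W y -> W (x + y).
Hypothesis WZ : forall t x, W x -> W (t *: x).
Variable nrm : V -> R.
Hypothesis nrmD : forall x y, W x -> W y -> nrm (x + y) <= nrm x + nrm y.
Hypothesis nrmZ : forall t x, W x -> nrm (t *: x) = `|t| * nrm x.
Variables (J : V -> R) (D : V -> V -> R).
Hypothesis D_linear : forall a b u v w, W u -> W v -> W w ->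
  D u (a *: v + b *: w) = a * D u v + b * D u w.
Hypothesis J_cont : forall (M e : R), 0 < e -> exists2 d, 0 < d &
  forall u h, W u -> W h -> nrm u <= M -> nrm h <= d -> `|J (u + h) - J u| <= e.
Hypothesis J_diff : forall (M e : R), 0 < e -> exists2 d, 0 < d &
  forall u h, W u -> W h -> nrm u <= M -> nrm h <= d ->
    `|J (u + h) - J u - D u h| <= e * nrm h.
Hypothesis D_cont : forall (M e : R), 0 < e -> exists2 d, 0 < d &
  forall u h v, W u -> W h -> W v -> nrm u <= M -> nrm h <= d ->
    `|D (u + h) v - D u v| <= e * nrm v.
Hypothesis J_coercive : forall L, exists M, forall u, W u -> J u <= L -> nrm u <= M.
Hypothesis J_bounded : forall M, exists B, forall u, W u -> nrm u <= M -> `|J u| <= B.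
Hypothesis PS : forall (un : nat -> V) (M : R), 0 < M -> (forall n, W (un n)) ->
  (forall n, nrm (un n) <= M) ->
  (forall n v, W v -> `|D (un n) v| <= n.+1%:R^-1 * nrm v) ->
  exists2 w, W w & forall e, 0 < e -> exists n, nrm (un n - w) <= e /\ n.+1%:R^-1 <= e.
Variables (rho m : R) (e0 : V).
Hypothesis rho_gt0 : 0 < rho.
Hypothesis m_gt0 : 0 < m.
Hypothesis J_sphere : forall u, W u -> nrm u = rho -> m <= J u.
Hypothesis J0 : J 0 <= 0.
Hypothesis We0 : W e0.
Hypothesis e0_out : rho < nrm e0.
Hypothesis Je0 : J e0 < 0.

Let W0 : W 0. Proof. by rewrite -(scale0r e0); exact: WZ. Qed.
Let WB x y : W x -> W y -> W (x - y).
Proof. by move=> ? ?; rewrite -scaleN1r; apply/WD/WZ. Qed.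
Let nrm0 : nrm 0 = 0.
Proof. by rewrite -(scale0r e0) nrmZ// normr0 mul0r. Qed.
Let nrmN x : W x -> nrm (- x) = nrm x.
Proof. by move=> Wx; rewrite -scaleN1r nrmZ// normrN1 mul1r. Qed.
Let nrm_ge0 x : W x -> 0 <= nrm x.
Proof.
move=> Wx; have := nrmD Wx (WB W0 Wx).
by rewrite sub0r subrr nrm0 nrmN//; lra.
Qed.
Let nrmB x y : W x -> W y -> nrm (x - y) = nrm (y - x).
Proof. by move=> Wx Wy; rewrite -opprB nrmN//; exact: WB. Qed.

(** The common level L bounds the approximations by coercivity, so they have a limit w. [Q] need not
    pass to w; approximations in [Q], close in norm and in level, are returned instead. *)
Lemma critical_limit (Q : set V) (L : R) :
  (forall eta, 0 < eta -> exists u, [/\ W u, Q u, J u <= L & almost_critical W nrm D eta u]) ->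
  exists w, [/\ W w, (forall v, W v -> D w v = 0) &
    forall e, 0 < e -> exists u, [/\ W u, Q u, J u <= L, nrm (u - w) <= e & `|J w - J u| <= e]].
Proof.
move=> H; have [M0 HM0] := J_coercive L.
pose M := Num.max 1 M0; have M_gt0 : 0 < M by rewrite lt_max ltr01.
have HM u : W u -> J u <= L -> nrm u <= M by move=> Wu JL; rewrite le_max HM0// orbT.
have /choice[un Hun] : forall n : nat, exists u, [/\ W u, Q u, J u <= L &
    almost_critical W nrm D n.+1%:R^-1 u] by move=> n; apply: H; rewrite invr_gt0.
have Wun n : W (un n) by have [] := Hun n.
have nun n : nrm (un n) <= M by have [? _ ? _] := Hun n; exact: HM.
have aun n v : W v -> `|D (un n) v| <= n.+1%:R^-1 * nrm v by have [_ _ _] := Hun n; exact.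
have [w Ww Hw] := PS M_gt0 Wun nun aun.
have unw n : un n + (w - un n) = w by rewrite addrC subrK.
exists w; split => //.
  move=> v Wv; apply/eqP; rewrite -normr_le0; apply/ler_addgt0Pr => e egt0; rewrite add0r.
  have nv := nrm_ge0 Wv.
  have K0 : 0 < nrm v + 1 by rewrite ltr_wpDl.
  pose e1 := e / 2 / (nrm v + 1).
  have e10 : 0 < e1 by rewrite !divr_gt0.
  have [d d0 Hd] := D_cont M e10.
  have [|n [wn ne]] := Hw (Num.min d e1); first by rewrite lt_min d0 e10.
  move: wn ne; rewrite !le_min => /andP[wd _] /andP[_ ne].
  have := Hd (un n) (w - un n) v (Wun n) (WB Ww (Wun n)) Wv (nun n).
  rewrite nrmB// unw => /(_ wd) h1.
  have h2 := aun n v Wv.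
  rewrite -(subrK (D (un n) v) (D w v)); apply: le_trans (ler_normD _ _) _.
  apply: le_trans (lerD h1 h2) _.
  apply: (@le_trans _ _ (e1 * nrm v + e1 * nrm v)); first by rewrite lerD2l ler_wpM2r.
  have q : e1 * nrm v <= e / 2.
    by rewrite /e1 mulrAC ler_pdivrMr// ler_pM2l ?divr_gt0// lerDl.
  by rewrite [leRHS]splitr lerD.
move=> e egt0; have [d d0 Hd] := J_cont M egt0.
have [|n [wn _]] := Hw (Num.min d e); first by rewrite lt_min d0 egt0.
move: wn; rewrite le_min => /andP[wd we].
exists (un n); split => //; [by have [] := Hun n|by have [] := Hun n|].
have := Hd (un n) (w - un n) (Wun n) (WB Ww (Wun n)) (nun n).
by rewrite nrmB// unw; exact.
Qed.

Let nrm_le u w e : W u -> W w -> nrm (u - w) <= e -> nrm u <= nrm w + e.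
Proof.
move=> Wu Ww h1; have := nrmD (WB Wu Ww) Ww; rewrite subrK => /le_trans; apply.
by rewrite addrC lerD2l.
Qed.

(** The limits of the two minimisations have J <= 0, so they are not on the sphere and the weak
    inequalities on the norm become strict. *)
Theorem three_critical_points : exists u1 u2 u3,
  [/\ [/\ W u1, W u2 & W u3],
      [/\ forall v, W v -> D u1 v = 0, forall v, W v -> D u2 v = 0 & forall v, W v -> D u3 v = 0],
      nrm u1 < rho < nrm u2 & [/\ J u1 <= 0, J u2 <= 0 & 0 < J u3]].
Proof.
have ivt x k := @nrm_segment_ivt R V W WD WZ nrm nrmD nrmZ rho e0 We0 x k.
have cmin (P : set V) b eta : W b -> P b -> J b <= 0 -> 0 < eta ->
    (forall u h, W u -> W h -> P u -> ~ P (u + h) ->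
      nrm u <= rho <= nrm (u + h) \/ nrm (u + h) <= rho <= nrm u) ->
    exists u, [/\ W u, P u, J u <= J b & almost_critical W nrm D eta u].
  move=> Wb Pb Jb eta0 HP; apply: (almost_critical_min WD WZ nrmD nrmZ D_linear J_cont J_diff
    J_coercive J_bounded m_gt0 J_sphere We0 eta0 Wb Pb Jb) => u k Wu Wk Pu nP.
  by apply: ivt => //; exact: HP.
have [u1 [W1 D1 C1]] := critical_limit (fun eta eta0 => cmin [set u | nrm u <= rho] 0 eta W0
  ltac:(by rewrite /= nrm0 ltW) J0 eta0 ltac:(by move=> u k _ _ /= -> /negP; rewrite -ltNge => /ltW ->; left)).
have [u2 [W2 D2 C2]] := critical_limit (fun eta eta0 => cmin [set u | rho <= nrm u] e0 eta We0
  ltac:(exact: ltW) (ltW Je0) eta0 ltac:(by move=> u k _ _ /= -> /negP; rewrite -ltNge => /ltW ->; right)).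
have [C HC] := almost_critical_mountain_pass WD WZ nrmD nrmZ D_linear J_cont J_diff D_cont
    J_coercive J_bounded rho_gt0 m_gt0 J_sphere J0 We0 e0_out (ltW Je0).
have [|u3 [W3 D3 C3]] := @critical_limit [set u | m / 2 <= J u] C.
  by move=> eta /HC[u [? ? ? ?]]; exists u.
have lim_le (w : V) (L : R) : (forall e, 0 < e -> J w <= L + e) -> L <= 0 -> J w <= 0.
  by move=> H L0; apply: le_trans L0; apply/ler_addgt0Pr.
have J1 : J u1 <= 0.
  apply: lim_le J0 => e /C1[u [_ _ Ju _]]; rewrite ler_norml => /andP[_].
  by rewrite lerBlDr => /le_trans; apply; rewrite addrC lerD2r.
have J2 : J u2 <= 0.
  apply: lim_le (ltW Je0) => e /C2[u [_ _ Ju _]]; rewrite ler_norml => /andP[_].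
  by rewrite lerBlDr => /le_trans; apply; rewrite addrC lerD2r.
have n1 : nrm u1 <= rho.
  apply/ler_addgt0Pr => e /C1[u [Wu Pu _ nu _]].
  by rewrite nrmB// in nu; apply: le_trans (nrm_le W1 Wu nu) _; rewrite lerD2r.
have n2 : rho <= nrm u2.
  by apply/ler_addgt0Pr => e /C2[u [Wu Pu _ nu _]]; apply: le_trans Pu _; exact: nrm_le nu.
have out u : W u -> J u <= 0 -> nrm u != rho.
  by move=> Wu Ju; apply/eqP => /(J_sphere Wu) mJ; have := lt_le_trans m_gt0 (le_trans mJ Ju); rewrite ltxx.
exists u1, u2, u3; split => //; first by rewrite !lt_neqAle n1 n2 out// eq_sym out.
split => //; have m40 : 0 < m / 4 by rewrite divr_gt0.
(* An approximation of level at least m/2 within m/4 of J u3 gives J u3 >= m/4 > 0. *)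
have [u [_ Pu _ _]] := C3 _ m40; rewrite ler_norml => /andP[+ _].
by move: Pu m_gt0 => /=; lra.
Qed.

End three_critical_points.

(** * The radial competitor *)

Section lipschitz_weak_derivative.
Context {R : realType} {N : nat}.
Local Notation RR := (measurableTypeR R).
Local Notation mu := (borel_lebesgue_rV R N).

Lemma test_function_is_derive (i : 'I_N) (phi : 'rV[R]_N -> R) (x : 'rV[R]_N) (s : R) :
  test_function phi ->
  is_derive s 1 (fun t => phi (x + t *: delta_mx ord0 i)) (partial i phi (x + s *: delta_mx ord0 i)).
Proof.
move=> [sphi _]; have [_ /(_ i (x + s *: delta_mx ord0 i)) dphi] := sphi [::].
have E : (fun h : R => h^-1 *: (phi (x + (h *: 1 + s) *: delta_mx ord0 i) - phi (x + s *: delta_mx ord0 i))) =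
    (fun h : R => h^-1 *: (phi (h *: delta_mx ord0 i + (x + s *: delta_mx ord0 i)) - phi (x + s *: delta_mx ord0 i))).
  apply/funext => h; congr (_ *: (phi _ - _)).
  by rewrite -[h *: 1]/(h * 1) mulr1 scalerDl addrCA addrA.
apply: DeriveDef; first by rewrite /derivable /= E; exact: dphi.
by rewrite /derive /= E.
Qed.

Lemma test_function_quotient (i : 'I_N) (phi : 'rV[R]_N -> R) (M : R) (x : 'rV[R]_N) (t : R) :
  test_function phi -> (forall x, `|partial i phi x| <= M) -> 0 < t ->
  `|(phi (x + t *: delta_mx ord0 i) - phi x) / t| <= M.
Proof.
move=> tphi pM t0; pose g s := phi (x + s *: delta_mx ord0 i).
have dg (s : R) : is_derive s 1 g (partial i phi (x + s *: delta_mx ord0 i)) by exact: test_function_is_derive.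
have cg : {within `[0, t], continuous g}.
  apply: continuous_subspaceT => s.
  by apply/differentiable_continuous/derivable1_diffP; have [] := dg s.
have [c _] := MVT t0 (fun s _ => dg s) cg.
rewrite /g scale0r addr0 subr0 => ->.
by rewrite mulfK ?gt_eqF.
Qed.

Lemma test_function_quotient_cvg (i : 'I_N) (phi : 'rV[R]_N -> R) (x : 'rV[R]_N) : test_function phi ->
  (phi (x + n.+1%:R^-1 *: delta_mx ord0 i) - phi x) / n.+1%:R^-1 @[n --> \oo] --> partial i phi x.
Proof.
move=> [sphi _]; have [_ /(_ i x) dphi] := sphi [::].
have h0 : n.+1%:R^-1 @[n --> \oo] --> (0 : R)^'.
  move=> P PP; have : \forall n \near \oo, n.+1%:R^-1 != 0 :> R -> P n.+1%:R^-1.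
    exact: (@cvg_harmonic R (fun y => y != 0 -> P y) PP).
  by apply: filterS => n; apply; rewrite gt_eqF// invr_gt0.
have := cvg_comp _ _ h0 dphi; apply: cvg_trans; apply: near_eq_cvg; apply: nearW => n /=.
by rewrite [x + _]addrC mulrC.
Qed.

Variables (i : 'I_N) (u g : 'rV[RR]_N -> R) (L : R).
Hypotheses (mU : measurable_fun [set: 'rV[RR]_N] u) (mg : measurable_fun [set: 'rV[RR]_N] g).
Hypothesis iu : mu.-integrable setT (EFin \o u).
Hypothesis lip : forall x (t : R), 0 < t -> `|u (x - t *: delta_mx ord0 i) - u x| <= L * t.
Hypothesis lim : {ae mu, forall x,
  (u (x - n.+1%:R^-1 *: delta_mx ord0 i) - u x) / n.+1%:R^-1 @[n --> \oo] --> - g x}.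

(* Summation by parts for difference quotients, and dominated convergence. *)
Lemma lipschitz_weak_derivative (phi : 'rV[R]_N -> R) : test_function phi ->
  \int[mu]_x (u x * partial i phi x) = - \int[mu]_x (g x * phi x).
Proof.
move=> tphi; have tp := test_function_partial i tphi.
pose t n : R := n.+1%:R^-1; have t0 n : 0 < t n by rewrite invr_gt0.
pose e : 'rV[R]_N := delta_mx ord0 i.
have mphi := test_function_measurable tphi.
have [M [n1 phiM]] := test_function_bounded tphi.
have [M' [n2 pM']] := test_function_bounded tp.
have ind1 (B : set 'rV[RR]_N) (x : 'rV[RR]_N) : 0 <= (\1_B x : R) <= 1 by rewrite [\1__ x]indicE ler0n lern1 leq_b1.
have bound (K : R) (B : set 'rV[RR]_N) (x : 'rV[RR]_N) (c : R) : `|c| <= K * \1_B x -> `|c| <= `|K|.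
  move=> /le_trans; apply; have /andP[i0 i1] := ind1 B x.
  by apply: le_trans (ler_norm _) _; rewrite normrM (ger0_norm i0) ler_piMr.
have {}phiM1 x : `|phi x| <= `|M| by exact: bound (phiM x).
have {}pM'1 x : `|partial i phi x| <= `|M'| by exact: bound (pM' x).
pose A n x := u x * ((phi (x + t n *: e) - phi x) / t n).
pose B n x := (u (x - t n *: e) - u x) / t n * phi x.
have msh n : measurable_fun [set: 'rV[RR]_N] (fun x => phi (x + t n *: e)).
  exact: (measurableT_comp mphi (shift_measurable _)).
have mush n : measurable_fun [set: 'rV[RR]_N] (fun x => u (x - t n *: e)).
  exact: (measurableT_comp mU (shift_measurable _)).
have iM (w : 'rV[RR]_N -> R) (K : R) : measurable_fun [set: 'rV[RR]_N] w -> (forall x, `|w x| <= K) ->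
    mu.-integrable setT (EFin \o (fun x => u x * w x)).
  move=> mw wK; have iK : mu.-integrable setT (EFin \o (fun x => K * `|u x|)).
    exact: (@integrableZl _ _ _ mu setT measurableT K _ (integrable_norm iu)).
  apply: le_integrable iK => //; first by apply/measurable_EFinP; exact: measurable_funM.
  by move=> x _; rewrite /= lee_fin normrM mulrC (le_trans _ (ler_norm _))// ler_wpM2r.
have AB n : \int[mu]_x A n x = \int[mu]_x B n x.
  have iuu := iM phi _ mphi phiM1.
  have iush := iM _ _ (msh n) (fun x => phiM1 _).
  have mgsh : measurable_fun [set: 'rV[RR]_N] (fun x => u (x - t n *: e) * phi x) by exact: measurable_funM.
  have shE : \int[mu]_x (u x * phi (x + t n *: e)) = \int[mu]_x (u (x - t n *: e) * phi x).
    congr fine; rewrite -(shift_integral (t n *: e) mgsh).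
    by apply: eq_integral => x _; rewrite addrK.
  have ish : mu.-integrable setT (EFin \o (fun x => u (x - t n *: e) * phi x)).
    have := shift_integrable (- (t n *: e)) (measurable_funM mU (msh n)) iush.
    by congr (mu.-integrable _ _); apply/funext => x /=; rewrite subrK.
  rewrite (_ : A n = fun x => (t n)^-1 * (u x * phi (x + t n *: e) - u x * phi x)); last first.
    by apply/funext => x; rewrite /A -mulrBr mulrA mulrC.
  rewrite (_ : B n = fun x => (t n)^-1 * (u (x - t n *: e) * phi x - u x * phi x)); last first.
    by apply/funext => x; rewrite /B -mulrBl mulrA [_ / t n]mulrC.
  have i1 := @integrableB _ _ _ mu setT measurableT _ _ iush iuu.
  have i2 := @integrableB _ _ _ mu setT measurableT _ _ ish iuu.
  by rewrite !RintegralZl// !RintegralB// shE.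
have mA n : measurable_fun [set: 'rV[RR]_N] (A n).
  by apply: measurable_funM => //; apply: measurable_funM => //; exact: measurable_funB.
have mB n : measurable_fun [set: 'rV[RR]_N] (B n).
  by apply: measurable_funM => //; apply: measurable_funM => //; exact: measurable_funB.
have dct (w : nat -> 'rV[RR]_N -> R) (l k : 'rV[RR]_N -> R) : (forall n, measurable_fun [set: 'rV[RR]_N] (w n)) ->
    measurable_fun [set: 'rV[RR]_N] l -> mu.-integrable setT (EFin \o k) ->
    {ae mu, forall x, w n x @[n --> \oo] --> l x} -> (forall n x, `|w n x| <= k x) ->
    mu.-integrable setT (EFin \o l) /\ \int[mu]_x w n x @[n --> \oo] --> \int[mu]_x l x.
  move=> mw ml ik cw wk.
  have [||||| il _ lim'] := @dominated_convergence _ _ R mu setT measurableT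
      (fun n => EFin \o w n) (EFin \o l) (EFin \o k).
  - by move=> n; apply/measurable_EFinP.
  - exact/measurable_EFinP.
  - by apply: ae_imply cw => x cx _; apply: cvg_EFin => //; exact: nearW.
  - exact: ik.
  - by apply: aeW => x n _; rewrite /= lee_fin.
  by split => //; apply: fine_cvg; rewrite fineK//; exact: integrable_fin_num il.
have [_ cA] : mu.-integrable setT (EFin \o (fun x => u x * partial i phi x)) /\
    \int[mu]_x A n x @[n --> \oo] --> \int[mu]_x (u x * partial i phi x).
  apply: (@dct A _ (fun x => `|M'| * `|u x|)) => //.
  - by apply: measurable_funM => //; exact: test_function_measurable.
  - exact: (@integrableZl _ _ _ mu setT measurableT `|M'| _ (integrable_norm iu)).
  - by apply: aeW => x; apply: cvgMr; exact: test_function_quotient_cvg.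
  - move=> n x; rewrite /A normrM mulrC ler_wpM2r//; exact: test_function_quotient.
have iphi : mu.-integrable setT (EFin \o phi).
  have ic : mu.-integrable setT (EFin \o (fun x => M * \1_(cube n1) x)).
    apply: (@integrableZl _ _ _ mu setT measurableT M (EFin \o \1_(cube n1))).
    apply/integrableP; split; first by apply/measurable_EFinP; apply: measurable_indic; exact: measurable_cube.
    under eq_integral do rewrite /= ger0_norm ?indicE ?ler0n//.
    have := @integral_indic _ _ R mu setT measurableT (cube n1) (measurable_cube n1).
    by rewrite setIT /= => ->; exact: cube_lty.
  apply: le_integrable ic => //; first exact/measurable_EFinP.
  by move=> x _; rewrite /= lee_fin (le_trans (phiM x))// ler_norm.
have [iB cB] : mu.-integrable setT (EFin \o (fun x => - g x * phi x)) /\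
    \int[mu]_x B n x @[n --> \oo] --> \int[mu]_x (- g x * phi x).
  apply: (@dct B _ (fun x => L * `|phi x|)) => //.
  - by apply: measurable_funM => //; exact: measurableT_comp.
  - exact: (@integrableZl _ _ _ mu setT measurableT L _ (integrable_norm iphi)).
  - by apply: ae_imply lim => x cx; apply: cvgMl.
  - move=> n x; rewrite /B normrM ler_wpM2r// normrM normfV (gtr0_norm (t0 n)).
    by rewrite ler_pdivrMr//; exact: lip.
have -> : - (\int[mu]_x (g x * phi x)) = \int[mu]_x (- g x * phi x) :> R.
  rewrite (_ : \int[mu]_x (g x * phi x) = \int[mu]_x (-1 * (- g x * phi x))); last first.
    by apply: eq_Rintegral => x _; rewrite mulN1r mulNr opprK.
  by rewrite RintegralZl// mulN1r opprK.
apply: (@cvg_unique _ (@Rhausdorff R) (\int[mu]_x A n x @[n --> \oo])) => //.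
by rewrite (_ : (fun n => _) = fun n => \int[mu]_x B n x)//; apply/funext.
Qed.

End lipschitz_weak_derivative.

(** * The tent function and its energy *)

Section tent.
Context {R : realType} {N : nat}.
Local Notation RR := (measurableTypeR R).
Local Notation mu := (borel_lebesgue_rV R N).
Local Notation omega := (unit_ball_volume (R := R) (N := N)).
Variables (x0 : 'rV[R]_N) (r d : R).
Hypotheses (r0 : 0 < r) (d0 : 0 < d).

Let profile (s : R) : R := d * Num.min 1 (Num.max 0 (2 * (1 - s / r))).

Definition tent (x : 'rV[RR]_N) : R := profile (enorm (x - x0)).

(** At the centre the division by 0 is harmless: the indicator of the annulus vanishes there. *)
Definition tent_gradient (x : 'rV[RR]_N) : 'rV[R]_N :=
  (- (2 * d / r) * \1_(eball x0 r `\` eball x0 (r / 2)) x / enorm (x - x0)) *: (x - x0).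

Let profile_small s : s <= r / 2 -> profile s = d.
Proof.
move=> sr; have : s / r <= 2^-1 by rewrite ler_pdivrMr// mulrC.
rewrite /profile; move: (s / r) => t ht; rewrite max_r; last by lra.
by rewrite min_l ?mulr1//; lra.
Qed.

Let profile_large s : r <= s -> profile s = 0.
Proof.
move=> sr; have : 1 <= s / r by rewrite ler_pdivlMr// mul1r.
rewrite /profile; move: (s / r) => t ht; rewrite max_l; last by lra.
by rewrite min_r ?ler01// mulr0.
Qed.

Let profile_mid s : r / 2 <= s -> s <= r -> profile s = 2 * d * (1 - s / r).
Proof.
move=> sr rs; have : 2^-1 <= s / r by rewrite ler_pdivlMr// mulrC.
have : s / r <= 1 by rewrite ler_pdivrMr// mul1r.
rewrite /profile; move: (s / r) => t h1 h2; rewrite max_r; last by lra.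
by rewrite min_r; [ring|lra].
Qed.

Let profile_lip s t : `|profile s - profile t| <= 2 * d / r * `|s - t|.
Proof.
have maxl (x y : R) : `|Num.max 0 x - Num.max 0 y| <= `|x - y|.
  rewrite ler_norml; have := ler_norm (x - y); have := ler_norm (- (x - y)); rewrite normrN.
  by rewrite /Num.max; case: (ltP 0 x) => ?; case: (ltP 0 y) => ? ? ?; apply/andP; split; lra.
have minl (x y : R) : `|Num.min 1 x - Num.min 1 y| <= `|x - y|.
  rewrite ler_norml; have := ler_norm (x - y); have := ler_norm (- (x - y)); rewrite normrN.
  by rewrite /Num.min; case: (ltP 1 x) => ?; case: (ltP 1 y) => ? ? ?; apply/andP; split; lra.
rewrite /profile -mulrBr normrM (gtr0_norm d0).
apply: le_trans (ler_wpM2l (ltW d0) (minl _ _)) _.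
apply: le_trans (ler_wpM2l (ltW d0) (maxl _ _)) _.
have -> : 2 * (1 - s / r) - 2 * (1 - t / r) = - (2 / r) * (s - t) by field; rewrite gt_eqF.
rewrite normrM normrN (gtr0_norm (divr_gt0 _ r0))// mulrA le_eqVlt; apply/orP; left; apply/eqP.
by move: (`|s - t|) => X; field; rewrite gt_eqF.
Qed.

Lemma tent_ball x : eball x0 (r / 2) x -> tent x = d.
Proof. by move=> /ltW; exact: profile_small. Qed.

Lemma tent_out x : ~ eball x0 r x -> tent x = 0.
Proof. by move=> /negP; rewrite -leNgt; exact: profile_large. Qed.

Lemma tent_ge0_le x : 0 <= tent x <= d.
Proof.
have a0 : 0 <= Num.min 1 (Num.max 0 (2 * (1 - enorm (x - x0) / r))) by rewrite le_min ler01 le_max lexx.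
have a1 : Num.min 1 (Num.max 0 (2 * (1 - enorm (x - x0) / r))) <= 1 by rewrite ge_min lexx.
by rewrite /tent /profile; apply/andP; split; [rewrite mulr_ge0// ltW|rewrite ger_pMr].
Qed.

Let msub : measurable_fun [set: 'rV[RR]_N] (fun x : 'rV[RR]_N => x - x0 : 'rV[RR]_N).
Proof. exact: shift_measurable. Qed.

Let menorm : measurable_fun [set: 'rV[RR]_N] (fun x : 'rV[RR]_N => enorm (x - x0)).
Proof. exact: measurable_enorm. Qed.

Lemma measurable_tent : measurable_fun [set: 'rV[RR]_N] tent.
Proof.
apply: (measurableT_comp _ menorm); apply: measurable_funM => //.
apply: measurable_minr => //; apply: measurable_maxr => //.
by apply: measurable_funM => //; apply: measurable_funB => //; exact: measurable_funM.
Qed.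

Let mS : measurable (eball x0 r `\` eball x0 (r / 2) : set 'rV[RR]_N).
Proof. by apply: measurableD; exact: measurable_eball. Qed.

Lemma measurable_tent_gradient : measurable_fun [set: 'rV[RR]_N] tent_gradient.
Proof.
have -> : tent_gradient = fun x => \row_i ((- (2 * d / r) * \1_(eball x0 r `\` eball x0 (r / 2)) x / enorm (x - x0)) * (x - x0) ord0 i).
  by apply/funext => x; apply/rowP => i; rewrite !mxE.
apply: measurable_row => i; apply: measurable_funM; last exact: measurable_coord.
apply: measurable_funM; last exact: (measurableT_comp measurable_invr).
by apply: measurable_funM => //; exact: measurable_indic.
Qed.

Lemma annulus_volume s t : 0 < s -> s < t ->
  mu (eball x0 t `\` eball x0 s) = (omega * (t ^+ N - s ^+ N))%:E.
Proof.
move=> s0 st; have t0 := lt_trans s0 st.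
have sub : eball x0 s `<=` eball x0 t by move=> y /= /lt_trans; apply.
have vt : mu (eball x0 t) = (omega * t ^+ N)%:E := eball_volume x0 t0.
have vs : mu (eball x0 s) = (omega * s ^+ N)%:E := eball_volume x0 s0.
have h : mu (eball x0 t `\` eball x0 s) = (mu (eball x0 t) - mu (eball x0 t `&` eball x0 s))%E.
  apply: measureD; [exact: measurable_eball|exact: measurable_eball|].
  exact: (eq_ind_r (fun z => z < +oo)%E (ltry _) vt).
rewrite h (_ : eball x0 t `&` eball x0 s = eball x0 s); last by rewrite setIC; exact/setIidPl.
by rewrite vt vs mulrBr.
Qed.

(** The sphere lies in annuli between s and s + k/2, whose volume tends to 0 by continuity of
    s^N. *)
Lemma sphere_null s : 0 < s -> mu [set x : 'rV[RR]_N | enorm (x - x0) = s] = 0%E.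
Proof.
move=> s0; have mSp : measurable [set x : 'rV[RR]_N | enorm (x - x0) = s].
  by rewrite -[X in measurable X]setTI; exact: (menorm measurableT (measurable_set1 s)).
apply/eqP; rewrite eq_le measure_ge0 andbT; apply/lee_addgt0Pr => e e0; rewrite add0e.
have cg : {for s, continuous (fun y : R => omega * y ^+ N)}.
  by apply: continuousM; [exact: cst_continuous|exact: exprn_continuous].
have /cvgrPdist_le /(_ _ e0) /nbhs_normP[k /= k0 Hk] := cg.
have k20 : 0 < k / 2 by rewrite divr_gt0.
have h1 := Hk (s + k / 2).
apply: (@le_trans _ _ (mu (eball x0 (s + k / 2) `\` eball x0 s))).
  apply: le_measure; rewrite ?inE//.
    by apply: measurableD; exact: measurable_eball.
  move=> y /= ys; rewrite /eball /= ys; split; first by rewrite ltrDl.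
  by rewrite ltxx.
rewrite annulus_volume ?ltrDl// lee_fin mulrBr (le_trans (ler_norm _))// distrC h1//=.
by rewrite opprD addrA subrr add0r normrN gtr0_norm// ltr_pdivrMr// ltr_pMr// ltr1n.
Qed.

Lemma tent_lip x y : `|tent x - tent y| <= 2 * d / r * enorm (x - y).
Proof.
apply: le_trans (profile_lip _ _) _; apply: ler_wpM2l; first by rewrite ltW// divr_gt0// mulr_gt0.
by apply: le_trans (ler_dist_enorm _ _) _; rewrite opprB addrA subrK.
Qed.

Let enorm_delta i : enorm (delta_mx ord0 i : 'rV[R]_N) = 1.
Proof.
rewrite /enorm /dot (bigD1 i)//= big1 => [|j ji]; last by rewrite !mxE eqxx (negbTE ji) mulr0.
by rewrite !mxE !eqxx mulr1 addr0 sqrtr1.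
Qed.

Let dist_shift i (y : 'rV[R]_N) (t : R) : `|enorm (y - t *: delta_mx ord0 i) - enorm y| <= `|t|.
Proof.
apply: le_trans (ler_dist_enorm _ _) _; move: (t *: _) (enormZ t (delta_mx ord0 i : 'rV[R]_N)) => z tz.
by rewrite addrAC subrr add0r enormN tz enorm_delta mulr1.
Qed.

(** [P] is a range of radii, containing a neighbourhood of that of x, on which the profile is
    constant; the quotient is eventually 0. *)
Let quotient_cvg0 (x : 'rV[R]_N) i (P : R -> Prop) (l : R) (del : R) : 0 < del ->
  P (enorm (x - x0)) ->
  (forall s, `|s - enorm (x - x0)| < del -> P s) -> (forall s, P s -> profile s = l) ->
  (tent (x - n.+1%:R^-1 *: delta_mx ord0 i) - tent x) / n.+1%:R^-1 @[n --> \oo] --> (0 : R).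
Proof.
move=> del0 Px HP Pl; apply: (@cvg_trans _ (cst 0 @ \oo)); last exact: cvg_cst.
apply: near_eq_cvg; near=> n; rewrite /tent [in RHS](Pl _ Px) Pl ?subrr ?mul0r//.
apply: HP; rewrite addrAC.
apply: (@le_lt_trans _ _ (n.+1%:R^-1)).
  by apply: le_trans (dist_shift _ _ _) _; rewrite gtr0_norm ?invr_gt0.
near: n; have := @cvg_harmonic R; move/cvgrPdist_lt => /(_ _ del0); apply: filterS => n.
by rewrite sub0r normrN gtr0_norm// /harmonic invr_gt0.
Unshelve. all: by end_near. Qed.

(** Multiplying by the sum of the two norms replaces their difference by a difference of squares,
    which is polynomial in the step. *)
Let enorm_quotient_cvg (y : 'rV[R]_N) i : 0 < enorm y ->
  (enorm (y - n.+1%:R^-1 *: delta_mx ord0 i) - enorm y) / n.+1%:R^-1 @[n --> \oo] --> - (y ord0 i / enorm y).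
Proof.
move=> y0; pose t n : R := n.+1%:R^-1; pose e : 'rV[R]_N := delta_mx ord0 i.
have t0 n : 0 < t n by rewrite invr_gt0.
have ct : t n @[n --> \oo] --> (0 : R) by exact: cvg_harmonic.
have ce : enorm (y - t n *: e) @[n --> \oo] --> enorm y.
  apply/cvgrPdist_le => eps eps0.
  move/cvgrPdist_le : ct => /(_ _ eps0); apply: filterS => n; rewrite sub0r normrN => tn.
  by apply: le_trans (ler_dist_enorm _ _) _; rewrite opprB addrC subrK enormZ enorm_delta mulr1.
have dE n : (enorm (y - t n *: e) - enorm y) / t n = (t n - 2 * y ord0 i) / (enorm (y - t n *: e) + enorm y).
  have s0 : 0 < enorm (y - t n *: e) + enorm y by rewrite ltr_wpDl// enorm_ge0.
  have key : (enorm (y - t n *: e) - enorm y) * (enorm (y - t n *: e) + enorm y) = (t n - 2 * y ord0 i) * t n.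
    rewrite -subr_sqr !sqr_enorm dotBl !dotBr !dotZl !dotZr.
    have -> : dot e e = 1 by rewrite -sqr_enorm enorm_delta expr1n.
    have ye : dot y e = y ord0 i.
      rewrite /dot (bigD1 i)//= big1 => [|j ji]; last by rewrite !mxE eqxx (negbTE ji) mulr0.
      by rewrite !mxE !eqxx mulr1 addr0.
    by rewrite (dotC e y) ye; ring.
  have -> : enorm (y - t n *: e) - enorm y = (t n - 2 * y ord0 i) * t n / (enorm (y - t n *: e) + enorm y).
    by rewrite -key mulfK// gt_eqF.
  by rewrite [LHS]mulrAC mulfK// gt_eqF.
rewrite (_ : (fun n => _) = fun n => (t n - 2 * y ord0 i) / (enorm (y - t n *: e) + enorm y)); last exact/funext.
have -> : - (y ord0 i / enorm y) = (0 - 2 * y ord0 i) / (enorm y + enorm y).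
  by have := y0; move: (enorm y) => E E0; field; rewrite !gt_eqF// addr_gt0.
apply: cvgM; first by apply: cvgB => //; exact: cvg_cst.
apply: cvgV; first by rewrite gt_eqF// addr_gt0.
by apply: cvgD => //; exact: cvg_cst.
Qed.

(** Off two null spheres the tent is, near x, constant or affine in the distance to the centre.
    Steps go backwards, hence the sign of the limit. *)
Let tent_quotient_cvg i : {ae mu, forall x,
  (tent (x - n.+1%:R^-1 *: delta_mx ord0 i) - tent x) / n.+1%:R^-1 @[n --> \oo] --> - tent_gradient x ord0 i}.
Proof.
have r20 : 0 < r / 2 by rewrite divr_gt0.
have off s : 0 < s -> {ae mu, forall x : 'rV[RR]_N, enorm (x - x0) != s}.
  move=> s0; exists [set x : 'rV[RR]_N | enorm (x - x0) = s]; split; last by move=> x /= /negP; rewrite negbK => /eqP.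
    by rewrite -[X in measurable X]setTI; exact: (menorm measurableT (measurable_set1 s)).
  exact: sphere_null.
apply: (ae_imply2 _ (off _ r20) (off _ r0)) => x xr2 xr.
rewrite /tent_gradient mxE [\1__ x]indicE.
have [xs|xs] := ltP (enorm (x - x0)) (r / 2).
  rewrite memNset ?mulr0 ?mul0r ?oppr0; last by case.
  apply: (@quotient_cvg0 x i (fun s => s < r / 2) d (r / 2 - enorm (x - x0))) => //.
  - by rewrite subr_gt0.
  - by move=> s; rewrite ltr_norml => /andP[_]; lra.
  - by move=> s /ltW; exact: profile_small.
have {}xs : r / 2 < enorm (x - x0) by rewrite lt_neqAle eq_sym xr2.
have [rx|rx] := leP r (enorm (x - x0)).
  rewrite memNset ?mulr0 ?mul0r ?oppr0; last by case => /=; rewrite /eball /= ltNge rx.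
  have {}rx : r < enorm (x - x0) by rewrite lt_neqAle eq_sym xr.
  apply: (@quotient_cvg0 x i (fun s => r < s) 0 (enorm (x - x0) - r)) => //.
  - by rewrite subr_gt0.
  - by move=> s; rewrite ltr_norml => /andP[+ _]; lra.
  - by move=> s /ltW; exact: profile_large.
rewrite mem_set; last by split => //=; rewrite /eball /=; apply/negP; rewrite -leNgt ltW.
rewrite mulr1.
have y0 : 0 < enorm (x - x0) by exact: lt_trans xs.
have cq := @enorm_quotient_cvg (x - x0) i y0.
have -> : - (- (2 * d / r) / enorm (x - x0) * (x - x0) ord0 i) =
    - (2 * d / r) * - ((x - x0) ord0 i / enorm (x - x0)).
  by rewrite mulrAC -mulrA mulrN.
apply: cvg_trans (cvgMr (a := - (2 * d / r)) cq).
apply: near_eq_cvg; near=> n.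
have close : `|enorm (x - n.+1%:R^-1 *: delta_mx ord0 i - x0) - enorm (x - x0)| <
    Num.min (enorm (x - x0) - r / 2) (r - enorm (x - x0)).
  apply: (@le_lt_trans _ _ n.+1%:R^-1).
    by rewrite addrAC; apply: le_trans (dist_shift _ _ _) _; rewrite gtr0_norm ?invr_gt0.
  near: n; have := @cvg_harmonic R; move/cvgrPdist_lt => /(_ (Num.min (enorm (x - x0) - r / 2) (r - enorm (x - x0)))).
  rewrite lt_min !subr_gt0 xs rx => /(_ isT); apply: filterS => n.
  by rewrite sub0r normrN gtr0_norm// /harmonic invr_gt0.
move: close (xs) (rx); rewrite /tent (addrAC x (- x0)).
move: (enorm (x - n.+1%:R^-1 *: delta_mx ord0 i - x0)) (enorm (x - x0)) => A B.
rewrite lt_min => /andP[] + + sB Br.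
rewrite ltr_norml => /andP[c1 _]; rewrite ltr_norml => /andP[_ c2].
have A1 : r / 2 <= A by move: c1; rewrite opprB ltrBlDr subrK => /ltW.
have A2 : A <= r by move: c2; rewrite ltrBlDr subrK => /ltW.
rewrite (profile_mid A1 A2) (profile_mid (ltW sB) (ltW Br)) mulrA; congr (_ / _).
by field; rewrite gt_eqF.
Unshelve. all: by end_near. Qed.

Lemma enorm_tent_gradient x :
  enorm (tent_gradient x) = 2 * d / r * \1_(eball x0 r `\` eball x0 (r / 2)) x.
Proof.
rewrite enormZ !normrM normrN (gtr0_norm (divr_gt0 _ r0)) ?mulr_gt0// normfV.
rewrite [\1__ x]indicE normr_nat [`|enorm _|]ger0_norm ?enorm_ge0//.
case: (boolP (x \in _)) => [/set_mem [_ /negP]|_]; last by rewrite mulr0 !mul0r.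
by rewrite -leNgt => xr; rewrite divfK// gt_eqF// (lt_le_trans _ xr)// divr_gt0.
Qed.

Lemma indic_integrable (B : set 'rV[RR]_N) : measurable B -> (mu B < +oo)%E ->
  mu.-integrable setT (EFin \o (\1_B : 'rV[RR]_N -> R)).
Proof.
move=> mB Boo; apply/integrableP; split; first by apply/measurable_EFinP; exact: measurable_indic.
under eq_integral do rewrite /= ger0_norm ?indicE ?ler0n//.
by have := @integral_indic _ _ R mu setT measurableT B mB; rewrite setIT /= => ->.
Qed.

Lemma Rintegral_indic (B : set 'rV[RR]_N) (K : R) : measurable B -> (mu B < +oo)%E ->
  \int[mu]_x (K * \1_B x) = K * fine (mu B).
Proof.
move=> mB Boo; rewrite RintegralZl//; last exact: indic_integrable.
congr (_ * _); rewrite /Rintegral.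
by have := @integral_indic _ _ R mu setT measurableT B mB; rewrite setIT => <-.
Qed.

Let ball_lty : (mu (eball x0 r) < +oo)%E.
Proof.
have v : mu (eball x0 r) = (omega * r ^+ N)%:E := eball_volume x0 r0.
exact: (eq_ind_r (fun z => z < +oo)%E (ltry _) v).
Qed.

Let r2 : 0 < r / 2. Proof. by rewrite divr_gt0. Qed.

Let r2r : r / 2 < r. Proof. by rewrite ltr_pdivrMr// ltr_pMr// ltr1n. Qed.

Let annulus_lty : (mu (eball x0 r `\` eball x0 (r / 2)) < +oo)%E.
Proof. exact: (eq_ind_r (fun z => z < +oo)%E (ltry _) (annulus_volume r2 r2r)). Qed.

Let tent_le_indic (p : R) x : 0 < p -> `|tent x| `^ p <= d `^ p * \1_(eball x0 r) x.
Proof.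
move=> p0; rewrite [\1__ x]indicE; case: (boolP (x \in _)) => xr.
  have /andP[t0 td] := tent_ge0_le x.
  by rewrite mulr1 ger0_norm// ge0_ler_powR ?nnegrE// ltW.
by rewrite tent_out ?normr0 ?powR0 ?gt_eqF ?mulr0// => /mem_set; rewrite (negbTE xr).
Qed.

Let tent_gradient_powR (p : R) x : 0 < p -> enorm (tent_gradient x) `^ p =
  (2 * d / r) `^ p * \1_(eball x0 r `\` eball x0 (r / 2)) x.
Proof.
move=> p0; rewrite enorm_tent_gradient [\1__ x]indicE.
by case: (x \in _); rewrite ?mulr1// !mulr0 powR0// gt_eqF.
Qed.

Lemma tent_sobolev (p : R) : 1 < p -> sobolev p tent tent_gradient.
Proof.
move=> p1; have p0 : 0 < p by exact: lt_trans p1.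
have mt := measurable_tent; have mG := measurable_tent_gradient.
have ib := indic_integrable (measurable_eball x0 r) ball_lty.
have ip : mu.-integrable setT (EFin \o (fun x => `|tent x| `^ p)).
  have i2 : mu.-integrable setT (EFin \o (fun x => d `^ p * \1_(eball x0 r) x)).
    exact: (@integrableZl _ _ _ mu setT measurableT (d `^ p) _ ib).
  apply: le_integrable i2 => //.
    apply/measurable_EFinP; apply: (measurableT_comp (measurable_powR p)); exact: measurableT_comp.
  move=> x _; rewrite /= lee_fin (ger0_norm (powR_ge0 _ _)) (le_trans _ (ler_norm _))//.
  exact: tent_le_indic.
split => //.
  rewrite (_ : (fun x => _) = fun x => (2 * d / r) `^ p * \1_(eball x0 r `\` eball x0 (r / 2)) x); last first.
    by apply/funext => x; exact: tent_gradient_powR.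
  exact: (@integrableZl _ _ _ mu setT measurableT ((2 * d / r) `^ p) _ (indic_integrable mS annulus_lty)).
move=> i phi tphi; apply: (@lipschitz_weak_derivative _ _ i tent (fun x => tent_gradient x ord0 i) (2 * d / r)) => //.
- exact: measurable_coord.
- have i2 : mu.-integrable setT (EFin \o (fun x => d * \1_(eball x0 r) x)).
    exact: (@integrableZl _ _ _ mu setT measurableT d _ ib).
  apply: le_integrable i2 => //; first exact/measurable_EFinP.
  move=> x _; rewrite /= lee_fin (le_trans _ (ler_norm _))//.
  by have := @tent_le_indic 1 x ltr01; rewrite !powRr1// ltW.
- move=> x t t0; apply: le_trans (tent_lip _ _) _.
  rewrite addrAC subrr add0r enormN enormZ enorm_delta mulr1 gtr0_norm//.
Qed.

Lemma tent_gradient_integral (p : R) : 0 < p ->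
  \int[mu]_x (enorm (tent_gradient x) `^ p) = (2 * d / r) `^ p * (omega * (r ^+ N - (r / 2) ^+ N)).
Proof.
move=> p0; under eq_Rintegral do rewrite tent_gradient_powR//.
by rewrite Rintegral_indic// (annulus_volume r2 r2r).
Qed.

Lemma tent_integral (p : R) : 1 < p -> \int[mu]_x (`|tent x| `^ p) <= d `^ p * (omega * r ^+ N).
Proof.
move=> p1; have p0 : 0 < p by exact: lt_trans p1.
have v : mu (eball x0 r) = (omega * r ^+ N)%:E := eball_volume x0 r0.
have ib := indic_integrable (measurable_eball x0 r) ball_lty.
have -> : d `^ p * (omega * r ^+ N) = \int[mu]_x (d `^ p * \1_(eball x0 r) x).
  rewrite Rintegral_indic//; last exact: measurable_eball.
  by congr (_ * _); exact: (congr1 fine (esym v)).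
apply: le_Rintegral => //.
- by have [_ _] := tent_sobolev p1.
- exact: (@integrableZl _ _ _ mu setT measurableT (d `^ p) _ ib).
- by move=> x _; exact: tent_le_indic.
Qed.

End tent.

(** * Proof of the theorem *)

Section essential_bounds.
Context {d} {T : measurableType d} {R : realType} (nu : {measure set T -> \bar R}).

(** [fine] sends infinite values to 0, so positivity shows that the essential infimum is finite. *)
Lemma ae_ess_inf_le (g : T -> R) : 0 < fine (ess_inf nu (EFin \o g)) ->
  {ae nu, forall x, fine (ess_inf nu (EFin \o g)) <= g x}.
Proof.
have := ess_inf_le nu (EFin \o g); case: (ess_inf nu _) => [l| |] /=; rewrite ?ltxx// => H _.
Qed.

Lemma ae_le_Linfty (g : T -> R) : g \in Lfun nu +oo%E ->
  {ae nu, forall x, `|g x| <= fine ('N[nu]_+oo[EFin \o g])%E}.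
Proof.
move=> /sub_Lfun_finLfun; rewrite inE /= /finite_norm unlock.
case: ifPn => [_|n0 _].
  have := ess_sup_ge nu (abse \o (EFin \o g)); case: (ess_sup nu _) => [l| |] //= H _.
  by apply: filterS H => x; rewrite leeNy_eq.
(* The remaining case is a space of measure 0, where every point may be exceptional. *)
exists setT; split => //; apply/eqP; rewrite eq_le measure_ge0 andbT leNgt; exact: n0.
Qed.

Lemma Lfun_measurable (g : T -> R) (q : \bar R) : g \in Lfun nu q -> measurable_fun [set: T] g.
Proof. by move=> /sub_Lfun_mfun; rewrite inE. Qed.

End essential_bounds.

(** * Identification of the constants, and a Borel version of the weight *)

Section constants.
Context {R : realType} {N : nat}.
Local Notation RR := (measurableTypeR R).
Local Notation mu := (borel_lebesgue_rV R N).
Local Notation omega := (unit_ball_volume (R := R) (N := N)).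

(** Both sides are products of powers; after taking logarithms and inserting that of [sup_radius] a
    rational identity remains. *)
Lemma k_const_powR (p : R) (a : 'rV[R]_N -> R) : (0 < N)%N -> N%:R < p -> 0 < ess_lower a ->
  k_const p a `^ p = sup_const (N := N) p (ess_lower a).
Proof.
move=> N0 Np; rewrite /k_const; move: (ess_lower a) => m m0.
have n0 : 0 < N%:R :> R by rewrite ltr0n.
have p1 : 1 < p by rewrite (le_lt_trans _ Np)// ler1n.
have p0 : 0 < p by exact: lt_trans p1.
have om0 : 0 < omega by exact: unit_ball_volume_gt0.
have q0 : 0 < p - N%:R by rewrite subr_gt0.
have q1 : 0 < p - 1 by rewrite subr_gt0.
have s0 : 0 < sup_radius (N := N) p m by exact: sup_radius_gt0.
have A1 : 0 < (1 / m) `^ ((p - N%:R) / p ^+ 2) by rewrite powR_gt0// divr_gt0.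
have A2 : 0 < 2 `^ ((p - 1) / p) :> R by rewrite powR_gt0.
have A3 : 0 < inv_ball_volume N `^ (1 / p) :> R by rewrite powR_gt0// inv_ball_volumeE invr_gt0.
have A4 : 0 < 1 / N%:R `^ (N%:R / p ^+ 2) :> R by rewrite divr_gt0// powR_gt0.
have A5 : 0 < ((p - 1) / (p - N%:R)) `^ (N%:R * (p - 1) / p ^+ 2) by rewrite powR_gt0// divr_gt0.
have A12 := mulr_gt0 A1 A2; have A123 := mulr_gt0 A12 A3; have A1234 := mulr_gt0 A123 A4.
have B1 : 0 < omega * m * sup_radius (N := N) p m ^+ N by apply: mulr_gt0; [apply: mulr_gt0|apply: exprn_gt0].
apply: ln_inj; rewrite ?posrE ?powR_gt0//; first exact: mulr_gt0.
  exact: sup_const_gt0.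
rewrite ln_powR lnM ?posrE// lnM ?posrE// lnM ?posrE// lnM ?posrE// !ln_powR.
rewrite [1 / m]div1r lnV ?posrE// inv_ball_volumeE lnV ?posrE// [1 / _ `^ _]div1r lnV ?posrE ?powR_gt0// ln_powR.
rewrite lnM ?posrE ?invr_gt0// lnV ?posrE//.
rewrite /sup_const lnM ?posrE ?powR_gt0 ?invr_gt0// lnV ?posrE// ln_powR.
rewrite lnM ?posrE ?exprn_gt0 ?mulr_gt0// lnM ?posrE// lnXn// ln_sup_radius// -mulr_natl.
by field; rewrite gt_eqF.
Qed.

(** Writing r^N as r^p / r^(p-N), and likewise for 2, exhibits the fraction of K_R: 2^p - 2^(p-N)
    comes from the annulus, r^p A from the whole ball. *)
Lemma tent_energy_algebra (p r d A : R) : 0 < p -> 0 < r -> 0 < d ->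
  (2 * d / r) `^ p * (omega * (r ^+ N - (r / 2) ^+ N)) + A * (d `^ p * (omega * r ^+ N)) =
  d `^ p * omega * ((2 `^ p - 2 `^ (p - N%:R) + r `^ p * A) / r `^ (p - N%:R)).
Proof.
move=> p0 r0 d0; have two0 : 0 < 2 :> R by [].
have xN (x : R) : 0 < x -> x ^+ N = x `^ p / x `^ (p - N%:R).
  move=> x0; rewrite -powRN -powRD; last by rewrite (gt_eqF x0) implybT.
  by rewrite opprB addrC subrK powR_mulrn// ltW.
have -> : (2 * d / r) `^ p = 2 `^ p * d `^ p / r `^ p.
  by rewrite powRM ?mulr_ge0 ?invr_ge0 ?ltW// powRM ?ltW// -powR_inv1 ?ltW// -powRrM mulN1r powRN.
rewrite exprMn exprVn (xN r r0) (xN 2 two0).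
have := powR_gt0 p two0; have := powR_gt0 (p - N%:R) two0.
have := powR_gt0 p r0; have := powR_gt0 (p - N%:R) r0.
move: (2 `^ p) (2 `^ (p - N%:R)) (r `^ p) (r `^ (p - N%:R)) => X Y Z T T0 Z0 Y0 X0.
by field; rewrite !gt_eqF.
Qed.

Lemma ae_ex (P : 'rV[RR]_N -> Prop) : {ae mu, forall x, P x} -> exists x, P x.
Proof.
move=> [B [mB B0 sub]]; apply: contrapT => no.
have BT : [set: 'rV[RR]_N] `<=` B by move=> x _; apply: sub => Px; apply: no; exists x.
have v : mu (eball 0 1) = (omega * 1 ^+ N)%:E := eball_volume 0 ltr01.
have : (mu (eball 0 1) <= mu B)%E.
  by apply: le_measure; rewrite ?inE//; [exact: measurable_eball|move=> x _; exact: BT].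
by rewrite v B0 lee_fin expr1n mulr1 leNgt unit_ball_volume_gt0.
Qed.

(** Clamping a Borel representative between the essential bounds makes them hold everywhere, as the
    energy estimates want. *)
Lemma borel_weight (a : 'rV[R]_N -> R) : a \in Lfun (leb R N) +oo%E -> 0 < ess_lower a ->
  exists b : 'rV[RR]_N -> R, [/\ measurable_fun [set: 'rV[RR]_N] b, {ae mu, forall x, a x = b x},
    (forall x, ess_lower a <= b x), (forall x, b x <= Linfty_norm a) & ess_lower a <= Linfty_norm a].
Proof.
move=> aL a0.
have ma : leb_measurable a.
  exact: Lfun_measurable aL.
have [b0 [mb0 ab0]] := leb_measurable_rep ma.
have lo : {ae mu, forall x, ess_lower a <= a x}.
  by apply/leb_ae; exact: ae_ess_inf_le.
have up : {ae mu, forall x, a x <= Linfty_norm a}.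
  have H : {ae mu, forall x, `|a x| <= Linfty_norm a} by apply/leb_ae; exact: ae_le_Linfty.
  by apply: ae_imply H => x; apply: le_trans; exact: ler_norm.
(* One point where both bounds hold shows that they are in the right order, so that the clamping
   makes sense. *)
have [x [x1 x2]] := ae_ex (ae_imply2 (fun x => @conj _ _) lo up).
exists (fun x => Num.max (ess_lower a) (Num.min (Linfty_norm a) (b0 x))); split.
- by apply: measurable_maxr => //; exact: measurable_minr.
- apply: (ae_imply2 _ ab0 (ae_imply2 (fun x => @conj _ _) lo up)) => y ab [l1 l2].
  by rewrite -ab min_r// max_r.
- by move=> y; rewrite le_max lexx.
- by move=> y; rewrite ge_max ge_min lexx (le_trans x1 x2).
- exact: le_trans x2.
Qed.

End constants.

Section fine_integrable.
Context {d} {T : measurableType d} {R : realType} (nu : {measure set T -> \bar R}) (S : T -> \bar R).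
Hypothesis iS : nu.-integrable setT S.

Lemma integrable_fin_num_ae : {ae nu, forall x, S x \is a fin_num}.
Proof. by have := integrable_ae measurableT iS; apply: filterS => x; apply. Qed.

Lemma measurable_fine_integrable : measurable_fun [set: T] (fun x => fine (S x)).
Proof. by apply: (measurableT_comp (fine_measurable measurableT)); exact: measurable_int iS. Qed.

Lemma fine_integrable : nu.-integrable setT (EFin \o (fun x => fine (S x))).
Proof.
apply: le_integrable iS => //; first exact/measurable_EFinP/measurable_fine_integrable.
by move=> x _ /=; case: (S x) => [r| |] //=; rewrite ?normr0 ?leey.
Qed.

End fine_integrable.

Section borel_nonlinearity.
Context {R : realType} {N : nat}.
Local Notation RR := (measurableTypeR R).
Local Notation mu := (borel_lebesgue_rV R N).

(** Only countably many sections, at rational t, and countably many suprema need Borel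
    representatives; off a single null set all of them agree with f and f(x, .) is continuous. On
    that null set g and h are 0. *)
Lemma borel_nonlinearity (f : 'rV[R]_N -> R -> R) : L1_caratheodory f ->
  exists (g : 'rV[RR]_N -> R -> R) (h : R -> 'rV[RR]_N -> R),
  [/\ (forall t, measurable_fun [set: 'rV[RR]_N] (g ^~ t)), (forall x, continuous (g x)),
     (forall s : R, 0 < s -> mu.-integrable setT (EFin \o h s)),
     (forall (s : R) x (t : R), 0 < s -> `|t| <= s -> `|g x t| <= h s x) &
     {ae mu, forall x, f x = g x}].
Proof.
move=> [mf cf isup].
pose S (n : nat) (x : 'rV[R]_N) := ereal_sup [set `|f x t|%:E | t in [set t | `|t| <= n.+1%:R]].
have iS n : (leb R N).-integrable setT (S n) by apply: isup.
have fS n : {ae mu, forall x, S n x \is a fin_num}.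
  apply/leb_ae; exact: integrable_fin_num_ae (iS n).
have /choice[H HP] : forall n, exists H : 'rV[RR]_N -> R, measurable_fun [set: 'rV[RR]_N] H /\
    {ae mu, forall x, fine (S n x) = H x}.
  move=> n; apply: leb_measurable_rep; exact: measurable_fine_integrable (iS n).
have iH n : mu.-integrable setT (EFin \o H n).
  have [mH eH] := HP n; apply/(leb_integrable_ae measurableT mH eH); exact: fine_integrable (iS n).
have /choice[q qP] : forall k : int * nat, exists q : 'rV[RR]_N -> R, measurable_fun [set: 'rV[RR]_N] q /\
    {ae mu, forall x, f x (k.1%:~R / k.2.+1%:R) = q x}.
  by move=> k; apply: leb_measurable_rep; exact: mf.
have bad : {ae mu, forall x, [/\ continuous (f x), forall n, S n x \is a fin_num,
    forall n, fine (S n x) = H n x & forall k, f x (k.1%:~R / k.2.+1%:R) = q k x]}.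
  have c1 : {ae mu, forall x, continuous (f x)} by apply/leb_ae.
  have c2 : {ae mu, forall x, forall n, S n x \is a fin_num} by exact/ae_foralln.
  have c3 : {ae mu, forall x, forall n, fine (S n x) = H n x} by apply/ae_foralln => n; have [] := HP n.
  have c4 : {ae mu, forall x, forall k : int * nat, f x (k.1%:~R / k.2.+1%:R) = q k x}.
    have : {ae mu, forall x, forall n, oapp (fun k : int * nat => f x (k.1%:~R / k.2.+1%:R) = q k x) True (unpickle n)}.
      apply/ae_foralln => n; case: (unpickle n) => [k|] /=; first by have [] := qP k.
      by exists set0; split => // x [].
    by apply: ae_imply => x Hx k; have := Hx (pickle k); rewrite pickleK.
  apply: (ae_imply2 _ (ae_imply2 (fun x => @conj _ _) c1 c2) (ae_imply2 (fun x => @conj _ _) c3 c4)).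
  by move=> x [? ?] [? ?].
have [B [mB B0 sub]] := bad.
have good x : ~ B x -> [/\ continuous (f x), forall n, S n x \is a fin_num,
    forall n, fine (S n x) = H n x & forall k, f x (k.1%:~R / k.2.+1%:R) = q k x].
  by move=> xB; apply: contrapT => nx; apply: xB; exact: sub.
pose g (x : 'rV[RR]_N) t := f x t * \1_(~` B) x.
have gE x t : ~ B x -> g x t = f x t by move=> xB; rewrite /g [\1__ x]indicE mem_set ?mulr1.
have g0 x t : B x -> g x t = 0 by move=> xB; rewrite /g [\1__ x]indicE memNset ?mulr0//= => /(_ xB).
have mI : measurable_fun [set: 'rV[RR]_N] (\1_(~` B) : 'rV[RR]_N -> R).
  by apply: measurable_indic; exact: measurableC.
(* [S n] covers |t| <= n + 1, and s < truncn s + 1. *)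
pose h (s : R) x := H (Num.truncn s) x * \1_(~` B) x.
exists g, h; split.
(* For general t, g(., t) is the limit of the sections at floor((n+1) t)/(n+1), which have Borel
   representatives. *)
- move=> t; pose k n : int * nat := (Num.floor (n.+1%:R * t), n).
  apply: (@measurable_fun_cvg _ _ R setT (fun n x => q (k n) x * \1_(~` B) x) (g ^~ t)).
    by move=> n; apply: measurable_funM => //; have [] := qP (k n).
  move=> x _; have [xB|xB] := pselect (B x).
    rewrite g0// (_ : (fun n => _) = cst 0); first exact: cvg_cst.
    by apply/funext => n; rewrite [\1__ x]indicE memNset ?mulr0//= => /(_ xB).
  have [cx _ _ qx] := good x xB; rewrite gE//.
  rewrite (_ : (fun n => _) = fun n => f x ((Num.floor (n.+1%:R * t))%:~R / n.+1%:R)); last first.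
    by apply/funext => n; rewrite [\1__ x]indicE mem_set ?mulr1// -qx.
  by apply: continuous_cvg; [exact: cx|exact: fraction_approx].
- move=> x; have [xB|xB] := pselect (B x).
    by rewrite (_ : g x = cst 0); [exact: cst_continuous|apply/funext => t; exact: g0].
  by have [cx _ _ _] := good x xB; rewrite (_ : g x = f x)//; apply/funext => t; exact: gE.
- move=> s s0; apply: le_integrable (iH (Num.truncn s)) => //.
    by apply/measurable_EFinP; apply: measurable_funM => //; have [] := HP (Num.truncn s).
  move=> x _; rewrite /= lee_fin /h normrM [\1__ x]indicE normr_nat ler_piMr// lern1 leq_b1//.
- move=> s x t s0 ts; have [xB|xB] := pselect (B x).
    by rewrite g0// normr0 /h [\1__ x]indicE memNset ?mulr0//= => /(_ xB).
  have [_ fx Hx _] := good x xB; rewrite gE// /h [\1__ x]indicE mem_set// mulr1 -Hx.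
  rewrite -lee_fin fineK//; apply: ereal_sup_ubound; exists t => //=.
  by apply: le_trans ts (ltW _); exact: truncnS_gt.
- exists B; split => // x /= nx; apply: contrapT => xB; apply: nx.
  by apply/funext => t; rewrite gE.
Qed.

End borel_nonlinearity.

(** * The maximum of F over |t| <= c *)

Section max_le.
Context {R : realType} {N : nat}.
Local Notation RR := (measurableTypeR R).
Local Notation mu := (borel_lebesgue_rV R N).
Variables (f : 'rV[RR]_N -> R -> R) (h : R -> 'rV[RR]_N -> R).
Hypotheses (mf : forall t, measurable_fun [set: 'rV[RR]_N] (f ^~ t)) (cf : forall x, continuous (f x)).
Hypotheses (ih : forall s : R, 0 < s -> mu.-integrable setT (EFin \o h s)).
Hypotheses (fh : forall (s : R) x (t : R), 0 < s -> `|t| <= s -> `|f x t| <= h s x).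
Variable c : R.
Hypothesis c0 : 0 < c.
Local Notation F := (primitive f).

Let F_le x t : `|t| <= c -> `|F x t| <= c * h c x.
Proof. by move=> tc; apply: primitive_le => // s; exact: fh. Qed.

Let values x := [set F x t | t in [set t | `|t| <= c]].

Let values0 x : values x 0.
Proof. by exists 0; rewrite /= ?normr0 ?(ltW c0)//; exact: primitive0. Qed.

Let values_ub x : ubound (values x) (c * h c x).
Proof. by move=> _ [t tc <-]; apply: le_trans (ler_norm _) _; exact: F_le. Qed.

Lemma primitive_le_max x t : `|t| <= c -> F x t <= max_le F c x.
Proof. by move=> tc; apply: ub_le_sup; [exists (c * h c x); exact: values_ub|exists t]. Qed.

Lemma max_le_ge0 x : 0 <= max_le F c x.
Proof. by apply: ub_le_sup; [exists (c * h c x); exact: values_ub|exact: values0]. Qed.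

Lemma max_le_bound x : max_le F c x <= c * h c x.
Proof. by apply: ge_sup; [exists 0; exact: values0|exact: values_ub]. Qed.

(** By continuity the supremum is taken over countably many t. Clamping the rationals to [-c, c]
    keeps every index admissible and still approximates the ends of the interval. *)
Lemma measurable_max_le : measurable_fun [set: 'rV[RR]_N] (max_le F c).
Proof.
pose clamp (t : R) := Num.max (- c) (Num.min c t).
have clampP t : `|clamp t| <= c.
  by rewrite ler_norml /clamp le_max lexx ge_max ge_min lexx orTb ge0_cp// ltW.
have clampE t : `|t| <= c -> clamp t = t.
  by rewrite ler_norml => /andP[h1 h2]; rewrite /clamp (min_idPr h2) (max_idPr h1).
have clampC : continuous clamp.
  move=> t; apply: (@continuous_max _ _ (cst (- c)) (fun s => Num.min c s)); first exact: cst_continuous.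
  by apply: (@continuous_min _ _ (cst c) id); [exact: cst_continuous|exact: cvg_id].
pose q n : R := clamp (oapp (fun k : int * nat => k.1%:~R / k.2.+1%:R) 0 (unpickle n)).
have bd x : has_ubound (range (fun n => F x (q n))).
  by exists (c * h c x) => _ [n _ <-]; apply: le_trans (ler_norm _) (F_le _ (clampP _)).
have -> : max_le F c = fun x => sups (fun n => F x (q n)) 0.
  apply/funext => x; apply/eqP; rewrite eq_le; apply/andP; split.
    apply: ge_sup; first by exists 0; exact: values0.
    move=> _ [t /= tc <-].
    have cv : F x (clamp ((Num.floor (n.+1%:R * t))%:~R / n.+1%:R)) @[n --> \oo] --> F x t.
      rewrite -[X in _ --> F x X](clampE t tc).
      have cc : {for t, continuous (fun s => F x (clamp s))}.
        apply: (@continuous_comp _ _ _ clamp (F x)); first exact: clampC.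
        by apply: primitive_continuous; exact: cf.
      pose k s := F x (clamp s).
      change (k ((Num.floor (n.+1%:R * t))%:~R / n.+1%:R) @[n --> \oo] --> k t).
      by apply: continuous_cvg; [exact: cc|exact: fraction_approx].
    apply: (@cvgr_to_le _ _ _ _ _ _ _ cv); apply: nearW => n.
    apply: ub_le_sup; first by apply: subset_has_ubound (bd x) => _ [m _ <-]; exists m.
    by exists (pickle (Num.floor (n.+1%:R * t), n)); rewrite // /q pickleK.
  apply: ge_sup; first by exists (F x (q 0)), 0.
  by move=> _ [n _ <-]; exact: primitive_le_max (clampP _).
apply: (@measurable_fun_sups _ _ _ setT (fun n x => F x (q n)) 0).
  by move=> x _; exact: bd.
by move=> n; exact: (measurable_primitive mf cf).
Qed.

Lemma max_le_integrable : mu.-integrable setT (EFin \o max_le F c).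
Proof.
have iS : mu.-integrable setT (EFin \o (fun x => c * h c x)).
  exact: (@integrableZl _ _ _ mu setT measurableT c _ (ih c0)).
apply: le_integrable iS => //; first by apply/measurable_EFinP; exact: measurable_max_le.
move=> x _; rewrite /= lee_fin ger0_norm ?max_le_ge0//.
by apply: le_trans (max_le_bound x) (ler_norm _).
Qed.

Lemma potential_le_max_le (u : 'rV[RR]_N -> R) : measurable_fun [set: 'rV[RR]_N] u ->
  {ae mu, forall x, `|u x| <= c} -> potential f u <= \int[mu]_x max_le F c x.
Proof.
move=> mU uc; apply: ae_le_Rintegral max_le_integrable _.
  exact: (primitive_integrable mf cf ih fh c0).
by apply: ae_imply uc => x; exact: primitive_le_max.
Qed.

End max_le.

Lemma tent_energy_lt0 (R : realFieldType) (p E X l P I : R) : 0 < p -> 0 < l -> E <= X -> I <= P ->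
  X / p < l * I -> E / p - l * P < 0.
Proof.
move=> p0 l0 EX IP h; rewrite subr_lt0; apply: le_lt_trans (lt_le_trans h _).
  by rewrite ler_pM2r// invr_gt0.
by rewrite ler_pM2l.
Qed.

Lemma positive_bound (R : realDomainType) (x : R) : exists2 M, 0 < M & x <= M.
Proof. by exists (Num.max 1 x); rewrite ?lt_max ?ltr01// le_max lexx orbT. Qed.

Lemma sign_neq (R : numDomainType) (T : Type) (J : T -> R) (u v : T) : J u <= 0 -> 0 < J v -> J u <> J v.
Proof. by move=> uJ vJ uv; move: vJ; rewrite -uv le_gtF. Qed.

Lemma separated_powR_neq (R : realType) (E1 E2 q rho : R) : E1 `^ q < rho < E2 `^ q -> E1 <> E2.
Proof. by move=> + e12; rewrite e12 => /andP[/lt_trans h /h]; rewrite ltxx. Qed.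

(** * Application to the functional of the problem *)

Section three_solutions.
Context {R : realType} {N : nat}.
Local Notation RR := (measurableTypeR R).
Local Notation mu := (borel_lebesgue_rV R N).
Local Notation omega := (unit_ball_volume (R := R) (N := N)).
Variables (p : R) (a : 'rV[RR]_N -> R) (am aM : R).
Hypotheses (p1 : 1 < p) (ma : measurable_fun [set: 'rV[RR]_N] a).
Hypotheses (am0 : 0 < am) (ama : forall x, am <= a x) (aaM : forall x, a x <= aM).
Hypotheses (N0 : (0 < N)%N) (Np : N%:R < p).
Variables (f : 'rV[RR]_N -> R -> R) (h : R -> 'rV[RR]_N -> R).
Hypotheses (mf : forall t, measurable_fun [set: 'rV[RR]_N] (f ^~ t)) (cf : forall x, continuous (f x)).
Hypotheses (ih : forall s : R, 0 < s -> mu.-integrable setT (EFin \o h s)).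
Hypotheses (fh : forall (s : R) x (t : R), 0 < s -> `|t| <= s -> `|f x t| <= h s x).
Variable lam : R.
Hypothesis lam0 : 0 < lam.

Local Notation V := (@field_pair R N).
Local Notation W := (in_sobolev (N := N) p).
Local Notation nrm := (energy_norm p a).
Local Notation F := (primitive f).
Local Notation J := (functional p a f lam).
Local Notation kap := (sup_embedding (N := N) p am).

Let p0 : 0 < p. Proof. exact: lt_trans p1. Qed.

Lemma ae_eq_Rintegral (g k : 'rV[RR]_N -> R) : mu.-integrable setT (EFin \o g) ->
  mu.-integrable setT (EFin \o k) -> {ae mu, forall x, g x = k x} ->
  \int[mu]_x g x = \int[mu]_x k x.
Proof.
move=> ig ik gk; apply/eqP; rewrite eq_le; apply/andP; split; apply: ae_le_Rintegral => //.
  by apply: ae_imply gk => x ->.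
by apply: ae_imply gk => x ->.
Qed.

(** Functions equal almost everywhere have the same weak gradient almost everywhere, so the gradient
    component of the pair cannot change the energy. *)
Lemma energy_ae (w v : V) : W w -> W v -> {ae mu, forall x, w.1 x = v.1 x} -> energy p a w = energy p a v.
Proof.
move=> Ww Wv wv; apply: ae_eq_Rintegral; [exact: (energy_density_integrable ma am0 ama aaM Ww)|exact: (energy_density_integrable ma am0 ama aaM Wv)|].
have [_ gw] := sobolev_W1p (ltW p1) Ww (aeW mu (fun x => erefl (w.1 x))).
have [_ gv] := sobolev_W1p (ltW p1) Wv wv.
apply: (ae_imply2 _ wv (ae_imply2 (fun x => @conj _ _) gw gv)) => x e1 [e2 e3].
by rewrite /energy_density e1 -e2 e3.
Qed.

Lemma potential_ae (u v : 'rV[RR]_N -> R) (s : R) : 0 < s ->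
  measurable_fun [set: 'rV[RR]_N] u -> measurable_fun [set: 'rV[RR]_N] v ->
  {ae mu, forall x, `|u x| <= s} -> {ae mu, forall x, u x = v x} -> potential f u = potential f v.
Proof.
move=> s0 mU mv us uv; apply: ae_eq_Rintegral; last by apply: ae_imply uv => x ->.
  exact: (primitive_integrable mf cf ih fh s0 mU us).
apply: (primitive_integrable mf cf ih fh s0 mv).
by apply: (ae_imply2 _ us uv) => x us' <-.
Qed.

Lemma functional_ae (w v : V) : W w -> W v -> {ae mu, forall x, w.1 x = v.1 x} -> J w = J v.
Proof.
move=> Ww Wv wv; have e1 := energy_ae Ww Wv wv.
have [mw _ _ _ _] := Ww; have [mv _ _ _ _] := Wv.
have k0 : 0 < kap by apply: powR_gt0; exact: sup_const_gt0.
have [M M0 wM] := positive_bound (nrm w).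
have us := sup_embedding_le p1 ma am0 ama aaM N0 Np Ww wM.
have e2 := potential_ae (mulr_gt0 k0 M0) mw mv us wv.
by rewrite /functional e1 e2.
Qed.

Variable c : R.
Hypothesis c0 : 0 < c.

(** On this sphere the embedding gives |u| <= c almost everywhere, so the maximum over |t| <= c
    bounds the potential. *)
Lemma functional_sphere (u : V) : W u -> nrm u = c / kap ->
  (c / kap) `^ p / p - lam * \int[mu]_x max_le F c x <= J u.
Proof.
move=> Wu nu; have k0 : 0 < kap by apply: powR_gt0; exact: sup_const_gt0.
have [mU _ _ _ _] := Wu.
have le : potential f u.1 <= \int[mu]_x max_le F c x.
  apply: (potential_le_max_le mf cf ih fh c0 mU).
  have := sup_embedding_le p1 ma am0 ama aaM N0 Np Wu (lexx (nrm u)).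
  by rewrite nu mulrCA mulfV ?gt_eqF// mulr1.
rewrite /functional -(energy_norm_powR p1 am0 ama) nu; apply: lerB => //.
by apply: ler_wpM2l => //; exact: ltW.
Qed.

Variables (x0 : 'rV[R]_N) (r d : R).
Hypotheses (r0 : 0 < r) (cd : c < d).
Hypothesis F_annulus : {ae mu, forall x, (eball x0 r `\` eball x0 (r / 2)) x ->
  forall t, 0 <= t <= d -> 0 <= F x t}.

Let d0 : 0 < d. Proof. exact: lt_trans cd. Qed.
Let e0 : V := (tent x0 r d, tent_gradient x0 r d).

Let We0 : W e0. Proof. exact: tent_sobolev. Qed.

Let r20 : 0 < r / 2. Proof. by rewrite divr_gt0. Qed.

(** Otherwise the embedding would give |tent| <= c almost everywhere, although it equals d > c on a
    ball of positive measure. *)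
Lemma tent_energy_norm_gt : c / kap < nrm e0.
Proof.
have k0 : 0 < kap by apply: powR_gt0; exact: sup_const_gt0.
rewrite ltNge; apply/negP => le.
have := sup_embedding_le p1 ma am0 ama aaM N0 Np We0 le; rewrite mulrCA mulfV ?gt_eqF// mulr1.
move=> [B [mB B0 sub]].
have : (mu (eball x0 (r / 2)) <= mu B)%E.
  apply: le_measure; rewrite ?inE//; first exact: measurable_eball.
  by move=> x xb; apply: sub => /=; rewrite tent_ball// gtr0_norm// leNgt cd.
have v : mu (eball x0 (r / 2)) = (omega * (r / 2) ^+ N)%:E := eball_volume x0 r20.
by rewrite v B0 lee_fin leNgt mulr_gt0 ?unit_ball_volume_gt0 ?exprn_gt0.
Qed.

Lemma tent_energy_le : energy p a e0 <=
  d `^ p * omega * ((2 `^ p - 2 `^ (p - N%:R) + r `^ p * aM) / r `^ (p - N%:R)).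
Proof.
rewrite -tent_energy_algebra// -(tent_gradient_integral x0 r0 d0 p0).
have [_ _ i1 i2 _] := We0.
have aM0 : 0 <= aM by apply: le_trans (ltW am0) (le_trans (ama 0) (aaM 0)).
have i3 : mu.-integrable setT (EFin \o (fun x => aM * `|tent x0 r d x| `^ p)).
  exact: (@integrableZl _ _ _ mu setT measurableT aM _ i1).
apply: (@le_trans _ _ (\int[mu]_x (enorm (tent_gradient x0 r d x) `^ p) +
    \int[mu]_x (aM * `|tent x0 r d x| `^ p))); last first.
  rewrite lerD2l RintegralZl//; apply: ler_wpM2l => //; exact: tent_integral.
rewrite -RintegralD//; apply: ae_le_Rintegral.
- exact: (energy_density_integrable ma am0 ama aaM We0).
- exact: (@integrableD _ _ _ mu setT measurableT _ _ i2 i3).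
- by apply: aeW => x; apply: lerD => //; apply: ler_wpM2r => //; exact: powR_ge0.
Qed.

(** On the annulus the values of the tent lie in [0, d], where F >= 0 by (ii); outside the large
    ball F(x, 0) = 0. *)
Lemma tent_potential_ge : \int[mu]_(x in eball x0 (r / 2)) F x d <= potential f e0.1.
Proof.
have mb : measurable (eball x0 (r / 2) : set 'rV[RR]_N) := measurable_eball x0 (r / 2).
have ic : mu.-integrable setT (EFin \o (fun x => F x d)).
  apply: (@primitive_integrable R N f h mf cf ih fh (cst d) d) => //.
  by apply: aeW => x; rewrite ger0_norm// ltW.
rewrite Rintegral_mkcond; apply: ae_le_Rintegral.
- rewrite (_ : EFin \o _ = (EFin \o (fun x => F x d)) \_ (eball x0 (r / 2))).
    by apply/(integrable_mkcond _ mb); exact: integrableS ic.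
  by apply/funext => x; rewrite /= /patch; case: ifP.
- apply: (primitive_integrable mf cf ih fh d0 (measurable_tent x0 r d)).
  by apply: aeW => x; have /andP[t0 td] := tent_ge0_le x0 r d0 x; rewrite ger0_norm.
- apply: ae_imply F_annulus => x Fx; rewrite /patch.
  case: (boolP (x \in _)) => [/set_mem xb|/negP xb]; first by rewrite /e0 /= tent_ball.
  have [xr|xr] := pselect (eball x0 r x); last by rewrite /e0 /= tent_out// primitive0.
  by apply: Fx; [split => // xb'; apply: xb; exact: mem_set|exact: tent_ge0_le].
Qed.

Hypothesis F_sub : forall eps : R, 0 < eps -> exists2 delta : R, 0 < delta &
  {ae mu, forall x, forall t, delta < `|t| -> `|F x t| <= eps * `|t| `^ p}.
Hypothesis lam_upper : lam * \int[mu]_x max_le F c x < (c / kap) `^ p / p.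
Hypothesis lam_lower :
  d `^ p * omega * ((2 `^ p - 2 `^ (p - N%:R) + r `^ p * aM) / r `^ (p - N%:R)) / p <
    lam * \int[mu]_(x in eball x0 (r / 2)) F x d.

Lemma functional0_le0 : J 0 <= 0.
Proof.
rewrite /functional; have -> : energy p a 0 = 0.
  by rewrite -(scale0r e0) (energyZ ma am0 ama aaM)// normr0 powR0 ?mul0r// gt_eqF.
rewrite mul0r sub0r oppr_le0; apply: mulr_ge0; first exact: ltW.
by apply: Rintegral_ge0 => x _; rewrite primitive0.
Qed.

(** The first two are told apart by their energies, separated by the sphere; the third from both by
    the sign of J. Neither quantity changes on null sets. *)
Lemma three_critical_pairs : exists u1 u2 u3 : V,
  [/\ [/\ W u1, W u2 & W u3],
      [/\ forall v, W v -> functional_diff p a f lam u1 v = 0,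
          forall v, W v -> functional_diff p a f lam u2 v = 0 &
          forall v, W v -> functional_diff p a f lam u3 v = 0],
      ~ {ae mu, forall x, u1.1 x = u2.1 x} &
      ~ {ae mu, forall x, u1.1 x = u3.1 x} /\ ~ {ae mu, forall x, u2.1 x = u3.1 x}].
Proof.
have k0 : 0 < kap by apply: powR_gt0; exact: sup_const_gt0.
have rho0 : 0 < c / kap by rewrite divr_gt0.
have m0 : 0 < (c / kap) `^ p / p - lam * \int[mu]_x max_le F c x by rewrite subr_gt0.
have Je0 : J e0 < 0 := tent_energy_lt0 p0 lam0 tent_energy_le tent_potential_ge lam_lower.
have [u1 [u2 [u3 [Wu Du n12 [J1 J2 J3]]]]] := @three_critical_points R V W
  (@sobolevD R N p p1) (@sobolevZ R N p p1) nrm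
  (@energy_normD _ _ p a am aM p1 ma am0 ama aaM) (@energy_normZ _ _ p a am aM p1 ma am0 ama aaM)
  J (functional_diff p a f lam)
  (functional_diff_linear p1 ma am0 ama aaM N0 Np mf cf ih fh lam)
  (functional_continuous p1 ma am0 ama aaM N0 Np mf cf ih fh lam0)
  (functional_differentiable p1 ma am0 ama aaM N0 Np mf cf ih fh lam0)
  (functional_diff_continuous p1 ma am0 ama aaM N0 Np mf cf ih fh lam0)
  (functional_coercive p1 ma am0 ama aaM N0 Np mf cf ih fh lam0 F_sub)
  (functional_bounded p1 ma am0 ama aaM N0 Np mf cf ih fh lam0)
  (@palais_smale _ _ p a am aM p1 ma am0 ama aaM N0 Np f h mf cf ih fh lam lam0)
  _ _ e0 rho0 m0 functional_sphere functional0_le0 We0 tent_energy_norm_gt Je0.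
have [W1 W2 W3] := Wu.
exists u1, u2, u3; split; [exact: Wu|exact: Du| |split] => e.
- exact: (separated_powR_neq n12 (energy_ae W1 W2 e)).
- exact: (sign_neq J1 J3 (functional_ae W1 W3 e)).
- exact: (sign_neq J2 J3 (functional_ae W2 W3 e)).
Qed.

End three_solutions.

(** With S = k_a^p, which cancels, this turns lambda > lambda_1 into negativity of J at the tent;
    P/T is the fraction of K_R. *)
Lemma tent_threshold_algebra (R : realFieldType) (p S P T om D I lam : R) : 0 < p -> 0 < S -> 0 < P -> 0 < T ->
  0 < om -> 0 < I -> 1 / (p * S * (1 / S * om^-1 * (P / T))) * (D / I) < lam -> D * om * (T / P) / p < lam * I.
Proof.
move=> p0 S0 P0 T0 om0 I0; rewrite -(ltr_pM2r I0).
suff -> : 1 / (p * S * (1 / S * om^-1 * (P / T))) * (D / I) * I = D * om * (T / P) / p by [].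
by field; rewrite !gt_eqF.
Qed.

Lemma sphere_threshold_algebra (R : realFieldType) (p S C M lam : R) : 0 < p -> 0 < S -> 0 < M ->
  lam < 1 / (p * S) * (C / M) -> lam * M < C / S / p.
Proof.
move=> p0 S0 M0; rewrite -(ltr_pM2r M0).
suff -> : 1 / (p * S) * (C / M) * M = C / S / p by [].
by field; rewrite !gt_eqF.
Qed.

(** * From critical pairs to weak solutions *)

Section weak_solution.
Context {R : realType} {N : nat}.
Local Notation RR := (measurableTypeR R).
Local Notation mu := (borel_lebesgue_rV R N).
Variables (p : R) (a b : 'rV[RR]_N -> R) (f g : 'rV[RR]_N -> R -> R) (lam : R).
Hypotheses (p1 : 1 < p) (mb : measurable_fun [set: 'rV[RR]_N] b) (ab : {ae mu, forall x, a x = b x}).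
Hypotheses (mg : forall t, measurable_fun [set: 'rV[RR]_N] (g ^~ t)) (cg : forall x, continuous (g x)).
Hypothesis fg : {ae mu, forall x, f x = g x}.

(** An arbitrary test function is replaced by a Borel pair; both integrands then change only on a
    null set. *)
Lemma critical_weak_solution (u : @field_pair R N) : in_sobolev p u ->
  (forall v, in_sobolev p v -> functional_diff p b g lam u v = 0) ->
  weak_solution p a f lam u.1.
Proof.
move=> Wu Du; have [mU _ _ _ _] := Wu.
have [Wu1 gu] := sobolev_W1p (ltW p1) Wu (aeW mu (fun x => erefl (u.1 x))).
split=> // v Wv; have [v' [G [so vv gv]]] := W1p_sobolev (ltW p1) Wv.
have Wv' : in_sobolev p (v', G) by exact: so.
have [mv _ _ _ _] := so.
have /eqP := Du _ Wv'; rewrite subr_eq0 => /eqP e.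
rewrite (leb_Rintegral_ae (measurable_flux_density mb Wu Wv')); last first.
  apply: (ae_imply2 _ (ae_imply2 (fun x => @conj _ _) ab gu) (ae_imply2 (fun x => @conj _ _) vv gv)).
  move=> x [-> ->] [-> ->]; rewrite /flux_density /pflux dotZl /=.
  by rewrite !mulrA.
rewrite (_ : \int[mu]_x _ = flux p b u (v', G)) // e; congr (_ * _); symmetry.
apply: leb_Rintegral_ae; last by apply: (ae_imply2 _ fg vv) => x -> ->.
by apply: measurable_funM => //; exact: measurable_superposition.
Qed.

End weak_solution.

Theorem theorem3p1 (R : realType) (N : nat) (p : R)
    (a : 'rV[R]_N -> R) (f : 'rV[R]_N -> R -> R)
    (x0 : 'rV[R]_N) (r c d : R)
    (F := primitive f)
    (annulus := eball x0 r `\` eball x0 (r / 2)) :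
  (1 <= N)%N -> N%:R < p ->
  a \in Lfun (leb R N) +oo%E -> 0 < ess_lower a ->
  L1_caratheodory f ->
  0 < r ->
  0 < c < d ->
  (\forall x \ae leb R N, annulus x -> forall t, 0 <= t <= d -> 0 <= F x t) ->
  (\int[leb R N]_x max_le F c x) / c `^ p <
    K_const p a r * ((\int[leb R N]_(x in eball x0 (r / 2)) F x d) / d `^ p) ->
  (forall eps, 0 < eps -> exists2 delta, 0 < delta &
    \forall x \ae leb R N,
      forall t, delta < `|t| -> `|F x t| <= eps * `|t| `^ p) ->
  forall lambda : R,
    lambda1 p a F x0 r d < lambda -> (lambda%:E < lambda2 p a F c)%E ->
    exists u1 u2 u3 : 'rV[R]_N -> R,
      [/\ weak_solution p a f lambda u1,
          weak_solution p a f lambda u2 &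
          weak_solution p a f lambda u3] /\
      [/\ ~ (u1 = u2 %[ae leb R N]),
          ~ (u1 = u3 %[ae leb R N]) &
          ~ (u2 = u3 %[ae leb R N])].
Proof.
move=> N0 Np aL a0 cara r0 /andP[c0 cd] Fann hiii Fsub lam lam1 lam2.
have p1 : 1 < p by rewrite (le_lt_trans _ Np)// ler1n.
have p0 : 0 < p by exact: lt_trans p1.
have d0 := lt_trans c0 cd.
have [b [mb ab bm bM mM]] := borel_weight aL a0.
have [g [h [mg cg ih gh fg]]] := borel_nonlinearity cara.
have FG : {ae borel_lebesgue_rV R N, forall x, F x = primitive g x}.
  by apply: ae_imply fg => x fgx; apply/funext => t; rewrite /F /primitive fgx.
have r20 : 0 < r / 2 by rewrite divr_gt0.
pose M := \int[borel_lebesgue_rV R N]_x max_le (primitive g) c x.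
pose I := \int[borel_lebesgue_rV R N]_(x in eball x0 (r / 2)) primitive g x d.
have iM : \int[leb R N]_x max_le F c x = M.
  apply: leb_Rintegral_ae; first exact: (measurable_max_le mg cg gh c0).
  by apply: ae_imply FG => x e; rewrite /max_le e.
have iI : \int[leb R N]_(x in eball x0 (r / 2)) F x d = I.
  apply: leb_Rintegral_on; [exact: measurable_eball|exact: measurable_primitive|].
  by apply: ae_imply FG => x ->.
have M0 : 0 <= M.
  by apply: Rintegral_ge0 => x _; exact: (max_le_ge0 cg gh c0).
have Gann : {ae borel_lebesgue_rV R N, forall x, annulus x -> forall t, 0 <= t <= d -> 0 <= primitive g x t}.
  by apply: (ae_imply2 _ FG ((leb_ae _).1 Fann)) => x <-.
have Gsub (eps : R) : 0 < eps -> exists2 delta : R, 0 < delta &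
    {ae borel_lebesgue_rV R N, forall x, forall t, delta < `|t| -> `|primitive g x t| <= eps * `|t| `^ p}.
  move=> /Fsub[delta delta0 H]; exists delta => //.
  by apply: (ae_imply2 _ FG ((leb_ae _).1 H)) => x <-.
have S0 : 0 < sup_const (N := N) p (ess_lower a) by exact: sup_const_gt0.
have kapE : sup_embedding (N := N) p (ess_lower a) `^ p = sup_const (N := N) p (ess_lower a).
  by rewrite -powRrM mulVf ?gt_eqF// powRr1// ltW.
have k0 : 0 < sup_embedding (N := N) p (ess_lower a) by exact: powR_gt0.
have om0 : 0 < unit_ball_volume (R := R) (N := N) by exact: unit_ball_volume_gt0.
have T0 : 0 < 2 `^ p - 2 `^ (p - N%:R) + r `^ p * Linfty_norm a.
  apply: ltr_wpDl; first by rewrite subr_ge0 ler_powR ?ler1n// gerBl.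
  by rewrite mulr_gt0 ?powR_gt0// (lt_le_trans a0).
move: hiii lam1 lam2; rewrite /lambda1 /lambda2 /K_const k_const_powR// inv_ball_volumeE.
rewrite iM iI => hiii lam1 lam2.
have P0 : 0 < r `^ (p - N%:R) by exact: powR_gt0.
(* The left side of (iii) is nonnegative, since the maximum of F over |t| <= c is at least F(x, 0) =
   0. *)
have I0 : 0 < I.
  have : 0 < 1 / sup_const (N := N) p (ess_lower a) * (unit_ball_volume (R := R) (N := N))^-1 *
      (r `^ (p - N%:R) / (2 `^ p - 2 `^ (p - N%:R) + r `^ p * Linfty_norm a)) * (I / d `^ p).
    by apply: le_lt_trans hiii; rewrite divr_ge0 ?powR_ge0.
  rewrite pmulr_rgt0; last by rewrite !mulr_gt0 ?invr_gt0.
  by rewrite pmulr_lgt0// invr_gt0 powR_gt0.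
have lam0 : 0 < lam.
  apply: le_lt_trans lam1; apply: mulr_ge0; last by rewrite divr_ge0 ?powR_ge0 ?ltW.
  apply: divr_ge0 => //; apply: mulr_ge0; first by rewrite mulr_ge0 ?ltW.
  by rewrite ltW// !mulr_gt0 ?invr_gt0.
have lower := tent_threshold_algebra p0 S0 P0 T0 om0 I0 lam1.
have upper : lam * M < (c / sup_embedding (N := N) p (ess_lower a)) `^ p / p.
  rewrite powRM ?invr_ge0 ?ltW// -powR_inv1 ?ltW// powRAC kapE powR_inv1 ?ltW//.
  have cp0 : 0 < c `^ p by exact: powR_gt0.
  (* M = 0 is the case lambda_2 = +oo, where the bound on the sphere is positive for every
     lambda. *)
  move: lam2; case: (eqVneq M 0) => [M00 _|Mn].
    by rewrite M00 mulr0; apply: divr_gt0 => //; exact: divr_gt0.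
  have M1 : 0 < M by rewrite lt_neqAle eq_sym Mn.
  by rewrite lte_fin; exact: sphere_threshold_algebra.
have [u1 [u2 [u3 [[W1 W2 W3] [D1 D2 D3] E12 [E13 E23]]]]] := three_critical_pairs p1 mb a0 bm bM N0 Np
  mg cg ih gh lam0 c0 r0 cd Gann Gsub upper lower.
exists u1.1, u2.1, u3.1; split.
  by split; apply: (critical_weak_solution p1 mb ab mg cg fg).
by split => /(leb_ae _).1 e; [apply: E12|apply: E13|apply: E23]; apply: ae_imply e => x; apply.
Qed.
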